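(* Let $l=-\frac{d^2}{dx^2}+q$ be a regular singular Sturm--Liouville operator on $(0,1)$ and let $L=(l,R_0,R_1)$ be the self-adjoint extension determined by admissible boundary operators $R_0$ at $0$ and $R_1$ at $1$, with associated numbers $\nu_0,\nu_1$ (all as described in the context). Let $\varphi$ be the normalized solution of $lf=0$ at $0$ and $\psi$ the normalized solution of $lf=0$ at $1$. Then $$\det\nolimits_\zeta(L)=\frac{\pi\,W(\psi,\varphi)}{2^{\nu_0+\nu_1}\,\Gamma(\nu_0+1)\,\Gamma(\nu_1+1)},$$ where $W(\psi,\varphi)=\psi\varphi'-\psi'\varphi$ is the (constant) Wronskian.
   Context: Setting. Let $N\ge 1$ be an integer and let $q\in C^\infty((0,1))$ be real-valued with $q(x)=x^{-2}a_0(x^{1/N})=(1-x)^{-2}a_1((1-x)^{1/N})$ for $x\in(0,1)$, where $a_0,a_1\in C^\infty([0,1))$ and $a_0(0)\ge -1/4$, $a_1(0)\ge-1/4$. Let $l=-\frac{d^2}{dx^2}+q$ on $C_c^\infty((0,1))\subset L^2[0,1]$ and $l_{\max}=l^*$. For $\nu\ge0$ put $\psi_\nu(x)=x^{1/2-\nu}/(2\nu)$ if $\nu>0$ and $\psi_0(x)=-x^{1/2}\log x$. A boundary operator $R_0$ at $0$ (defined on $\mathcal D(l_{\max})$) is one of: (i) if $q$ extends continuously to $0$: $R_0f=f(0)$ (Dirichlet), and then $\nu_0:=1/2$; (ii) if $q$ extends continuously to $0$: $R_0f=f'(0)+Af(0)$ with some $A\in\mathbb R$, and then $\nu_0:=-1/2$;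 (iii) if $q$ does not extend continuously to $0$: $\nu_0:=\sqrt{a_0(0)+1/4}$ and $R_0f=\lim_{x\to0}\psi_{\nu_0}(x)^{-1}f(x)$ (this is the Friedrichs boundary condition near $0$). The boundary operator $R_1$ at $1$ and the number $\nu_1$ are defined in the same way with $x$ replaced by $1-x$ and $a_0$ by $a_1$ (in case (ii): $R_1f=f'(1)+Bf(1)$, $B\in\mathbb R$). $L=(l,R_0,R_1)$ denotes the restriction of $l_{\max}$ to $\{f\in\mathcal D(l_{\max}): R_0f=R_1f=0\}$; it is self-adjoint, bounded below, with discrete spectrum and trace class resolvent. Determinant. $\zeta_L(s)=\sum_{\lambda\in\mathrm{spec}(L)\setminus\{0\}}\lambda^{-s}$ (eigenvalues with multiplicity, $\lambda^{-s}:=e^{-i\pi s}|\lambda|^{-s}$ for $\lambda<0$), which converges for $\mathrm{Re}\,s$ large and extends meromorphically to $\mathbb C$, regular at $s=0$. Put $T(L):=-\zeta_L'(0)$ and $\det_\zeta(L):=\exp(-\zeta_L'(0))$ if $0\notin\mathrm{spec}(L)$, $\det_\zeta(L):=0$ otherwise. Normalized solutions. A real function $\varphi$ on $(0,1)$ is the normalized solution of $lf=0$ at $0$ if $l\varphi=0$, $R_0\varphi=0$ and $\varphi(x)=x^{\nu_0+1/2}\varphi_1(x)$ with $\varphi_1$ continuous at $0$, $\varphi_1(0)=1$; the normalized solution $\psi$ at $1$ satisfies $l\psi=0$, $R_1\psi=0$, $\psi(x)=(1-x)^{\nu_1+1/2}\psi_1(x)$, $\psi_1(1)=1$. These exist and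 are unique. *)

(* Defs.v *)
From HB Require Import structures.
From mathcomp Require Import all_boot all_order all_algebra.
From mathcomp Require Import all_classical all_reals all_analysis.
From mathcomp Require Import complex.
Import Order.TTheory GRing.Theory Num.Theory numFieldNormedType.Exports.

Set Implicit Arguments.
Unset Strict Implicit.
Unset Printing Implicit Defensive.

Local Open Scope ring_scope.
Local Open Scope classical_set_scope.

(* The complex plane R[i] viewed as a normed space over itself (for complex
   differentiability). *)
Notation Cx R := ((R[i])^o).

Definition cexp (R : realType) (z : R[i]) : R[i] :=
  Complex (expR (complex.Re z) * cos (complex.Im z))
          (expR (complex.Re z) * sin (complex.Im z)).

Definition cpow_neg (R : realType) (lam : R) (s : R[i]) : R[i] :=
  if 0 < lam then cexp (- (s * Complex (ln lam) 0))
  else cexp (- (Complex 0 pi * s)) * cexp (- (s * Complex (ln (- lam)) 0)).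

(* Euler Gamma function (used for arguments > 0) *)
Definition Gamma (R : realType) (x : R) : R :=
  fine (\int[@lebesgue_measure R]_(t in `]0%R, +oo[)
          (t `^ (x - 1) * expR (- t))%:E)%E.

Definition smooth_01 (R : realType) (f : R -> R) : Prop :=
  forall (n : nat) (x : R), 0 < x < 1 -> derivable (iter n (@derive1 R R) f) x 1.

Definition smooth_01c (R : realType) (f : R -> R) : Prop :=
  smooth_01 f /\
  (forall n : nat, exists l : R, (iter n (@derive1 R R) f) x @[x --> 0^'+] --> l) /\
  f x @[x --> 0^'+] --> f 0.

Inductive bckind (R : Type) := BDir | BRob of R | BFried.
Arguments BDir {R}.
Arguments BFried {R}.

Definition extends0 (R : realType) (q : R -> R) : Prop :=
  exists c : R, q x @[x --> 0^'+] --> c.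
Definition extends1 (R : realType) (q : R -> R) : Prop :=
  exists c : R, q x @[x --> 1^'-] --> c.

Definition admissible0 (R : realType) (b : bckind R) (q : R -> R) : Prop :=
  match b with BFried => ~ extends0 q | _ => extends0 q end.
Definition admissible1 (R : realType) (b : bckind R) (q : R -> R) : Prop :=
  match b with BFried => ~ extends1 q | _ => extends1 q end.

Definition nu_of (R : realType) (b : bckind R) (a : R -> R) : R :=
  match b with
  | BDir => 1 / 2
  | BRob _ => - (1 / 2)
  | BFried => Num.sqrt (a 0 + 1 / 4)
  end.

Definition psinu (R : realType) (nu x : R) : R :=
  if 0 < nu then x `^ (1 / 2 - nu) / (2 * nu) else - (Num.sqrt x * ln x).

Definition bc0 (R : realType) (b : bckind R) (a0 : R -> R) (f : R -> R) : Prop :=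
  match b with
  | BDir => f x @[x --> 0^'+] --> 0
  | BRob A => exists u v : R, f x @[x --> 0^'+] --> u /\
              (derive1 f) x @[x --> 0^'+] --> v /\ v + A * u = 0
  | BFried => (f x / psinu (nu_of b a0) x) @[x --> 0^'+] --> 0
  end.

Definition bc1 (R : realType) (b : bckind R) (a1 : R -> R) (f : R -> R) : Prop :=
  match b with
  | BDir => f x @[x --> 1^'-] --> 0
  | BRob B => exists u v : R, f x @[x --> 1^'-] --> u /\
              (derive1 f) x @[x --> 1^'-] --> v /\ v + B * u = 0
  | BFried => (f x / psinu (nu_of b a1) (1 - x)) @[x --> 1^'-] --> 0
  end.

Definition solves (R : realType) (q : R -> R) (lam : R) (f : R -> R) : Prop :=
  forall x : R, 0 < x < 1 ->
    derivable f x 1 /\ derivable (derive1 f) x 1 /\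
    - (derive1 (derive1 f)) x + q x * f x = lam * f x.

Definition sq_int01 (R : realType) (f : R -> R) : Prop :=
  (\int[@lebesgue_measure R]_(x in `]0%R, 1%R[) ((f x) ^+ 2)%:E < +oo)%E.

Definition eigfun (R : realType) (q : R -> R) (b0 : bckind R) (a0 : R -> R)
    (b1 : bckind R) (a1 : R -> R) (lam : R) (f : R -> R) : Prop :=
  solves q lam f /\ sq_int01 f /\ bc0 b0 a0 f /\ bc1 b1 a1 f.

Definition nonzero01 (R : realType) (f : R -> R) : Prop :=
  exists x : R, 0 < x < 1 /\ f x != 0.

Definition linindep01 (R : realType) (f g : R -> R) : Prop :=
  forall al be : R, (forall x : R, 0 < x < 1 -> al * f x + be * g x = 0) ->
    al = 0 /\ be = 0.

(* multiplicity of lam as an eigenvalue of L = dimension of the eigenspace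
   (a subspace of the 2-dimensional solution space of the ODE) *)
Definition mult (R : realType) (q : R -> R) (b0 : bckind R) (a0 : R -> R)
    (b1 : bckind R) (a1 : R -> R) (lam : R) : nat :=
  if `[< exists f g, eigfun q b0 a0 b1 a1 lam f /\ eigfun q b0 a0 b1 a1 lam g /\
                    linindep01 f g >] then 2%N
  else if `[< exists f, eigfun q b0 a0 b1 a1 lam f /\ nonzero01 f >] then 1%N
  else 0%N.

Definition zeta_partial (R : realType) (q : R -> R) (b0 : bckind R) (a0 : R -> R)
    (b1 : bckind R) (a1 : R -> R) (n : nat) (s : R[i]) : R[i] :=
  \sum_(lam \in [set lam : R | (0 < mult q b0 a0 b1 a1 lam)%N /\ lam != 0 /\
                               `|lam| <= n%:R])
     ((mult q b0 a0 b1 a1 lam)%:R * cpow_neg lam s).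

(* det_zeta(L) = D : D = 0 if 0 is an eigenvalue; otherwise D = exp(-zeta_L'(0)),
   where zeta_L is (the unique) holomorphic continuation, to a connected open set
   containing 0, of the series sum lam^{-s} convergent on a right half plane. *)
Definition is_zeta_det (R : realType) (q : R -> R) (b0 : bckind R) (a0 : R -> R)
    (b1 : bckind R) (a1 : R -> R) (D : R[i]) : Prop :=
  if (0 < mult q b0 a0 b1 a1 0)%N then D = 0
  else exists (sigma : R) (U : set (Cx R)) (Z : Cx R -> Cx R),
    open U /\ connected U /\ U 0 /\
    (forall s : Cx R, sigma < complex.Re s -> U s) /\
    (forall s : Cx R, U s -> derivable Z s 1) /\
    (forall s : Cx R, sigma < complex.Re s ->
        zeta_partial q b0 a0 b1 a1 n s @[n --> \oo] --> Z s) /\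
    D = cexp (- ('D_1 Z 0)).

Definition regsing_potential (R : realType) (N : nat) (q a0 a1 : R -> R) : Prop :=
  (0 < N)%N /\ smooth_01 q /\ smooth_01c a0 /\ smooth_01c a1 /\
  - (1 / 4) <= a0 0 /\ - (1 / 4) <= a1 0 /\
  (forall x : R, 0 < x < 1 ->
     q x = x ^- 2 * a0 (x `^ (N%:R^-1)) /\
     q x = (1 - x) ^- 2 * a1 ((1 - x) `^ (N%:R^-1))).

Definition normalized0 (R : realType) (q : R -> R) (b0 : bckind R) (a0 : R -> R)
    (phi : R -> R) : Prop :=
  [/\ solves q 0 phi, bc0 b0 a0 phi &
      (phi x / x `^ (nu_of b0 a0 + 1 / 2)) @[x --> 0^'+] --> (1 : R)].

Definition normalized1 (R : realType) (q : R -> R) (b1 : bckind R) (a1 : R -> R)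
    (psi : R -> R) : Prop :=
  [/\ solves q 0 psi, bc1 b1 a1 psi &
      (psi x / (1 - x) `^ (nu_of b1 a1 + 1 / 2)) @[x --> 1^'-] --> (1 : R)].

Definition wronskian (R : realType) (psi phi : R -> R) (x : R) : R :=
  psi x * (derive1 phi) x - (derive1 psi) x * phi x.

(* Main.v *)
(** Let [phi_lam], [psi_lam] be the solutions of [(l - lam) f = 0] normalized at the two
    ends and [W(lam)] their Wronskian; its zeros are simple and are the eigenvalues of [L].
    Since [- W'/W] is the trace of the resolvent, which is computed by discretizing the Green
    function and diagonalizing the resulting matrices, [W(lam) / W(lb)] is the product of the
    [1 - (lam - lb) th_i], where [lb] lies below the spectrum and the [th_i] are the
    eigenvalues of [(L - lb)^-1].  Comparison with the Bessel equation
    [f'' = (k^2 + (m^2 - m) / x^2) f], [m = nu + 1/2], shows that [W(- k^2)] is asymptotic to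
    [2 K_0 K_1 k^(1 - m_0 - m_1) exp k] with [K = 2^m Gamma(m + 1/2) / (2 sqrt pi)].
    Up to an explicit factor, the zeta function is the Mellin transform of
    [log (W(- mu) / W(0))]; hence [zeta'(0)] is the constant term of the expansion of this
    logarithm at infinity, and [exp (- zeta'(0)) = W(0) / (2 K_0 K_1)]. *)
Require Import Defs.
From HB Require Import structures.
From mathcomp Require Import all_boot all_order all_algebra.
From mathcomp Require Import all_classical all_reals all_analysis.
From mathcomp Require Import complex.
From mathcomp Require Import ring lra.
Import Order.TTheory GRing.Theory Num.Theory numFieldNormedType.Exports.
Set Implicit Arguments.
Unset Strict Implicit.
Unset Printing Implicit Defensive.
Local Open Scope ring_scope.
Local Open Scope classical_set_scope.

(** The numbers [th_i] are limits of matrix eigenvalues, and such limits may lose trace. At first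
    the sum of the [th_i] is only known to be at most the trace of the resolvent; a gap [g] would
    put a factor [exp (- g lam)] into the product for [W], and it is excluded because [W (- k^2)]
    grows no faster than a power of [k] times [exp k]. The expansion of [log (W (- mu) / W 0)]
    contains [sqrt mu], which gives the zeta function a pole at [1/2], on the way from the half
    plane of convergence to [0]. The domain of the continuation therefore passes above [1/2]. It is
    thin because the explicit factor has a denominator [H] whose zeros are excluded only near a real
    segment. Negative eigenvalues are finite in number. They are split off before logarithms are
    taken, and the terms [exp (- z (i pi + ln |lam|))] are added back at the end; this restores the
    sign of [W 0]. Integrals are mostly carried by primitives and their limits at the endpoints, so
    that comparisons of integrals become comparisons of derivatives. *)

Local Notation Re := complex.Re.
Local Notation Im := complex.Im.
Local Notation der x := (is_derive x 1).

Ltac tri := apply: le_trans (ler_normD _ _) _.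
(* [lra] is slow in large contexts; [glra] only sees the hypotheses moved to the goal. *)
Ltac glra := repeat match goal with H : is_true _ |- _ => clear H end; lra.

Local Notation squeeze0 f := (@squeeze_cvgr _ _ _ _ (fun=> 0) f).

(** * Differentiation and antiderivatives on open intervals *)

Ltac pos := repeat first [assumption | done | exact: powR_ge0 | exact: expR_ge0 | exact: normr_ge0
  | exact: sqr_ge0 | exact: powR_gt0 | exact: expR_gt0 | apply: mulr_ge0 | apply: mulr_gt0
  | rewrite invr_ge0 | rewrite invr_gt0 | apply: exprn_ge0 | apply: exprn_gt0
  | apply: addr_ge0 | apply: ltW; (assumption || lra) ].

Lemma le_of_eq (R : realType) (x y : R) : x = y -> x <= y.
Proof. by move=> ->. Qed.

Lemma le34_1 (R : realType) : (3 / 4 : R) <= 1.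
Proof. lra. Qed.

Lemma lt0_34 (R : realType) : 0 < (3 / 4 : R).
Proof. lra. Qed.

Lemma half_le1 (R : realType) : 0 < (1 / 2 : R) <= 1.
Proof. lra. Qed.

Lemma half_lt34 (R : realType) : 0 < (1 / 2 : R) < 3 / 4.
Proof. lra. Qed.

Section Derive.
Variable R : realType.
Implicit Types (f g h : R -> R) (x y a b l : R).

Lemma dv_eq f x l l' : der x f l' -> l' = l -> der x f l.
Proof. by move=> ? <-. Qed.

Lemma dv_cst (c x : R) : der x (fun=> c) 0.
Proof. exact: (is_derive_cst c x 1). Qed.

Lemma dv_id x : der x (fun y => y) 1.
Proof. exact: is_derive_id. Qed.

Lemma dvD f g x a b : der x f a -> der x g b ->
  der x (fun y => f y + g y) (a + b).
Proof. by move=> fa gb; exact: (is_deriveD fa gb). Qed.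

Lemma dvN f x a : der x f a -> der x (fun y => - f y) (- a).
Proof. by move=> fa; exact: (is_deriveN fa). Qed.

Lemma dvM f g x a b : der x f a -> der x g b ->
  der x (fun y => f y * g y) (a * g x + f x * b).
Proof.
move=> fa gb; apply: dv_eq (is_deriveM fa gb) _.
by rewrite addrC [a * _]mulrC.
Qed.

Lemma dv_lin (c x : R) : der x ( *%R c) c.
Proof. by apply: dv_eq (dvM (dv_cst c x) (dv_id x)) _; rewrite mul0r add0r mulr1. Qed.

Lemma dvV f x a : f x != 0 -> der x f a ->
  der x (fun y => (f y)^-1) (- (a / f x ^+ 2)).
Proof.
move=> f0 fa; apply: dv_eq (is_deriveV f0 fa) _.
by rewrite scaleNr mulrC.
Qed.

Lemma dv_comp f g x a b : der (g x) f a -> der x g b ->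
  der x (fun y => f (g y)) (a * b).
Proof. by move=> fa gb; exact: (is_derive1_comp fa gb). Qed.

Lemma dvX f n x a : der x f a ->
  der x (fun y => f y ^+ n) (n%:R * f x ^+ n.-1 * a).
Proof.
move=> fa; have dX : der (f x) (fun y : R => y ^+ n) (n%:R * f x ^+ n.-1).
  apply: DeriveDef; first exact: exprn_derivable.
  by rewrite exp_derive /GRing.scale/= mulr1.
exact: (dv_comp dX fa).
Qed.

Lemma dv_exp f x a : der x f a ->
  der x (fun y => expR (f y)) (expR (f x) * a).
Proof. by move=> fa; apply: dv_comp fa. Qed.

Lemma dv_ln f x a : 0 < f x -> der x f a ->
  der x (fun y => ln (f y)) (a / f x).
Proof.
move=> f0 fa; apply: dv_eq (dv_comp (is_derive1_ln f0) fa) _.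
lra.
Qed.

Lemma dv_pow f x a (r : R) : 0 < f x -> der x f a ->
  der x (fun y => f y `^ r) (r * f x `^ (r - 1) * a).
Proof. by move=> f0 fa; exact: (dv_comp (is_derive1_powR r f0) fa). Qed.

Lemma dv_cont f x a : der x f a -> {for x, continuous f}.
Proof.
by move=> [/derivable1_diffP/differentiable_continuous].
Qed.

Lemma dv_derive1 f x a : der x f a -> derivable f x 1 /\ f^`() x = a.
Proof. by move=> fa; rewrite derive1E; case: fa => ? <-. Qed.

Lemma derive1_dv f x : derivable f x 1 -> der x f (f^`() x).
Proof. by move=> fx; rewrite derive1E; by []. Qed.

Lemma near_itvoo a b x : a < x < b -> \forall y \near x, a < y < b.
Proof.
move=> /andP[ax xb]; near=> y; apply/andP; split; near: y.
  exact: lt_nbhsr.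
exact: lt_nbhsl.
Unshelve. all: by end_near. Qed.

Lemma dv_near a b f g x l : a < x < b -> (forall y, a < y < b -> f y = g y) ->
  der x f l -> der x g l.
Proof.
move=> xab fg; apply: near_eq_is_derive; near=> y; apply: fg.
by near: y; exact: near_itvoo.
Unshelve. all: by end_near. Qed.

Lemma dv_within a b f f' : (forall x, a <= x <= b -> der x f (f' x)) ->
  {within `[a, b], continuous f}.
Proof.
move=> df; apply: continuous_subspace_itv => x; rewrite in_itv/= => xab.
exact: dv_cont (df x xab).
Qed.

Lemma dv_mvt a b f f' : a <= b -> (forall x, a <= x <= b -> der x f (f' x)) ->
  exists2 c, a <= c <= b & f b - f a = f' c * (b - a).
Proof.
move=> ab df; have [||c cab e] := @MVT_segment R f f' a b ab.
- by move=> x; rewrite in_itv => /andP[/ltW ? /ltW ?]; apply: df; apply/andP.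
- exact: dv_within df.
by exists c; rewrite //.
Qed.

Lemma dv_le a b f f' : a <= b -> (forall x, a <= x <= b -> der x f (f' x)) ->
  (forall x, a <= x <= b -> 0 <= f' x) -> f a <= f b.
Proof.
move=> ab df f0; have [c cab e] := dv_mvt ab df.
by rewrite -subr_ge0 e mulr_ge0 ?subr_ge0// f0.
Qed.

Lemma dv_le_norm a b f f' h h' : a <= b ->
  (forall x, a <= x <= b -> der x f (f' x)) ->
  (forall x, a <= x <= b -> der x h (h' x)) ->
  (forall x, a <= x <= b -> `|f' x| <= h' x) -> `|f b - f a| <= h b - h a.
Proof.
move=> ab df dh fh; rewrite ler_norml; apply/andP; split.
  have := @dv_le a b (fun y => f y + h y) (fun y => f' y + h' y) ab.
  suff + : f a + h a <= f b + h b by lra.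
  apply: (@dv_le a b (fun y => f y + h y) (fun y => f' y + h' y) ab) => x xab.
    by apply: dvD; [exact: df|exact: dh].
  by have := fh x xab; rewrite ler_norml => /andP[? _]; lra.
suff : h a - f a <= h b - f b by lra.
apply: (@dv_le a b (fun y => h y - f y) (fun y => h' y - f' y) ab) => x xab.
  by apply: dvD; [exact: dh|apply: dvN; exact: df].
by have := fh x xab; rewrite ler_norml => /andP[_ ?]; lra.
Qed.

Lemma dv_const a b f : (forall x, a < x < b -> der x f 0) ->
  forall x y, a < x < b -> a < y < b -> f x = f y.
Proof.
move=> df; suff H x y : x <= y -> a < x < b -> a < y < b -> f x = f y.
  by move=> x y xab yab; case: (leP x y) => [|/ltW] xy; [|symmetry]; exact: H.
move=> xy /andP[ax xb] /andP[ay yb].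
have [|c _ e] := @dv_mvt x y f (fun=> 0) xy.
  by move=> z /andP[xz zy]; apply: df; rewrite (lt_le_trans ax)// (le_lt_trans zy).
lra.
Qed.

(** Convexity and openness of [I] put [x] and the base point [c] inside a compact interval contained
    in [I], where the fundamental theorem applies to the oriented integral from [c]. Bounded
    intervals and the half line are both instances. *)
Lemma antiderivative_convex (I : R -> Prop) c f : I c ->
  (forall x y z, I x -> I y -> x <= z <= y -> I z) ->
  (forall x, I x -> exists y z, [/\ I y, I z & y < x < z]) ->
  (forall x, I x -> {for x, continuous f}) -> exists F, forall x, I x -> der x F (f x).
Proof.
move=> Ic cI oI cf; pose mu := @lebesgue_measure R.
exists (fun x => if c <= x then (\int[mu]_(t in `[c, x]) f t)%R
                 else - (\int[mu]_(t in `[x, c]) f t)%R) => x Ix.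
have mx : (Num.min x c <= x) && (Num.min x c <= c) by rewrite !ge_min !lexx orbT.
have mn : (x <= Num.max x c) && (c <= Num.max x c) by rewrite !le_max !lexx orbT.
have [a' [_ [Ia _ /andP[am _]]]] : exists y z, [/\ I y, I z & y < Num.min x c < z].
  by apply: oI; case: leP.
have [_ [u [_ Iu /andP[_ um]]]] : exists y z, [/\ I y, I z & y < Num.max x c < z].
  by apply: oI; case: leP.
have intf p q : a' <= p -> q <= u -> mu.-integrable `[p, q] (EFin \o f).
  move=> pa qu; apply: continuous_compact_integrable; first exact: segment_compact.
  apply: continuous_subspace_itv => z; rewrite in_itv/= => /andP[pz zq].
  by apply: cf; apply: (cI a' u) => //; lra.
have a'x : a' < x by lra.
have xu : x < u by lra.
have [d1 d2] := @continuous_FTC1_closed R f a' x u xu (intf _ _ (lexx _) (lexx _)) a'x (cf x Ix).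
pose F0 y := (\int[mu]_(t in `[a', y]) f t)%R.
have dF0 : der x F0 (f x) by rewrite -d2; exact: derive1_dv.
have spl p q : a' <= p -> p <= q -> q <= u ->
    (\int[mu]_(t in `[p, q]) f t)%R = F0 q - F0 p.
  move=> pa pq qu; have := @Rintegral_itvB R f (BLeft a') (BRight q) p (intf _ _ (lexx _) qu).
  rewrite !bnd_simp => /(_ pa pq); rewrite Rintegral_itv_obnd_cbnd//.
  apply: integrableS (intf p q pa qu) => //.
  by move=> z/=; rewrite !in_itv/= => /andP[/ltW -> ->].
apply: (@dv_near a' u (fun y => F0 y - F0 c)).
- lra.
- move=> y /andP[a'y yu]; case: ifPn => [cy|]; first by rewrite spl; lra.
  by rewrite -ltNge => yc; rewrite spl ?opprB; lra.
by apply: dv_eq (dvD dF0 (dv_cst _ _)) _; rewrite addr0.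
Qed.

Lemma antiderivative a b f : a < b -> (forall x, a < x < b -> {for x, continuous f}) ->
  exists F, forall x, a < x < b -> der x F (f x).
Proof.
move=> ab; apply: (@antiderivative_convex _ ((a + b) / 2)); first lra.
  by move=> *; lra.
by move=> x h; exists ((a + x) / 2), ((x + b) / 2); split; lra.
Qed.

Lemma antiderivative_pos f : (forall x, 0 < x -> {for x, continuous f}) ->
  exists F, forall x, 0 < x -> der x F (f x).
Proof.
apply: (@antiderivative_convex (fun x => 0 < x) 1) => [|x y z *|x h]; [by []|lra|].
by exists (x / 2), (x + 1); split; lra.
Qed.

(** Both [h + f] and [h - f] are nondecreasing and bounded below near [c], so they have limits
    there, and [f] is half their difference. This is convergence of an absolutely dominated improper
    integral, stated for primitives. *)
Lemma cvg_right_bounded (c b : R) f h : c < b ->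
  (forall x y, c < x -> x <= y -> y < b -> `|f y - f x| <= h y - h x) ->
  (forall x, c < x < b -> 0 <= h x) -> exists l, f x @[x --> c^'+] --> l /\
  (forall x, c < x < b -> `|f x - l| <= h x).
Proof.
move=> cb fh h0.
have hm x y : c < x -> x <= y -> y < b -> h x <= h y.
  by move=> cx xy yb; have := le_trans (normr_ge0 _) (fh x y cx xy yb); rewrite subr_ge0.
have mono (s : R) : `|s| = 1 -> exists l, h x + s * f x @[x --> c^'+] --> l.
  move=> s1; apply/cvg_ex; apply: nondecreasing_at_right_is_cvgr.
    near=> x => y z; rewrite !in_itv/= => /andP[cy yx] /andP[cz zx] yz.
    have xb : x < b by [].
    have := fh y z cy yz (lt_trans zx xb).
    have -> : `|f z - f y| = `|s * f z - s * f y| by rewrite -mulrBr normrM s1 mul1r.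
    by rewrite ler_norml => /andP[+ _]; lra.
  near=> x; exists (s * f x - `|h x|); move=> _ [y /=] /[!in_itv]/= /andP[cy yx] <-.
  have xb : x < b by [].
  have yb := lt_trans yx xb.
  have hy : 0 <= h y by rewrite h0// cy.
  have := fh y x cy (ltW yx) xb; rewrite -[leLHS]mul1r -s1 -normrM mulrBr ler_norml.
  by move=> /andP[_ +]; have := ler_norm (h x); lra.
have [l1 cl1] := mono 1 (normr1 _).
have [l2 cl2] := mono (-1) (normrN1 _).
exists ((l1 - l2) / 2).
have cvf : f x @[x --> c^'+] --> (l1 - l2) / 2.
  have -> : f = fun x => ((h x + 1 * f x) - (h x + -1 * f x)) / 2.
    by apply/funext => x; rewrite mul1r; lra.
  by apply: cvgMl; exact: cvgB.
split => // x /andP[cx xb].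
have : `|f x - f y| @[y --> c^'+] --> `|f x - (l1 - l2) / 2|.
  by apply: cvg_norm; apply: cvgB => //; exact: cvg_cst.
move=> /cvgr_to_le; apply; near=> y.
have cy : c < y by [].
have yx : y <= x by near: y; exact: nbhs_right_le.
have hy : 0 <= h y by rewrite h0// cy (le_lt_trans yx).
by apply: le_trans (fh y x cy yx xb) _; lra.
Unshelve. all: by end_near. Qed.

(** [F] plays the part of the improper integral of [f] from [a]; domination by the derivative of a
    nonnegative function stands for integrability at [a]. *)
Lemma prim_dominated a b f h h' : a < b ->
  (forall x, a < x < b -> {for x, continuous f}) ->
  (forall x, a < x < b -> der x h (h' x)) ->
  (forall x, a < x < b -> `|f x| <= h' x) -> (forall x, a < x < b -> 0 <= h x) ->
  exists F, [/\ forall x, a < x < b -> der x F (f x),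
   F x @[x --> a^'+] --> 0 & forall x, a < x < b -> `|F x| <= h x].
Proof.
move=> ab cf dh fh h0; have [F0 dF0] := antiderivative ab cf.
have [|//|l [Fl Fh]] := @cvg_right_bounded a b F0 h ab.
  move=> x y ax xy yb.
  have H z : x <= z <= y -> a < z < b.
    lra.
  apply: (dv_le_norm xy) => z zxy; [apply: dF0|apply: dh|apply: fh]; lra.
exists (fun x => F0 x - l); split => //.
- move=> x xab; apply: dv_eq (dvD (dF0 x xab) (dv_cst _ _)) _.
  lra.
- by rewrite -(subrr l); apply: cvgB => //; exact: cvg_cst.
Qed.

End Derive.

Ltac dv1 := lazymatch goal with
  | |- is_derive _ _ (fun y => @?f y + @?g y) _ => eapply (@dvD _ f g)
  | |- is_derive _ _ (fun y => - @?f y) _ => eapply (@dvN _ f)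
  | |- is_derive _ _ (fun y => @?f y * @?g y) _ => eapply (@dvM _ f g)
  | |- is_derive _ _ (fun y => (@?f y)^-1) _ => eapply (@dvV _ f)
  | |- is_derive _ _ (fun y => @?f y ^+ ?n) _ => eapply (@dvX _ f n)
  | |- is_derive _ _ (fun y => expR (@?f y)) _ => eapply (@dv_exp _ f)
  | |- is_derive _ _ (fun y => ln (@?f y)) _ => eapply (@dv_ln _ f)
  | |- is_derive _ _ (fun y => powR (@?f y) ?r) _ => eapply (@dv_pow _ f _ _ r)
  | |- is_derive _ _ ( *%R ?c) _ => eapply dv_lin
  | |- is_derive _ _ (fun y => y) _ => eapply dv_id
  | |- is_derive _ _ (fun y => ?c) _ => eapply dv_cst
  | |- is_derive _ _ _ _ => first [eassumption | match goal with H : _ |- _ => eapply H end]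
  end.
Ltac dvt := eapply dv_eq; [repeat dv1 | ].

(** * A Volterra existence theorem with majorant *)

Section Volterra_tools.
Variable R : realType.
Implicit Types (f g h F H : R -> R) (x y z : R).

Lemma dv_bound0 (b : R) F F' H H' : 
  (forall x, 0 < x < b -> der x F (F' x)) -> F x @[x --> 0^'+] --> (0 : R) ->
  (forall x, 0 < x < b -> der x H (H' x)) ->
  (forall x, 0 < x < b -> `|F' x| <= H' x) -> (forall x, 0 < x < b -> 0 <= H x) ->
  forall x, 0 < x < b -> `|F x : R| <= H x.
Proof.
move=> dF F0 dH FH H0 x xb; have b0 : 0 < b by case/andP: xb => x0; lra.
have [|//|l [Fl /(_ x xb)]] := @cvg_right_bounded R 0 b F H b0.
  move=> y z y0 yz zb.
  have I t : y <= t <= z -> 0 < t < b.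
    lra.
  apply: (dv_le_norm yz) => t tyz; [apply: dF|apply: dH|apply: FH]; lra.
have -> : l = 0 by apply: (cvg_unique _ Fl F0).
by rewrite subr0.
Qed.

Lemma ge0_of_right_limit (b : R) h : h x @[x --> 0^'+] --> (0 : R) ->
  (forall x y, 0 < x -> x <= y -> y < b -> h x <= h y) ->
  forall x, 0 < x < b -> 0 <= h x.
Proof.
move=> h0 hm x /andP[x0 xb]; move: h0 => /cvgr_to_le; apply; near=> y.
by apply: hm => //; near: y; exact: nbhs_right_le.
Unshelve. all: by end_near. Qed.

Lemma uniform_approx_continuous (a b : R) f (g : nat -> R -> R) (e : nat -> R) x :
  a < x < b -> e n @[n --> \oo] --> 0 ->
  (forall n y, a < y < b -> `|f y - g n y| <= e n) ->
  (forall n, {for x, continuous (g n)}) -> {for x, continuous f}.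
Proof.
move=> xab e0 fg cg; apply/cvgrPdist_lt => eps eps0.
have e3 : 0 < eps / 3 by lra.
have [n _ /(_ n (leqnn n))/=] : \forall n \near \oo, `|0 - e n| < eps / 3 by move/cvgrPdist_lt: e0; apply.
rewrite sub0r normrN => en.
have cgn : \forall y \near x, `|g n x - g n y| < eps / 3 by move/cvgrPdist_lt: (cg n); apply.
near=> y.
have yab : a < y < b by near: y; exact: near_itvoo.
have h1 := le_lt_trans (fg n x xab) (le_lt_trans (ler_norm _) en).
have h2 := le_lt_trans (fg n y yab) (le_lt_trans (ler_norm _) en).
have h3 : `|g n x - g n y| < eps / 3 by near: y.
have -> : f x - f y = (f x - g n x) + ((g n x - g n y) - (f y - g n y)) by ring.
apply: le_lt_trans (ler_normD _ _) _; apply: le_lt_trans (lerD (lexx _) (ler_normB _ _)) _.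
lra.
Unshelve. all: by end_near. Qed.

Lemma cvg_seq_tail (u e : nat -> R) : e n @[n --> \oo] --> 0 ->
  (forall n m, (n <= m)%N -> `|u m - u n| <= e n) ->
  u n @[n --> \oo] --> limn u /\ forall n, `|limn u - u n| <= e n.
Proof.
move=> e0 ue; have cu : cvgn u.
  apply: cauchy_cvg; apply: cauchy_exP => eps eps0.
  have [n _ /(_ n (leqnn n))/=] : \forall n \near \oo, `|0 - e n| < eps.
    by move/cvgrPdist_lt: e0; apply.
  rewrite sub0r normrN => en; exists (u n); exists n => // m /= nm.
  rewrite /ball/= distrC; apply: le_lt_trans (ue n m nm) _.
  exact: le_lt_trans (ler_norm _) en.
split=> // n; have : `|u m - u n| @[m --> \oo] --> `|limn u - u n|.
  by apply: cvg_norm; apply: cvgB => //; exact: cvg_cst.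
move=> /cvgr_to_le; apply; near=> m; apply: ue.
by near: m; exact: nbhs_infty_ge.
Unshelve. all: by end_near. Qed.

Lemma cvg_sub0 (f g : R -> R) (Fl : set_system R) {FF : Filter Fl} :
  f x @[x --> Fl] --> (0 : R) -> g x @[x --> Fl] --> (0 : R) ->
  f x - g x @[x --> Fl] --> (0 : R).
Proof. by move=> f0 g0; rewrite -[0 in X in _ --> X](subr0 0); apply: cvgB. Qed.

Lemma cvg_sum0 (f : nat -> R -> R) n (Fl : set_system R) {FF : Filter Fl} :
  (forall k, f k x @[x --> Fl] --> (0 : R)) -> \sum_(k < n) f k x @[x --> Fl] --> (0 : R).
Proof.
move=> f0; elim: n => [|n ih].
  under eq_fun do rewrite big_ord0; exact: cvg_cst.
rewrite (_ : (fun x => _) = fun x => \sum_(k < n) f k x + f n x).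
  by rewrite -[0 in X in _ --> X](addr0 0); apply: cvgD.
by apply/funext => x; rewrite big_ord_recr.
Qed.

End Volterra_tools.

Section Primitive0.
Variables (R : realType) (b : R).
Implicit Types (g H F : R -> R) (x y z : R).
Hypothesis b0 : 0 < b.

Definition is_prim0 (g F : R -> R) :=
  (forall x, 0 < x < b -> der x F (g x)) /\ F x @[x --> 0^'+] --> (0 : R).

(** The integral from [0] as a total operation, with the zero function as default, so that iterates
    can be defined by recursion before their convergence at [0] is known. *)
Definition prim0 (g : R -> R) : R -> R := xget (fun=> 0) [set F | is_prim0 g F].

Lemma prim0P g H H' : (forall x, 0 < x < b -> {for x, continuous g}) ->
  (forall x, 0 < x < b -> der x H (H' x)) ->
  (forall x, 0 < x < b -> `|g x| <= H' x) -> (forall x, 0 < x < b -> 0 <= H x) ->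
  is_prim0 g (prim0 g) /\ (forall x, 0 < x < b -> `|prim0 g x| <= H x).
Proof.
move=> cg dH gH H0; have [F [dF F0 _]] := prim_dominated b0 cg dH gH H0.
have [p1 p2] : is_prim0 g (prim0 g) by exact: (@xgetPex _ (fun=> 0) [set F | is_prim0 g F] (ex_intro _ F (conj dF F0))).
by split => //; exact: (dv_bound0 p1 p2 dH gH H0).
Qed.

End Primitive0.

Section Volterra.
Variables (R : realType) (b B : R) (be P f h eta eta' : R -> R).
Implicit Types (x y z : R) (n : nat).
Hypotheses (b0 : 0 < b) (B0 : 0 <= B).
Hypothesis be0 : forall x, 0 < x < b -> 0 < be x.
Hypothesis cbe : forall x, 0 < x < b -> {for x, continuous be}.
Hypothesis cP : forall x, 0 < x < b -> {for x, continuous P}.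
Hypothesis cf : forall x, 0 < x < b -> {for x, continuous f}.
Hypothesis dh : forall x, 0 < x < b -> der x h (eta x / be x).
Hypothesis deta : forall x, 0 < x < b -> der x eta (eta' x).
Hypothesis h_cvg0 : h x @[x --> 0^'+] --> (0 : R).
Hypothesis eta0 : forall x, 0 < x < b -> 0 <= eta x.
Hypothesis Peta : forall x, 0 < x < b -> `|P x * be x| <= eta' x.
Hypothesis feta : forall x, 0 < x < b -> `|f x| <= B * eta' x.

Let h_mono x y : 0 < x -> x <= y -> y < b -> h x <= h y.
Proof.
move=> x0 xy yb; have I t : x <= t <= y -> 0 < t < b.
  lra.
apply: (dv_le xy) => [t /I|t /I tb]; first exact: dh.
by rewrite divr_ge0 ?eta0// ltW// be0.
Qed.

Let h0 x : 0 < x < b -> 0 <= h x.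
Proof. exact: ge0_of_right_limit h_cvg0 h_mono x. Qed.

(** Increments of the Picard iteration for [w' = z / be], [z' = P be w + f] with zero data at [0]:
    the solution is the pair of sums of the [vw n] and of the [vz n]. *)
Fixpoint vz (n : nat) : R -> R :=
  if n is n'.+1 then prim0 b (fun x => P x * be x * prim0 b (fun y => vz n' y / be y) x)
  else prim0 b f.
Definition vw (n : nat) : R -> R := prim0 b (fun y => vz n y / be y).

Let vzS n : vz n.+1 = prim0 b (fun x => P x * be x * vw n x). Proof. by []. Qed.

Let fact_gt0 n : 0 < (n`!)%:R :> R. Proof. by []. Qed.

Let dhpow n x : 0 < x < b ->
  der x (fun y => B * (h y ^+ n.+1 / (n.+1)`!%:R)) (B * (eta x * (h x ^+ n / n`!%:R) / be x)).
Proof.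
move=> xb; have bx := be0 xb; dvt; first exact: (dh xb); first by [].
rewrite factS; field.
by rewrite (gt_eqF bx) (gt_eqF (fact_gt0 n)) nat1r pnatr_eq0.
Qed.

Let deltapow n x : 0 < x < b ->
  der x (fun y => B * (eta y * (h y ^+ n / n`!%:R)))
   (B * (eta' x * (h x ^+ n / n`!%:R)) + B * (eta x * (n%:R * h x ^+ n.-1 * (eta x / be x) / n`!%:R))).
Proof.
move=> xb; have bx := be0 xb.
dvt; [exact: (deta xb)|exact: (dh xb)|by []|].
lra.
Qed.

(** Since [h' = eta / be], integrating [h^n eta / be] gives [h^(n+1) / (n+1)], whence the
    factorials. In the other equation [P be] is absorbed by [eta'], the remaining part of the
    derivative of [eta h^n] being nonnegative. *)
Let vP n :
  [/\ is_prim0 b (if n is n'.+1 then fun x => P x * be x * vw n' x else f) (vz n),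
    forall x, 0 < x < b -> `|vz n x| <= B * (eta x * (h x ^+ n / n`!%:R)),
    is_prim0 b (fun y => vz n y / be y) (vw n) &
    forall x, 0 < x < b -> `|vw n x| <= B * (h x ^+ n.+1 / (n.+1)`!%:R)].
Proof.
have wP m : is_prim0 b (if m is n'.+1 then fun x => P x * be x * vw n' x else f) (vz m) ->
    (forall x, 0 < x < b -> `|vz m x| <= B * (eta x * (h x ^+ m / m`!%:R))) ->
    is_prim0 b (fun y => vz m y / be y) (vw m) /\
    forall x, 0 < x < b -> `|vw m x| <= B * (h x ^+ m.+1 / (m.+1)`!%:R).
  move=> [zd _] zb; apply: (prim0P b0 _ (@dhpow m)) => x xb.
  - apply: cvgM; first exact: dv_cont (zd x xb).
    by apply: cvgV; [rewrite gt_eqF ?be0|exact: cbe].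
  - rewrite normrM normfV (gtr0_norm (be0 xb)) mulrA ler_pM2r ?invr_gt0 ?be0//.
    exact: zb.
  - by rewrite mulr_ge0// divr_ge0 ?exprn_ge0 ?h0.
elim: n => [|n [z1 z2 w1 w2]].
  have [z1 z2] : is_prim0 b f (vz 0) /\
      forall x, 0 < x < b -> `|vz 0 x| <= B * (eta x * (h x ^+ 0 / 0`!%:R)).
    apply: (prim0P b0 cf (@deltapow 0)) => x xb.
      apply: le_trans (feta xb) _.
      by rewrite divr1 mul0r mulr1 mul0r mul0r !mulr0 addr0.
    by rewrite divr1 mulr1 mulr_ge0// eta0.
  by have [w1 w2] := wP 0%N z1 z2.
have [z1' z2'] : is_prim0 b (fun x => P x * be x * vw n x) (vz n.+1) /\
    forall x, 0 < x < b -> `|vz n.+1 x| <= B * (eta x * (h x ^+ n.+1 / n.+1`!%:R)).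
  apply: (prim0P b0 _ (@deltapow n.+1)) => x xb.
  - apply: cvgM; first by apply: cvgM; [exact: cP|exact: cbe].
    exact: dv_cont (w1.1 x xb).
  - rewrite normrM.
    apply: (@le_trans _ _ (eta' x * (B * (h x ^+ n.+1 / n.+1`!%:R)))).
      by apply: ler_pM => //; [exact: Peta|exact: w2].
    rewrite mulrCA lerDl mulr_ge0// mulr_ge0 ?eta0// mulr_ge0 ?ler0n//.
    apply: mulr_ge0; first by rewrite mulr_ge0 ?exprn_ge0 ?h0.
    by rewrite divr_ge0 ?eta0// ltW// be0.
  - by rewrite mulr_ge0// mulr_ge0 ?eta0// divr_ge0 ?exprn_ge0 ?h0.
by have [w1' w2'] := wP n.+1 z1' z2'.
Qed.

Let S n x := \sum_(k < n) vw k x.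
Let e (H : R) n := expR H - \sum_(k < n.+1) H ^+ k / k`!%:R.

Let exp_sums (H : R) : (fun n => \sum_(k < n) H ^+ k / k`!%:R) @ \oo --> expR H.
Proof.
rewrite (_ : (fun n => _) = series (exp_coeff H)); first exact: is_cvg_series_exp_coeff.
by apply/funext => n; rewrite /series/= big_mkord.
Qed.

Let e_cvg (H : R) : e H n @[n --> \oo] --> 0.
Proof.
rewrite -(subrr (expR H)); apply: cvgB; first exact: cvg_cst.
by have := @exp_sums H; rewrite -(@cvg_shiftS _ (fun n => \sum_(k < n) _)).
Qed.

Let exp_sum_le (H : R) n : 0 <= H -> \sum_(k < n) H ^+ k / k`!%:R <= expR H.
Proof.
move=> H0; move: (@exp_sums H) => /cvgr_to_ge; apply; near=> m.
have nm : (n <= m)%N by near: m; exact: nbhs_infty_ge.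
rewrite -[leRHS](big_mkord xpredT (fun k => H ^+ k / k`!%:R)) (big_cat_nat (n := n))//=.
rewrite big_mkord lerDl sumr_ge0// => k _.
pos.
Unshelve. all: by end_near. Qed.

Let S_Cauchy n m x H : (n <= m)%N -> 0 < x < b -> h x <= H ->
  `|S m x - S n x| <= B * e H n.
Proof.
move=> nm xb hH; have H0 : 0 <= H by apply: le_trans hH; exact: h0.
rewrite /S -(big_mkord xpredT (vw ^~ x)) (big_cat_nat (n := n))//= big_mkord [X in X - _]addrC addrK.
apply: le_trans (ler_norm_sum _ _ _) _.
apply: (@le_trans _ _ (\sum_(n <= k < m) B * (H ^+ k.+1 / k.+1`!%:R))).
  apply: ler_sum => k _; have [_ _ _ /(_ x xb) le1] := vP k.
  apply: le_trans le1 _; rewrite ler_wpM2l// ler_pM2r ?invr_gt0//.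
  by rewrite ler_pXn2r ?nnegrE ?h0.
rewrite -mulr_sumr ler_wpM2l// lerBrDl.
rewrite -(big_mkord xpredT (fun k => H ^+ k / k`!%:R)).
have -> : \sum_(n <= k < m) H ^+ k.+1 / k.+1`!%:R = \sum_(n.+1 <= k < m.+1) H ^+ k / k`!%:R.
  by rewrite big_add1.
by rewrite -big_cat_nat// big_mkord exp_sum_le.
Qed.

Definition volterra_sum x := limn (fun n => S n x).
Let W := volterra_sum.

Let W_tail x H : 0 < x < b -> h x <= H ->
  S n x @[n --> \oo] --> W x /\ forall n, `|W x - S n x| <= B * e H n.
Proof.
move=> xb hH; apply: (@cvg_seq_tail _ (fun n => S n x)).
  by rewrite -(mulr0 B); apply: cvgMr.
by move=> n m nm; exact: S_Cauchy.
Qed.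

Let dvw n x : 0 < x < b -> der x (vw n) (vz n x / be x).
Proof. by move=> xb; have [_ _ [+ _] _] := vP n; exact. Qed.

Let dS n x : 0 < x < b -> der x (S n) (\sum_(k < n) vz k x / be x).
Proof.
move=> xb; elim: n => [|n ih].
  rewrite big_ord0 (_ : S 0 = fun=> 0); first exact: dv_cst.
  by apply/funext => y; rewrite /S big_ord0.
rewrite big_ord_recr/= (_ : S n.+1 = fun y => S n y + vw n y).
  by apply: dvD; exact: dvw.
by apply/funext => y; rewrite /S big_ord_recr.
Qed.

Let W_cont x : 0 < x < b -> {for x, continuous W}.
Proof.
move=> /andP[x0 xb]; pose x1 := (x + b) / 2.
have xx1 : x < x1 by rewrite /x1; lra.
have x1b : x1 < b by rewrite /x1; lra.
apply: (@uniform_approx_continuous _ 0 x1 W S (fun n => B * e (h x1) n)).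
- by rewrite x0.
- by rewrite -(mulr0 B); apply: cvgMr.
- move=> n y /andP[y0 yx1]; have yb : 0 < y < b by rewrite y0 (lt_trans yx1).
  have [_ +] := @W_tail y (h x1) yb (h_mono y0 (ltW yx1) x1b).
  exact.
- by move=> n; apply: dv_cont (dS n _); rewrite x0.
Qed.

Let W_le x : 0 < x < b -> `|W x| <= B * (expR (h x) - 1).
Proof.
move=> xb; have [_ /(_ 0%N)] := W_tail xb (lexx _).
by rewrite /S /e big_ord0 subr0 big_ord1 divr1.
Qed.

(* The majorants are [B * (expR h - 1)] for [w] and [B * eta * expR h] for [z]. *)
Theorem volterra : exists w z : R -> R,
  [/\ forall x, 0 < x < b -> der x w (z x / be x),
      forall x, 0 < x < b -> der x z (P x * be x * w x + f x),
      forall x, 0 < x < b -> `|w x| <= B * (expR (h x) - 1) &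
      forall x, 0 < x < b -> `|z x| <= B * (eta x * expR (h x))].
Proof.
pose z := prim0 b (fun x => P x * be x * W x + f x).
have [[dz zl] zb] : is_prim0 b (fun x => P x * be x * W x + f x) z /\
    forall x, 0 < x < b -> `|z x| <= B * (eta x * expR (h x)).
  apply: (@prim0P R b b0 _ _ (fun x => B * (eta' x * expR (h x) +
     eta x * (expR (h x) * (eta x / be x))))) => x xb.
  - apply: cvgD; last exact: cf.
    by apply: cvgM; [apply: cvgM; [exact: cP|exact: cbe]|exact: W_cont].
  - by dvt; [exact: (deta xb)|exact: (dh xb)|ring].
  - have := feta xb; have := Peta xb; have := W_le xb => H1 H2 H3.
    tri; rewrite normrM.
    have H4 : `|P x * be x| * `|W x| <= eta' x * (B * (expR (h x) - 1)).
      by apply: ler_pM.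
    have H5 : 0 <= B * (eta x * (expR (h x) * (eta x / be x))).
      rewrite mulr_ge0// mulr_ge0 ?eta0// mulr_ge0 ?expR_ge0// divr_ge0 ?eta0//.
      by rewrite ltW// be0.
    lra.
  - by rewrite mulr_ge0// mulr_ge0 ?eta0.
pose w := prim0 b (fun x => z x / be x).
have [[dw wl] wb] : is_prim0 b (fun x => z x / be x) w /\
    forall x, 0 < x < b -> `|w x| <= B * (expR (h x) - 1).
  apply: (@prim0P R b b0 _ _ (fun x => B * (expR (h x) * (eta x / be x)))) => x xb.
  - apply: cvgM; first exact: dv_cont (dz x xb).
    by apply: cvgV; [rewrite gt_eqF ?be0|exact: cbe].
  - by dvt; [exact: (dh xb)|ring].
  - rewrite normrM normfV (gtr0_norm (be0 xb)) mulrA mulrA ler_pM2r ?invr_gt0 ?be0//.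
    by apply: le_trans (zb x xb) _; rewrite -mulrA (mulrC (eta x)).
  - by rewrite mulr_ge0// subr_ge0 -expR0 ler_expR h0.
(* The sum [W] served to define [z], and [z] to define [w]. The fixed point closes because [w] and
   [W] both differ from the partial sums [S n] by a tail of the exponential series, uniformly on
   [(0, x1)]. *)
have wW x : 0 < x < b -> w x = W x.
  move=> /andP[x0 xb]; pose x1 := (x + b) / 2.
  have xx1 : x < x1 by rewrite /x1; lra.
  have x1b : x1 < b by rewrite /x1; lra.
  have sub y : 0 < y < x1 -> 0 < y < b by lra.
  have e0 n : 0 <= B * e (h x1) n.
    have x1b' : 0 < x1 < b by lra.
    by have [_ /(_ n)] := W_tail x1b' (lexx _); exact: le_trans (normr_ge0 _).
  have zn n y : 0 < y < x1 ->
      `|z y - \sum_(k < n.+1) vz k y| <= B * e (h x1) n * eta y.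
    apply: (@dv_bound0 R x1 (fun y => z y - \sum_(k < n.+1) vz k y)
       (fun y => P y * be y * (W y - S n y)) (fun y => B * e (h x1) n * eta y)
       (fun y => B * e (h x1) n * eta' y)).
    - move=> t /sub tb; have : der t (fun y => \sum_(k < n.+1) vz k y)
          (P t * be t * S n t + f t).
        elim: n => [|n ih].
          rewrite /S big_ord0 mulr0 add0r (_ : (fun y => _) = vz 0).
            by have [[+ _] _ _ _] := vP 0; exact.
          by apply/funext => u; rewrite big_ord1.
        rewrite (_ : (fun y => _) = fun y => \sum_(k < n.+1) vz k y + vz n.+1 y).
          have [[d _] _ _ _] := vP n.+1.
          apply: dv_eq (dvD ih (d t tb)) _.
          by rewrite /S big_ord_recr/=; ring.
        by apply/funext => u; rewrite big_ord_recr.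
      move=> d; apply: dv_eq (dvD (dz t tb) (dvN d)) _; ring.
    - by apply: cvg_sub0 => //; apply: cvg_sum0 => k; have [[_ +] _ _ _] := vP k.
    - by move=> t /sub tb; dvt; [exact: (deta tb)|ring].
    - move=> t tx1; have tb := sub t tx1; move/andP: (tx1) => [t0 tx].
      rewrite normrM mulrC; apply: ler_pM => //; last exact: Peta.
      exact: ((W_tail tb (h_mono t0 (ltW tx) x1b)).2 n).
    - by move=> t /sub tb; rewrite mulr_ge0// eta0.
  have wn n : `|w x - S n.+1 x| <= B * e (h x1) n * h x.
    apply: (@dv_bound0 R x1 (fun y => w y - S n.+1 y)
      (fun y => (z y - \sum_(k < n.+1) vz k y) / be y) (fun y => B * e (h x1) n * h y)
       (fun y => B * e (h x1) n * (eta y / be y))).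
    - move=> t /sub tb; apply: dv_eq (dvD (dw t tb) (dvN (dS n.+1 tb))) _.
      by rewrite -mulr_suml; ring.
    - by apply: cvg_sub0 => //; apply: cvg_sum0 => k; have [_ _ [_ +] _] := vP k.
    - by move=> t /sub tb; dvt; [exact: (dh tb)|ring].
    - move=> t tx1; have tb := sub t tx1.
      rewrite normrM normfV (gtr0_norm (be0 tb)) mulrA ler_pM2r ?invr_gt0 ?be0//.
      exact: zn.
    - by move=> t /sub tb; rewrite mulr_ge0// h0.
    - lra.
  have xb' : 0 < x < b by rewrite x0.
  have [Sx _] := W_tail xb' (lexx _).
  apply/eqP; rewrite -subr_eq0 -normr_le0.
  have H1 : B * e (h x1) n * h x @[n --> \oo] --> 0.
    rewrite -(mul0r (h x)) -(mulr0 B); apply: cvgMl; apply: cvgMr; by [].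
  have H2 : `|w x - S n.+1 x| @[n --> \oo] --> `|w x - W x|.
    apply: cvg_norm; apply: cvgB; first exact: cvg_cst.
    by rewrite (@cvg_shiftS _ (fun n => S n x)).
  by apply: (ler_cvg_to H2 H1); near=> n.
exists w, z; split => // x xb.
by rewrite wW//; exact: dz.
Unshelve. all: by end_near. Qed.

End Volterra.

(** * Normalized solutions at a regular singular endpoint *)

Section RightLimits.
Variable R : realType.
Implicit Types (a b c l x : R) (f : R -> R).

Lemma near_right a (P : R -> Prop) : (\forall x \near a^'+, P x) ->
  exists2 e, 0 < e & forall x, a < x < a + e -> P x.
Proof.
move=> [e /= e0 He]; exists e => // x /andP[ax xe]; apply: He => //=.
by rewrite ltr0_norm; lra.
Qed.

Lemma cvg_right_eq a b f g l : a < b -> (forall x, a < x < b -> f x = g x) ->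
  f x @[x --> a^'+] --> l -> g x @[x --> a^'+] --> l.
Proof.
move=> ab fg; apply: cvg_trans; apply: near_eq_cvg; near=> x; apply: fg.
by apply/andP; split; near: x; [exact: nbhs_right_gt|exact: nbhs_right_lt].
Unshelve. all: by end_near. Qed.

Lemma right_lim_cst a b f c l : a < b -> (forall x, a < x < b -> f x = c) ->
  f x @[x --> a^'+] --> l -> c = l.
Proof.
move=> ab fc H; have H2 := cvg_right_eq ab fc H.
have H3 : c @[_ --> a^'+] --> c by exact: cvg_cst.
exact: (cvg_unique _ H3 H2).
Qed.

Lemma right_lim_unique a f l l' : f x @[x --> a^'+] --> l -> f x @[x --> a^'+] --> l' -> l = l'.
Proof. by move=> H1 H2; exact: (cvg_unique _ H1 H2). Qed.

End RightLimits.

Section LinearODE.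
Variable R : realType.
Implicit Types (a b x y m d : R) (f g Q : R -> R).

Definition ode2 a b Q f g :=
  (forall x, a < x < b -> der x f (g x)) /\
  (forall x, a < x < b -> der x g (Q x * f x)).

Lemma ode2_sub a b a' b' Q f g : a <= a' -> b' <= b -> ode2 a b Q f g -> ode2 a' b' Q f g.
Proof.
move=> aa bb [h1 h2]; split => x /andP[ax xb]; [apply: h1|apply: h2];
  lra.
Qed.

Lemma ode2_lin a b Q f1 g1 f2 g2 (c1 c2 : R) : ode2 a b Q f1 g1 -> ode2 a b Q f2 g2 ->
  ode2 a b Q (fun x => c1 * f1 x + c2 * f2 x) (fun x => c1 * g1 x + c2 * g2 x).
Proof.
move=> [h1 h2] [h3 h4]; split => x xab.
  by dvt; [exact: h1|exact: h3|ring].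
by dvt; [exact: h2|exact: h4|ring].
Qed.

(** Gronwall for the energy [f^2 + g^2]: its derivative [2 f g (1 + Q)] is at most [(1 + |Q|) E] in
    absolute value, so [E exp A] and [- E exp (- A)] are nondecreasing when [A' = 1 + |Q|]. *)
Lemma ode2_zero a b Q f g x0 : (forall x, a < x < b -> {for x, continuous Q}) ->
  ode2 a b Q f g -> a < x0 < b -> f x0 = 0 -> g x0 = 0 ->
  forall x, a < x < b -> f x = 0 /\ g x = 0.
Proof.
move=> cQ [df dg] /andP[ax0 x0b] f0 g0.
have ab := lt_trans ax0 x0b.
have [|A dA] := @antiderivative R a b (fun x => 1 + `|Q x|) ab.
  move=> x xab; apply: cvgD; first exact: cvg_cst.
  by apply: cvg_norm; exact: cQ.
pose E x := f x ^+ 2 + g x ^+ 2.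
have E0 : E x0 = 0 by rewrite /E f0 g0 expr0n addr0.
have bnd x : `|2 * f x * g x * (1 + Q x)| <= (1 + `|Q x|) * E x.
  rewrite normrM mulrC; apply: ler_pM => //.
    by rewrite (le_trans (ler_normD _ _))// normr1.
  rewrite ler_norml /E; apply/andP; split.
    by have := sqr_ge0 (f x + g x); nra.
  by have := sqr_ge0 (f x - g x); nra.
have concl x : E x <= 0 -> f x = 0 /\ g x = 0.
  rewrite /E => H; have := sqr_ge0 (f x); have := sqr_ge0 (g x) => H1 H2.
  have h1 : f x ^+ 2 = 0 by lra.
  have h2 : g x ^+ 2 = 0 by lra.
  by move: h1 h2 => /eqP + /eqP; rewrite !sqrf_eq0 => /eqP -> /eqP.
move=> x /andP[ax xb]; apply: concl; have [xx0|x0x] := leP x x0.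
  have I y : x <= y <= x0 -> a < y < b.
    lra.
  have : E x * expR (A x) <= E x0 * expR (A x0).
    apply: (@dv_le R x x0 (fun y => E y * expR (A y))
      (fun y => (2 * f y * g y * (1 + Q y) + (1 + `|Q y|) * E y) * expR (A y)) xx0) => y /I yab.
      rewrite /E; dvt; [exact: df|exact: dg|exact: dA|].
      lra.
    rewrite mulr_ge0 ?expR_ge0//; have := bnd y; rewrite ler_norml => /andP[+ _]; lra.
  by rewrite E0 mul0r pmulr_lle0 ?expR_gt0.
have I y : x0 <= y <= x -> a < y < b.
  lra.
have : - (E x0 * expR (- A x0)) <= - (E x * expR (- A x)).
  apply: (@dv_le R x0 x (fun y => - (E y * expR (- A y)))
    (fun y => ((1 + `|Q y|) * E y - 2 * f y * g y * (1 + Q y)) * expR (- A y)) (ltW x0x)) => y /I yab.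
    rewrite /E; dvt; [exact: df|exact: dg|exact: dA|].
    lra.
  rewrite mulr_ge0 ?expR_ge0//; have := bnd y; rewrite ler_norml => /andP[_ +]; lra.
by rewrite E0 mul0r oppr0 oppr_ge0 pmulr_lle0 ?expR_gt0.
Qed.

(** For potentials [q - lam] and [q - mu] this is the Lagrange identity with factor [lam - mu], from
    which the resolvent identity is obtained later. *)
Lemma wronskian_const a b Q1 Q2 f1 g1 f2 g2 : ode2 a b Q1 f1 g1 -> ode2 a b Q2 f2 g2 ->
  forall x, a < x < b ->
  der x (fun y => f1 y * g2 y - g1 y * f2 y) ((Q2 x - Q1 x) * (f1 x * f2 x)).
Proof.
move=> [h1 h2] [h3 h4] x xab.
by dvt; [exact: h1|exact: h4|exact: h2|exact: h3|ring].
Qed.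

Lemma wronskian_eq a b Q f1 g1 f2 g2 : ode2 a b Q f1 g1 -> ode2 a b Q f2 g2 ->
  forall x y, a < x < b -> a < y < b -> f1 x * g2 x - g1 x * f2 x = f1 y * g2 y - g1 y * f2 y.
Proof.
move=> h1 h2; apply: (@dv_const R a b (fun y => f1 y * g2 y - g1 y * f2 y)) => x xab.
by apply: dv_eq (wronskian_const h1 h2 xab) _; rewrite subrr mul0r.
Qed.

Lemma ode2_eq a b Q f g f' g' : (forall x, a < x < b -> f x = f' x) ->
  (forall x, a < x < b -> g x = g' x) -> ode2 a b Q f g -> ode2 a b Q f' g'.
Proof.
move=> ff gg [h1 h2]; split => x xab; rewrite -?ff -?gg//.
  exact: dv_near xab ff (h1 x xab).
exact: dv_near xab gg (h2 x xab).
Qed.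

End LinearODE.

Section PowerFacts.
Variable R : realType.
Implicit Types (x m s : R).

Lemma powRB1 x m : 0 < x -> x `^ (m - 1) = x `^ m / x.
Proof. by move=> x0; rewrite powRB ?powRr1 ?ltW// (gt_eqF x0) ?implybT. Qed.

Lemma powRB2 x m : 0 < x -> x `^ (m - 2) = x `^ m / x ^+ 2.
Proof. by move=> x0; rewrite powRB ?powR_mulrn ?ltW// (gt_eqF x0) ?implybT. Qed.

Lemma powR_add x m s : 0 < x -> x `^ (m + s) = x `^ m * x `^ s.
Proof. by move=> x0; rewrite powRD// (gt_eqF x0) ?implybT. Qed.

Lemma powR_dbl x m : 0 < x -> x `^ (2 * m) = (x `^ m) ^+ 2.
Proof. by move=> x0; rewrite mulrDl mul1r powR_add. Qed.

Lemma powR_le1 x m : 0 < x <= 1 -> 0 <= m -> x `^ m <= 1.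
Proof. by move=> x1 m0; rewrite -(powRr0 x); exact: ger_powR. Qed.

Lemma powR_ge1 x m : 0 < x <= 1 -> m <= 0 -> 1 <= x `^ m.
Proof. by move=> x1 m0; rewrite -(powRr0 x); exact: ger_powR. Qed.

End PowerFacts.

Section NormalizedSolution.
Variable R : realType.
Implicit Types (m d al b lam x : R) (q Q f g v z : R -> R).

(* [f = x^m v] with [v -> 1] and [x^(2m) v' -> al]; here [m = nu + 1/2] and [al] is
   nonzero only for Robin conditions, where [m = 0] and [al] is the prescribed slope. *)
Definition nsol m al b Q f g := [/\ ode2 0 b Q f g,
  f x / x `^ m @[x --> 0^'+] --> (1 : R) &
  x `^ m * g x - m * (x `^ (m - 1) * f x) @[x --> 0^'+] --> al].

(** The number [m (m - 1)] is the coefficient of the inverse square part at [0] and [d] measures how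
    much weaker the remainder is. The condition [0 < d + 2 m - 1] makes the remainder integrable
    against [x^(2m)]. The factor [(1 - x)^-2] admits an inverse square singularity at the other
    endpoint. *)
Definition sing_pot m d al q :=
  [/\ 0 <= m, [/\ 0 < d, d <= 2 & 0 < d + 2 * m - 1], m = 0 \/ (al = 0 /\ 1 / 2 <= m),
   forall x, 0 < x < 1 -> {for x, continuous q} &
   exists2 C, 0 <= C & forall x, 0 < x < 1 ->
     `|q x - (m ^+ 2 - m) / x ^+ 2| <= C * (x `^ (d - 2) / (1 - x) ^+ 2)].

(** The substitution [f = x^m v], [z = x^(2m) v'] removes the inverse square part of the potential
    and leaves a system of the Volterra form with weight [be = x^(2m)]. *)
Lemma nsol_of_system m b Q v z : 0 < b ->
  (forall x, 0 < x < b -> der x v (z x / x `^ (2 * m))) ->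
  (forall x, 0 < x < b ->
     der x z ((Q x - (m ^+ 2 - m) / x ^+ 2) * x `^ (2 * m) * v x)) ->
  ode2 0 b Q (fun x => x `^ m * v x) (fun x => m * (x `^ m / x) * v x + z x / x `^ m).
Proof.
move=> b0 dv dz; split => x xb; have /andP[x0 _] := xb; have e0 := powR_gt0 m x0.
  dvt; [exact: x0|exact: dv|].
  by rewrite powRB1// powR_dbl//; field; rewrite !gt_eqF.
dvt; [exact: x0|by rewrite gt_eqF|exact: dv|exact: dz|by rewrite gt_eqF|exact: x0|].
by rewrite powRB1// powR_dbl//; field; rewrite !gt_eqF.
Qed.

Lemma nsol_sub m al b b' Q f g : b' <= b -> nsol m al b Q f g -> nsol m al b' Q f g.
Proof. by move=> bb [h1 h2 h3]; split => //; exact: ode2_sub h1. Qed.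

(** The singular terms [m f1 f2 / x] cancel in the Wronskian, and what remains are the two
    prescribed limits. The potentials may differ, as they do for two spectral parameters. *)
Lemma nsol_wronskian m al al' b Q Q' f1 g1 f2 g2 :
  nsol m al b Q f1 g1 -> nsol m al' b Q' f2 g2 ->
  f1 x * g2 x - g1 x * f2 x @[x --> 0^'+] --> al' - al.
Proof.
move=> [_ v1 z1] [_ v2 z2].
have H : (f1 x / x `^ m) * (x `^ m * g2 x - m * (x `^ (m - 1) * f2 x)) -
  (x `^ m * g1 x - m * (x `^ (m - 1) * f1 x)) * (f2 x / x `^ m) @[x --> 0^'+] --> 1 * al' - al * 1.
  by apply: cvgB; exact: cvgM.
rewrite mul1r mulr1 in H; apply: (@cvg_right_eq _ 0 1 _ _ _ ltr01 _ H) => x /andP[x0 _].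
rewrite powRB1//; have e0 := powR_gt0 m x0; field.
lra.
Qed.

Lemma nsol_pos_near m al b Q f g : 0 < b -> nsol m al b Q f g ->
  exists x0, [/\ 0 < x0, x0 < b & forall x, 0 < x <= x0 -> x `^ m / 2 <= f x <= 2 * x `^ m].
Proof.
move=> b0 [_ v1 _].
have : \forall x \near 0^'+, `|1 - f x / x `^ m| < 1 / 2.
  by move/cvgrPdist_lt: v1; apply.
move=> /near_right[e e0 He]; exists (Num.min e b / 2).
have eb0 : 0 < Num.min e b by rewrite lt_min e0.
split; first lra.
  have : Num.min e b <= b by rewrite ge_min lexx orbT.
  lra.
move=> x /andP[x0 xe]; have ? : Num.min e b <= e by rewrite ge_min lexx.
have := He x ltac:(rewrite x0; lra); have p0 := powR_gt0 m x0.
rewrite ltr_norml => /andP[h1 h2]; apply/andP; split.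
  suff : 1 / 2 <= f x / x `^ m by rewrite ler_pdivlMr; lra.
  lra.
suff : f x / x `^ m <= 2 by rewrite ler_pdivrMr.
lra.
Qed.

(** The Wronskian is constant with limit [0], so [f2 / f1] is constant where [f1 > 0]; the
    normalization makes it [1] near [0], and uniqueness of the Cauchy problem carries the equality
    to the whole interval. *)
Lemma nsol_unique m al b Q f1 g1 f2 g2 : 0 < b ->
  (forall x, 0 < x < b -> {for x, continuous Q}) ->
  nsol m al b Q f1 g1 -> nsol m al b Q f2 g2 ->
  forall x, 0 < x < b -> f1 x = f2 x /\ g1 x = g2 x.
Proof.
move=> b0 cQ n1 n2; have W0 x : 0 < x < b -> f1 x * g2 x - g1 x * f2 x = 0.
  move=> xb; have := nsol_wronskian n1 n2; rewrite subrr => W.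
  move: (n1) (n2) => [p1 _ _] [p2 _ _].
  by apply: (right_lim_cst b0 _ W) => y yb; exact: (wronskian_eq p1 p2).
have [x0 [x00 x0b f1pos]] := nsol_pos_near b0 n1.
move: (n1) (n2) => [[d1 d1'] v1 _] [[d2 d2'] v2 _].
have f10 x : 0 < x < x0 -> 0 < f1 x.
  move=> /andP[xp xx]; have /andP[+ _] := f1pos x ltac:(lra).
  by apply: lt_le_trans; rewrite divr_gt0// powR_gt0.
have sub x : 0 < x < x0 -> 0 < x < b by lra.
have rc x y : 0 < x < x0 -> 0 < y < x0 -> f2 x / f1 x = f2 y / f1 y.
  apply: (@dv_const R 0 x0 (fun y => f2 y / f1 y)) => t t0.
  have f1t := f10 t t0; have tb := sub t t0.
  dvt; [exact: d2|lra|exact: d1|].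
  have -> : g2 t * (f1 t)^-1 + f2 t * - (g1 t / f1 t ^+ 2) =
     (f1 t * g2 t - g1 t * f2 t) / f1 t ^+ 2 by field; rewrite gt_eqF.
  by rewrite W0// mul0r.
have r1 x : 0 < x < x0 -> f2 x / f1 x = 1.
  move=> xx0; have H : (f2 x / x `^ m) / (f1 x / x `^ m) @[x --> 0^'+] --> (1 / 1 : R).
    by apply: cvgM => //; apply: cvgV.
  rewrite divr1 in H; apply: (right_lim_cst x00 _ H) => y yx0.
  have y0 : 0 < y by case/andP: yx0.
  rewrite (rc x y)//=; field; rewrite gt_eqF ?f10//= gt_eqF// powR_gt0//.
have eqf x : 0 < x < x0 -> f1 x - f2 x = 0.
  move=> xx0; have := r1 x xx0 => /(congr1 (fun t => t * f1 x)).
  by rewrite mul1r divfK ?gt_eqF ?f10// => ->; rewrite subrr.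
pose c := x0 / 2; have cx0 : 0 < c < x0 by rewrite /c; lra.
have eqg : g1 c - g2 c = 0.
  have := dvD (d1 c (sub c cx0)) (dvN (d2 c (sub c cx0))) => D1.
  have D2 : der c (fun y => f1 y - f2 y) 0.
    by apply: (dv_near cx0 _ (dv_cst 0 c)) => y yx; rewrite eqf.
  by have [_ <-] := D1; have [_ <-] := D2.
move=> x xb; have o : ode2 0 b Q (fun x => f1 x - f2 x) (fun x => g1 x - g2 x).
  split => y yb; first by dvt; [exact: d1|exact: d2|].
  by dvt; [exact: d1'|exact: d2'|ring].
have [/eqP + /eqP] := ode2_zero cQ o (sub c cx0) (eqf c cx0) eqg xb.
lra.
Qed.

End NormalizedSolution.

(** * Explicit majorants and existence of normalized solutions *)

Section Majorant.
Variables (R : realType) (m d : R).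
Hypotheses (m0 : 0 <= m) (d0 : 0 < d) (d2 : d <= 2) (dm : 0 < d + 2 * m - 1).
Implicit Types (K A B b x : R).

Definition maj_weight x := x `^ (2 * m) * (x `^ (d - 2) / (1 - x) ^+ 2).
(** A closed form for the Volterra majorants: [maj_eta] is [x^(2m)] times the derivative of [maj_h],
    and [maj_eta'] is its own derivative, so the only inequality left to check compares [maj_eta']
    with the weight. *)
Definition maj_h K x := K * (x `^ d / (1 - x)).
Definition maj_eta K x := K * (x `^ (2 * m + d - 1) * (d / (1 - x)) + x `^ (2 * m + d) / (1 - x) ^+ 2).
Definition maj_eta' K x := K * (x `^ (2 * m + d - 2) *
  ((2 * m + d - 1) * d / (1 - x) + (2 * m + 2 * d) * x / (1 - x) ^+ 2 + 2 * x ^+ 2 / (1 - x) ^+ 3)).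

Lemma maj_hD K x : 0 < x < 1 -> der x (maj_h K) (maj_eta K x / x `^ (2 * m)).
Proof.
move=> /andP[x0 x1]; have y0 : 0 < 1 - x by lra.
rewrite /maj_h; dvt; [by []|by rewrite gt_eqF|].
rewrite /maj_eta !powRB1// !powR_add//.
have e0 := powR_gt0 (2 * m) x0; field; rewrite !gt_eqF//.
Qed.

Lemma maj_etaD K x : 0 < x < 1 -> der x (maj_eta K) (maj_eta' K x).
Proof.
move=> /andP[x0 x1]; have y0 : 0 < 1 - x by lra.
rewrite /maj_eta; dvt; [by []|by rewrite gt_eqF|by []|by rewrite expf_neq0// gt_eqF|].
have y0' : 1 - x != 0 by rewrite gt_eqF.
have x0' : x != 0 by rewrite gt_eqF.
rewrite /maj_eta' !powRB1// powRB2//; field; rewrite y0'//.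
Qed.

Lemma maj_h_cvg0 K : maj_h K x @[x --> 0^'+] --> (0 : R).
Proof.
have H : K * (x `^ d / (1 - x)) @[x --> 0^'+] --> K * (0 / (1 - 0)).
  apply: cvgMr; apply: cvgM; first exact: powR_cvg0.
  apply: cvgV; first by rewrite subr0 oner_neq0.
  by apply: cvgB; [exact: cvg_cst|apply: cvg_at_right_filter].
by rewrite mul0r mulr0 in H.
Qed.

Lemma maj_eta_cvg0 K : maj_eta K x @[x --> 0^'+] --> (0 : R).
Proof.
have i1 : 1 - x @[x --> 0^'+] --> (1 - 0 : R).
  by apply: cvgB; [exact: cvg_cst|apply: cvg_at_right_filter].
have H : K * (x `^ (2 * m + d - 1) * (d / (1 - x)) + x `^ (2 * m + d) / (1 - x) ^+ 2)
    @[x --> 0^'+] --> K * (0 * (d / (1 - 0)) + 0 / (1 - 0) ^+ 2).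
  apply: cvgMr; apply: cvgD; apply: cvgM.
  - by apply: powR_cvg0; move: dm; lra.
  - by apply: cvgMr; apply: cvgV.
  - by apply: powR_cvg0; move: dm d0; lra.
  - apply: cvgV; first by rewrite subr0 expr1n oner_neq0.
    by rewrite !expr2; exact: cvgM.
by rewrite !mul0r addr0 mulr0 in H.
Qed.

Lemma maj_eta_ge0 K x : 0 <= K -> 0 < x < 1 -> 0 <= maj_eta K x.
Proof.
move=> K0 /andP[x0 x1]; have y0 : 0 < 1 - x by lra.
rewrite mulr_ge0// addr_ge0// mulr_ge0 ?powR_ge0//; first by rewrite divr_ge0// ltW.
pos.
Qed.

Lemma maj_h_mono K x y : 0 <= K -> 0 < x -> x <= y -> y < 1 -> maj_h K x <= maj_h K y.
Proof.
move=> K0 x0 xy y1; apply: (dv_le xy) => [t /andP[xt ty]|t /andP[xt ty]].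
  by apply: maj_hD; rewrite (lt_le_trans x0)//= (le_lt_trans ty).
rewrite divr_ge0 ?powR_ge0// maj_eta_ge0//.
lra.
Qed.

Lemma maj_eta'_ge A : 0 < A -> exists2 K, 0 < K &
  forall x, 0 < x < 1 -> A * maj_weight x <= maj_eta' K x.
Proof.
(* Once the weight is factored out, the bracket is at least [s d (1 - x) + (2 m + 2 d) x], hence at
   least [c (1 - x) + c x = c]. This gives [K = A / c]. *)
move=> A0; pose s := 2 * m + d - 1; pose c := Num.min (d * s) (2 * d).
have s0 : 0 < s by rewrite /s; move: dm; lra.
have c0 : 0 < c by rewrite lt_min mulr_gt0//= mulr_gt0.
have c1 : c <= d * s by rewrite ge_min lexx.
have c2 : c <= 2 * d by rewrite ge_min lexx orbT.
exists (A / c); first pos.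
move=> x /andP[x0 x1]; have y0 : 0 < 1 - x by lra.
rewrite /maj_eta' /maj_weight; have -> : 2 * m + d - 2 = 2 * m + (d - 2) by ring.
rewrite (powR_add (2 * m) (d - 2) x0).
set E := x `^ (2 * m) * x `^ (d - 2); have E0 : 0 < E by rewrite mulr_gt0 ?powR_gt0.
have -> : A * (x `^ (2 * m) * (x `^ (d - 2) / (1 - x) ^+ 2)) = A * E / (1 - x) ^+ 2 * 1.
  by rewrite /E; ring.
have -> : A / c * (E * ((2 * m + d - 1) * d / (1 - x) + (2 * m + 2 * d) * x / (1 - x) ^+ 2 +
    2 * x ^+ 2 / (1 - x) ^+ 3)) = A * E / (1 - x) ^+ 2 * ((s * d * (1 - x) +
    (2 * m + 2 * d) * x + 2 * x ^+ 2 / (1 - x)) / c).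
  by rewrite /s; field; rewrite (gt_eqF y0) (gt_eqF c0).
apply: ler_wpM2l.
  pos.
rewrite ler_pdivlMr// mul1r.
have : 0 <= 2 * x ^+ 2 / (1 - x) by rewrite divr_ge0 ?mulr_ge0 1?ltW.
have : c * (1 - x) <= s * d * (1 - x) by nra.
have : c * x <= (2 * m + 2 * d) * x by rewrite ler_pM2r; move: m0; lra.
lra.
Qed.

(** [K] depends on the bound [A] and not on [P], [f] or [b]. The same [K] therefore serves all
    spectral parameters in a bounded set. *)
Lemma nvolterra A : 0 < A -> exists2 K, 0 < K & forall b B (P f : R -> R),
  0 < b <= 1 -> 0 <= B ->
  (forall x, 0 < x < b -> {for x, continuous P}) ->
  (forall x, 0 < x < b -> {for x, continuous f}) ->
  (forall x, 0 < x < b -> `|P x| <= A * (x `^ (d - 2) / (1 - x) ^+ 2)) ->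
  (forall x, 0 < x < b -> `|f x| <= B * (A * maj_weight x)) ->
  exists w z : R -> R,
  [/\ forall x, 0 < x < b -> der x w (z x / x `^ (2 * m)),
      forall x, 0 < x < b -> der x z (P x * x `^ (2 * m) * w x + f x),
      forall x, 0 < x < b -> `|w x| <= B * (expR (maj_h K x) - 1) &
      forall x, 0 < x < b -> `|z x| <= B * (maj_eta K x * expR (maj_h K x))].
Proof.
move=> A0; have [K K0 HK] := maj_eta'_ge A0; exists K => // b B P f /andP[b0 b1] B0 cP cf PA fA.
have sub x : 0 < x < b -> 0 < x < 1 by lra.
apply: (@volterra R b B (fun x => x `^ (2 * m)) P f (maj_h K) (maj_eta K) (maj_eta' K)) => //.
- by move=> x /andP[x0 _]; rewrite powR_gt0.
- move=> x /andP[x0 _]; apply: (@dv_cont _ _ _ (2 * m * x `^ (2 * m - 1) * 1)).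
  exact: dv_pow (dv_id x).
- by move=> x /sub; exact: maj_hD.
- by move=> x /sub; exact: maj_etaD.
- exact: maj_h_cvg0.
- by move=> x /sub; apply: maj_eta_ge0; rewrite ltW.
- move=> x xb; rewrite normrM (ger0_norm (powR_ge0 _ _)).
  apply: le_trans (HK x (sub x xb)).
  by rewrite mulrCA [leRHS]mulrC ler_wpM2r ?powR_ge0// PA.
- move=> x xb; apply: le_trans (fA x xb) _; rewrite ler_wpM2l//.
  exact: HK (sub x xb).
Qed.

End Majorant.

Section Existence.
Variables (R : realType) (m d al : R) (q : R -> R).
Hypothesis qs : sing_pot m d al q.
Implicit Types (lam x b s : R).

Let m0 : 0 <= m. Proof. by case: qs. Qed.
Let d0 : 0 < d. Proof. by case: qs => _ []. Qed.
Let d2 : d <= 2. Proof. by case: qs => _ []. Qed.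
Let dm : 0 < d + 2 * m - 1. Proof. by case: qs => _ []. Qed.
Let alm : al = 0 \/ m = 0. Proof. by case: qs => _ _ [->|[-> _]]; [right|left]. Qed.

Lemma sing_pot_cont lam x : 0 < x < 1 -> {for x, continuous (fun y => q y - lam)}.
Proof.
by case: qs => _ _ _ cq _ x1; apply: cvgB; [exact: cq|exact: cvg_cst].
Qed.

Lemma weight_ge1 x : 0 < x < 1 -> 1 <= x `^ (d - 2) / (1 - x) ^+ 2.
Proof.
move=> /andP[x0 x1]; rewrite -[leLHS]mulr1 ler_pM//.
  by apply: powR_ge1; [rewrite x0 ltW|rewrite subr_le0].
by rewrite invf_ge1 ?exprn_gt0 ?subr_gt0// expr_le1 //; lra.
Qed.

Definition regpart lam x := q x - (m ^+ 2 - m) / x ^+ 2 - lam.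
Local Notation P := regpart.

Lemma regpart_cont lam x : 0 < x < 1 -> {for x, continuous (P lam)}.
Proof.
move=> x1; have x0 : x != 0 by case/andP: x1 => x0 _; rewrite gt_eqF.
apply: cvgB; last exact: cvg_cst; apply: cvgB; first by case: qs => _ _ _ cq _; exact: cq.
apply: cvgMr; apply: cvgV; first by rewrite expf_neq0.
exact: exprn_continuous.
Qed.

Lemma powR_cont_for (s x : R) : 0 < x < 1 -> {for x, continuous (fun y : R => y `^ s)}.
Proof.
move=> /andP[x0 _]; apply: (@dv_cont _ _ _ (s * x `^ (s - 1) * 1)).
exact: dv_pow (dv_id x).
Qed.

(** The spectral parameter is absorbed into the weight, which is at least [1] because [d <= 2]. *)
Lemma regpart_bound L : 0 <= L -> exists2 A, 1 <= A & forall lam, `|lam| <= L -> forall x, 0 < x < 1 ->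
  `|P lam x| <= A * (x `^ (d - 2) / (1 - x) ^+ 2).
Proof.
move=> L0; case: qs => _ _ _ _ [C C0 HC]; exists (C + L + 1); first lra.
move=> lam lL x x1; have := HC x x1; have := weight_ge1 x1; set w := _ / _ => w1 hc.
apply: le_trans (ler_normB _ _) _.
have : L * 1 <= L * w by nra.
lra.
Qed.

Lemma nsol_system lam : exists v z K B,
  [/\ forall x, 0 < x < 1 -> der x v (z x / x `^ (2 * m)),
      forall x, 0 < x < 1 -> der x z (P lam x * x `^ (2 * m) * v x),
      0 < K /\ 0 <= B,
      forall x, 0 < x < 1 -> `|v x - (1 + al * x)| <= B * (expR (maj_h d K x) - 1) &
      forall x, 0 < x < 1 -> `|z x - al| <= B * (maj_eta m d K x * expR (maj_h d K x))].
Proof.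
have [A A1 HA] := regpart_bound (normr_ge0 lam).
have A0 : 0 < A by lra.
have [K K0 HK] := nvolterra m0 d0 dm A0.
have v0b x : 0 < x < 1 -> `|1 + al * x| <= 1 + `|al|.
  move=> /andP[x0 x1]; tri; rewrite normr1 lerD2l normrM.
  by rewrite -[leRHS]mulr1 ler_wpM2l// gtr0_norm ?ltW.
have [] := HK 1 (1 + `|al|) (P lam) (fun x => P lam x * x `^ (2 * m) * (1 + al * x)).
- lra.
- by rewrite addr_ge0.
- by move=> x x1; exact: regpart_cont.
- move=> x x1; apply: cvgM; first by apply: cvgM; [exact: regpart_cont|exact: powR_cont_for].
  by apply: cvgD; [exact: cvg_cst|apply: cvgMr].
- by move=> x x1; exact: HA.
- move=> x x1; rewrite normrM mulrC; apply: ler_pM => //; first exact: v0b.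
  rewrite normrM (ger0_norm (powR_ge0 _ _)) mulrCA [leRHS]mulrC.
  by rewrite ler_wpM2r ?powR_ge0// HA.
move=> w [z [dw dz wb zb]].
exists (fun x => 1 + al * x + w x), (fun x => al + z x), K, (1 + `|al|); split => //.
(* Either [al = 0], or [m = 0] and the weight is [1]; in both cases [1 + al x] has derivative
   [al / x^(2m)], so it is the right zeroth approximation. *)
- move=> x x1; dvt; [exact: dw|]; rewrite [RHS]mulrDl; congr (_ + _).
  case: alm => ->; first by rewrite !mul0r !add0r.
  by rewrite mulr0 powRr0 divr1; ring.
- by move=> x x1; dvt; [exact: dz|ring].
- by move=> x x1; rewrite addrAC subrr add0r; exact: wb.
- by move=> x x1; rewrite addrAC subrr add0r; exact: zb.
Qed.

Lemma maj_cvg b K B (g : R -> R) : 0 < b -> (forall x, 0 < x < b -> `|g x| <= B * (expR (maj_h d K x) - 1)) ->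
  g x @[x --> 0^'+] --> (0 : R).
Proof.
move=> b0 gb; apply: norm_cvg0.
have H : B * (expR (maj_h d K x) - 1) @[x --> 0^'+] --> B * (expR 0 - 1).
  apply: cvgMr; apply: cvgB; last exact: cvg_cst.
  by apply: continuous_cvg; [exact: continuous_expR|exact: maj_h_cvg0].
rewrite expR0 subrr mulr0 in H.
apply: (squeeze0 (fun x => B * (expR (maj_h d K x) - 1))) => //.
  near=> x; rewrite normr_ge0/=; apply: gb; apply/andP; split; near: x.
    exact: nbhs_right_gt.
  exact: nbhs_right_lt.
exact: cvg_cst.
Unshelve. all: by end_near. Qed.

Lemma maj_cvg' b K B (g : R -> R) : 0 < b ->
  (forall x, 0 < x < b -> `|g x| <= B * (maj_eta m d K x * expR (maj_h d K x))) ->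
  g x @[x --> 0^'+] --> (0 : R).
Proof.
move=> b0 gb; apply: norm_cvg0.
have H : B * (maj_eta m d K x * expR (maj_h d K x)) @[x --> 0^'+] --> B * (0 * expR 0).
  apply: cvgMr; apply: cvgM; first exact: maj_eta_cvg0.
  by apply: continuous_cvg; [exact: continuous_expR|exact: maj_h_cvg0].
rewrite mul0r mulr0 in H.
apply: (squeeze0 (fun x => B * (maj_eta m d K x * expR (maj_h d K x)))) => //.
  near=> x; rewrite normr_ge0/=; apply: gb; apply/andP; split; near: x.
    exact: nbhs_right_gt.
  exact: nbhs_right_lt.
exact: cvg_cst.
Unshelve. all: by end_near. Qed.

Lemma nsol_intro b Q (v z : R -> R) : 0 < b ->
  (forall x, 0 < x < b -> der x v (z x / x `^ (2 * m))) ->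
  (forall x, 0 < x < b ->
     der x z ((Q x - (m ^+ 2 - m) / x ^+ 2) * x `^ (2 * m) * v x)) ->
  v x @[x --> 0^'+] --> (1 : R) -> z x @[x --> 0^'+] --> al ->
  nsol m al b Q (fun x => x `^ m * v x) (fun x => m * (x `^ m / x) * v x + z x / x `^ m).
Proof.
move=> b0 dv dz v1 zal; split; first exact: nsol_of_system.
- apply: (cvg_right_eq b0 _ v1) => x /andP[x0 _].
  by have e0 := powR_gt0 m x0; field; rewrite gt_eqF.
- apply: (cvg_right_eq b0 _ zal) => x /andP[x0 _]; rewrite powRB1//.
  by have e0 := powR_gt0 m x0; field; rewrite !gt_eqF.
Qed.

Lemma maj_half K : 0 <= K -> exists2 C, 0 <= C & forall x, 0 < x <= 1 / 2 ->
  expR (maj_h d K x) - 1 <= C * x `^ d /\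
  maj_eta m d K x * expR (maj_h d K x) <= C * x `^ (2 * m + d - 1).
Proof.
move=> K0; pose E := expR (2 * K); exists (2 * K * E + K * (2 * d + 4) * E).
  pos.
move=> x /andP[x0 x2]; have x1 : x <= 1 by lra.
have xd0 := powR_ge0 x d.
have iv : (1 - x)^-1 <= 2 by rewrite -[2]invrK lef_pV2 ?posrE; lra.
have iv0 : 0 <= (1 - x)^-1 by rewrite invr_ge0; lra.
have h1 : maj_h d K x <= 2 * K * x `^ d.
  rewrite /maj_h mulrCA mulrA mulrAC -mulrA [_^-1 * _]mulrC.
  have H : 0 <= K * x `^ d by pos.
  have -> : x `^ d * (K / (1 - x)) = K * x `^ d * (1 - x)^-1 by ring.
  nra.
have xd1 : x `^ d <= 1 by apply: powR_le1; [rewrite x0|rewrite ltW].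
have h2 : maj_h d K x <= 2 * K by nra.
have Eh : expR (maj_h d K x) <= E by rewrite ler_expR.
split.
  have := expR_ge1Dx (- maj_h d K x); rewrite expRN => H.
  have e0 := expR_gt0 (maj_h d K x).
  have H2 : expR (maj_h d K x) - 1 <= maj_h d K x * expR (maj_h d K x).
    have := ler_wpM2r (ltW e0) H; rewrite mulVf ?gt_eqF// => ?; lra.
  have h0 : 0 <= maj_h d K x by pos.
  apply: le_trans H2 _; apply: (@le_trans _ _ (2 * K * x `^ d * E)).
    by apply: ler_pM.
  rewrite [leRHS]mulrDl [X in _ <= X + _]mulrAC lerDl.
  pos.
have y0 := powR_ge0 x (2 * m + d - 1).
have e1 : maj_eta m d K x <= K * (2 * d + 4) * x `^ (2 * m + d - 1).
  rewrite -mulrA ler_wpM2l//.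
  have -> : x `^ (2 * m + d) = x * x `^ (2 * m + d - 1).
    by rewrite powRB1// mulrCA divff ?mulr1// gt_eqF.
  rewrite mulrC [x * _ / _]mulrAC; set y := _ `^ _ in y0 *.
  have a1 : d / (1 - x) <= 2 * d by rewrite mulrC ler_wpM2r// ltW.
  have a2 : x / (1 - x) ^+ 2 <= 4.
    rewrite -exprVn expr2; have : (1 - x)^-1 * (1 - x)^-1 <= 2 * 2 by apply: ler_pM.
    have : 0 <= (1 - x)^-1 * (1 - x)^-1 by pos.
    nra.
  have -> : d / (1 - x) * y + x / (1 - x) ^+ 2 * y = (d / (1 - x) + x / (1 - x) ^+ 2) * y by ring.
  by apply: ler_wpM2r; lra.
have e0 : 0 <= maj_eta m d K x by pos.
apply: (@le_trans _ _ (K * (2 * d + 4) * x `^ (2 * m + d - 1) * E)).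
  by apply: ler_pM.
rewrite [leRHS]mulrDl [X in _ <= _ + X]mulrAC lerDr.
pos.
Qed.

Lemma nsolE lam f g : nsol m al 1 (fun x => q x - lam) f g -> exists v z K B,
  [/\ forall x, 0 < x < 1 -> der x v (z x / x `^ (2 * m)),
      forall x, 0 < x < 1 ->
        der x z ((q x - lam - (m ^+ 2 - m) / x ^+ 2) * x `^ (2 * m) * v x),
      [/\ 0 < K, 0 <= B, v x @[x --> 0^'+] --> (1 : R) & z x @[x --> 0^'+] --> al],
      (forall x, 0 < x < 1 -> f x = x `^ m * v x /\ g x = m * (x `^ m / x) * v x + z x / x `^ m) &
      (forall x, 0 < x < 1 -> `|v x - (1 + al * x)| <= B * (expR (maj_h d K x) - 1) /\ `|z x - al| <= B * (maj_eta m d K x * expR (maj_h d K x)))].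
Proof.
move=> fg; have [v [z [K [B [dv dz [K0 B0] vb zb]]]]] := nsol_system lam.
have b0 : (0 : R) < 1 by [].
have dz' x : 0 < x < 1 ->
    der x z ((q x - lam - (m ^+ 2 - m) / x ^+ 2) * x `^ (2 * m) * v x).
  by move=> x1; apply: dv_eq (dz x x1) _; rewrite /P; ring.
have v1 : v x @[x --> 0^'+] --> (1 : R).
  have H : (v x - (1 + al * x)) + (1 + al * x) @[x --> 0^'+] --> 0 + (1 + al * 0).
    apply: cvgD; first exact: maj_cvg b0 vb.
    apply: cvgD; first exact: cvg_cst.
    by apply: cvgMr; apply: cvg_at_right_filter.
  rewrite mulr0 addr0 add0r in H.
  by apply: (cvg_right_eq b0 _ H) => x _; rewrite subrK.
have zal : z x @[x --> 0^'+] --> al.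
  have H : (z x - al) + al @[x --> 0^'+] --> 0 + al.
    by apply: cvgD; [exact: maj_cvg' b0 zb|exact: cvg_cst].
  rewrite add0r in H.
  by apply: (cvg_right_eq b0 _ H) => x _; rewrite subrK.
exists v, z, K, B; split => //.
  by apply: (nsol_unique b0 _ fg (nsol_intro b0 dv dz' v1 zal)) => x; exact: sing_pot_cont.
by move=> x x1; split; [exact: vb|exact: zb].
Qed.

Lemma nsol_exists lam : exists f g, nsol m al 1 (fun x => q x - lam) f g.
Proof.
have b0 : (0 : R) < 1 by [].
have [v [z [K [B [dv dz [K0 B0] vb zb]]]]] := nsol_system lam.
exists (fun x => x `^ m * v x), (fun x => m * (x `^ m / x) * v x + z x / x `^ m).
apply: (nsol_intro b0 dv).
- by move=> x x1; apply: dv_eq (dz x x1) _; rewrite /P; ring.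
- have H : (v x - (1 + al * x)) + (1 + al * x) @[x --> 0^'+] --> 0 + (1 + al * 0).
    apply: cvgD; first exact: maj_cvg b0 vb.
    apply: cvgD; first exact: cvg_cst.
    by apply: cvgMr; apply: cvg_at_right_filter.
  rewrite mulr0 addr0 add0r in H.
  by apply: (cvg_right_eq b0 _ H) => x _; rewrite subrK.
- have H : (z x - al) + al @[x --> 0^'+] --> 0 + al.
    by apply: cvgD; [exact: maj_cvg' b0 zb|exact: cvg_cst].
  rewrite add0r in H.
  by apply: (cvg_right_eq b0 _ H) => x _; rewrite subrK.
Qed.

End Existence.

(** * Differentiability in the spectral parameter *)

Section LambdaDerivative.
Variables (R : realType) (m d al : R) (q : R -> R).
Hypothesis qs : sing_pot m d al q.
Implicit Types (lam x b s : R).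

Let m0 : 0 <= m. Proof. by case: qs. Qed.
Let d0 : 0 < d. Proof. by case: qs => _ []. Qed.
Let d2 : d <= 2. Proof. by case: qs => _ []. Qed.
Let dm : 0 < d + 2 * m - 1. Proof. by case: qs => _ []. Qed.

(** [fd] solves the equation differentiated in [lam], with zero data at [0], which gains a factor
    [x^d] over [f]. The remainder after the first order term solves a Volterra system with a source
    of size [s^2]. The estimates stop at [3/4] because the majorants blow up at [1]; values at [1/2]
    suffice to differentiate the Wronskian. *)
Lemma nsol_dlambda lam f g : nsol m al 1 (fun x => q x - lam) f g -> exists fd gd C,
  [/\ forall x, 0 < x < 3 / 4 -> der x fd (gd x),
      forall x, 0 < x < 3 / 4 -> der x gd ((q x - lam) * fd x - f x),
      0 <= C,
      forall x, 0 < x <= 1 / 2 -> `|fd x| <= C * x `^ (m + d) /\ `|gd x| <= C * x `^ (m + d - 1) &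
      forall s F G, `|s| <= 1 -> nsol m al 1 (fun x => q x - (lam + s)) F G ->
        `|F (1 / 2) - f (1 / 2) - s * fd (1 / 2)| <= C * s ^+ 2 /\
        `|G (1 / 2) - g (1 / 2) - s * gd (1 / 2)| <= C * s ^+ 2].
Proof.
move=> fg; have [v [z [K0 [B0 [dv dz [K00 B00 v1 zal] fgE vzb]]]]] := nsolE qs fg.
have [A A1 HA] := regpart_bound qs (addr_ge0 (normr_ge0 lam) (@ler01 R)).
have A0 : 0 < A by exact: lt_le_trans A1.
have [K K00' HK] := nvolterra m0 d0 dm A0.
have b34 : 0 < (3 / 4 : R) <= 1 by lra.
have h12 : 0 < (1 / 2 : R) < 3 / 4 by lra.
have sub x : 0 < x < 3 / 4 -> 0 < x < 1 by move=> /andP[-> xb]/=; lra.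
have majle K1 x : 0 <= K1 -> 0 < x < 3 / 4 -> maj_h d K1 x <= maj_h d K1 (3 / 4).
  by move=> K10 /andP[x0 xb]; apply: (maj_h_mono m d0) => //; lra.
have cpow x : 0 < x < 3 / 4 -> {for x, continuous (fun y : R => y `^ (2 * m))}.
  by move=> /sub xb; exact: powR_cont_for xb.
pose M1 := 1 + `|al| + B0 * (expR (maj_h d K0 (3 / 4)) - 1).
have v_le x : 0 < x < 3 / 4 -> `|v x| <= M1.
  move=> xb; have [h1 _] := vzb x (sub x xb); rewrite -(subrK (1 + al * x) (v x)).
  tri; rewrite addrC /M1 lerD//.
    tri; rewrite normr1 lerD2l normrM -[leRHS]mulr1.
    by rewrite ler_wpM2l// gtr0_norm; case/andP: (sub x xb) => // _ /ltW.
  by apply: le_trans h1 _; rewrite ler_wpM2l// lerD2r ler_expR majle// ltW.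
have M10 : 0 <= M1 by apply: le_trans (v_le _ h12).
have wt x : 0 < x < 3 / 4 -> x `^ (2 * m) <= A * maj_weight m d x.
  move=> /sub xb; rewrite /maj_weight mulrCA -[leLHS]mulr1 ler_wpM2l ?powR_ge0//.
  have := weight_ge1 qs xb; set w := _ / _ => w1.
  by rewrite -[1]mulr1; apply: ler_pM.
have [] := HK (3 / 4) M1 (regpart m q lam) (fun x => - (x `^ (2 * m) * v x)) b34 M10.
- by move=> x /sub; exact: regpart_cont qs lam x.
- move=> x xb; apply: cvgN; apply: cvgM; first exact: cpow.
  exact: dv_cont (dv x (sub x xb)).
- by move=> x /sub xb; apply: HA => //; rewrite lerDl.
- move=> x xb; rewrite normrN normrM mulrC; apply: ler_pM => //; first exact: v_le.
  by rewrite ger0_norm ?powR_ge0//; exact: wt.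
move=> vd [zd [dvd dzd vdb zdb]].
pose M2 := M1 * (expR (maj_h d K (3 / 4)) - 1).
have vd_le x : 0 < x < 3 / 4 -> `|vd x| <= M2.
  by move=> xb; apply: le_trans (vdb x xb) _; rewrite ler_wpM2l// lerD2r ler_expR majle// ltW.
have M20 : 0 <= M2 by apply: le_trans (vd_le _ h12).
have [Ch Ch0 HCh] := maj_half qs (ltW K00').
pose C1 := Ch * M1 + m * Ch * M1.
pose C2 := 2 `^ (- m) * (M2 * (expR (maj_h d K (1 / 2)) - 1)) +
  (m * (2 `^ (- m) * 2) * (M2 * (expR (maj_h d K (1 / 2)) - 1)) +
   M2 * (maj_eta m d K (1 / 2) * expR (maj_h d K (1 / 2))) * 2 `^ m).
exists (fun x => x `^ m * vd x), (fun x => m * (x `^ m / x) * vd x + zd x / x `^ m), (C1 + C2).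
have e1 : 0 <= expR (maj_h d K (1 / 2)) - 1.
  rewrite subr_ge0 -[leLHS]expR0 ler_expR /maj_h; apply: mulr_ge0; first exact: ltW.
  by apply: divr_ge0; [exact: powR_ge0|lra].
have e2 : 0 <= maj_eta m d K (1 / 2) by apply: (maj_eta_ge0 m d0 (ltW K00')); lra.
have C10 : 0 <= C1 by rewrite /C1 !addr_ge0 ?mulr_ge0.
have C20 : 0 <= C2.
  by rewrite /C2; pos.
split.
- move=> x xb; have /andP[x0 _] := xb; have e0 := powR_gt0 m x0.
  dvt; [exact: x0|exact: dvd|].
  by rewrite powRB1// powR_dbl//; field; rewrite !gt_eqF.
- move=> x xb; have /andP[x0 _] := xb; have e0 := powR_gt0 m x0.
  dvt; [exact: x0|by rewrite gt_eqF|exact: dvd|exact: dzd|by rewrite gt_eqF|exact: x0|].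
  have [-> _] := fgE x (sub x xb).
  by rewrite /regpart powRB1// powR_dbl//; field; rewrite !gt_eqF.
- exact: addr_ge0.
- move=> x /andP[x0 x2]; have x34 : 0 < x < 3 / 4 by rewrite x0/=; lra.
  have [h1 h2] := HCh x ltac:(by rewrite x0).
  have a1 : `|vd x| <= M1 * (Ch * x `^ d).
    by apply: le_trans (vdb x x34) _; rewrite ler_wpM2l.
  have a2 : `|zd x| <= M1 * (Ch * x `^ (2 * m + d - 1)).
    by apply: le_trans (zdb x x34) _; rewrite ler_wpM2l.
  have e0 := powR_gt0 m x0; split.
    rewrite normrM (gtr0_norm e0) powR_add// mulrCA ler_wpM2l ?(ltW e0)//.
    apply: le_trans a1 _; rewrite mulrA ler_wpM2r ?powR_ge0//.
    have := mulr_ge0 (mulr_ge0 m0 Ch0) M10; rewrite /C1; lra.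
  tri.
  rewrite !normrM !normfV (ger0_norm m0) (gtr0_norm e0) (gtr0_norm x0).
  have E1 : x `^ (m + d - 1) = x `^ m * x `^ d / x by rewrite powRB1// powR_add.
  have E2 : x `^ (2 * m + d - 1) = x `^ m * (x `^ m * x `^ d / x).
    by rewrite powRB1// powR_add// powR_dbl//; ring.
  rewrite E2 in a2; rewrite E1; set y := _ * _ / x in a2 *.
  have y0 : 0 <= y by rewrite /y !mulr_ge0 ?powR_ge0 ?invr_ge0 1?ltW.
  have b1 : m * (x `^ m / x) * `|vd x| <= m * Ch * M1 * y.
    have -> : m * Ch * M1 * y = m * (x `^ m / x) * (M1 * (Ch * x `^ d)) by rewrite /y; ring.
    by apply: ler_wpM2l => //; rewrite mulr_ge0// divr_ge0// ltW.
  have b2 : `|zd x| / x `^ m <= Ch * M1 * y.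
    by rewrite ler_pdivrMr//; apply: le_trans a2 _; apply: le_of_eq; ring.
  have := mulr_ge0 C20 y0; rewrite /C1; move: b2 b1; glra.
move=> s F G s1 FG.
have lams : `|lam + s| <= `|lam| + 1 by tri; rewrite lerD2l.
have s20 : 0 <= s ^+ 2 by exact: sqr_ge0.
(* Inserting [v + s vd] into the system at [lam + s] leaves exactly the source [- s^2 x^(2m) vd]. *)
have [] := HK (3 / 4) (s ^+ 2 * M2) (regpart m q (lam + s))
  (fun x => - (s ^+ 2 * (x `^ (2 * m) * vd x))) b34 (mulr_ge0 s20 M20).
- by move=> x /sub; exact: regpart_cont qs _ x.
- move=> x xb; apply: cvgN; apply: cvgMr; apply: cvgM; first exact: cpow.
  exact: dv_cont (dvd x xb).
- by move=> x /sub xb; apply: HA.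
- move=> x xb; rewrite normrN normrM (ger0_norm s20) -[leRHS]mulrA ler_wpM2l//.
  rewrite normrM mulrC; apply: ler_pM => //; first exact: vd_le.
  by rewrite ger0_norm ?powR_ge0//; exact: wt.
move=> w [y [dw dy wb yb]].
have b0 : (0 : R) < 3 / 4 by exact: lt0_34.
have vd_0 := maj_cvg qs b0 vdb; have zd_0 := maj_cvg' qs b0 zdb.
have w_0 := maj_cvg qs b0 wb; have y_0 := maj_cvg' qs b0 yb.
(* By uniqueness this is the pair attached to [F] and [G], so [w] and [y] are the errors to be
   estimated. *)
pose V x := v x + s * vd x + w x; pose Z x := z x + s * zd x + y x.
have dV x : 0 < x < 3 / 4 -> der x V (Z x / x `^ (2 * m)).
  move=> xb; rewrite /V; dvt; [exact: dv (sub x xb)|exact: dvd|exact: dw|].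
  by rewrite /Z; ring.
have dZ x : 0 < x < 3 / 4 ->
    der x Z ((q x - (lam + s) - (m ^+ 2 - m) / x ^+ 2) * x `^ (2 * m) * V x).
  move=> xb; rewrite /Z; dvt; [exact: dz (sub x xb)|exact: dzd|exact: dy|].
  by rewrite /V /regpart; ring.
have V1 : V x @[x --> 0^'+] --> (1 : R).
  have H : v x + s * vd x + w x @[x --> 0^'+] --> 1 + s * 0 + 0.
    by apply: cvgD => //; apply: cvgD => //; exact: cvgMr.
  by rewrite mulr0 !addr0 in H.
have Zal : Z x @[x --> 0^'+] --> al.
  have H : z x + s * zd x + y x @[x --> 0^'+] --> al + s * 0 + 0.
    by apply: cvgD => //; apply: cvgD => //; exact: cvgMr.
  by rewrite mulr0 !addr0 in H.
have N := @nsol_intro R m al (3 / 4) (fun x => q x - (lam + s)) V Z b0 dV dZ V1 Zal.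
have b01 : (3 / 4 : R) <= 1 by exact: le34_1.
have cQ x : 0 < x < 3 / 4 -> {for x, continuous (fun y => q y - (lam + s))}.
  by move=> /sub; exact: (sing_pot_cont qs).
have [EF EG] := nsol_unique b0 cQ (nsol_sub b01 FG) N h12.
have [Ef Eg] := fgE (1 / 2) (sub _ h12).
have w2 := wb _ h12; have y2 := yb _ h12.
have p2 : (1 / 2 : R) `^ m = 2 `^ (- m).
  by rewrite div1r -powR_inv1 // -powRrM mulN1r.
have p0 : 0 < (2 : R) `^ (- m) by rewrite powR_gt0.
have p0' : 0 < (2 : R) `^ m by rewrite powR_gt0.
rewrite EF EG Ef Eg p2 /V /Z.
have -> : 2 `^ (- m) * (v (1 / 2) + s * vd (1 / 2) + w (1 / 2)) - 2 `^ (- m) * v (1 / 2) -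
    s * (2 `^ (- m) * vd (1 / 2)) = 2 `^ (- m) * w (1 / 2) by ring.
have iv : ((2 : R) `^ (- m))^-1 = 2 `^ m by rewrite powRN invrK.
have -> : m * (2 `^ (- m) / (1 / 2)) * (v (1 / 2) + s * vd (1 / 2) + w (1 / 2)) +
     (z (1 / 2) + s * zd (1 / 2) + y (1 / 2)) / 2 `^ (- m) -
     (m * (2 `^ (- m) / (1 / 2)) * v (1 / 2) + z (1 / 2) / 2 `^ (- m)) -
     s * (m * (2 `^ (- m) / (1 / 2)) * vd (1 / 2) + zd (1 / 2) / 2 `^ (- m)) =
     m * (2 `^ (- m) * 2) * w (1 / 2) + y (1 / 2) * 2 `^ m.
  by rewrite iv; field.
set Ew := expR _ in w2 *; rewrite -/Ew in e1 y2.
have t1 : 2 `^ (- m) * `|w (1 / 2)| <= 2 `^ (- m) * (M2 * (Ew - 1)) * s ^+ 2.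
  by have := ler_wpM2l (ltW p0) w2; glra.
have t2 : m * (2 `^ (- m) * 2) * `|w (1 / 2)| <= m * (2 `^ (- m) * 2) * (M2 * (Ew - 1)) * s ^+ 2.
  have p1 : 0 <= m * (2 `^ (- m) * 2) by pos.
  by have := ler_wpM2l p1 w2; glra.
have t3 : `|y (1 / 2)| * 2 `^ m <= M2 * (maj_eta m d K (1 / 2) * Ew) * 2 `^ m * s ^+ 2.
  by have := ler_wpM2r (ltW p0') y2; glra.
have u1 : 0 <= 2 `^ (- m) * (M2 * (Ew - 1)) * s ^+ 2.
  by apply: le_trans t1; rewrite mulr_ge0// ltW.
have u2 : 0 <= m * (2 `^ (- m) * 2) * (M2 * (Ew - 1)) * s ^+ 2.
  by apply: le_trans t2; rewrite !mulr_ge0// ltW.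
have u3 : 0 <= M2 * (maj_eta m d K (1 / 2) * Ew) * 2 `^ m * s ^+ 2.
  pos.
have u4 : 0 <= C1 * s ^+ 2 by pos.
have E : (C1 + C2) * s ^+ 2 = C1 * s ^+ 2 + (2 `^ (- m) * (M2 * (Ew - 1)) * s ^+ 2 +
  (m * (2 `^ (- m) * 2) * (M2 * (Ew - 1)) * s ^+ 2 +
   M2 * (maj_eta m d K (1 / 2) * Ew) * 2 `^ m * s ^+ 2)) by rewrite /C2 -/Ew; ring.
split; rewrite E.
  by rewrite normrM (gtr0_norm p0); move: t1 u2 u3 u4; glra.
tri; rewrite !normrM (ger0_norm m0) (gtr0_norm p0) (gtr0_norm p0').
by rewrite [`|2|]gtr0_norm//; move: t2 t3 u1 u4; glra.
Qed.

End LambdaDerivative.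

(** * Growth of arbitrary solutions at a singular endpoint *)

Section Growth.
Variables (R : realType) (m d al : R) (q : R -> R).
Hypothesis qs : sing_pot m d al q.
Implicit Types (lam x b s : R) (f g F G : R -> R).

Let m0 : 0 <= m. Proof. by case: qs. Qed.
Let d0 : 0 < d. Proof. by case: qs => _ []. Qed.
Let dm : 0 < d + 2 * m - 1. Proof. by case: qs => _ []. Qed.

Lemma nsol_growth lam f g : nsol m al 1 (fun x => q x - lam) f g -> exists2 C, 0 <= C &
  forall x, 0 < x <= 1 / 2 -> [/\ `|f x| <= C * x `^ m,
    1 / 2 <= m -> `|g x| <= C * x `^ (m - 1) & m = 0 -> `|g x| <= C].
Proof.
move=> fg; have [v [z [K [B [_ _ [K0 B0 _ _] fgE vzb]]]]] := nsolE qs fg.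
have [C C0 HC] := maj_half qs (ltW K0).
pose C1 := 1 + `|al| + B * C.
have C10 : 0 <= C1 by pos.
have mC10 : 0 <= m * C1 by pos.
exists (C1 + m * C1); first lra.
move=> x /andP[x0 x2]; have x1 : 0 < x < 1 by rewrite x0; lra.
have [Ef Eg] := fgE x x1; have [vb zb] := vzb x x1.
have [h1 h2] := HC x ltac:(lra).
have e0 := powR_gt0 m x0.
have x01 : 0 < x <= 1 by (move: x1; glra).
have vC : `|v x| <= C1.
  rewrite -(subrK (1 + al * x) (v x)); tri.
  have : `|v x - (1 + al * x)| <= B * C.
    apply: le_trans vb _; rewrite ler_wpM2l//; apply: le_trans h1 _.
    by rewrite -[leRHS]mulr1 ler_wpM2l// powR_le1// ltW.
  have : `|1 + al * x| <= 1 + `|al|.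
    tri; rewrite normr1 lerD2l normrM -[leRHS]mulr1.
    by rewrite ler_wpM2l// gtr0_norm; move: x01; glra.
  by rewrite /C1; glra.
split.
- rewrite Ef normrM (gtr0_norm e0) mulrC ler_wpM2r ?(ltW e0)//.
  lra.
- move=> m12; have al0 : al = 0 by case: qs => _ _ [mm|[->//]] _ _; lra.
  rewrite al0 subr0 in zb.
  have zC : `|z x| / x `^ m <= B * C * x `^ (m - 1).
    rewrite ler_pdivrMr//; apply: le_trans zb _.
    apply: le_trans (ler_wpM2l B0 h2) _; rewrite -!mulrA; apply: ler_wpM2l => //.
    apply: ler_wpM2l => //; rewrite powRB1// powRB1// powR_add// powR_dbl//.
    have := powR_le1 x01 (ltW d0) => xd1; have xd0 := powR_ge0 x d.
    have -> : x `^ m / x * x `^ m = (x `^ m) ^+ 2 / x by ring.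
    rewrite ler_wpM2r ?invr_ge0 ?(ltW x0)// -[leRHS]mulr1.
    by rewrite ler_wpM2l// exprn_ge0// ltW.
  rewrite Eg; tri.
  rewrite !normrM !normfV (ger0_norm m0) (gtr0_norm e0) (gtr0_norm x0).
  rewrite powRB1// in zC *.
  have y0 : 0 <= x `^ m / x by pos.
  have t1 : m * (x `^ m / x) * `|v x| <= m * C1 * (x `^ m / x).
    by have := ler_wpM2l (mulr_ge0 m0 y0) vC; glra.
  have t2 : B * C * (x `^ m / x) <= C1 * (x `^ m / x).
    by rewrite ler_wpM2r// /C1; have := normr_ge0 al; glra.
  move: t2 t1 y0 zC zb; glra.
- move=> mE; rewrite Eg mE mul0r mul0r add0r powRr0 divr1.
  rewrite -(subrK al (z x)); tri.
  have : `|z x - al| <= B * C.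
    apply: le_trans zb _; rewrite ler_wpM2l//; apply: le_trans h2 _.
    rewrite -[leRHS]mulr1 ler_wpM2l// powR_le1//.
    by move: dm; glra.
  by rewrite /C1; glra.
Qed.

Lemma cont_bounded f a b : a <= b -> (forall x, a <= x <= b -> {for x, continuous f}) ->
  exists2 C, 0 <= C & forall x, a <= x <= b -> `|f x| <= C.
Proof.
move=> ab cf; have [|c cab cmax] := @EVT_max R (fun x => `|f x|) a b ab.
  apply: continuous_subspace_itv => x; rewrite in_itv/= => xab.
  by apply: cvg_norm; exact: cf.
exists `|f c| => // x xab; apply: cmax; by [].
Qed.

Lemma powR_min x1 x s : 0 < x1 -> x1 <= x <= 1 -> Num.min (x1 `^ s) 1 <= x `^ s.
Proof.
move=> x10 /andP[x1x x1']; have x0 : 0 < x by lra.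
have [s0|s0] := leP 0 s.
  rewrite ge_min; apply/orP; left; apply: ge0_ler_powR => //; rewrite nnegrE ltW//.
by rewrite ge_min; apply/orP; right; apply: powR_ge1; [rewrite x0|lra].
Qed.

Let bound_extend F x1 s : 0 < x1 -> x1 <= 1 / 2 ->
  (forall x, 0 < x < 1 -> {for x, continuous F}) ->
  (exists2 C, 0 <= C & forall x, 0 < x <= x1 -> `|F x| <= C * x `^ s) ->
  exists2 C, 0 <= C & forall x, 0 < x <= 1 / 2 -> `|F x| <= C * x `^ s.
Proof.
move=> x10 x12 cF [C C0 HC].
have [|M M0 HM] := @cont_bounded F x1 (1 / 2) x12.
  by move=> x /andP[a1 a2]; apply: cF; lra.
pose k := Num.min (x1 `^ s) 1.
have k0 : 0 < k by rewrite lt_min powR_gt0//=.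
exists (C + M / k); first pos.
move=> x /andP[x0 x2]; have [xx1|/ltW x1x] := leP x x1.
  apply: le_trans (HC x _) _; first by rewrite x0.
  by rewrite ler_wpM2r ?powR_ge0// lerDl divr_ge0// ltW.
apply: le_trans (HM x _) _; first lra.
have : k <= x `^ s by apply: powR_min => //; rewrite x1x; lra.
move=> kx; have : M <= M / k * x `^ s by rewrite mulrAC ler_pdivlMr// ler_wpM2l.
have : 0 <= C * x `^ s by pos.
lra.
Qed.

Section OneSolution.
Variables (lam : R) (f g F G : R -> R).
Hypothesis fg : nsol m al 1 (fun x => q x - lam) f g.
Hypothesis FG : ode2 0 1 (fun x => q x - lam) F G.

Let ofg : ode2 0 1 (fun x => q x - lam) f g. Proof. by case: fg. Qed.
Let b01 : (0 : R) < 1. Proof. by []. Qed.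

Let cF x : 0 < x < 1 -> {for x, continuous F}.
Proof. by move=> x1; exact: dv_cont (FG.1 x x1). Qed.
Let cG x : 0 < x < 1 -> {for x, continuous G}.
Proof. by move=> x1; exact: dv_cont (FG.2 x x1). Qed.

Let near0 : exists x1, [/\ 0 < x1, x1 <= 1 / 2 & forall x, 0 < x <= x1 -> x `^ m / 2 <= f x <= 2 * x `^ m].
Proof.
have [x0 [x00 x01 H]] := nsol_pos_near b01 fg.
have t : 0 < Num.min x0 (1 / 2) by rewrite lt_min; lra.
exists (Num.min x0 (1 / 2)); split => //; first by rewrite ge_min lexx orbT.
move=> x /andP[xp xm]; apply: H; rewrite xp; apply: le_trans xm _.
by rewrite ge_min lexx.
Qed.

Let W x := F x * g x - G x * f x.

Let WE x y : 0 < x < 1 -> 0 < y < 1 -> W x = W y.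
Proof. exact: (wronskian_eq FG ofg). Qed.

Let dr x : 0 < x < 1 -> f x != 0 ->
  der x (fun y => F y / f y) (- (W x / f x ^+ 2)).
Proof.
move=> x1 fx; dvt; [exact: FG.1 x x1|by []|exact: ofg.1 x x1|].
by rewrite /W; field.
Qed.

(* Reduction of order: [F = f r] with [r' = - W / f^2], so [r] is at most of order
   [x^(1 - 2m)] up to an arbitrarily small loss (needed for the logarithm at m = 1/2). *)
Lemma sol_growth e : 0 < e -> exists2 C, 0 <= C & forall x, 0 < x <= 1 / 2 ->
  (1 / 2 <= m -> `|F x| <= C * x `^ (1 - m - e) /\ `|G x| <= C * x `^ (- m - e)) /\
  (m = 0 -> `|F x| <= C /\ `|G x| <= C).
Proof.
move=> e0; have [x1 [x10 x12 fb]] := near0; have [C C0 HC] := nsol_growth fg.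
pose w : R := `|W x1|; have w0 : 0 <= w by exact: normr_ge0.
have x11 : 0 < x1 < 1 by rewrite x10/=; lra.
have sub x : 0 < x <= x1 -> 0 < x < 1 by move=> /andP[-> h]/=; lra.
have f0 x : 0 < x <= x1 -> 0 < f x.
  move=> xx; have /andP[x0 _] := xx; have /andP[h _] := fb x xx.
  by apply: lt_le_trans h; rewrite divr_gt0// powR_gt0.
have rb x : 0 < x <= x1 -> `|- (W x / f x ^+ 2)| <= 4 * w * x `^ (- (2 * m)).
  move=> xx; have /andP[x0 _] := xx; have /andP[h _] := fb x xx.
  rewrite normrN normrM normfV (WE (sub x xx) x11) -/w.
  have e1 := powR_gt0 m x0; have e2 := f0 x xx.
  rewrite powRN powR_dbl// normrX (gtr0_norm e2).
  have H : (f x ^+ 2)^-1 <= ((x `^ m / 2) ^+ 2)^-1.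
    rewrite lef_pV2 ?posrE ?exprn_gt0 ?divr_gt0//.
    by rewrite ler_pXn2r ?nnegrE ?divr_ge0 ?(ltW e1) ?(ltW e2).
  have E : ((x `^ m / 2) ^+ 2)^-1 = 4 * (x `^ m ^+ 2)^-1 by field; rewrite gt_eqF.
  by rewrite E in H; have := ler_wpM2l (normr_ge0 (W x1)) H; rewrite -/w; lra.
have GE x : 0 < x <= x1 -> G x = F x / f x * g x - W x1 / f x.
  move=> xx; rewrite -(WE (sub x xx) x11) /W; field; rewrite gt_eqF// f0//.
(* Integrates the bound on [(F / f)'] from [x1] down to [x]. The case [t = 0] is used for [m = 0];
   otherwise [t = 2 m - 1 + e] is positive, so no logarithm appears. *)
have key (t : R) : 0 <= t -> (forall x, 0 < x <= x1 -> x `^ (- (2 * m)) <= x `^ (- t - 1) \/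
    (t = 0 /\ x `^ (- (2 * m)) <= 1)) ->
   (t = 0 -> forall x, 0 < x <= x1 -> x `^ (- (2 * m)) <= 1) ->
   exists2 C, 0 <= C & forall x, 0 < x <= x1 -> `|F x / f x| <= C * x `^ (- t).
  move=> t0 Ht Ht0; pose r x := F x / f x.
  have [tE|tn] := eqVneq t 0.
    exists (`|r x1| + 4 * w); first by pos.
    move=> x xx; have /andP[x0 xx1] := xx; rewrite tE oppr0 powRr0 mulr1.
    have := @dv_le_norm R x x1 r (fun y => - (W y / f y ^+ 2)) (fun y => 4 * w * y)
      (fun=> 4 * w) xx1 => H.
    have : `|r x1 - r x| <= 4 * w * x1 - 4 * w * x.
      apply: H => y /andP[xy yx1].
      - have yx : 0 < y <= x1 by rewrite (lt_le_trans x0).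
        by apply: dr; [exact: sub|rewrite gt_eqF// f0].
      - exact: dv_lin.
      - have yx : 0 < y <= x1 by rewrite (lt_le_trans x0).
        apply: le_trans (rb y yx) _; rewrite -[leRHS]mulr1 ler_wpM2l ?mulr_ge0//.
        exact: Ht0.
    rewrite -/(r x) => h; have -> : r x = r x1 - (r x1 - r x) by ring.
    apply: le_trans (ler_normB _ _) _; nra.
  exists (`|r x1| + 4 * w / t); first by pos.
  move=> x xx; have /andP[x0 xx1] := xx.
  have : `|r x1 - r x| <= - (4 * w / t * x1 `^ (- t)) - - (4 * w / t * x `^ (- t)).
    apply: (@dv_le_norm R x x1 r (fun y => - (W y / f y ^+ 2))
      (fun y => - (4 * w / t * y `^ (- t))) (fun y => 4 * w * y `^ (- t - 1)) xx1) => y /andP[xy yx1].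
    - have yx : 0 < y <= x1 by rewrite (lt_le_trans x0).
      by apply: dr; [exact: sub|rewrite gt_eqF// f0].
    - by dvt; [exact: tn|exact: lt_le_trans xy|field].
    - have yx : 0 < y <= x1 by rewrite (lt_le_trans x0).
      apply: le_trans (rb y yx) _; rewrite ler_wpM2l ?mulr_ge0//.
      by have [//|[tE _]] := Ht y yx; rewrite tE eqxx in tn.
  rewrite -/(r x) => h; have -> : r x = r x1 - (r x1 - r x) by ring.
  apply: le_trans (ler_normB _ _) _.
  have p1 : 1 <= x `^ (- t) by apply: powR_ge1; [rewrite x0/=; lra|lra].
  have p2 : 0 <= 4 * w / t * x1 `^ (- t) by rewrite mulr_ge0 ?powR_ge0// divr_ge0 ?mulr_ge0.
  have p3 : `|r x1| <= `|r x1| * x `^ (- t) by rewrite -[leLHS]mulr1 ler_wpM2l.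
  by rewrite mulrDl; move: p3 p2 p1 h xx1; glra.
have wf x : 0 < x <= x1 -> `|W x1 / f x| <= 2 * w * x `^ (- m).
  move=> xx; have /andP[x0 _] := xx; have /andP[h _] := fb x xx; have e1 := powR_gt0 m x0.
  rewrite normrM -/w normfV (gtr0_norm (f0 x xx)) powRN.
  have H : (f x)^-1 <= (x `^ m / 2)^-1 by rewrite lef_pV2 ?posrE ?divr_gt0 ?f0.
  have E : (x `^ m / 2)^-1 = 2 * (x `^ m)^-1 by field; rewrite gt_eqF.
  by rewrite E in H; have := ler_wpM2l (normr_ge0 (W x1)) H; rewrite -/w; lra.
have fle x : 0 < x <= x1 -> `|f x| <= 2 * x `^ m.
  by move=> xx; have /andP[_ h] := fb x xx; rewrite gtr0_norm// f0.
have FE x : 0 < x <= x1 -> `|F x| = `|F x / f x| * `|f x|.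
  by move=> xx; rewrite -normrM divfK// gt_eqF// f0.
have x12' x : 0 < x <= x1 -> 0 < x <= 1 / 2 by move=> /andP[-> h]/=; lra.
case: qs => _ _ [mE|[_ m12]] _ _.
  have [||C1 C10 HC1] := key 0 (lexx _).
  - by move=> x _; right; split => //; rewrite mE mulr0 oppr0 powRr0.
  - by move=> _ x _; rewrite mE mulr0 oppr0 powRr0.
  have [|C2 C20 HC2] := @bound_extend F x1 0 x10 x12 cF.
    exists (C1 * 2); first by rewrite mulr_ge0.
    move=> x xx; rewrite powRr0 mulr1 FE//; apply: ler_pM => //.
      by have := HC1 x xx; rewrite oppr0 powRr0 mulr1.
    by have := fle x xx; rewrite mE powRr0 mulr1.
  have [|C3 C30 HC3] := @bound_extend G x1 0 x10 x12 cG.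
    exists (C1 * C + 2 * w); first by rewrite addr_ge0 ?mulr_ge0.
    move=> x xx; rewrite powRr0 mulr1 GE//; apply: le_trans (ler_normB _ _) _.
    rewrite normrM lerD//.
      apply: ler_pM => //; first by have := HC1 x xx; rewrite oppr0 powRr0 mulr1.
      by have [_ _] := HC x (x12' x xx); exact.
    by have := wf x xx; rewrite mE oppr0 powRr0 mulr1.
  exists (C2 + C3); first exact: addr_ge0.
  move=> x xx; split=> [|_]; first by rewrite mE => ?; exfalso; lra.
  have := HC2 x xx; have := HC3 x xx; rewrite powRr0 !mulr1 => h1 h2.
  move: h2 h1 xx C30 C20; glra.
have tm : 0 <= 2 * m - 1 + e by lra.
have [||C1 C10 HC1] := key _ tm.
- move=> x /andP[x0 xx]; left; apply: ger_powR; first lra.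
  lra.
- lra.
have mul x (r s : R) : 0 < x <= x1 -> x `^ r * x `^ s = x `^ (r + s).
  by move=> /andP[x0 _]; rewrite powR_add.
have [|C2 C20 HC2] := @bound_extend F x1 (1 - m - e) x10 x12 cF.
  exists (C1 * 2); first pos.
  move=> x xx; rewrite FE//; have h1 := HC1 x xx; have h2 := fle x xx.
  have := ler_pM (normr_ge0 _) (normr_ge0 _) h1 h2.
  have := mul x (- (2 * m - 1 + e)) m xx.
  have -> : - (2 * m - 1 + e) + m = 1 - m - e by ring.
  by move=> <-; glra.
have [|C3 C30 HC3] := @bound_extend G x1 (- m - e) x10 x12 cG.
  exists (C1 * C + 2 * w); first pos.
  move=> x xx; rewrite GE//; apply: le_trans (ler_normB _ _) _; rewrite normrM.
  have h1 := HC1 x xx; have [_ /(_ m12) h2 _] := HC x (x12' x xx).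
  have := ler_pM (normr_ge0 _) (normr_ge0 _) h1 h2.
  have := mul x (- (2 * m - 1 + e)) (m - 1) xx.
  have -> : - (2 * m - 1 + e) + (m - 1) = - m - e by ring.
  move=> <- h3; have h4 := wf x xx.
  have h5 : x `^ (- m) <= x `^ (- (2 * m - 1 + e)) * x `^ (m - 1).
    rewrite mul//; apply: ger_powR; last lra.
    move: h4 h3 h2 h1 xx C20 C10 tm m12 x11 w0 C0; glra.
  nra.
exists (C2 + C3); first pos.
move=> x xx; split=> [_|mE]; last lra.
have := HC2 x xx; have := HC3 x xx => h1 h2.
have p1 := powR_ge0 x (1 - m - e); have p2 := powR_ge0 x (- m - e).
nra.
Qed.

(** As [z <= x], the smallness of the normalized solution at [z] compensates the possible growth of
    the other one at [x]. The loss [e = 1/4] in the growth estimate fits within the exponent [1/2]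
    allowed for the derivatives. *)
Lemma green_bounds : exists2 C, 0 <= C & forall z x, 0 < z -> z <= x -> x <= 1 / 2 ->
  [/\ `|f z * F x| <= C, `|g z * F x| <= C * z `^ (- (1 / 2)) &
      `|f z * G x| <= C * x `^ (- (1 / 2))].
Proof.
have [C C0 HC] := nsol_growth fg.
have e4 : (0 : R) < 1 / 4 by lra.
have [D D0 HD] := sol_growth e4.
exists (C * D); first exact: mulr_ge0.
move=> z x z0 zx x2; have x0 : 0 < x by exact: lt_le_trans zx.
have z2 : z <= 1 / 2 by exact: le_trans x2.
have [f1 g1 g2] := HC z ltac:(by rewrite z0).
have [F1 F2] := HD x ltac:(by rewrite x0).
have CD0 : 0 <= C * D by rewrite mulr_ge0.
have pz : 1 <= z `^ (- (1 / 2)) by apply: powR_ge1 => //; lra.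
have px : 1 <= x `^ (- (1 / 2)) by apply: powR_ge1 => //; move: g1 f1 z2 x0 x2; glra.
have mk (u v U V p : R) : `|u| <= C * U -> `|v| <= D * V -> 0 <= U -> 0 <= V -> U * V <= p ->
    `|u * v| <= C * D * p.
  move=> h1 h2 U0 V0 h3; rewrite normrM.
  have := ler_pM (normr_ge0 _) (normr_ge0 _) h1 h2.
  have := ler_wpM2l CD0 h3; glra.
case: qs => _ _ [mE|[_ m12]] _ _.
  have [h1 h2] := F2 mE; have h3 := g2 mE; rewrite mE powRr0 in f1.
  split.
  - by rewrite -[leRHS]mulr1; apply: (mk _ _ 1 1) => //; rewrite ?mulr1.
  - by apply: (mk _ _ 1 1) => //; rewrite ?mulr1.
  - by apply: (mk _ _ 1 1) => //; rewrite ?mulr1.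
have [h1 h2] := F1 m12; have h3 := g1 m12.
have mono (s : R) : 0 <= s -> z `^ s <= x `^ s.
  by move=> s0; apply: ge0_ler_powR => //; rewrite nnegrE ltW.
split.
- rewrite -[leRHS]mulr1; apply: (mk _ _ _ _ _ f1 h1); rewrite ?powR_ge0//.
  apply: le_trans (ler_wpM2r (powR_ge0 _ _) (mono m m0)) _.
  by rewrite -powR_add//; apply: powR_le1; move: x0 x2 m0 m12; glra.
- apply: (mk _ _ _ _ _ h3 h1); rewrite ?powR_ge0//.
  have -> : m - 1 = - (1 / 2) + (m - 1 / 2) by field.
  rewrite powR_add// -mulrA -[leRHS]mulr1 ler_wpM2l ?powR_ge0//.
  apply: le_trans (ler_wpM2r (powR_ge0 _ _) (mono (m - 1 / 2) _)) _; first by (move: h3 h2 h1 m12 px; glra).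
  by rewrite -powR_add//; apply: powR_le1; move: x0 x2 m0 m12; glra.
- apply: (mk _ _ _ _ _ f1 h2); rewrite ?powR_ge0//.
  apply: le_trans (ler_wpM2r (powR_ge0 _ _) (mono m m0)) _.
  by rewrite -powR_add//; apply: ger_powR; move: x0 x2 m0 m12; glra.
Qed.

Lemma wronskian_prop : (forall x, 0 < x < 1 -> F x * g x - G x * f x = 0) ->
  exists c, forall x, 0 < x < 1 -> F x = c * f x /\ G x = c * g x.
Proof.
move=> W0; have [x1 [x10 x12 fb]] := near0.
have x11 : 0 < x1 < 1 by lra.
have f0 : 0 < f x1.
  have /andP[h _] := fb x1 ltac:(by rewrite x10/=).
  by apply: lt_le_trans h; rewrite divr_gt0// powR_gt0.
exists (F x1 / f x1) => x xx.
have o := ode2_lin 1 (- (F x1 / f x1)) FG ofg.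
have [|||] := @ode2_zero R 0 1 (fun x => q x - lam) _ _ x1 _ o x11 _ _ x xx.
- by move=> y; exact: (sing_pot_cont qs).
- by field; rewrite gt_eqF.
- have : G x1 = F x1 * g x1 / f x1.
    by have := W0 x1 x11 => /eqP; rewrite subr_eq0 => /eqP ->; rewrite mulfK// gt_eqF.
  by move=> ->; field; rewrite gt_eqF.
by move=> h1 h2; split; lra.
Qed.

End OneSolution.
End Growth.

(** * Boundary conditions and the Wronskian *)

Section BoundaryCondition.
Variables (R : realType).
Implicit Types (m d al x lam : R) (q f g F G : R -> R).

(** Ratio of the two model solutions: [x^m Theta m x] is [psinu (m - 1 / 2) x], and for [m = 1] it
    is the constant [1], so that the Dirichlet and the Friedrichs conditions take the same form. *)
Definition Theta m x := if 1 / 2 < m then x `^ (1 - 2 * m) / (2 * m - 1) else - ln x.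

Lemma Theta_gt m : 1 / 2 < m -> Theta m = fun x => x `^ (1 - 2 * m) / (2 * m - 1).
Proof. by move=> h; rewrite /Theta h. Qed.

Lemma Theta_half m : 1 / 2 <= m -> (1 / 2 < m) = false -> m = 1 / 2 /\ Theta m = fun x => - ln x.
Proof.
move=> m12 h; split; last by apply/funext => x; rewrite /Theta h.
lra.
Qed.

Lemma cvg_pow_bound (b : R) f E s : 0 < b -> 0 < s ->
  (forall x, 0 < x <= b -> `|f x| <= E * x `^ s) -> f x @[x --> 0^'+] --> (0 : R).
Proof.
move=> b0 s0 HE; apply: norm_cvg0.
apply: (squeeze0 (fun x => E * x `^ s)).
- near=> x; rewrite normr_ge0/=; apply: HE; apply/andP; split.
    by [].
  by near: x; exact: nbhs_right_le.
- exact: cvg_cst.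
- have H : E * x `^ s @[x --> 0^'+] --> E * 0 by apply: cvgMr; exact: powR_cvg0.
  by rewrite mulr0 in H.
Unshelve. all: by end_near. Qed.

Lemma ThetaD m x : 1 / 2 <= m -> 0 < x -> der x (Theta m) (- x `^ (- (2 * m))).
Proof.
move=> m12 x0; case: (boolP (1 / 2 < m)) => [m12'|/negbTE m12'].
  have mn : 2 * m - 1 != 0 by rewrite gt_eqF; lra.
  rewrite Theta_gt//; dvt; [by []|exact: mn|].
  have -> : 1 - 2 * m - 1 = - (2 * m) by ring.
  by field.
have [-> ->] := Theta_half m12 m12'.
rewrite mul1r mulfV ?powR_inv1 ?ltW//.
by dvt; [by []|]; rewrite mul1r.
Qed.

Lemma Theta_cvg m : 1 / 2 <= m -> (Theta m x)^-1 @[x --> 0^'+] --> (0 : R).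
Proof.
move=> m12; case: (boolP (1 / 2 < m)) => [m12'|/negbTE m12'].
  rewrite Theta_gt//.
  have H : (2 * m - 1) * x `^ (2 * m - 1) @[x --> 0^'+] --> (2 * m - 1) * 0.
    by apply: cvgMr; apply: powR_cvg0; lra.
  rewrite mulr0 in H; apply: (cvg_right_eq ltr01 _ H) => x /andP[x0 _].
  by rewrite -[1 - _]opprB powRN invf_div invrK.
have [_ ->] := Theta_half m12 m12'.
apply/cvgrPdist_lt => e e0; near=> x.
have : x < expR (- e^-1) by near: x; apply: nbhs_right_lt; pos.
rewrite -ltr_ln ?posrE ?expR_gt0// expRK => lx.
have L : 0 < - ln x.
  have : 0 < e^-1 by pos. lra.
rewrite sub0r normrN gtr0_norm ?invr_gt0// -[e]invrK ltf_pV2 ?posrE ?invr_gt0; lra.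
Unshelve. all: by end_near. Qed.

Lemma Theta_pos m : 1 / 2 <= m -> exists2 e, 0 < e & forall x, 0 < x < e -> 0 < Theta m x.
Proof.
move=> m12; exists 1 => // x /andP[x0 x1]; rewrite /Theta; case: ifPn => [m12'|_].
  by rewrite divr_gt0 ?powR_gt0; lra.
by rewrite oppr_gt0 ln_lt0// x0.
Qed.

Section Fixed.
Variables (m d al : R) (q : R -> R) (lam : R) (f g F G : R -> R).
Hypothesis qs : sing_pot m d al q.
Hypothesis fg : nsol m al 1 (fun x => q x - lam) f g.
Hypothesis FG : ode2 0 1 (fun x => q x - lam) F G.

Let b01 : (0 : R) < 1. Proof. by []. Qed.

(** With [W] the constant Wronskian, [(F / f)' = - W / f^2] and [f <= 2 x^m] near [0], so [W F / f]
    is at least [W^2 Theta / 4] up to a constant. Dividing by [Theta], which tends to infinity,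
    gives [W^2 / 4 <= 0]. *)
Lemma bc_Theta_wronskian : 1 / 2 <= m -> F x / (x `^ m * Theta m x) @[x --> 0^'+] --> (0 : R) ->
  forall x, 0 < x < 1 -> F x * g x - G x * f x = 0.
Proof.
move=> m12 F0; have [x1 [x10 x11 fb]] := nsol_pos_near b01 fg.
have [ofg v1 _] := fg.
have WE : forall x y, 0 < x < 1 -> 0 < y < 1 ->
  F x * g x - G x * f x = F y * g y - G y * f y by exact: (wronskian_eq FG ofg).
have x1I : 0 < x1 < 1 by rewrite x10.
set W := F x1 * g x1 - G x1 * f x1.
suff W0 : W ^+ 2 <= 0.
  have W00 : W = 0 by apply/eqP; rewrite -sqrf_eq0 eq_le W0 sqr_ge0.
  by move=> x xx; rewrite (WE x x1).
pose K := W * (F x1 / f x1) - W ^+ 2 / 4 * Theta m x1.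
have f0 x : 0 < x <= x1 -> 0 < f x.
  move=> xx; have /andP[x0 _] := xx; have /andP[h _] := fb x xx.
  by apply: lt_le_trans h; rewrite divr_gt0// powR_gt0.
have lb x : 0 < x < x1 -> W ^+ 2 / 4 * Theta m x + K <= W * (F x / f x).
  move=> /andP[x0 xx1].
  suff : W ^+ 2 / 4 * Theta m x - W * (F x / f x) <= W ^+ 2 / 4 * Theta m x1 - W * (F x1 / f x1).
    by rewrite /K; lra.
  apply: (@dv_le R x x1 (fun y => W ^+ 2 / 4 * Theta m y - W * (F y / f y))
    (fun y => W ^+ 2 * ((f y ^+ 2)^-1 - (4 * y `^ m ^+ 2)^-1)) (ltW xx1)) => y /andP[xy yx1].
    have y0 : 0 < y by lra.
    have yI : 0 < y < 1 by lra.
    have fy : f y != 0 by rewrite gt_eqF// f0// y0.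
    have dT := ThetaD m12 y0.
    have d1 := FG.1 y yI; have d2 := ofg.1 y yI.
    have D := dvD (dvM (dv_cst (W ^+ 2 / 4) y) dT) (dvN (dvM (dv_cst W y) (dvM d1 (dvV fy d2)))).
    apply: dv_eq D _.
    have WW : F y * g y - G y * f y = W by rewrite (WE y x1).
    have -> : 0 * Theta m y + W ^+ 2 / 4 * - y `^ (- (2 * m)) -
      (0 * (F y / f y) + W * (G y * (f y)^-1 + F y * - (g y / f y ^+ 2))) =
      W ^+ 2 / 4 * - y `^ (- (2 * m)) + W * (F y * g y - G y * f y) / f y ^+ 2 by field.
    rewrite WW powRN powR_dbl//; field.
    by rewrite gt_eqF ?powR_gt0.
  have y0 : 0 < y by lra.
  rewrite mulr_ge0 ?sqr_ge0// subr_ge0.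
  have yy : 0 < y <= x1 by rewrite y0.
  have /andP[_ h] := fb y yy; have e0 := powR_gt0 m y0.
  rewrite lef_pV2 ?posrE ?mulr_gt0 ?f0//.
  have -> : 4 * y `^ m ^+ 2 = (2 * y `^ m) ^+ 2 by ring.
  by rewrite ler_pXn2r ?nnegrE ?mulr_ge0 ?(ltW e0) ?(ltW (f0 _ yy)).
have L1 : (f x / x `^ m) * (W ^+ 2 / 4 + K * (Theta m x)^-1) @[x --> 0^'+] --> 1 * (W ^+ 2 / 4 + K * 0).
  by apply: cvgM => //; apply: cvgD; [exact: cvg_cst|apply: cvgMr; exact: Theta_cvg].
have L2 : W * (F x / (x `^ m * Theta m x)) @[x --> 0^'+] --> W * 0 by exact: cvgMr.
rewrite !mulr0 addr0 mul1r in L1 L2.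
suff : W ^+ 2 / 4 <= 0 by lra.
have [e e0 Te] := Theta_pos m12.
apply: (ler_cvg_to L1 L2); near=> x.
have x0 : 0 < x by [].
have xe : x < e by pos.
have xx1 : x < x1 by [].
have T0 := Te x ltac:(lra).
have fx : 0 < f x by rewrite f0// x0 ltW.
have xm := powR_gt0 m x0.
have -> : W * (F x / (x `^ m * Theta m x)) = (f x / x `^ m) * (W * (F x / f x) / Theta m x).
  by field; rewrite !gt_eqF.
rewrite ler_wpM2l ?divr_ge0 ?(ltW fx) ?(ltW xm)// ler_pdivlMr// mulrDl mulfVK ?gt_eqF//.
by apply: lb; rewrite x0.
Unshelve. all: by end_near. Qed.

Lemma bc_Theta_nsol : 1 / 2 <= m -> f x / (x `^ m * Theta m x) @[x --> 0^'+] --> (0 : R).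
Proof.
move=> m12; have [_ v1 _] := fg.
have H : f x / x `^ m * (Theta m x)^-1 @[x --> 0^'+] --> (1 * 0 : R).
  by apply: cvgM => //; exact: Theta_cvg.
rewrite mulr0 in H; apply: (cvg_right_eq b01 _ H) => x _.
lra.
Qed.

Lemma bc_robin_wronskian u v : m = 0 -> F x @[x --> 0^'+] --> u -> G x @[x --> 0^'+] --> v ->
  v = al * u -> forall x, 0 < x < 1 -> F x * g x - G x * f x = 0.
Proof.
move=> mE Fu Gv vu x xx; have [ofg v1 z1] := fg.
have f1 : f x @[x --> 0^'+] --> (1 : R).
  by apply: (cvg_right_eq b01 _ v1) => y _; rewrite mE powRr0 divr1.
have g1 : g x @[x --> 0^'+] --> al.
  by apply: (cvg_right_eq b01 _ z1) => y _; rewrite mE powRr0 mul1r mul0r subr0.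
have H : F x * g x - G x * f x @[x --> 0^'+] --> u * al - v * 1.
  by apply: cvgB; exact: cvgM.
rewrite vu mulr1 mulrC subrr in H.
apply: (right_lim_cst b01 _ H) => y yy; exact: (wronskian_eq FG ofg).
Qed.

Lemma bc_robin_nsol : m = 0 -> f x @[x --> 0^'+] --> (1 : R) /\ g x @[x --> 0^'+] --> al.
Proof.
move=> mE; have [ofg v1 z1] := fg; split.
  by apply: (cvg_right_eq b01 _ v1) => y _; rewrite mE powRr0 divr1.
by apply: (cvg_right_eq b01 _ z1) => y _; rewrite mE powRr0 mul1r mul0r subr0.
Qed.

(** The factor [x^d] gained by the derivative in [lam] beats the growth of an arbitrary solution,
    which is known up to a loss [d / 2]; for [m = 0] solutions are bounded and [d > 1]. *)
Lemma dlambda_wronskian_cvg fd gd C : 0 <= C ->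
  (forall x, 0 < x <= 1 / 2 -> `|fd x| <= C * x `^ (m + d) /\ `|gd x| <= C * x `^ (m + d - 1)) ->
  F x * gd x - G x * fd x @[x --> 0^'+] --> (0 : R).
Proof.
move=> C0 Hd; have d0 : 0 < d by case: qs => _ [].
have dm : 0 < d + 2 * m - 1 by case: qs => _ [].
have d20 : 0 < d / 2 by lra.
have [D D0 HD] := sol_growth qs fg FG d20.
case: qs => _ _ [mE|[_ m12]] _ _.
  have d1 : 0 < d - 1 by move: dm; lra.
  apply: (@cvg_pow_bound (1 / 2) _ (2 * (D * C)) _ _ d1); first lra.
  move=> x xx; have [_ /(_ mE) [h1 h2]] := HD x xx; have [h3 h4] := Hd x xx.
  rewrite mE !add0r in h3 h4; apply: le_trans (ler_normB _ _) _; rewrite !normrM.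
  have h5 : x `^ d <= x `^ (d - 1) by apply: ger_powR; lra.
  have := ler_pM (normr_ge0 _) (normr_ge0 _) h1 h4.
  have := ler_pM (normr_ge0 _) (normr_ge0 _) h2 h3.
  have := ler_wpM2l (mulr_ge0 D0 C0) h5.
  lra.
apply: (@cvg_pow_bound (1 / 2) _ (2 * (D * C)) _ _ d20); first lra.
move=> x xx; have [/(_ m12) [h1 h2] _] := HD x xx; have [h3 h4] := Hd x xx.
apply: le_trans (ler_normB _ _) _; rewrite !normrM.
have x0 : 0 < x by case/andP: xx.
have := ler_pM (normr_ge0 _) (normr_ge0 _) h1 h4.
have := ler_pM (normr_ge0 _) (normr_ge0 _) h2 h3.
have E1 : x `^ (1 - m - d / 2) * x `^ (m + d - 1) = x `^ (d / 2).
  by rewrite -powR_add//; congr (_ `^ _); field.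
have E2 : x `^ (- m - d / 2) * x `^ (m + d) = x `^ (d / 2).
  by rewrite -powR_add//; congr (_ `^ _); field.
nra.
Qed.

End Fixed.

Lemma dv_of_quad F lam D : (exists C, forall s, `|s| <= 1 ->
  `|F (lam + s) - F lam - s * D| <= C * s ^+ 2) -> der lam F D.
Proof.
move=> [C HC]; have C0 : 0 <= C.
  have := HC 1 ltac:(by rewrite normr1); rewrite expr1n mulr1.
  exact: le_trans (normr_ge0 _).
have H : h^-1 *: (F (h *: 1 + lam) - F lam) @[h --> (0 : R)^'] --> D.
  apply/cvgrPdist_lt => e e0; near=> h.
  have h0 : h != 0 by near: h; exact: nbhs_dnbhs_neq.
  have h1 : `|h| < Num.min 1 (e / (C + 1)).
    near: h; apply: dnbhs0_lt; rewrite lt_min ltr01/= divr_gt0//; lra.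
  move: h1; rewrite lt_min => /andP[h1 h2].
  have hn : 0 < `|h| by rewrite normr_gt0.
  have := HC h (ltW h1); rewrite /GRing.scale/= mulr1 [h + lam]addrC => Hh.
  have -> : D - h^-1 * (F (lam + h) - F lam) = - (h^-1 * (F (lam + h) - F lam - h * D)).
    by field.
  rewrite normrN normrM normfV mulrC ltr_pdivrMr//.
  apply: le_lt_trans Hh _; rewrite -[h ^+ 2]real_normK ?num_real// mulrA ltr_pM2r//.
  move: h2; rewrite ltr_pdivlMr; last lra.
  nra.
by apply: DeriveDef; [apply/cvg_ex; exists D|exact/cvg_lim].
Unshelve. all: by end_near. Qed.
End BoundaryCondition.

(** * Quadrature of the resolvent identity for the Green function *)

Section Quadrature.
Variable R : realType.
Implicit Types (x y z a b C : R) (f Q : R -> R) (n i j k : nat).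

(* Bounded, with derivative dominating the endpoint singularities of Green functions:
   it serves as a common modulus of bounded variation. *)
Definition bvH x : R := 2 * x `^ (1 / 2) - 2 * (1 - x) `^ (1 / 2).
Definition bvH' x : R := x `^ (- (1 / 2)) + (1 - x) `^ (- (1 / 2)).

Lemma bvHD x : 0 < x < 1 -> der x bvH (bvH' x).
Proof.
move=> /andP[x0 x1]; have y0 : 0 < 1 - x by lra.
have d1 : der x (fun y : R => y `^ (1 / 2)) (1 / 2 * x `^ (1 / 2 - 1) * 1).
  exact: (dv_pow (1 / 2) x0 (dv_id x)).
have d2 : der x (fun y : R => (1 - y) `^ (1 / 2)) (1 / 2 * (1 - x) `^ (1 / 2 - 1) * (0 - 1)).
  exact: (@dv_pow R (fun y => 1 - y) x _ (1 / 2) y0 (dvD (dv_cst 1 x) (dvN (dv_id x)))).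
apply: dv_eq (dvD (dvM (dv_cst 2 x) d1) (dvN (dvM (dv_cst 2 x) d2))) _.
rewrite /bvH'; have -> : 1 / 2 - 1 = - (1 / 2) :> R by field.
lra.
Qed.

Lemma bvH'_ge0 x : 0 <= bvH' x.
Proof. pos. Qed.

Lemma bvH_bound x : 0 < x < 1 -> -2 <= bvH x <= 2.
Proof.
move=> /andP[x0 x1]; rewrite /bvH.
have h1 : x `^ (1 / 2) <= 1 by apply: powR_le1; [rewrite x0 ltW|lra].
have h2 : (1 - x) `^ (1 / 2) <= 1 by apply: powR_le1; lra.
have h3 := powR_ge0 x (1 / 2); have h4 := powR_ge0 (1 - x) (1 / 2).
lra.
Qed.

Definition xg n k : R := k%:R / n.+1%:R.
Definition hg n : R := n.+1%:R^-1.

Lemma hg_gt0 n : 0 < hg n. Proof. pos. Qed.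

Lemma xgS n k : xg n k.+1 = xg n k + hg n.
Proof. by rewrite /xg -natr1 mulrDl mul1r. Qed.

Lemma xg0 n : xg n 0 = 0. Proof. by rewrite /xg mul0r. Qed.

Lemma xg_in n k : (0 < k)%N -> (k <= n)%N -> 0 < xg n k < 1.
Proof.
move=> k0 kn; rewrite divr_gt0 ?ltr0n//= ltr_pdivrMr ?ltr0n// mul1r ltr_nat.
by [].
Qed.

Lemma xg_le n i j : (i <= j)%N -> xg n i <= xg n j.
Proof. by move=> ij; rewrite ler_pM2r ?ltr0n// ler_nat. Qed.

Lemma xg_lt n i j : (i < j)%N -> xg n i < xg n j.
Proof. by move=> ij; rewrite ltr_pM2r ?ltr0n// ltr_nat. Qed.

Lemma bv_le f (f' : R -> R) C a b : 0 < a -> a <= b -> b < 1 ->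
  (forall z, a <= z <= b -> der z f (f' z)) ->
  (forall z, a <= z <= b -> `|f' z| <= C * bvH' z) -> `|f b - f a| <= C * bvH b - C * bvH a.
Proof.
move=> a0 ab b1 df fC; have dH : forall z, a <= z <= b -> der z (fun z => C * bvH z) (C * bvH' z); last first.
  exact: (@dv_le_norm R a b f f' (fun z => C * bvH z) (fun z => C * bvH' z) ab df dH fC).
move=> z /andP[az zb]; have zI : 0 < z < 1 by rewrite (lt_le_trans a0)//= (le_lt_trans zb).
by apply: dv_eq (dvM (dv_cst C z) (bvHD zI)) _; rewrite mul0r add0r.
Qed.

(** The error of the right endpoint rule is the step times the variation of [f] on the cell.
    Variations telescope over the grid, so the total error is of the order of the step although [f']
    may be unbounded. *)
Lemma quad_cell f (f' : R -> R) Q C a b : 0 <= C -> 0 < a -> a <= b -> b < 1 ->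
  (forall z, a <= z <= b -> der z Q (f z)) ->
  (forall z, a <= z <= b -> der z f (f' z)) ->
  (forall z, a <= z <= b -> `|f' z| <= C * bvH' z) ->
  `|Q b - Q a - (b - a) * f b| <= (b - a) * (C * bvH b - C * bvH a).
Proof.
move=> C0 a0 ab b1 dQ df fC; have [c /andP[ac cb] ->] := dv_mvt ab dQ.
have -> : f c * (b - a) - (b - a) * f b = - ((b - a) * (f b - f c)) by ring.
rewrite normrN normrM (ger0_norm (_ : 0 <= b - a)) ?subr_ge0// ler_wpM2l ?subr_ge0//.
have c0 : 0 < c by lra.
apply: (@le_trans _ _ (C * bvH b - C * bvH c)).
  apply: (@bv_le f f') => // z /andP[cz zb]; [apply: df|apply: fC]; lra.
rewrite lerB// ler_wpM2l//; apply: (@dv_le R a c bvH bvH' ac) => z /andP[az zc].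
  by apply: bvHD; rewrite (lt_le_trans a0)//= (le_lt_trans zc)// (le_lt_trans cb).
pos.
Qed.

Section Sums.
Variables (n : nat) (f f' Q : R -> R) (C : R).
Hypothesis C0 : 0 <= C.

Lemma quad_sum i j : (0 < i)%N -> (i <= j)%N -> (j <= n)%N ->
  (forall z, xg n i <= z <= xg n j -> [/\ der z Q (f z), der z f (f' z) &
     `|f' z| <= C * bvH' z]) ->
  `|Q (xg n j) - Q (xg n i) - hg n * \sum_(i <= k < j) f (xg n k.+1)| <=
  hg n * (C * bvH (xg n j) - C * bvH (xg n i)).
Proof.
move=> i0; elim: j => [|j IH]; first by rewrite leqn0 => /eqP ii; rewrite ii in i0.
rewrite leq_eqVlt => /predU1P[<- _ _|].
  by rewrite big_geq// mulr0 !subrr normr0 mulr0.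
rewrite ltnS => ij jn H.
have H1 z : xg n i <= z <= xg n j -> [/\ der z Q (f z), der z f (f' z) &
     `|f' z| <= C * bvH' z].
  by move=> /andP[iz zj]; apply: H; rewrite iz (le_trans zj)// xg_le.
have H2 z : xg n j <= z <= xg n j.+1 -> [/\ der z Q (f z), der z f (f' z) &
     `|f' z| <= C * bvH' z].
  by move=> /andP[jz zj]; apply: H; rewrite (le_trans _ jz)// xg_le.
have h1 := IH ij (ltnW jn) H1.
have /andP[xj0 _] : 0 < xg n j < 1 by apply: xg_in; [exact: leq_trans ij|exact: ltnW].
have /andP[_ xj1] : 0 < xg n j.+1 < 1 by exact: xg_in.
have h2 : `|Q (xg n j.+1) - Q (xg n j) - (xg n j.+1 - xg n j) * f (xg n j.+1)| <=
    (xg n j.+1 - xg n j) * (C * bvH (xg n j.+1) - C * bvH (xg n j)).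
  apply: (@quad_cell f f') => //; first exact: xg_le.
  - by move=> z /H2[].
  - by move=> z /H2[].
  - by move=> z /H2[].
have e : xg n j.+1 - xg n j = hg n by rewrite xgS addrAC subrr add0r.
rewrite e in h2; rewrite big_nat_recr//=.
have -> : Q (xg n j.+1) - Q (xg n i) - hg n * (\sum_(i <= k < j) f (xg n k.+1) + f (xg n j.+1)) =
  (Q (xg n j) - Q (xg n i) - hg n * \sum_(i <= k < j) f (xg n k.+1)) +
  (Q (xg n j.+1) - Q (xg n j) - hg n * f (xg n j.+1)) by ring.
tri; apply: le_trans (lerD h1 h2) _.
lra.
Qed.

Lemma quad_left j (A0 : R) : (0 < j)%N -> (j <= n)%N -> Q x @[x --> 0^'+] --> A0 ->
  (forall z, 0 < z <= xg n j -> [/\ der z Q (f z), der z f (f' z) &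
     `|f' z| <= C * bvH' z]) ->
  `|Q (xg n j) - A0 - hg n * \sum_(0 <= k < j) f (xg n k.+1)| <= hg n * (4 * C).
Proof.
move=> j0 jn QQ0 H; have n0 : (0 < n)%N by exact: leq_trans jn.
have /andP[x10 x11] := xg_in (ltn0Sn 0) n0.
(* The first cell reaches the singular endpoint; its estimate is the limit of those on
   [[a, xg n 1]], with [- bvH a] replaced by its bound [2]. *)
have h1 : `|Q (xg n 1) - A0 - hg n * f (xg n 1)| <= hg n * (C * bvH (xg n 1) + 2 * C).
  have L : `|Q (xg n 1) - Q a - (xg n 1 - a) * f (xg n 1)| @[a --> 0^'+] -->
      `|Q (xg n 1) - A0 - (xg n 1 - 0) * f (xg n 1)|.
    apply: cvg_norm; apply: cvgB; first by apply: cvgB => //; exact: cvg_cst.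
    apply: cvgMl; apply: cvgB; first exact: cvg_cst.
    by apply: cvg_at_right_filter.
  rewrite subr0 [X in X * f _]xgS xg0 add0r in L.
  move: L => /cvgr_to_le; apply; near=> a.
  have a0 : 0 < a by [].
  have a1 : a <= xg n 1 by near: a; exact: nbhs_right_le.
  have sub z : a <= z <= xg n 1 -> 0 < z <= xg n j.
    by move=> /andP[az z1]; rewrite (lt_le_trans a0)//= (le_trans z1)// xg_le.
  have aI : 0 < a < 1 by rewrite a0/=; by [].
  apply: le_trans (@quad_cell f f' Q C a (xg n 1) C0 a0 a1 x11 _ _ _) _.
  - by move=> z /sub /H[].
  - by move=> z /sub /H[].
  - by move=> z /sub /H[].
  have /andP[b1 _] := bvH_bound aI.
  have /andP[b2 _] := bvH_bound (xg_in (ltn0Sn 0) n0).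
  apply: ler_pM.
  - by rewrite subr_ge0.
  - rewrite subr_ge0 ler_wpM2l//; apply: (@dv_le R a (xg n 1) bvH bvH' a1) => z /andP[az z1].
      by apply: bvHD; rewrite (lt_le_trans a0)//= (le_lt_trans z1).
    exact: bvH'_ge0.
  - by rewrite xgS xg0 add0r lerBlDr lerDl.
  - by have := ler_wpM2l C0 b1; lra.
have h2 : `|Q (xg n j) - Q (xg n 1) - hg n * \sum_(1 <= k < j) f (xg n k.+1)| <=
  hg n * (C * bvH (xg n j) - C * bvH (xg n 1)).
  apply: quad_sum => // z /andP[z1 zj]; apply: H; rewrite zj andbT.
  lra.
rewrite big_ltn//.
have -> : Q (xg n j) - A0 - hg n * (f (xg n 1) + \sum_(1 <= k < j) f (xg n k.+1)) =
 (Q (xg n 1) - A0 - hg n * f (xg n 1)) +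
 (Q (xg n j) - Q (xg n 1) - hg n * \sum_(1 <= k < j) f (xg n k.+1)) by ring.
tri; apply: le_trans (lerD h1 h2) _.
have /andP[_ b3] := bvH_bound (xg_in j0 jn).
rewrite -mulrDr ler_wpM2l ?(ltW (hg_gt0 n))//.
by have := ler_wpM2l C0 b3; lra.
Unshelve. all: by end_near. Qed.

Lemma quad_right j (A1 : R) : (0 < j)%N -> (j <= n)%N -> Q (1 - x) @[x --> 0^'+] --> A1 ->
  (forall z, xg n j <= z < 1 -> [/\ der z Q (f z), der z f (f' z) &
     `|f' z| <= C * bvH' z]) -> (forall z, xg n j <= z < 1 -> `|f z| <= C) ->
  `|A1 - Q (xg n j) - hg n * \sum_(j <= k < n) f (xg n k.+1)| <= hg n * (5 * C).
Proof.
move=> j0 jn QQ1 H fC; have n0 : (0 < n)%N by exact: leq_trans jn.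
have /andP[xn0 xn1] := xg_in n0 (leqnn n).
have hn : 1 - xg n n = hg n.
  by rewrite /hg -[X in X - _](divff (_ : n.+1%:R != 0 :> R)) ?pnatr_eq0// -mulrBl -natr1 addrAC subrr add0r mul1r.
(* The last node of the sum is [xg n n], so the cell ending at [1] is simply dropped, at the cost of
   one step times the supremum of [f]. *)
have h1 : `|A1 - Q (xg n n)| <= hg n * C.
  have L : `|Q (1 - a) - Q (xg n n)| @[a --> 0^'+] --> `|A1 - Q (xg n n)|.
    by apply: cvg_norm; apply: cvgB => //; exact: cvg_cst.
  move: L => /cvgr_to_le; apply; near=> a.
  have a0 : 0 < a by [].
  have a1 : a <= hg n by near: a; apply: nbhs_right_le; lra.
  have sub z : xg n n <= z <= 1 - a -> xg n j <= z < 1.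
    move=> /andP[nz za]; apply/andP; split; last by lra.
    by apply: le_trans nz; exact: xg_le.
  have na : xg n n <= 1 - a by lra.
  have [|c cI ->] := @dv_mvt R (xg n n) (1 - a) Q f na.
    by move=> z /sub /H[].
  rewrite normrM mulrC; apply: ler_pM => //; last exact: fC (sub _ cI).
  by rewrite ger0_norm; lra.
have h2 : `|Q (xg n n) - Q (xg n j) - hg n * \sum_(j <= k < n) f (xg n k.+1)| <=
  hg n * (C * bvH (xg n n) - C * bvH (xg n j)).
  apply: quad_sum => // z /andP[z1 zj]; apply: H; rewrite z1/=.
  lra.
have -> : A1 - Q (xg n j) - hg n * \sum_(j <= k < n) f (xg n k.+1) =
 (A1 - Q (xg n n)) + (Q (xg n n) - Q (xg n j) - hg n * \sum_(j <= k < n) f (xg n k.+1)) by ring.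
tri; apply: le_trans (lerD h1 h2) _.
have /andP[_ b3] := bvH_bound (xg_in n0 (leqnn n)).
have /andP[b4 _] := bvH_bound (xg_in j0 jn).
rewrite -mulrDr ler_wpM2l ?(ltW (hg_gt0 n))//.
by have := ler_wpM2l C0 b3; have := ler_wpM2l C0 b4; lra.
Unshelve. all: by end_near. Qed.

End Sums.
End Quadrature.

(** * Spectral decomposition of real symmetric matrices *)

Section RealSpectral.
Variable R : realType.
Import complex.
Local Notation C := (R[i]).
Implicit Types (n : nat).

Lemma Re_sum (I : Type) (r : seq I) (P : pred I) (F : I -> C) :
  Re (\sum_(i <- r | P i) F i) = \sum_(i <- r | P i) Re (F i).
Proof. by elim/big_rec2: _ => // i y1 y2 _ <-; case: (F i) y2 => ? ? []. Qed.

Lemma Im_sum (I : Type) (r : seq I) (P : pred I) (F : I -> C) :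
  Im (\sum_(i <- r | P i) F i) = \sum_(i <- r | P i) Im (F i).
Proof. by elim/big_rec2: _ => // i y1 y2 _ <-; case: (F i) y2 => ? ? []. Qed.

Lemma Re_mulr_real (z : C) (x : R) : Re (z * Complex x 0) = Re z * x.
Proof. by case: z => a b /=; rewrite mulr0 subr0. Qed.

Lemma Im_mulr_real (z : C) (x : R) : Im (z * Complex x 0) = Im z * x.
Proof. by case: z => a b /=; rewrite mulr0 add0r. Qed.

Lemma Re_mull_real (z : C) (x : R) : Re (Complex x 0 * z) = x * Re z.
Proof. by rewrite mulrC Re_mulr_real mulrC. Qed.

Lemma Im_mull_real (z : C) (x : R) : Im (Complex x 0 * z) = x * Im z.
Proof. by rewrite mulrC Im_mulr_real mulrC. Qed.

Lemma Re_mul_conj (z w : C) : Re (z * w^*)%R =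
  Re z * Re w + Im z * Im w.
Proof. by case: z w => a b [c d]; rewrite /= mulrN opprK. Qed.

(** The matrices [a] and [b] are the real and imaginary parts of a unitary diagonalization. Keeping
    both, with the weights [a_i a_j + b_i b_j], gives the diagonal entries in an eigenbasis without
    choosing a real one. *)
Lemma sym_diag n (A : 'M[R]_n) : A^T = A -> exists th (a b : 'M[R]_n),
  [/\ forall k j, \sum_i a k i * A i j = th k * a k j,
      forall k j, \sum_i b k i * A i j = th k * b k j,
      forall k, \sum_i (a k i * a k i + b k i * b k i) = 1 &
      forall i j, \sum_k (a k i * a k j + b k i * b k j) = (i == j)%:R].
Proof.
move=> At; pose Ac : 'M[C]_n := map_mx (fun x : R => Complex x 0) A.
have Ar : Ac \is a mxOver Num.real.
  by apply/mxOverP => i j; rewrite mxE; apply/complex_realP; exists (A i j).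
have As : Ac \is hermsymmx.
  apply: realsym_hermsym => //; apply/is_hermitianmxP.
  rewrite scale1r; apply/matrixP => i j; rewrite !mxE.
  by rewrite -[in LHS]At mxE.
set P := spectralmx Ac; set D := spectral_diag Ac.
have Dr : D \is a mxOver Num.real := hermitian_spectral_diag_real As.
have /orthomx_spectralP E := hermitian_normalmx As.
have PU : P \is unitarymx := spectral_unitarymx Ac.
have PA : P *m Ac = diag_mx D *m P.
  by rewrite [X in P *m X = _]E -/P !mulmxA mulmxV ?mul1mx// unitarymx_unit.
have U1 : P *m (P^T ^ (@Num.conj C))%sesqui = 1%:M by apply/unitarymxP.
have U2 : (P^T ^ (@Num.conj C))%sesqui *m P = 1%:M.
  by rewrite -invmx_unitary// mulVmx// unitarymx_unit.
have DE k : D 0 k = Complex (Re (D 0 k)) 0.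
  by have /mxOverP/(_ 0 k) := Dr; move/RRe_real => {1}<-.
have row k j : \sum_i P k i * Complex (A i j) 0 = D 0 k * P k j.
  have /matrixP/(_ k j) := PA; rewrite mul_diag_mx !mxE => <-.
  by apply: eq_bigr => i _; rewrite mxE.
exists (fun k => Re (D 0 k)), (\matrix_(k, i) Re (P k i)), (\matrix_(k, i) Im (P k i)).
split.
- move=> k j; have /(congr1 (@Re R)) := row k j.
  rewrite Re_sum DE Re_mull_real mxE /= => <-.
  by apply: eq_bigr => i _; rewrite mxE Re_mulr_real.
- move=> k j; have /(congr1 (@Im R)) := row k j.
  rewrite Im_sum DE Im_mull_real mxE /= => <-.
  by apply: eq_bigr => i _; rewrite mxE Im_mulr_real.
- move=> k; have /matrixP/(_ k k) := U1; rewrite !mxE eqxx => /(congr1 (@Re R)).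
  rewrite Re_sum /= => <-; apply: eq_bigr => i _; rewrite !mxE.
  by rewrite -[X in X = _]Re_mul_conj.
- move=> i j; have /matrixP/(_ j i) := U2; rewrite !mxE => /(congr1 (@Re R)).
  rewrite Re_sum => H; transitivity (Re ((j == i)%:R : C)); last by rewrite eq_sym; case: (i == j).
  rewrite -H; apply: eq_bigr => k _; rewrite !mxE.
  by rewrite [in RHS]mulrC; exact/esym/Re_mul_conj.
Qed.

(* [d k] is the diagonal entry number [k] in an orthonormal eigenbasis of [A]. *)
Lemma psd_spectral n (A : 'M[R]_n) : A^T = A -> (forall v : 'I_n -> R, 0 <= \sum_i \sum_j v i * A i j * v j) ->
  exists (th : nat -> R) (d : nat -> 'M[R]_n -> R),
  [/\ forall k, 0 <= th k, forall i j : nat, (i <= j)%N -> th j <= th i,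
      forall k : nat, (n <= k)%N -> th k = 0,
      forall k (B E F : 'M[R]_n) t, (k < n)%N -> (1%:M - t *: A) *m B = E + F ->
        (1 - t * th k) * d k B = d k E + d k F &
      (forall k, (k < n)%N -> d k A = th k) /\
      (forall B, \tr B = \sum_(0 <= k < n) d k B) /\
      forall (k : nat) (B : 'M[R]_n) (M : R), (k < n)%N -> (forall i j, `|B i j| <= M) -> `|d k B| <= n%:R * M].
Proof.
move=> At Ap; have [th [a [b [aA bA n1 n2]]]] := sym_diag At.
pose dd (k : 'I_n) (B : 'M[R]_n) := \sum_i \sum_j B i j * (a k i * a k j + b k i * b k j).
have ddD k B E : dd k (B + E) = dd k B + dd k E.
  by rewrite -big_split; apply: eq_bigr => i _; rewrite -big_split; apply: eq_bigr => j _; rewrite mxE mulrDl.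
have ddZ k t B : dd k (t *: B) = t * dd k B.
  by rewrite mulr_sumr; apply: eq_bigr => i _; rewrite mulr_sumr; apply: eq_bigr => j _; rewrite mxE mulrA.
have ddN k B : dd k (- B) = - dd k B by rewrite -scaleN1r ddZ mulN1r.
have dd1 k : dd k 1%:M = 1.
  rewrite -[RHS](n1 k); apply: eq_bigr => i _; rewrite (bigD1 i)//= mxE eqxx mul1r big1 ?addr0// => j ji.
  by rewrite mxE eq_sym (negbTE ji) mul0r.
have ddA k B : dd k (A *m B) = th k * dd k B.
  have -> : dd k (A *m B) = \sum_l \sum_j B l j * ((\sum_i a k i * A i l) * a k j + (\sum_i b k i * A i l) * b k j).
    transitivity (\sum_i \sum_l \sum_j A i l * B l j * (a k i * a k j + b k i * b k j)).
      apply: eq_bigr => i _; rewrite exchange_big; apply: eq_bigr => j _.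
      by rewrite mxE mulr_suml.
    rewrite exchange_big; apply: eq_bigr => l _; rewrite exchange_big; apply: eq_bigr => j _.
    rewrite !mulr_suml -big_split mulr_sumr; apply: eq_bigr => i _ /=; ring.
  rewrite mulr_sumr; apply: eq_bigr => i _; rewrite mulr_sumr; apply: eq_bigr => j _.
  by rewrite aA bA; ring.
have ddth k : dd k A = th k by rewrite -[A in LHS]mulmx1 ddA dd1 mulr1.
have th0 k : 0 <= th k.
  rewrite -ddth; have -> : dd k A = \sum_i \sum_j a k i * A i j * a k j + \sum_i \sum_j b k i * A i j * b k j.
    rewrite -big_split; apply: eq_bigr => i _; rewrite -big_split; apply: eq_bigr => j _ /=; ring.
  pos.
have dtr B : \tr B = \sum_k dd k B.
  rewrite exchange_big; apply: eq_bigr => i _; rewrite exchange_big (bigD1 i)//= -mulr_sumr n2 eqxx mulr1.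
  by rewrite big1 ?addr0// => j ji; rewrite -mulr_sumr n2 eq_sym (negbTE ji) mulr0.
have dbd k (B : 'M[R]_n) (M : R) : (forall i j, `|B i j| <= M) -> `|dd k B| <= n%:R * M.
  move=> BM; pose p i := a k i * a k i + b k i * b k i.
  apply: le_trans (ler_norm_sum _ _ _) _.
  (* The weight [a_i a_j + b_i b_j] is at most [(p_i + p_j) / 2] in absolute value, and these
     averages add up to [n] because the [p_i] add up to [1]. *)
  have -> : n%:R * M = \sum_(i < n) \sum_(j < n) M * ((p i + p j) / 2).
    transitivity (\sum_(i < n) M * ((n%:R * p i + 1) / 2)); last first.
      apply: eq_bigr => i _; rewrite -mulr_sumr -mulr_suml big_split/= n1 sumr_const card_ord -mulr_natl; lra.
    rewrite -mulr_sumr -mulr_suml big_split/= -mulr_sumr n1 sumr_const card_ord; lra.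
  apply: ler_sum => i _.
  apply: (le_trans (ler_norm_sum _ _ _)).
  apply: ler_sum => j _.
  rewrite normrM; apply: ler_pM => //; rewrite ler_norml /p.
  have [s1 s2] := (sqr_ge0 (a k i + a k j), sqr_ge0 (a k i - a k j)).
  have [s3 s4] := (sqr_ge0 (b k i + b k j), sqr_ge0 (b k i - b k j)).
  move: s1 s2 s3 s4; lra.
case: n A At Ap th a b aA bA n1 n2 dd ddD ddZ ddN dd1 ddA ddth th0 dtr dbd => [|n] A At Ap th a b aA bA n1 n2 dd ddD ddZ ddN dd1 ddA ddth th0 dtr dbd.
  exists (fun=> 0), (fun _ _ => 0); split => //; split; split => // B.
  by rewrite big_geq// /mxtrace big_ord0.
(* Decreasing order makes the eigenvalue of rank [k] comparable between matrices of different sizes;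
   ranks beyond the size get the value [0]. *)
pose s := sort (fun i j => th j <= th i) (enum 'I_n.+1).
have sz : size s = n.+1 by rewrite size_sort size_enum_ord.
have ssort : sorted (fun i j => th j <= th i) s by apply: sort_sorted => i j; lra.
have tr : transitive (fun i j => th j <= th i) by move=> y x z /= h1 h2; lra.
exists (fun k => if (k < n.+1)%N then th (nth ord0 s k) else 0), (fun k => dd (nth ord0 s k)); split.
- by move=> k; case: ifP.
- move=> i j ij; case: ifP => [jn|_]; last by case: ifP.
  rewrite (leq_ltn_trans ij jn).
  have rf : reflexive (fun i j => th j <= th i) by [].
  by apply: (sorted_leq_nth tr rf ord0 ssort) => //; rewrite inE sz// (leq_ltn_trans ij).
- by move=> k; rewrite leqNgt => /negbTE ->.
- move=> k B E F t kn EF; rewrite kn -ddD -EF mulmxBl mul1mx ddD ddN -scalemxAl ddZ ddA; ring.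
split; [by move=> k ->|split; last by move=> k B M _; exact: dbd].
move=> B; rewrite dtr -big_enum (perm_big s) /=; last by rewrite perm_sym perm_sort.
by rewrite (big_nth ord0) sz.
Qed.

End RealSpectral.

(** * Ultrafilter limits, positivity and traces of finite matrices *)

Section UltraLimits.
Variable R : realType.

Lemma ultra_cvg (U : set_system nat) (f : nat -> R) C : UltraFilter U ->
  (forall n, 0 <= f n <= C) -> exists l : R, f n @[n --> U] --> l.
Proof.
move=> UU fC; have PU : ProperFilter U by exact: ultra_proper.
have [|p [_ cp]] := @segment_compact R 0 C (f @ U) _.
  by apply: (@filterE _ U) => n; rewrite /= in_itv/=.
exists p => V Vp; have [//|UV] := @in_ultra_setVsetC _ U (f @^-1` V) UU.
have [x [nVx Vx]] := cp (~` V) V UV Vp.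
by [].
Qed.

(** A kernel [r (min i j)] with [r] nondecreasing is a sum of squares weighted by the increments of
    [r]: subtracting [r 0] splits off one square and leaves the same kind of kernel of smaller
    size. *)
Lemma min_psd n (r w : nat -> R) : (forall i, (i < n)%N -> 0 <= r i) ->
  (forall i j, (i <= j)%N -> (j < n)%N -> r i <= r j) ->
  0 <= \sum_(i < n) \sum_(j < n) w i * w j * r (minn i j).
Proof.
elim: n r w => [|n IH] r w r0 rm; first by rewrite big_ord0.
have -> : \sum_(i < n.+1) \sum_(j < n.+1) w i * w j * r (minn i j) =
  r 0 * (\sum_(i < n.+1) w i) ^+ 2 +
  \sum_(i < n) \sum_(j < n) w i.+1 * w j.+1 * (r (minn i j).+1 - r 0).
  have -> : r 0 * (\sum_(i < n.+1) w i) ^+ 2 = \sum_(i < n.+1) \sum_(j < n.+1) w i * w j * r 0.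
    rewrite expr2 mulr_suml mulr_sumr; apply: eq_bigr => i _.
    by rewrite !mulr_sumr; apply: eq_bigr => j _; ring.
  have -> : \sum_(i < n) \sum_(j < n) w i.+1 * w j.+1 * (r (minn i j).+1 - r 0) =
    \sum_(i < n.+1) \sum_(j < n.+1) w i * w j * (r (minn i j) - r 0).
    rewrite [RHS]big_ord_recl [X in _ = X + _]big1 ?add0r => [|j _]; last by rewrite min0n subrr mulr0.
    apply: eq_bigr => i _; rewrite [RHS]big_ord_recl subrr mulr0 add0r.
    by apply: eq_bigr => j _; rewrite minnSS.
  rewrite -big_split; apply: eq_bigr => i _; rewrite -big_split; apply: eq_bigr => j _ /=.
  lra.
rewrite addr_ge0//; first by rewrite mulr_ge0 ?sqr_ge0 ?r0.
apply: (IH (fun i => r i.+1 - r 0) (fun i => w i.+1)) => [i i_n|i j ij jn].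
  by rewrite subr_ge0 rm.
by rewrite lerB// rm.
Qed.

(** Here [b k = (th k + e k) / (1 - t th k)], and [b k - th k - e k] equals
    [t th k^2 / (1 - t th k)] plus a term proportional to [e k]. For [k >= K] the denominators are
    at least [1/2], so the tail is at most [2 |t| th K] times the sum of the [th k]. *)
Lemma finite_trace N (th b e : nat -> R) (t S D hh : R) K (eps : R) :
  (forall k, 0 <= th k) -> (forall i j : nat, (i <= j)%N -> th j <= th i) -> 0 <= D * hh ->
  (forall k, (k < N)%N -> (1 - t * th k) * b k = th k + e k) ->
  (forall k, (k < N)%N -> `|e k| <= D * hh) -> \sum_(0 <= k < N) th k <= S ->
  (K <= N)%N -> 0 < eps -> `|t * th K| <= 1 / 2 -> (forall k, (k < K)%N -> eps <= `|1 - t * th k|) ->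
  `|\sum_(0 <= k < N) b k - \sum_(0 <= k < N) th k - \sum_(0 <= k < N) e k -
     \sum_(0 <= k < K) t * th k ^+ 2 / (1 - t * th k)| <=
   2 * `|t| * th K * S + `|t| * S * (D * hh) * (eps^-1 + 2).
Proof.
move=> th0 thm Dh bE eE thS KN eps0 tK ke.
have den2 k : (K <= k)%N -> 1 / 2 <= `|1 - t * th k|.
  move=> Kk; have : `|t * th k| <= 1 / 2.
    by apply: le_trans tK; rewrite !normrM !(ger0_norm (th0 _)) ler_wpM2l// thm.
  by rewrite ler_norml => /andP[a1 a2]; apply: le_trans (ler_norm _); lra.
have iv2 k : (K <= k)%N -> `|1 - t * th k|^-1 <= 2.
  move=> Kk; rewrite -[leRHS]invrK lef_pV2 ?posrE ?invr_gt0//; last by apply: lt_le_trans (den2 k Kk).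
  by apply: le_trans (den2 k Kk); lra.
have den k : 1 - t * th k != 0 /\ `|1 - t * th k|^-1 <= eps^-1 + 2.
  have e1 : 0 < eps^-1 by pos.
  have [kK|Kk] := ltnP k K.
    have dk := lt_le_trans eps0 (ke k kK); split; first by rewrite -normr_gt0.
    have : `|1 - t * th k|^-1 <= eps^-1 by rewrite lef_pV2 ?posrE// ke.
    lra.
  split; first by rewrite -normr_gt0; apply: lt_le_trans (den2 k Kk).
  by have := iv2 k Kk; lra.
have -> : \sum_(0 <= k < N) b k - \sum_(0 <= k < N) th k - \sum_(0 <= k < N) e k -
     \sum_(0 <= k < K) t * th k ^+ 2 / (1 - t * th k) =
   \sum_(0 <= k < N) t * th k * e k / (1 - t * th k) + \sum_(K <= k < N) t * th k ^+ 2 / (1 - t * th k).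
  rewrite -!sumrB (eq_big_nat _ _ (F2 := fun k => t * th k * e k / (1 - t * th k) + t * th k ^+ 2 / (1 - t * th k))).
    by rewrite big_split (@big_cat_nat _ _ _ K 0 N (fun=> true) (fun k => t * th k ^+ 2 / (1 - t * th k)))//=; ring.
  move=> k /andP[_ kN]; have [dk _] := den k.
  have -> : b k = (th k + e k) / (1 - t * th k) by rewrite -(bE k kN) mulrC mulKf.
  by field.
have thsum a : 0 <= a -> \sum_(0 <= k < N) a * th k <= a * S.
  by move=> a0; rewrite -mulr_sumr ler_wpM2l.
have c0 : 0 <= `|t| * (D * hh) * (eps^-1 + 2).
  pos.
rewrite [leRHS]addrC; tri; apply: lerD.
  apply: le_trans (ler_norm_sum _ _ _) _.
  have -> : `|t| * S * (D * hh) * (eps^-1 + 2) = `|t| * (D * hh) * (eps^-1 + 2) * S by ring.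
  apply: le_trans (thsum _ c0); rewrite [leLHS]big_nat [leRHS]big_nat; apply: ler_sum => k /andP[_ kN].
  rewrite !normrM normfV (ger0_norm (th0 k)).
  have -> : `|t| * (D * hh) * (eps^-1 + 2) * th k = `|t| * th k * (D * hh) * (eps^-1 + 2) by ring.
  have [_ dk] := den k; have tk : 0 <= `|t| * th k by rewrite mulr_ge0.
  apply: ler_pM; [by rewrite mulr_ge0|by rewrite invr_ge0| |exact: dk].
  by apply: ler_wpM2l => //; exact: eE.
apply: le_trans (ler_norm_sum _ _ _) _.
have c1 : 0 <= 2 * `|t| * th K by pos.
apply: le_trans (thsum _ c1); rewrite [leRHS](@big_cat_nat _ _ _ K)//=.
apply: (@le_trans _ _ (\sum_(K <= k < N) 2 * `|t| * th K * th k)); last first.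
  by rewrite lerDr; apply: sumr_ge0 => k _; rewrite !mulr_ge0.
rewrite [leLHS]big_nat [leRHS]big_nat; apply: ler_sum => k /andP[Kk kN].
rewrite !normrM normfV !(ger0_norm (th0 k)).
have -> : 2 * `|t| * th K * th k = `|t| * (th K * th k) * 2 by ring.
apply: ler_pM; [by rewrite mulr_ge0// mulr_ge0|by rewrite invr_ge0| |exact: iv2].
by rewrite ler_wpM2l// ler_wpM2r// thm.
Qed.

End UltraLimits.

(** * Infinite product from a formula for the logarithmic derivative *)

Section ProductFormula.
Variable R : realType.
Implicit Types (f W : R -> R) (a b c x y lam : R).

Definition slope f a D x : R := if x == a then D else (f x - f a) / (x - a).

Lemma slopeE f a D x : x != a -> slope f a D x = (f x - f a) / (x - a).
Proof. by rewrite /slope => /negbTE ->. Qed.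

Lemma slope_at f a D : slope f a D a = D.
Proof. by rewrite /slope eqxx. Qed.

Lemma cont_for f a l : f a = l -> f x @[x --> a] --> l -> {for a, continuous f}.
Proof. by move=> <-. Qed.

Lemma slope_cvg f a D : der a f D -> slope f a D x @[x --> a] --> D.
Proof.
move=> [df dE]; have H : h^-1 *: (f (h *: 1 + a) - f a) @[h --> 0^'] --> D.
  by rewrite -dE.
apply/cvgrPdist_le => e e0.
move/cvgrPdist_le: H => /(_ e e0) [d /= d0 Hd]; exists d => // x /= xd.
rewrite /slope; case: eqVneq => [_|xa]; first by rewrite subrr normr0 ltW.
have := Hd (x - a); rewrite /ball_/= sub0r normrN distrC => /(_ xd).
rewrite subr_eq0 => /(_ xa); rewrite /GRing.scale/= mulr1 subrK.
by rewrite mulrC.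
Qed.

Lemma lipschitz_off (s : seq R) f c a b : a <= b ->
  (forall x, a <= x <= b -> {for x, continuous f}) ->
  (forall x, a < x < b -> x \notin s -> exists2 D, der x f D & `|D| <= c) ->
  `|f b - f a| <= c * (b - a).
Proof.
elim: s a b => [|z s IH] a b ab cf df.
  have [ab'|ba] := ltP a b; last first.
    have -> : b = a by apply: le_anti; rewrite ba.
    by rewrite !subrr normr0 mulr0.
  have df' : forall x, x \in `]a, b[%R -> der x f (f^`() x).
    move=> x; rewrite in_itv/= => xab; have [//|D dD _] := df x xab _.
    by apply: derive1_dv.
  have [|z zab ->] := @MVT R f f^`() a b ab' df'.
    by apply: continuous_subspace_itv => x; exact: cf.
  have zI : a < z < b by [].
  have [//|D dD Dc] := df z zI _.
  have [_ ->] := dv_derive1 dD.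
  by rewrite normrM (ger0_norm (_ : 0 <= b - a)) ?subr_ge0// ler_wpM2r ?subr_ge0.
have [zab|zab] := boolP (a < z < b); last first.
  apply: IH => // x xab xs; apply: df => //; rewrite negb_or xs andbT.
  lra.
have /andP[az zb] := zab.
have h1 : `|f z - f a| <= c * (z - a).
  apply: IH => [|x /andP[ax xz]|x /andP[ax xz] xs]; first exact: ltW.
    by apply: cf; rewrite ax (le_trans xz)// ltW.
  by apply: df; rewrite ?ax ?(lt_trans xz)// inE (lt_eqF xz).
have h2 : `|f b - f z| <= c * (b - z).
  apply: IH => [|x /andP[ax xz]|x /andP[ax xz] xs]; first exact: ltW.
    by apply: cf; rewrite (le_trans _ ax)// ltW.
  by apply: df; rewrite ?(lt_trans az)// inE (gt_eqF ax).
have -> : f b - f a = (f b - f z) + (f z - f a) by ring.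
tri; apply: le_trans (lerD h2 h1) _.
lra.
Qed.

(** On an interval with [c (b - a) <= 1/2] the maximum of [|f|] is at most twice any value, which
    turns the Lipschitz bound into a relative one. The finite set [s] is there for the zeros of [W],
    at which only continuity will be known. *)
Lemma gronwall_off (s : seq R) f c a b : 0 <= c -> a <= b -> c * (b - a) <= 1 / 2 ->
  (forall x, a <= x <= b -> {for x, continuous f}) ->
  (forall x, a < x < b -> x \notin s -> exists2 D, der x f D & `|D| <= c * `|f x|) ->
  forall x y, a <= x <= b -> a <= y <= b -> `|f x - f y| <= 2 * (c * (b - a)) * `|f y|.
Proof.
move=> c0 ab cab cf df; have [|m mab Hm] := @EVT_max R (fun x => `|f x|) a b ab.
  by apply: continuous_subspace_itv => x; rewrite in_itv => xab; apply: cvg_norm; exact: cf.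
have M x : a <= x <= b -> `|f x| <= `|f m| by move=> xab; apply: Hm.
have L x y : a <= x <= b -> a <= y <= b -> `|f x - f y| <= c * (b - a) * `|f m|.
  wlog yx : x y / y <= x => [H xab yab|xab yab].
    by have [yx|/ltW xy] := leP y x; [|rewrite distrC]; exact: H.
  have /andP[ax xb] := xab; have /andP[ay yb] := yab.
  apply: le_trans (_ : c * `|f m| * (x - y) <= _); last first.
    by rewrite mulrAC ler_wpM2r// ler_wpM2l// lerB.
  apply: (@lipschitz_off s) => // z /andP[z1 z2].
    by apply: cf; rewrite (le_trans ay)//= (le_trans z2).
  move=> zs; have zab : a < z < b by rewrite (le_lt_trans ay)//= (lt_le_trans z2).
  have [D dD Dc] := df z zab zs; exists D => //; apply: le_trans Dc _.
  by rewrite ler_wpM2l// M//; case/andP: zab => /ltW -> /ltW ->.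
move=> x y xab yab; apply: le_trans (L x y xab yab) _.
have mI : a <= m <= b by [].
have h := L m y mI yab.
have m2 : `|f m| <= 2 * `|f y|.
  have h2 : `|f m| <= `|f m - f y| + `|f y|.
    by rewrite -[X in `|X| <= _](subrK (f y)); exact: ler_normD.
  have := ler_wpM2r (normr_ge0 (f m)) cab; move: h2 h; glra.
rewrite mulrAC [2 * _]mulrC -mulrA [leRHS]mulrC -mulrA.
have cab0 : 0 <= c * (b - a) by nra.
nra.
Qed.

Section Abstract.
Variables (W : R -> R) (lb : R) (th : nat -> R) (Ts S : R).
Hypothesis Wneg : forall lam, lam <= lb -> 0 < W lam.
Hypothesis th0 : forall k, 0 <= th k.
Hypothesis thm : forall i j, (i <= j)%N -> th j <= th i.
Hypothesis thT : forall K, \sum_(0 <= k < K) th k <= Ts.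
Hypothesis thS : forall K, th K * K.+1%:R <= S.
Hypothesis S0 : 0 <= S.
Hypothesis Wsimple : forall lam, W lam = 0 -> exists2 D, D != 0 & der lam W D.
Hypothesis Wtrace : forall lam, W lam != 0 -> (forall k, (lam - lb) * th k != 1) /\
   exists2 T, der lam W (- (T * W lam)) & forall K, `|(lam - lb) * th K| <= 1 / 3 ->
    `|T - Ts - \sum_(0 <= k < K) (lam - lb) * th k ^+ 2 / (1 - (lam - lb) * th k)| <= 2 * `|lam - lb| * th K * S.
(** Excludes a factor [exp (- g lam)] in the product for [W], which is the trace possibly lost in
    passing from matrices to their limit. *)
Hypothesis Wgrowth : forall g, 0 < g -> exists2 lam, lam <= lb & W lam < W lb * expR (g * (lb - lam)).

Definition Qp K lam : R := \prod_(0 <= k < K) (1 - (lam - lb) * th k).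

Lemma th_small e : 0 < e -> exists K, forall k, (K <= k)%N -> th k <= e.
Proof.
move=> e0; exists (Num.truncn (S / e)) => k Kk.
have := thS k; rewrite -ler_pdivlMr// => h; apply: le_trans h _.
rewrite ler_pdivrMr// mulrC -ler_pdivrMr//.
apply: ltW; apply: lt_le_trans (truncnS_gt _) _; by rewrite ler_nat.
Qed.

Lemma Qp_factor_dv k lam : der lam (fun l => 1 - (l - lb) * th k) (- th k).
Proof. by dvt; ring. Qed.

Lemma Qp_dv K lam : (forall k, (k < K)%N -> (lam - lb) * th k != 1) ->
  der lam (Qp K) (- (\sum_(0 <= k < K) th k / (1 - (lam - lb) * th k)) * Qp K lam) /\ Qp K lam != 0.
Proof.
elim: K => [|K IH] ne.
  split; last by rewrite /Qp big_geq.
  rewrite big_geq// oppr0 mul0r; have -> : Qp 0 = fun=> 1 by apply/funext => l; rewrite /Qp big_geq.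
  exact: dv_cst.
have [|dK nK] := IH; first by move=> k kK; apply: ne; exact: leqW.
have -> : Qp K.+1 = fun l => Qp K l * (1 - (l - lb) * th K).
  by apply/funext => l; rewrite /Qp big_nat_recr.
have nz : 1 - (lam - lb) * th K != 0 by rewrite subr_eq0 eq_sym ne.
split; last by rewrite mulf_neq0.
apply: dv_eq (dvM dK (Qp_factor_dv K lam)) _.
rewrite big_nat_recr//=; move: (\sum_(0 <= k < K) _) (Qp K lam) nz => s r nz.
by field.
Qed.

Lemma Qp_cont K lam : {for lam, continuous (Qp K)}.
Proof.
elim: K => [|K IH].
  by have -> : Qp 0 = fun=> 1; [apply/funext => l; rewrite /Qp big_geq|exact: cvg_cst].
have -> : Qp K.+1 = fun l => Qp K l * (1 - (l - lb) * th K).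
  by apply/funext => l; rewrite /Qp big_nat_recr.
by apply: cvgM => //; exact: dv_cont (Qp_factor_dv K lam).
Qed.

Let quot K lam := W lam / Qp K lam.
Let rate K L := Ts - \sum_(0 <= k < K) th k + 2 * L * th K * S.

Lemma rate_ge0 K L : 0 <= L -> 0 <= rate K L.
Proof. by move=> L0; rewrite addr_ge0 ?subr_ge0// !mulr_ge0. Qed.

Lemma quot_dv K L lam : W lam != 0 -> `|lam - lb| <= L -> L * th K <= 1 / 3 ->
  exists2 D, der lam (quot K) D & `|D| <= rate K L * `|quot K lam|.
Proof.
move=> Wl lL LK; have [ne [T dT HT]] := Wtrace Wl.
have [|dQ nQ] := @Qp_dv K lam; first by [].
set s := \sum_(0 <= k < K) _ in dQ.
exists ((s - T) * quot K lam).
  apply: dv_eq (dvM dT (dvV nQ dQ)) _; rewrite /quot.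
  by move: (Qp K lam) nQ => r r0; field.
rewrite normrM ler_wpM2r//.
have tK : `|(lam - lb) * th K| <= 1 / 3.
  by apply: le_trans LK; rewrite normrM (ger0_norm (th0 K)) ler_wpM2r.
have := HT K tK.
have -> : T - Ts - \sum_(0 <= k < K) (lam - lb) * th k ^+ 2 / (1 - (lam - lb) * th k) =
   (T - s) - (Ts - \sum_(0 <= k < K) th k).
  have -> : \sum_(0 <= k < K) (lam - lb) * th k ^+ 2 / (1 - (lam - lb) * th k) = s - \sum_(0 <= k < K) th k.
    rewrite -sumrB; apply: eq_bigr => k _.
    have nz : 1 - (lam - lb) * th k != 0 by rewrite subr_eq0 eq_sym.
    by move: (lam - lb) nz => t nz; field.
  lra.
have r0 : 0 <= Ts - \sum_(0 <= k < K) th k by rewrite subr_ge0.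
have h1 : 2 * `|lam - lb| * th K * S <= 2 * L * th K * S.
  by rewrite ler_wpM2r// ler_wpM2r// ler_wpM2l.
rewrite /rate; move: (Ts - _) r0 => u u0 H; rewrite distrC -[T - s](subrK u).
tri; rewrite (ger0_norm u0) addrC lerD2l.
lra.
Qed.

(** If the sums stayed below [Ts - e], then [- W' / W >= e / 2] on the half line below [lb], and
    [W lam] would be at least [W lb exp (e (lb - lam) / 2)], against [Wgrowth]. *)
Lemma th_sum e : 0 < e -> exists K, forall k, (K <= k)%N -> Ts - \sum_(0 <= k < k) th k <= e.
Proof.
move=> e0; apply: contrapT => /forallNP H.
have He K : e <= Ts - \sum_(0 <= k < K) th k.
  have /existsNP[k /not_implyP[Kk /negP]] := H K; rewrite -ltNge => /ltW h; apply: le_trans h _.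
  by rewrite lerB// (@big_cat_nat _ _ _ K 0 k)//= lerDl sumr_ge0.
have Tge lam : lam <= lb -> exists2 T, e / 2 <= T & der lam W (- (T * W lam)).
  move=> ll; have Wl : W lam != 0 by rewrite gt_eqF// Wneg.
  have [ne [T dT HT]] := Wtrace Wl; exists T => //.
  pose L := `|lam - lb|.
  have L1 : 0 < L + 1 by rewrite /L.
  have S1 : 0 < S + 1 by rewrite ltr_wpDl.
  have d0 : 0 < Num.min (1 / (3 * (L + 1))) (e / (4 * (L + 1) * (S + 1))).
    by rewrite lt_min !divr_gt0// !mulr_gt0.
  have [K HK] := th_small d0; have := HK K (leqnn K); rewrite le_min => /andP[k1 k2].
  have LK : (L + 1) * th K <= 1 / 3.
    by rewrite mulrC -ler_pdivlMr//; apply: le_trans k1 _; rewrite invfM mulrA.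
  have LS : (L + 1) * th K * (S + 1) <= e / 4.
    rewrite mulrAC mulrC -ler_pdivlMr ?mulr_gt0//; apply: le_trans k2 _.
    lra.
  have tK : `|(lam - lb) * th K| <= 1 / 3.
    by rewrite normrM (ger0_norm (th0 K)) -/L; have := th0 K; move: LS LK; glra.
  have := HT K tK; rewrite -/L; rewrite ler_norml => /andP[h _].
  have sum_ge : \sum_(0 <= k < K) (lam - lb) * th k ^+ 2 / (1 - (lam - lb) * th k) >= - \sum_(0 <= k < K) th k.
    rewrite -sumrN; apply: ler_sum => k _.
    have t0 : 0 <= (lb - lam) * th k by rewrite mulr_ge0 ?subr_ge0.
    have nz : 0 < 1 - (lam - lb) * th k by move: t0; glra.
    have -> : (lam - lb) * th k ^+ 2 / (1 - (lam - lb) * th k) = th k / (1 - (lam - lb) * th k) - th k.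
      by move: (lam - lb) nz => t nz; field; rewrite gt_eqF.
    by rewrite lerDr divr_ge0// ltW.
  have := He K.
  have : 2 * L * th K * S <= 2 * ((L + 1) * th K * (S + 1)).
    have L00 : 0 <= L by pos.
    by rewrite -!mulrA ler_wpM2l// !mulrA; apply: ler_pM; rewrite ?mulr_ge0 ?ler_wpM2r// lerDl.
  move: sum_ge h tK LS LK; glra.
have e2 : 0 < e / 2 by lra.
have [lam ll] := Wgrowth e2; apply/negP; rewrite -leNgt.
pose g x := W x * expR (e / 2 * x).
have mono : - g lam <= - g lb.
  have dg x : x <= lb -> exists2 D, der x (fun x => - g x) D & 0 <= D.
    move=> xl; have [T T0 dT] := Tge x xl.
    exists ((T - e / 2) * g x); last by rewrite mulr_ge0 ?subr_ge0// mulr_ge0 ?expR_ge0// ltW// Wneg.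
    have dE : der x (fun x => expR (e / 2 * x)) (expR (e / 2 * x) * (e / 2)).
      exact: dv_exp (dv_lin (e / 2) x).
    by apply: dv_eq (dvN (dvM dT dE)) _; rewrite /g; ring.
  apply: (@dv_le R lam lb (fun x => - g x) (fun x => (fun x => - g x)^`() x) ll) => x /andP[_ xl].
    by have [D dD _] := dg x xl; apply: derive1_dv; case: dD.
  by have [D dD D0] := dg x xl; have [_ ->] := dv_derive1 dD.
have Ee : expR (e / 2 * (lb - lam)) = expR (e / 2 * lb) / expR (e / 2 * lam).
  by rewrite mulrBr expRB.
rewrite Ee mulrA ler_pdivrMr ?expR_gt0//.
by move: mono; rewrite lerN2.
Qed.

Lemma prod_dv (P : pred nat) K lam : exists D,
  der lam (fun l => \prod_(0 <= k < K | P k) (1 - (l - lb) * th k)) D.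
Proof.
elim: K => [|K [D dD]].
  exists 0; rewrite (_ : (fun _ => _) = fun=> 1); last by apply/funext => l; rewrite big_geq.
  exact: dv_cst.
have [PK|PK] := boolP (P K).
  exists (D * (1 - (lam - lb) * th K) + (\prod_(0 <= k < K | P k) (1 - (lam - lb) * th k)) * (- th K)).
  rewrite (_ : (fun _ => _) = fun l => \prod_(0 <= k < K | P k) (1 - (l - lb) * th k) * (1 - (l - lb) * th K)).
    exact: dvM dD (Qp_factor_dv K lam).
  by apply/funext => l; rewrite big_mkcond big_nat_recr//= -big_mkcond PK.
exists D; rewrite (_ : (fun _ => _) = fun l => \prod_(0 <= k < K | P k) (1 - (l - lb) * th k))//.
by apply/funext => l; rewrite big_mkcond big_nat_recr//= -big_mkcond (negbTE PK) mulr1.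
Qed.

Let rest K i lam := \prod_(0 <= k < K | k != i) (1 - (lam - lb) * th k).

Lemma Qp_rest K i lam : (i < K)%N -> Qp K lam = (1 - (lam - lb) * th i) * rest K i lam.
Proof. by move=> iK; rewrite /Qp (bigD1_seq i) ?iota_uniq// mem_index_iota. Qed.

Lemma Qp_zero_dv K i lam : (i < K)%N -> (lam - lb) * th i = 1 ->
  Qp K lam = 0 /\ der lam (Qp K) (- th i * rest K i lam).
Proof.
move=> iK e; split; first by rewrite (Qp_rest lam iK) e subrr mul0r.
have -> : Qp K = fun l => (1 - (l - lb) * th i) * rest K i l by apply/funext => l; exact: Qp_rest.
have [D dD] := prod_dv (fun k => k != i) K lam.
by apply: dv_eq (dvM (Qp_factor_dv i lam) dD) _; rewrite e subrr mul0r addr0.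
Qed.

Lemma index_lt K L i lam : `|lam - lb| <= L -> L * th K <= 1 / 3 -> (lam - lb) * th i = 1 -> (i < K)%N.
Proof.
move=> lL LK e; rewrite ltnNge; apply/negP => Ki.
have h : `|lam - lb| * th i <= L * th K by apply: ler_pM => //; exact: thm.
have : 1 <= `|lam - lb| * th i by rewrite -[leLHS]e ler_wpM2r// ler_norm.
lra.
Qed.

(** To the right of a zero, the quotient of [W] by a finite product stays comparable with its value
    at a fixed point [y], since its logarithmic derivative is bounded. If no factor vanished the
    quotient would tend to [0]; if two did, the product would vanish to second order while the zero
    of [W] is simple. *)
Lemma zero_index lam : W lam = 0 -> exists2 i, (lam - lb) * th i = 1 &
  forall j, (lam - lb) * th j = 1 -> j = i.
Proof.
move=> W0; have [D D0 dW] := Wsimple W0.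
pose L := `|lam - lb| + 1; have L0 : 0 < L by rewrite ltr_wpDl.
have [K HK] : exists K, forall k, (K <= k)%N -> th k <= 1 / (3 * L) by apply: th_small; rewrite divr_gt0// mulr_gt0.
have LK : L * th K <= 1 / 3 by rewrite mulrC -ler_pdivlMr// -mulrA -invfM; exact: HK.
pose c := rate K L; have c0 : 0 <= c by apply: rate_ge0; lra.
have sc := slope_cvg dW.
have [e1 /= e10 He1] : \forall x \near lam, slope W lam D x != 0.
  move/cvgrPdist_lt: sc => /(_ `|D|); rewrite normr_gt0 => /(_ D0); apply: filterS => x.
  apply: contraTneq => ->; by rewrite subr0 ltxx.
pose e := Num.min (e1 / 2) (1 / (2 * (c + 1))).
have c1 : 0 < c + 1 by lra.
have e0 : 0 < e by rewrite lt_min !divr_gt0// mulr_gt0.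
have ee1 : e < e1 by apply: le_lt_trans (_ : e1 / 2 < e1); [rewrite ge_min lexx|lra].
have ec : e * (c + 1) <= 1 / 2.
  by rewrite -ler_pdivlMr// -mulrA -invfM ge_min lexx orbT.
have ce : c * e <= 1 / 2 by lra.
have e_1 : e <= 1 / 2 by nra.
pose y := lam + e.
have xP x : lam < x <= y -> W x != 0 /\ `|x - lb| <= L.
  move=> /andP[lx xy]; have xl : x != lam by rewrite gt_eqF.
  split.
    have := He1 x; rewrite /= distrC ger0_norm ?subr_ge0 ?(ltW lx)// slopeE// W0 subr0.
    have -> : x - lam < e1 by move: xy; rewrite /y; lra.
    by move=> /(_ isT); apply: contraNneq => ->; rewrite mul0r.
  have -> : x - lb = (lam - lb) + (x - lam) by ring.
  tri; rewrite lerD2l ger0_norm ?subr_ge0 ?(ltW lx)//.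
  by move: xy; rewrite /y; lra.
have cmp x : lam < x <= y -> `|quot K x| <= 2 * `|quot K y| /\ `|quot K y| <= 2 * `|quot K x|.
  move=> /andP[lx xy].
  have zP z : x <= z <= y -> lam < z <= y by (move: lx; glra).
  have cyx : c * (y - x) <= c * e by rewrite ler_wpM2l /y; lra.
  have G := @gronwall_off [::] (quot K) c x y c0 xy (le_trans cyx ce).
  have {G} G : forall a b, x <= a <= y -> x <= b <= y -> `|quot K a - quot K b| <= 2 * (c * (y - x)) * `|quot K b|.
    apply: G => z; first by move=> /zP/xP[Wz zL]; have [E dE _] := quot_dv Wz zL LK; exact: dv_cont dE.
    move=> /andP[/ltW xz /ltW zy] _; have [//|Wz zL] := xP z _; first by apply: zP; rewrite xz.
    exact: quot_dv.
  have I1 : x <= x <= y by rewrite lexx.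
  have I2 : x <= y <= y by (move: I1; glra).
  have two a : 2 * (c * (y - x)) * `|a| <= `|a|.
    by rewrite -[leRHS]mul1r ler_wpM2r//; move: I2 I1 cyx xy lx e_1 ce ec; glra.
  have tri (a b : R) : `|a| <= `|a - b| + `|b| by rewrite -[X in `|X| <= _](subrK b); exact: ler_normD.
  have g1 := G x y I1 I2; have g2 := G y x I2 I1.
  have t1 := two (quot K y); have t2 := two (quot K x).
  have r1 := tri (quot K x) (quot K y); have r2 := tri (quot K y) (quot K x).
  move: r2 r1 t2 t1 g2 g1 I2 I1; glra.
have yI : lam < y <= y by rewrite lexx andbT ltrDl.
have [Wy _] := xP y yI.
have near_x : \forall x \near lam^'+, lam < x <= y.
  near=> x; apply/andP; split; near: x; first exact: nbhs_right_gt.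
  by apply: nbhs_right_le; rewrite ltrDl.
have Qy : quot K y != 0.
  rewrite mulf_neq0// invr_eq0.
  by have [ne _] := Wtrace Wy; have [|_ //] := @Qp_dv K y.
have [i ei] : exists i, (lam - lb) * th i = 1.
  apply: contrapT => /forallNP ne.
  have [|dQ nQ] := @Qp_dv K lam; first by move=> k _; apply/eqP.
  have dq := dvM dW (dvV nQ dQ).
  have H : 2 * `|quot K x| @[x --> lam^'+] --> 2 * `|quot K lam|.
    apply: cvgMr; apply: cvg_norm; apply: cvg_at_right_filter.
    exact: dv_cont dq.
  have : `|quot K y| <= 2 * `|quot K lam|.
    by apply: (cvgr_to_ge H); apply: filterS near_x => x xI; have [] := cmp x xI.
  by rewrite /quot W0 mul0r normr0 mulr0 normr_le0 (negbTE Qy).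
exists i => // j ej; apply/eqP; apply/negPn/negP => ji.
have lL : `|lam - lb| <= L by rewrite lerDl.
have iK := index_lt lL LK ei; have jK := index_lt lL LK ej.
have [Q0 dQ] := Qp_zero_dv iK ei.
have r0 : rest K i lam = 0.
  apply/eqP; rewrite prodf_seq_eq0; apply/hasP; exists j; first by rewrite mem_index_iota.
  by rewrite ji ej subrr eqxx.
rewrite r0 mulr0 in dQ; have sq := slope_cvg dQ.
have H : 2 * `|quot K y| * `|slope (Qp K) lam 0 x| - `|slope W lam D x| @[x --> lam^'+] --> 2 * `|quot K y| * 0 - `|D|.
  apply: cvgB.
    apply: cvgMr; have n0 : `|0 : R| = 0 by rewrite normr0.
    by rewrite -[X in _ --> X]n0; apply: cvg_norm; apply: cvg_at_right_filter.
  by apply: cvg_norm; apply: cvg_at_right_filter.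
have : 0 <= 2 * `|quot K y| * 0 - `|D|.
  apply: (cvgr_to_ge H); apply: filterS near_x => x xI; have [c1' _] := cmp x xI.
  have xl : x != lam by case/andP: xI => lx _; rewrite gt_eqF.
  have [Wx xL] := xP x xI.
  have nQx : Qp K x != 0.
    by have [ne _] := Wtrace Wx; have [|_ //] := @Qp_dv K x.
  rewrite !slopeE// W0 Q0 !subr0 subr_ge0.
  have -> : W x / (x - lam) = quot K x * (Qp K x / (x - lam)) by rewrite mulrA divfK.
  by rewrite normrM ler_wpM2r.
rewrite mulr0 sub0r oppr_ge0 normr_le0 => /eqP DD.
by rewrite DD eqxx in D0.
Unshelve. all: by end_near. Qed.

(** The quotient [W / Qp K] with its removable singularities filled in by the ratio of
    derivatives. *)
Let Vx K lam := if Qp K lam == 0 then derive1 W lam / derive1 (Qp K) lam else quot K lam.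

Lemma Vx_cont K L lam : `|lam - lb| <= L -> L * th K <= 1 / 3 -> {for lam, continuous (Vx K)}.
Proof.
move=> lL LK; have [W0|Wl] := eqVneq (W lam) 0.
  have [D D0 dW] := Wsimple W0; have [i ei uniq_i] := zero_index W0.
  have iK := index_lt lL LK ei; have [Q0 dQ] := Qp_zero_dv iK ei.
  have ti : th i != 0 by apply/eqP => t0; move: ei; rewrite t0 mulr0 => /eqP; rewrite eq_sym oner_eq0.
  have r0 : rest K i lam != 0.
    rewrite prodf_seq_neq0; apply/allP => k _; apply/implyP => ki.
    by rewrite subr_eq0 eq_sym; apply: contraNneq ki => /uniq_i ->.
  set DQ := - th i * _ in dQ; have DQ0 : DQ != 0 by rewrite mulf_neq0// oppr_eq0.
  have [_ eW] := dv_derive1 dW; have [_ eQ] := dv_derive1 dQ.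
  have sW := slope_cvg dW; have sQ := slope_cvg dQ.
  have H : slope W lam D x / slope (Qp K) lam DQ x @[x --> lam] --> D / DQ.
    by apply: cvgM => //; apply: cvgV.
  have E0 : Vx K lam = D / DQ by rewrite /Vx Q0 eqxx eW eQ.
  apply: (cont_for E0); apply: cvg_trans H; apply: near_eq_cvg.
  have nz : \forall x \near lam, slope (Qp K) lam DQ x != 0.
    by move: sQ => /cvgr_neq0; apply.
  apply: filterS nz => x nz.
  have [->|xl] := eqVneq x lam; first by rewrite !slope_at.
  move: nz; rewrite !slopeE// W0 Q0 !subr0 => nz.
  have xl0 : x - lam != 0 by rewrite subr_eq0.
  have qx : Qp K x != 0 by apply: contraNneq nz => ->; rewrite mul0r.
  by rewrite /Vx (negbTE qx) invf_div mulrA divfK.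
have [ne _] := Wtrace Wl; have [|_ nQ] := @Qp_dv K lam; first by [].
have [E dE _] := quot_dv Wl lL LK.
have E0 : Vx K lam = quot K lam by rewrite /Vx (negbTE nQ).
apply: (cont_for E0); apply: cvg_trans (dv_cont dE); apply: near_eq_cvg.
have nz : \forall x \near lam, Qp K x != 0 by move: (@Qp_cont K lam) => /cvgr_neq0; apply.
by apply: filterS nz => x nz; rewrite /Vx (negbTE nz).
Qed.

(** Between [lb] and [lam] the logarithmic derivative of [W / Qp K] is at most [rate K L] off
    finitely many points, and this rate tends to [0] by [th_sum]. As the quotient is [W lb] at [lb],
    its value at [lam] tends to [W lb]. *)
Theorem product_formula lam : W lam != 0 -> Qp K lam @[K --> \oo] --> W lam / W lb.
Proof.
move=> Wl; have Wb : 0 < W lb by exact: Wneg.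
suff H : W lam / Qp K lam @[K --> \oo] --> W lb.
  have H2 : W lam * (W lam / Qp K lam)^-1 @[K --> \oo] --> W lam * (W lb)^-1.
    by apply: cvgMr; apply: cvgV => //; rewrite gt_eqF.
  apply: cvg_trans H2; apply: near_eq_cvg; apply: filterE => K.
  by rewrite invf_div mulrCA divff// mulr1.
apply/cvgrPdist_le => e e0.
pose L := `|lam - lb|; have L0 : 0 <= L by exact: normr_ge0.
pose w := W lb + 1; have w0 : 0 < w by rewrite addr_gt0.
pose eps := Num.min (1 / (2 * (L + 1))) (e / (2 * (L + 1) * w)).
have L1 : 0 < L + 1 by lra.
have eps0 : 0 < eps by rewrite lt_min !divr_gt0// !mulr_gt0.
have [K1 HK1] : exists K, forall k, (K <= k)%N -> Ts - \sum_(0 <= i < k) th i <= eps / 2 by apply: th_sum; lra.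
have S1 : 0 < S + 1 by rewrite ltr_wpDl.
have d0 : 0 < Num.min (1 / (3 * (L + 1))) (eps / (4 * (L + 1) * (S + 1))).
  by rewrite lt_min !divr_gt0// !mulr_gt0.
have [K2 HK2] := th_small d0.
near=> K.
have k1 : (K1 <= K)%N by near: K; exact: nbhs_infty_ge.
have k2 : (K2 <= K)%N by near: K; exact: nbhs_infty_ge.
have h1 := HK1 K k1; have := HK2 K k2; rewrite le_min => /andP[h2 h3].
have LK1 : (L + 1) * th K <= 1 / 3 by rewrite mulrC -ler_pdivlMr// -mulrA -invfM.
have LK : L * th K <= 1 / 3 by nra.
have LS : L * th K * S <= eps / 4.
  apply: (@le_trans _ _ ((L + 1) * th K * (S + 1))).
    by apply: ler_pM => //; rewrite ?mulr_ge0// ?ler_wpM2r// lerDl.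
  by rewrite mulrAC mulrC -ler_pdivlMr ?mulr_gt0// -mulrA -invfM mulrA.
have rK : rate K L <= eps by rewrite /rate; lra.
have r0 : 0 <= rate K L by exact: rate_ge0.
pose a := Num.min lb lam; pose b := Num.max lb lam.
have ab : a <= b by rewrite ge_min !le_max lexx.
have baL : b - a = L.
  rewrite /a /b /L; have [ll|ll] := leP lb lam; first by rewrite ger0_norm ?subr_ge0.
  by rewrite ltr0_norm ?subr_lt0// opprB.
have epsL : eps * (L + 1) <= 1 / 2 by rewrite -ler_pdivlMr// -mulrA -invfM ge_min lexx.
have epsw : eps * (2 * (L + 1) * w) <= e by rewrite -ler_pdivlMr ?mulr_gt0// ge_min lexx orbT.
have rL : rate K L * L <= eps * (L + 1) by apply: ler_pM => //; rewrite lerDl.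
have xL x : a <= x <= b -> `|x - lb| <= L.
  rewrite -baL /a /b => /andP[]; have [ll|ll] := leP lb lam; first by move=> *; rewrite ger0_norm; lra.
  by move=> *; rewrite ler0_norm; lra.
have aI : a <= lb <= b by rewrite ge_min le_max lexx.
have bI : a <= lam <= b by rewrite ge_min le_max lexx !orbT.
have := @gronwall_off [seq lb + (th k)^-1 | k <- iota 0 K] (Vx K) (rate K L) a b r0 ab.
rewrite baL => /(_ (le_trans rL epsL)) G.
have {G} G : forall x y, a <= x <= b -> a <= y <= b -> `|Vx K x - Vx K y| <= 2 * (rate K L * L) * `|Vx K y|.
  apply: G => x; first by move=> /xL xab; exact: Vx_cont xab LK.
  move=> /andP[/ltW ax /ltW xb] xs; have xab : `|x - lb| <= L by apply: xL; rewrite ax.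
  have Wx : W x != 0.
    apply: contraNneq xs => /zero_index[i ei _].
    have ti : th i != 0 by apply/eqP => t0; move: ei; rewrite t0 mulr0 => /eqP; rewrite eq_sym oner_eq0.
    apply/mapP; exists i; first by rewrite mem_iota; exact: index_lt xab LK ei.
    by apply: (mulIf ti); rewrite mulrDl mulVf// -ei; ring.
  have [D dD Dle] := quot_dv Wx xab LK.
  have nz : \forall y \near x, Qp K y != 0.
    move: (@Qp_cont K x) => /cvgr_neq0; apply.
    by have [ne _] := Wtrace Wx; have [|_ //] := @Qp_dv K x.
  have eqV : \forall y \near x, quot K y = Vx K y by apply: filterS nz => y; rewrite /Vx => /negbTE ->.
  exists D; first exact: (near_eq_is_derive eqV dD).
  by rewrite -(nbhs_singleton eqV).
have Vlb : Vx K lb = W lb.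
  have Qlb : Qp K lb = 1 by rewrite /Qp big1// => k; rewrite subrr mul0r subr0.
  by rewrite /Vx Qlb oner_eq0 /quot Qlb divr1.
have Vlam : Vx K lam = W lam / Qp K lam.
  have [ne _] := Wtrace Wl; have [|_ nQ] := @Qp_dv K lam; first by move=> k _.
  by rewrite /Vx (negbTE nQ).
have := G lam lb bI aI; rewrite Vlb Vlam distrC => h; apply: le_trans h _; apply: le_trans epsw.
rewrite (ger0_norm (ltW Wb)).
have -> : eps * (2 * (L + 1) * w) = 2 * (eps * (L + 1)) * w by ring.
by apply: ler_pM => //; [rewrite !mulr_ge0|pos|rewrite ler_wpM2l|rewrite /w lerDl].
Unshelve. all: by end_near. Qed.

End Abstract.
End ProductFormula.

(** * The Gamma function through primitives *)

Section GammaIntegral.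
Variable R : realType.
Implicit Types (f F H : R -> R) (a b s t x y n : R).
Let mu := @lebesgue_measure R.

Lemma primitive_limits f H H' M : (forall t, 0 < t -> {for t, continuous f}) ->
  (forall t, 0 < t -> der t H (H' t)) -> (forall t, 0 < t -> 0 <= f t <= H' t) ->
  (forall t, 0 < t -> `|H t| <= M) ->
  exists F (A B : R), [/\ forall t, 0 < t -> der t F (f t),
    F t @[t --> 0^'+] --> A & F t @[t --> +oo] --> B].
Proof.
move=> cf dH fH HM; have [F0 dF0] := antiderivative_pos cf.
(* The value given for [t <= 0] is a lower bound of the primitive, so [F] is nondecreasing on the
   whole line and the monotone limit theorems apply. *)
pose F t := if 0 < t then F0 t else F0 1 - 2 * M.
have FE t : 0 < t -> F t = F0 t by rewrite /F => ->.
have dF t : 0 < t -> der t F (f t).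
  move=> t0; apply: (@dv_near R 0 (t + 1) F0 F t) (dF0 t t0); first by rewrite t0 ltrDl ltr01.
  by move=> y /andP[y0 _]; rewrite FE.
have FN t : t <= 0 -> F t = F 1 - 2 * M by move=> t0; rewrite (FE 1 ltr01) /F ltNge t0.
have mono s t : 0 < s -> s <= t -> F s <= F t /\ F t - F s <= H t - H s.
  move=> s0 st; have I z : s <= z <= t -> 0 < z by case/andP => sz _; lra.
  split; first by apply: (dv_le st) => z /I z0; [exact: dF|have /andP[] := fH z z0].
  rewrite -subr_ge0; have -> : H t - H s - (F t - F s) = (H t - F t) - (H s - F s) by ring.
  rewrite subr_ge0; apply: (@dv_le R s t (fun z => H z - F z) (fun z => H' z - f z) st) => z /I z0.
    exact: dvD (dH z z0) (dvN (dF z z0)).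
  by rewrite subr_ge0; have /andP[] := fH z z0.
have bnd t : 0 < t -> F 1 - 2 * M <= F t <= F 1 + 2 * M.
  move=> t0; have := HM t t0; have := HM 1 ltr01; rewrite !ler_norml => /andP[a1 a2] /andP[a3 a4].
  have [t1|/ltW t1] := leP t 1.
    by have [h1 h2] := mono t 1 t0 t1; lra.
  by have [h1 h2] := mono 1 t ltr01 t1; lra.
have M0 : 0 <= M by apply: le_trans (HM 1 ltr01).
have mF : {homo F : s t / s <= t}.
  move=> s t st; have [s0|s0] := ltP 0 s; first by have [] := mono s t s0 st.
  rewrite (FN s s0); have [t0|t0] := ltP 0 t; first by have /andP[] := bnd t t0.
  by rewrite (FN t t0).
have Fl t : F 1 - 2 * M <= F t.
  have [t0|t0] := ltP 0 t; first by have /andP[] := bnd t t0.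
  by rewrite (FN t t0).
have Fu t : F t <= F 1 + 2 * M.
  have [t0|t0] := ltP 0 t; first by have /andP[] := bnd t t0.
  by rewrite (FN t t0); lra.
exists F.
exists (inf (F @` `]0, 1[)), (sup (range F)); split => //.
  apply: (@nondecreasing_at_right_cvgr R F 0 (BLeft 1)); first by rewrite bnd_simp.
    by move=> *; exact: mF.
  by exists (F 1 - 2 * M) => _ [t _ <-].
by apply: nondecreasing_cvgr => //; exists (F 1 + 2 * M) => _ [t _ <-].
Qed.

(** The singular endpoint is approached along the half lines starting at [1 / (i + 1)], with
    monotone convergence for the nonnegative integrand. *)
Lemma integral_primitive f F (A B : R) : (forall t, 0 < t -> {for t, continuous f}) ->
  (forall t, 0 < t -> 0 <= f t) -> (forall t, 0 < t -> der t F (f t)) ->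
  F t @[t --> 0^'+] --> A -> F t @[t --> +oo] --> B ->
  (\int[mu]_(t in `]0%R, +oo[) (f t)%:E = (B - A)%:E)%E.
Proof.
move=> cf f0 dF FA FB; pose G i := `[harmonic i, +oo[%classic : set R.
have h0 i : 0 < @harmonic R i by pos.
have GU : \bigcup_i G i = `]0, +oo[%classic.
  apply/seteqP; split => [x [i _]|x]; rewrite /G/= !in_itv/= !andbT; first exact: (lt_le_trans (h0 i)).
  move=> x0; have /cvgr_lt/(_ x x0)[N _ HN] := @cvg_harmonic R.
  by exists N => //; rewrite /G/= in_itv/= ltW// HN//=.
have E i : (\int[mu]_(t in G i) (f t)%:E = (B - F (harmonic i))%:E)%E.
  rewrite EFinB; apply: ge0_continuous_FTC2y => //.
  - by move=> x hx; apply: f0; exact: lt_le_trans hx.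
  - apply/continuous_within_itvcyP; split.
      by move=> x; rewrite in_itv andbT => hx; apply: cf; exact: lt_trans hx.
    by apply: cvg_at_right_filter; exact: cf.
  - by move=> x hx; have [] := dF x (lt_trans (h0 i) hx).
  - by apply: cvg_at_right_filter; exact: dv_cont (dF _ (h0 i)).
  - by move=> x; rewrite in_itv andbT => hx; have [] := dv_derive1 (dF x (lt_trans (h0 i) hx)).
have mf : measurable_fun (`]0, +oo[%classic : set R) f.
  apply: measurable_realfun.subspace_continuous_measurable_fun; first exact: measurable_itv.
  by apply: continuous_in_subspaceT => x; rewrite inE/= in_itv andbT; exact: cf.
have L : (\int[mu]_(t in G i) (f t)%:E)%E @[i --> \oo] --> (\int[mu]_(t in \bigcup_i G i) (f t)%:E)%E.
  apply: ge0_nondecreasing_set_cvg_integral.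
  - move=> i j ij; apply/subsetPset => x; rewrite /G/= !in_itv !andbT; apply: le_trans.
    by rewrite lef_pV2 ?posrE// ler_nat.
  - by move=> i; exact: measurable_itv.
  - move=> i; apply/measurable_realfun.measurable_EFinP; apply: measurable_funS mf => //.
    by rewrite -GU; exact: bigcup_sup.
  - by move=> i x; rewrite /G/= in_itv andbT => hx; rewrite lee_fin f0// (lt_le_trans (h0 i)).
rewrite GU in L; suff H : (\int[mu]_(t in G i) (f t)%:E)%E @[i --> \oo] --> (B - A)%:E by exact: (cvg_unique _ L H).
rewrite (_ : (fun i => _) = fun i => (B - F (harmonic i))%:E); last by apply/funext => i.
apply: cvg_EFin; first by near=> i.
apply: cvgB; first exact: cvg_cst.
have /cvg_at_rightP := FA; apply; split => //; exact: cvg_harmonic.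
Unshelve. all: by end_near. Qed.

Definition gamma_integrand x t : R := t `^ (x - 1) * expR (- t).

(** The value of the Gamma integral, carried by a primitive and its two limits; relations between
    Gamma values then follow from relations between derivatives. *)
Definition isG x g := exists F (A B : R), [/\ forall t, 0 < t -> der t F (gamma_integrand x t),
  F t @[t --> 0^'+] --> A, F t @[t --> +oo] --> B & g = B - A].

Lemma gamma_integrand_cont x t : 0 < t -> {for t, continuous (gamma_integrand x)}.
Proof.
move=> t0; have h : der t (gamma_integrand x)
   ((x - 1) * t `^ (x - 1 - 1) * 1 * expR (- t) + t `^ (x - 1) * (expR (- t) * -1)).
  exact: dvM (dv_pow _ t0 (dv_id t)) (dv_exp (dvN (dv_id t))).
exact: dv_cont h.
Qed.

Lemma gamma_integrand_gt0 x t : 0 < t -> 0 < gamma_integrand x t.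
Proof. by move=> t0; rewrite mulr_gt0 ?powR_gt0 ?expR_gt0. Qed.

Lemma isG_Gamma x g : isG x g -> Gamma x = g.
Proof.
move=> [F [A [B [dF FA FB ->]]]].
rewrite /Gamma (@integral_primitive (gamma_integrand x) F A B)//; first exact: gamma_integrand_cont.
by move=> t t0; pos.
Qed.

Lemma mono_limits F (A B : R) t : (forall s t, 0 < s -> s <= t -> F s <= F t) ->
  F t @[t --> 0^'+] --> A -> F t @[t --> +oo] --> B -> 0 < t -> A <= F t <= B.
Proof.
move=> m FA FB t0; apply/andP; split.
  apply: (cvgr_to_le FA); near=> s; apply: m; near: s; first exact: nbhs_right_gt.
  exact: nbhs_right_le.
by apply: (cvgr_to_ge FB); near=> s; apply: m => //; near: s; exact: nbhs_pinfty_ge.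
Unshelve. all: by end_near. Qed.

Lemma isG_gt0 x g : isG x g -> 0 < g.
Proof.
move=> [F [A [B [dF FA FB ->]]]].
have mono s t : 0 < s -> s <= t -> F s <= F t.
  move=> s0 st; apply: (dv_le st) => z /andP[sz _]; have z0 : 0 < z by lra.
    exact: dF.
  pos.
have /andP[b1 _] := mono_limits mono FA FB ltr01.
have /andP[_ b2] := mono_limits mono FA FB (ltr0n R 2).
have [c c12 e] : exists2 c, 1 <= c <= 2 & F 2 - F 1 = gamma_integrand x c * (2 - 1).
  apply: dv_mvt; first by rewrite ler1n.
  by move=> z /andP[z1 _]; apply: dF; lra.
have : 0 < gamma_integrand x c by apply: gamma_integrand_gt0; lra.
lra.
Qed.

Lemma expR_dominates k : exists2 C, 0 < C & forall t, 0 < t -> (1 + t) ^+ k.+1 * expR (- t) <= C.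
Proof.
exists (k.+1`!%:R * expR 1); first by [].
move=> t t0; have t1 : 0 <= 1 + t by rewrite addr_ge0// ltW.
have := expR_ge1Dxn k t1; rewrite expRN ler_pdivrMr ?expR_gt0// -mulrA -expRD => h.
rewrite -ler_pdivrMl//; lra.
Qed.

(** The majorant is the derivative of the bounded function [- 2 C / (1 + sqrt t)], and its
    singularity [t^(-1/2)] at [0] covers all [x >= 1/2]. *)
Lemma gamma_majorant x : 1 / 2 <= x -> exists2 C, 0 < C & forall t, 0 < t ->
  gamma_integrand x t <= C * (t `^ (- (1 / 2)) / (1 + t `^ (1 / 2)) ^+ 2).
Proof.
move=> x12; pose k := (Num.truncn (x - 1 / 2)).+1.
have [C C0 HC] := expR_dominates k; exists (2 * C); first lra.
move=> t t0; rewrite mulrA ler_pdivlMr; last by rewrite exprn_gt0// ltr_wpDr// powR_ge0.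
have -> : gamma_integrand x t = t `^ (- (1 / 2)) * (t `^ (x - 1 / 2) * expR (- t)).
  by rewrite mulrA -powR_add//; congr (_ `^ _ * _); lra.
rewrite mulrC mulrCA [leRHS]mulrC ler_wpM2l ?powR_ge0//.
have t1 : 0 < 1 + t by lra.
have h1 : (1 + t `^ (1 / 2)) ^+ 2 <= 2 * (1 + t).
  have e : t `^ (1 / 2) ^+ 2 = t by rewrite -powR_dbl// (_ : 2 * (1 / 2) = 1) ?powRr1; lra.
  have := sqr_ge0 (1 - t `^ (1 / 2)); lra.
have h2 : t `^ (x - 1 / 2) <= (1 + t) ^+ k.
  apply: (@le_trans _ _ ((1 + t) `^ (x - 1 / 2))).
    by apply: ge0_ler_powR; rewrite ?nnegrE ?subr_ge0 ?(ltW t0) ?(ltW t1)// lerDr.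
  rewrite -powR_mulrn ?(ltW t1)//; apply: ler_powR; first by rewrite lerDl ltW.
  by rewrite ltW// truncnS_gt.
apply: (@le_trans _ _ (2 * (1 + t) * ((1 + t) ^+ k * expR (- t)))).
  by apply: ler_pM; rewrite ?sqr_ge0 ?mulr_ge0 ?powR_ge0// ler_wpM2r.
rewrite -mulrA ler_wpM2l// mulrA; exact: HC.
Qed.

Lemma powR_half_dv t : 0 < t -> der t (fun t => t `^ (1 / 2)) (1 / 2 * t `^ (- (1 / 2))).
Proof.
move=> t0; apply: dv_eq (dv_pow (1 / 2) t0 (dv_id t)) _.
by rewrite mulr1; congr (_ * _ `^ _); lra.
Qed.

Lemma isG_exists x : 1 / 2 <= x -> exists g, isG x g.
Proof.
move=> x12; have [C C0 HC] := gamma_majorant x12.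
have [|||F [A [B [dF FA FB]]]] := @primitive_limits (gamma_integrand x)
   (fun t => - (2 * C) / (1 + t `^ (1 / 2))) (fun t => C * (t `^ (- (1 / 2)) / (1 + t `^ (1 / 2)) ^+ 2)) (2 * C)
   (@gamma_integrand_cont x).
- move=> t t0; have n0 : 1 + t `^ (1 / 2) != 0 by rewrite gt_eqF// ltr_wpDr// powR_ge0.
  have dd := dvD (dv_cst 1 t) (powR_half_dv t0).
  have Dv := dvM (dv_cst (- (2 * C)) t) (@dvV R (fun t => 1 + t `^ (1 / 2)) t _ n0 dd).
  by apply: dv_eq Dv _; field.
- by move=> t t0; rewrite HC// ltW// gamma_integrand_gt0.
- move=> t t0; rewrite normrM normrN normfV (ger0_norm (_ : 0 <= 2 * C)) ?mulr_ge0 ?(ltW C0)//.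
  have h := powR_ge0 t (1 / 2); rewrite ger0_norm; last by lra.
  by rewrite ler_pdivrMr ?ler_peMr; lra.
by exists (B - A), F, A, B.
Qed.

Lemma inv_cvg0y : t^-1 @[t --> +oo] --> (0 : R).
Proof.
apply/cvgrPdist_le => e e0; near=> t; have t0 : 0 < t by [].
rewrite sub0r normrN ger0_norm ?invr_ge0 ?(ltW t0)// -[leRHS]invrK lef_pV2 ?posrE ?invr_gt0//.
Unshelve. all: by end_near. Qed.

Lemma pow_exp_cvg0 x : 0 < x -> t `^ x * expR (- t) @[t --> +oo] --> (0 : R).
Proof.
move=> x0; pose k := (Num.truncn (x + 1)).+1.
have [C C0 HC] := expR_dominates k.
apply: norm_cvg0; apply: (squeeze0 (fun t => C / t)).
- near=> t; have t0 : 0 < t by near: t; exact: nbhs_pinfty_gt.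
  rewrite normr_ge0/= ger0_norm ?mulr_ge0 ?powR_ge0 ?expR_ge0//.
  rewrite ler_pdivlMr// mulrC mulrA; apply: le_trans (HC t t0); rewrite ler_wpM2r ?expR_ge0//.
  have -> : t * t `^ x = t `^ (x + 1) by rewrite powR_add// powRr1// mulrC.
  apply: (@le_trans _ _ ((1 + t) `^ (x + 1))).
    by apply: ge0_ler_powR; rewrite ?nnegrE ?addr_ge0 ?(ltW x0)// lerDr.
  rewrite -powR_mulrn ?addr_ge0//; apply: ler_powR; first by rewrite lerDl.
  by rewrite ltW// (lt_trans (truncnS_gt _))// ltr_nat.
- exact: cvg_cst.
- rewrite -[X in _ --> X](mulr0 C); apply: cvgMr.
  exact: inv_cvg0y.
Unshelve. all: by end_near. Qed.

Lemma isG_rec x g : 0 < x -> isG x g -> isG (x + 1) (x * g).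
Proof.
move=> x0 [F [A [B [dF FA FB ->]]]].
exists (fun t => x * F t - t `^ x * expR (- t)), (x * A - 0), (x * B - 0); split.
- move=> t t0; have d1 := dvM (dv_pow x t0 (dv_id t)) (dv_exp (dvN (dv_id t))).
  apply: dv_eq (dvD (dvM (dv_cst x t) (dF t t0)) (dvN d1)) _.
  by rewrite /gamma_integrand addrK; ring.
- apply: cvgB; first exact: cvgMr.
  have H : t `^ x * expR (- t) @[t --> 0^'+] --> (0 * expR (- 0) : R).
    apply: cvgM; first exact: powR_cvg0.
    apply: cvg_at_right_filter; exact: dv_cont (dv_exp (dvN (dv_id 0))).
  by rewrite mul0r in H.
- by apply: cvgB; [exact: cvgMr|exact: pow_exp_cvg0].
lra.
Qed.

(** Equivalent to [t^s n^(1-s) <= D] with [D] the weighted mean of [t] and [n]; it is the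
    combination with weights [s] and [1 - s] of [ln y <= y - 1] at [t / D] and [n / D]. *)
Lemma weighted_am_gm t n s : 0 < t -> 0 < n -> 0 <= s <= 1 ->
  t `^ s <= n `^ (s - 1) * (s * t + (1 - s) * n).
Proof.
move=> t0 n0 /andP[s0 s1]; pose D := s * t + (1 - s) * n.
have D0 : 0 < D.
  have [s00|s'] := eqVneq s 0; first by rewrite /D s00 mul0r add0r subr0 mul1r.
  by rewrite ltr_wpDr ?mulr_ge0 ?subr_ge0 ?(ltW n0)// mulr_gt0// lt0r s'.
have lnle y : 0 < y -> ln y <= y - 1.
  by move=> y0; have := expR_ge1Dx (ln y); rewrite lnK ?posrE; lra.
have h1 := lnle _ (divr_gt0 t0 D0); have h2 := lnle _ (divr_gt0 n0 D0).
rewrite !ln_div ?posrE// in h1 h2.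
rewrite /powR (gt_eqF t0) (gt_eqF n0) -/D.
have -> : D = expR (ln D) by rewrite lnK.
rewrite -expRD ler_expR.
have e : s * (t / D - 1) + (1 - s) * (n / D - 1) = 0.
  have -> : s * (t / D - 1) + (1 - s) * (n / D - 1) = (s * t + (1 - s) * n) / D - 1 by field; rewrite gt_eqF.
  by rewrite divff ?gt_eqF// subrr.
nra.
Qed.

(** Integrates the pointwise inequality. The free parameter [n] is tuned afterwards to the index
    around which the Bessel series concentrates. *)
Lemma isG_young a s n g g1 g2 : 0 < n -> 0 <= s <= 1 -> isG a g -> isG (a + 1) g1 -> isG (a + s) g2 ->
  g2 <= n `^ (s - 1) * (s * g1 + (1 - s) * n * g).
Proof.
move=> n0 s01 [F [A [B [dF FA FB ->]]]] [F1 [A1 [B1 [dF1 FA1 FB1 ->]]]] [F2 [A2 [B2 [dF2 FA2 FB2 ->]]]].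
pose c := n `^ (s - 1).
pose K t := c * (s * F1 t + (1 - s) * n * F t) - F2 t.
have mono x y : 0 < x -> x <= y -> K x <= K y.
  move=> x0 xy; apply: (@dv_le R x y K (fun t => c * (s * gamma_integrand (a + 1) t + (1 - s) * n * gamma_integrand a t) - gamma_integrand (a + s) t) xy) => z /andP[xz _];
    have z0 : 0 < z by lra.
    apply: dv_eq (dvD (dvM (dv_cst c z) (dvD (dvM (dv_cst s z) (dF1 z z0)) (dvM (dv_cst ((1 - s) * n) z) (dF z z0)))) (dvN (dF2 z z0))) _.
    lra.
  rewrite subr_ge0; have := weighted_am_gm z0 n0 s01; rewrite -/c => h.
  have -> : gamma_integrand (a + s) z = z `^ s * gamma_integrand a z.
    by rewrite mulrA -powR_add//; congr (_ `^ _ * _); ring.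
  have -> : gamma_integrand (a + 1) z = z * gamma_integrand a z.
    rewrite /gamma_integrand mulrA -[X in X * _ `^ _](powRr1 (ltW z0)) -powR_add//.
    by congr (_ `^ _ * _); ring.
  have := ler_wpM2r (ltW (gamma_integrand_gt0 a z0)) h; lra.
have KA : K t @[t --> 0^'+] --> c * (s * A1 + (1 - s) * n * A) - A2.
  by apply: cvgB => //; apply: cvgMr; apply: cvgD; exact: cvgMr.
have KB : K t @[t --> +oo] --> c * (s * B1 + (1 - s) * n * B) - B2.
  by apply: cvgB => //; apply: cvgMr; apply: cvgD; exact: cvgMr.
have := mono_limits mono KA KB ltr01; rewrite -/c; lra.
Qed.

(** The substitution [t = r^2] reduces it to the Gaussian integral over the half line. *)
Lemma isG_half : isG (1 / 2) (Num.sqrt pi).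
Proof.
pose f r : R := expR (- r ^+ 2).
have df (r : R) : der r f (expR (- r ^+ 2) * - (2%:R * r ^+ 1 * 1)).
  exact: dv_exp (dvN (dvX 2 (dv_id r))).
have cf r : 0 < r -> {for r, continuous f} by move=> _; exact: dv_cont (df r).
have [|||E [A [B [dE EA EB]]]] := @primitive_limits f (fun r => - 2 / (1 + r)) (fun r => 2 / (1 + r) ^+ 2) 2 cf.
- move=> r r0; have n0 : 1 + r != 0 by rewrite gt_eqF// addr_gt0.
  by apply: dv_eq (dvM (dv_cst (- 2) r) (dvV n0 (dvD (dv_cst 1 r) (dv_id r)))) _; field.
- move=> r r0; rewrite expR_ge0/= ler_pdivlMr ?exprn_gt0 ?addr_gt0// /f expRN mulrC ler_pdivrMr ?expR_gt0//.
  have := expR_ge1Dx (r ^+ 2); have := sqr_ge0 (1 - r); lra.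
- move=> r r0; rewrite normrM normrN normfV !ger0_norm; [|lra|lra].
  by rewrite ler_pdivrMr; lra.
have BA : B - A = Num.sqrt pi / 2.
  have f0 r : 0 < r -> 0 <= f r by rewrite expR_ge0.
  have := integral_primitive cf f0 dE EA EB.
  rewrite integral_itv_obnd_cbnd.
    by rewrite integral0y_gauss => -[].
  by apply/measurable_realfun.measurable_EFinP; apply: measurable_funTS; exact: measurable_gauss_fun.
have sq t : 0 < t -> (t `^ (1 / 2)) ^+ 2 = t.
  by move=> t0; rewrite -powR_dbl// (_ : 2 * (1 / 2) = 1) ?powRr1; lra.
exists (fun t => 2 * E (t `^ (1 / 2))), (2 * A), (2 * B); split.
- move=> t t0; have r0 := powR_gt0 (1 / 2) t0.
  apply: dv_eq (dvM (dv_cst 2 t) (@dv_comp R E (fun t => t `^ (1 / 2)) t _ _ (dE _ r0) (powR_half_dv t0))) _.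
  rewrite /f sq// /gamma_integrand (_ : 1 / 2 - 1 = - (1 / 2)); last lra.
  lra.
- apply: cvgMr; move/cvgrPdist_le: EA => HE; apply/cvgrPdist_le => e e0.
  have [d d0 Hd] := near_right (HE e e0).
  near=> t; apply: Hd; rewrite add0r powR_gt0/=; last by near: t; exact: nbhs_right_gt.
  near: t; have /cvgr_lt := @powR_cvg0 R (1 / 2) ltac:(lra); exact.
- apply: cvgMr; apply/cvgrPdist_le => e e0; move/cvgrPdist_le: EB => /(_ e e0) [M [Mr HM]].
  exists (Num.max 1 M ^+ 2); split; first exact: num_real.
  move=> t tM; apply: HM.
  have t0 : 0 < t by nra.
  have r0 := powR_gt0 (1 / 2) t0.
  apply: (@le_lt_trans _ _ (Num.max 1 M)); first by rewrite le_max lexx orbT.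
  rewrite -(sq t t0) ltr_pXn2r// in tM; rewrite nnegrE ?(ltW r0)//.
  by rewrite le_max ler01.
lra.
Unshelve. all: by end_near. Qed.

End GammaIntegral.

Section GammaFacts.
Variable R : realType.
Implicit Types (x a n s : R).

(* Locked: conversion must not unfold the integral. *)
Definition gam x : R := locked (@Gamma R) x.

Lemma gamE x : gam x = Gamma x. Proof. by rewrite /gam -lock. Qed.

Lemma Gamma_rec x : 1 / 2 <= x -> gam (x + 1) = x * gam x.
Proof.
move=> x12; rewrite !gamE; have [g gx] := isG_exists x12; rewrite (isG_Gamma gx).
by apply: isG_Gamma; apply: isG_rec => //; lra.
Qed.

Lemma Gamma_pos x : 1 / 2 <= x -> 0 < gam x.
Proof. by move=> x12; rewrite gamE; have [g gx] := isG_exists x12; rewrite (isG_Gamma gx); exact: isG_gt0 gx. Qed.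

Lemma Gamma_half : gam (1 / 2) = Num.sqrt pi :> R.
Proof. rewrite gamE; exact: isG_Gamma (isG_half R). Qed.

Lemma Gamma_young a n s : 1 / 2 <= a -> 0 < n -> 0 <= s <= 1 ->
  gam (a + s) <= n `^ (s - 1) * (s * a + (1 - s) * n) * gam a.
Proof.
rewrite !gamE.
move=> a12 n0 s01; have /andP[s0 s1] := s01; have [g ga] := isG_exists a12.
have [g2 ga2] : exists g, isG (a + s) g by apply: isG_exists; lra.
have a0 : 0 < a by lra.
have := isG_young n0 s01 ga (isG_rec a0 ga) ga2.
rewrite (isG_Gamma ga) (isG_Gamma ga2) => h; apply: le_trans h _.
lra.
Qed.

End GammaFacts.

(** * Power series and the normalized Bessel series *)

Section PowerSeries.
Variable R : realType.
Implicit Types (c d : nat -> R) (x z s t C : R).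

Definition psum c z s := pseries c z n @[n --> \oo] --> s.

Lemma psum_unique c z s t : psum c z s -> psum c z t -> s = t.
Proof. by move=> h1 h2; exact: (cvg_unique _ h1 h2). Qed.

Lemma psum_add c d z s t : psum c z s -> psum d z t -> psum (fun k => c k + d k) z (s + t).
Proof.
move=> h1 h2; rewrite /psum (_ : pseries _ z = fun n => pseries c z n + pseries d z n); first exact: cvgD.
apply/funext => n; by rewrite -big_split; apply: eq_bigr => k _; rewrite /= mulrDl.
Qed.

Lemma psum_scale c z s a : psum c z s -> psum (fun k => a * c k) z (a * s).
Proof.
move=> h1; rewrite /psum (_ : pseries _ z = fun n => a * pseries c z n); first exact: cvgMr.
apply/funext => n; by rewrite mulr_sumr; apply: eq_bigr => k _; rewrite mulrA.
Qed.

Arguments psum_scale {c z s} a _.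

Lemma psum_ext c d z s : (forall k, c k = d k) -> psum c z s -> psum d z s.
Proof. by move=> cd; have -> : d = c by apply/funext. Qed.

Lemma psum_shift c d z s : d 0%N = 0 -> (forall k, d k.+1 = c k) -> psum c z s -> psum d z (z * s).
Proof.
move=> d0 dS h1; have H : z * pseries c z n @[n --> \oo] --> z * s by exact: cvgMr.
rewrite /psum -(cvg_shiftS (pseries d z)); apply: cvg_trans H; apply: near_eq_cvg; apply: filterE => n /=.
rewrite /pseries /series/= big_nat_recl//= d0 mul0r add0r mulr_sumr; apply: eq_bigr => k _.
by rewrite dS exprS mulrCA.
Qed.

Lemma psum_ge0 c z s : 0 <= z -> (forall k, 0 <= c k) -> psum c z s -> 0 <= s.
Proof.
move=> z0 c0 h1; apply: (cvgr_to_ge h1); apply: filterE => n.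
by apply: sumr_ge0 => k _; rewrite mulr_ge0// exprn_ge0.
Qed.

Lemma psum_le c d z s t : 0 <= z -> (forall k, c k <= d k) -> psum c z s -> psum d z t -> s <= t.
Proof.
move=> z0 cd h1 h2; rewrite -subr_ge0; apply: (@psum_ge0 (fun k => d k + -1 * c k) z) => //.
  by move=> k; rewrite mulN1r subr_ge0.
have -> : t - s = t + -1 * s by rewrite mulN1r.
by apply: psum_add => //; exact: psum_scale (-1) h1.
Qed.

Lemma psum_cvg c C z : (forall k, `|c k| <= C / k`!%:R) -> cvgn (pseries c z).
Proof.
move=> cC; apply: normed_cvg.
have C0 : 0 <= C by have := cC 0%N; rewrite divr1; exact: le_trans.
apply: (@series_le_cvg _ _ (fun k => C * exp_coeff `|z| k)) => [k|k|k|].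
- pos.
- pos.
- rewrite /= normrM normrX /exp_coeff/=.
  apply: (@le_trans _ _ (C / k`!%:R * `|z| ^+ k)); first by rewrite ler_wpM2r.
  lra.
- exact: (@is_cvg_seriesZ _ _ C (is_cvg_series_exp_coeff `|z|)).
Qed.

End PowerSeries.
Arguments psum_scale {R c z s} a _.

Section Bessel.
Variable R : realType.
Implicit Types (nu x y z n : R) (k : nat).

(* [y^(nu+1/2) bes nu (y^2/4)] is [2^nu Gamma(nu+1) sqrt y I_nu(y)]. *)
Definition bcoef nu k : R := \prod_(0 <= i < k) (i.+1%:R * (nu + i.+1%:R))^-1.
Definition bes nu z : R := limn (pseries (bcoef nu) z).

Lemma bcoefS nu k : bcoef nu k.+1 = bcoef nu k / (k.+1%:R * (nu + k.+1%:R)).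
Proof. by rewrite /bcoef big_nat_recr. Qed.

Lemma bcoef0 nu : bcoef nu 0 = 1. Proof. by rewrite /bcoef big_geq. Qed.

Let pos nu k : - (1 / 2) <= nu -> 0 < nu + k.+1%:R.
Proof. by move=> h; have : 1 <= k.+1%:R :> R by [rewrite ler1n]; lra. Qed.

Let natp k : 0 < k.+1%:R :> R. Proof. by []. Qed.

Lemma bcoef_gt0 nu k : - (1 / 2) <= nu -> 0 < bcoef nu k.
Proof.
move=> h; elim: k => [|k IH]; first by rewrite bcoef0.
by rewrite bcoefS divr_gt0// mulr_gt0// pos.
Qed.

(** Among the factors [nu + i] only [nu + 1] can be below [1], and it is at least [1/2]; hence the
    constant [2]. *)
Lemma bcoef_le nu k : - (1 / 2) <= nu -> bcoef nu k <= 2 / k`!%:R.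
Proof.
move=> h; elim: k => [|k IH]; first by rewrite bcoef0 divr1 ler1n.
rewrite bcoefS [in X in X <= _]invfM mulrA ler_pdivrMr ?pos//.
have -> : 2 / (k.+1)`!%:R * (nu + k.+1%:R) = 2 / k`!%:R * (nu + k.+1%:R) / k.+1%:R.
  have f0 : k`!%:R != 0 :> R by [].
  by rewrite natrM; field; rewrite gt_eqF.
rewrite ler_wpM2r ?invr_ge0//.
case: k IH => [|k] IH.
  by rewrite bcoef0 fact0; lra.
have k2 : 2 <= k.+2%:R :> R by rewrite ler_nat.
apply: le_trans IH _; rewrite ler_peMr ?divr_ge0//; lra.
Qed.

Lemma bes_psum nu z : - (1 / 2) <= nu -> psum (bcoef nu) z (bes nu z).
Proof.
move=> h; apply: (@psum_cvg _ _ 2) => k.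
by rewrite ger0_norm ?bcoef_le// ltW// bcoef_gt0.
Qed.

Arguments bes_psum {nu} z _.

(** Coefficient form of the rule that differentiation raises the index of the Bessel series by one;
    the second equality expresses the derivative by weights on the original coefficients. *)
Lemma bcoef_nu nu k : - (1 / 2) <= nu -> k.+1%:R * bcoef nu k.+1 = bcoef (nu + 1) k / (nu + 1) /\
  bcoef nu k / (nu + k.+1%:R) = bcoef (nu + 1) k / (nu + 1).
Proof.
move=> h; have e1 : k.+1%:R * bcoef nu k.+1 = bcoef nu k / (nu + k.+1%:R).
  rewrite bcoefS; have := pos k h; have := natp k.
  by move: (bcoef nu k) k.+1%:R => a b b0 c0; field; rewrite !gt_eqF.
rewrite e1; suff : bcoef nu k / (nu + k.+1%:R) = bcoef (nu + 1) k / (nu + 1) by [].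
elim: k {e1} => [|k IH]; first by rewrite !bcoef0.
have p1 := pos k h; have p2 := pos k.+1 h; have p0 := pos 0 h.
rewrite [bcoef nu k.+1]bcoefS [bcoef (nu + 1) k.+1]bcoefS.
have -> : bcoef nu k = bcoef (nu + 1) k / (nu + 1) * (nu + k.+1%:R) by rewrite -IH divfK// gt_eqF.
have -> : nu + 1 + k.+1%:R = nu + k.+2%:R by rewrite -[k.+2%:R]natr1; ring.
move: (bcoef _ k) (natp k) p0 p1 p2; move: k.+1%:R k.+2%:R => a b c a0 p0 p1 p2.
by field; rewrite !gt_eqF.
Qed.

Let le1 nu : - (1 / 2) <= nu -> - (1 / 2) <= nu + 1. Proof. lra. Qed.

Definition bes1 nu z : R := bes (nu + 1) z / (nu + 1).

Lemma bes_dv nu z : - (1 / 2) <= nu -> der z (bes nu) (bes1 nu z).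
Proof.
move=> h; have dE : pseries_diffs (bcoef nu) = fun k => (nu + 1)^-1 * bcoef (nu + 1) k.
  by apply/funext => k; rewrite /pseries_diffs; have [-> _] := bcoef_nu k h; rewrite mulrC.
have dE2 : pseries_diffs (pseries_diffs (bcoef nu)) = fun k => (nu + 1)^-1 * ((nu + 1 + 1)^-1 * bcoef (nu + 1 + 1) k).
  apply/funext => k; rewrite {1}/pseries_diffs dE; have [e _] := bcoef_nu k (le1 h).
  by rewrite mulrCA e [X in _ * X]mulrC.
have p1 := psum_scale (nu + 1)^-1 (bes_psum z (le1 h)).
have -> : bes1 nu z = limn (pseries (pseries_diffs (bcoef nu)) z).
  by rewrite dE; apply/esym/cvg_lim => //; rewrite /bes1 mulrC.
apply: (@pseries_snd_diffs _ _ (`|z| + 1)).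
- by apply/cvg_ex; eexists; exact: bes_psum.
- by rewrite dE; apply/cvg_ex; eexists; apply: psum_scale; apply: bes_psum; lra.
- rewrite dE2; apply/cvg_ex; eexists; apply: psum_scale; apply: psum_scale.
  by apply: bes_psum; do 2 apply: le1.
by rewrite [X in _ < X]ger0_norm ?addr_ge0// ltrDl.
Qed.

Section Identities.
Variables (nu z : R).
Hypothesis h : - (1 / 2) <= nu.
Local Notation M := (bes nu z).
Local Notation M1 := (bes1 nu z).

Lemma psum_m1 : psum (fun k => bcoef nu k / (nu + k.+1%:R)) z M1.
Proof.
have := psum_scale (nu + 1)^-1 (bes_psum z (le1 h)); rewrite mulrC; apply: psum_ext => k.
by have [_ ->] := bcoef_nu k h; rewrite mulrC.
Qed.

Lemma psum_k : psum (fun k => k%:R * bcoef nu k) z (z * M1).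
Proof.
apply: psum_shift psum_m1; first by rewrite mul0r.
by move=> k; have [-> ->] := bcoef_nu k h.
Qed.

Lemma psum_kk : psum (fun k => k%:R * (k%:R + nu) * bcoef nu k) z (z * M).
Proof.
apply: psum_shift (bes_psum z h); first lra.
move=> k; rewrite bcoefS; have := pos k h; have := natp k.
by move: (bcoef nu k) k.+1%:R => a b b0 c0; field; rewrite !gt_eqF.
Qed.

Lemma bes_ode : (nu + 1) * M1 + z * (bes1 (nu + 1) z / (nu + 1)) = M.
Proof.
suff H : psum (bcoef nu) z ((nu + 1) * M1 + z * (bes1 (nu + 1) z / (nu + 1))) by exact: (psum_unique H (bes_psum z h)).
have p1 := psum_scale (nu + 1) psum_m1.
have h' := le1 h; have p0 := pos 0 h.
have p2 : psum (fun k => k%:R / (nu + k.+1%:R) * bcoef nu k) z (z * (bes1 (nu + 1) z / (nu + 1))).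
  apply: (@psum_shift _ (fun k => (nu + 1)^-1 * (bcoef (nu + 1) k / (nu + 1 + k.+1%:R)))).
  - lra.
  - move=> k; have [e _] := bcoef_nu k h; rewrite mulrAC e.
    have -> : nu + 1 + k.+1%:R = nu + k.+2%:R by rewrite -[k.+2%:R]natr1; ring.
    lra.
  rewrite mulrC; apply: psum_scale.
  have := psum_scale (nu + 1 + 1)^-1 (bes_psum z (le1 h')).
  rewrite [X in psum _ _ X]mulrC; apply: psum_ext => k.
  by have [_ ->] := bcoef_nu k h'; rewrite mulrC.
apply: psum_ext (psum_add p1 p2) => k.
have := pos k h; rewrite -[k.+1%:R]natr1; move: (bcoef nu k) k%:R => a b b0.
by field; rewrite gt_eqF.
Qed.

Lemma bes_ge1 : 0 <= z -> 1 <= M.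
Proof.
move=> z0; have H : pseries (bcoef nu) z j @[j --> \oo] --> M by exact: bes_psum.
apply: (cvgr_to_ge H); near=> j.
have j0 : (0 < j)%N by near: j; by [].
rewrite /pseries /series/= big_ltn// bcoef0 mulr1 lerDl; apply: sumr_ge0 => k _.
by rewrite mulr_ge0 ?exprn_ge0// ltW// bcoef_gt0.
Unshelve. all: by end_near. Qed.

(** Nonnegativity of a variance: sum [(k - x)^2] against the positive weights [bcoef nu k z^k], with
    [x = z M1 / M] the mean of [k]. *)
Lemma bes_riccati_le : 0 < z -> z * M1 ^+ 2 + nu * M1 * M <= M ^+ 2.
Proof.
move=> z0; have M0 : 0 < M by apply: lt_le_trans (bes_ge1 (ltW z0)).
pose x := z * M1 / M.
have := psum_add (psum_add psum_kk (psum_scale (- nu - 2 * x) psum_k)) (psum_scale (x ^+ 2) (bes_psum z h)).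
move=> /(psum_ge0 (ltW z0) _) => H.
have {H} : 0 <= z * M + (- nu - 2 * x) * (z * M1) + x ^+ 2 * M.
  apply: H => k; have -> : k%:R * (k%:R + nu) * bcoef nu k + (- nu - 2 * x) * (k%:R * bcoef nu k) + x ^+ 2 * bcoef nu k =
     (k%:R - x) ^+ 2 * bcoef nu k by ring.
  by rewrite mulr_ge0 ?sqr_ge0// ltW// bcoef_gt0.
have -> : z * M + (- nu - 2 * x) * (z * M1) + x ^+ 2 * M = (z / M) * (M ^+ 2 - nu * M1 * M - z * M1 ^+ 2).
  by rewrite /x; field; rewrite gt_eqF.
rewrite pmulr_rge0 ?divr_gt0; lra.
Qed.

Lemma bes1_ge0 : 0 <= z -> 0 <= M1.
Proof.
move=> z0; apply: psum_ge0 psum_m1 => // k.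
by rewrite divr_ge0// ltW ?bcoef_gt0 ?pos.
Qed.

(** The same argument for [1 - x (nu + k + 1)] against the weights [bcoef nu k z^k / (nu + k + 1)],
    with the minimizing [x = M / D]. *)
Lemma bes_riccati_ge : 0 < z -> M ^+ 2 <= z * M1 ^+ 2 + (nu + 1) * M1 * M.
Proof.
move=> z0; have M0 : 0 < M by apply: lt_le_trans (bes_ge1 (ltW z0)).
have m1 := bes1_ge0 (ltW z0); have p0 : 0 < nu + 1 by move: h; lra.
pose D := z * M1 + (nu + 1) * M; have D0 : 0 < D.
  by apply: ltr_wpDl; [apply: mulr_ge0; lra|pos].
pose x := M / D.
have := psum_add psum_m1 (psum_add (psum_scale (- 2 * x + x ^+ 2 * (nu + 1)) (bes_psum z h)) (psum_scale (x ^+ 2) psum_k)).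
move=> /(psum_ge0 (ltW z0) _) => H.
have {H} : 0 <= M1 + ((- 2 * x + x ^+ 2 * (nu + 1)) * M + x ^+ 2 * (z * M1)).
  apply: H => k.
  have -> : bcoef nu k / (nu + k.+1%:R) + ((- 2 * x + x ^+ 2 * (nu + 1)) * bcoef nu k + x ^+ 2 * (k%:R * bcoef nu k)) =
     (1 - x * (nu + k.+1%:R)) ^+ 2 * (bcoef nu k / (nu + k.+1%:R)).
    have := pos k h; rewrite -[k.+1%:R]natr1; move: (bcoef nu k) k%:R => a b b0.
    by field; rewrite gt_eqF.
  by rewrite mulr_ge0 ?sqr_ge0// divr_ge0// ltW ?bcoef_gt0 ?pos.
have -> : M1 + ((- 2 * x + x ^+ 2 * (nu + 1)) * M + x ^+ 2 * (z * M1)) = (M1 * D - M ^+ 2) / D.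
  rewrite /x; have -> : z * M1 = D - (nu + 1) * M by rewrite addrK.
  by move: D0; move: (D) => d d0'; field; rewrite gt_eqF.
by rewrite pmulr_lge0 ?invr_gt0// /D; lra.
Qed.

End Identities.

Lemma bes_at0 nu : - (1 / 2) <= nu -> bes nu 0 = 1.
Proof.
move=> h; suff H : psum (bcoef nu) 0 1 by exact: (psum_unique (bes_psum 0 h) H).
have H2 : (1 : R) @[j --> \oo] --> (1 : R) by exact: cvg_cst.
have E : (fun j => pseries (bcoef nu) 0 j.+1) = fun=> 1.
  apply/funext => j; rewrite /pseries /series/= big_nat_recl//= bcoef0 mulr1 big1 ?addr0// => k _.
  by rewrite expr0n mulr0.
by rewrite /psum -(cvg_shiftS (pseries _ _)) E.
Qed.

(* [n] plays the role of [sqrt z] and [rho = n bes'/bes]. *)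
Lemma bes_ratio nu n : - (1 / 2) <= nu -> 0 < n ->
  1 - (nu + 1) / n <= n * bes1 nu (n ^+ 2) / bes nu (n ^+ 2) <= 1 + 1 / (2 * n).
Proof.
move=> h n0; have z0 : 0 < n ^+ 2 by rewrite exprn_gt0.
have h1 := bes_riccati_le h z0; have h2 := bes_riccati_ge h z0.
have m1 := bes1_ge0 h (ltW z0).
have M0 : 0 < bes nu (n ^+ 2) by apply: lt_le_trans (bes_ge1 h (ltW z0)).
move: (bes nu _) (bes1 nu _) M0 m1 h1 h2 => M M1 M0 m1 h1 h2.
pose rho := n * M1 / M; have r0 : 0 <= rho by rewrite divr_ge0 ?mulr_ge0// ltW.
have e : M1 = rho * M / n by rewrite /rho; field; rewrite !gt_eqF.
have {}h1 : rho ^+ 2 + nu / n * rho <= 1.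
  have MM : 0 < M ^+ 2 by pos.
  rewrite -(ler_pM2r MM) mul1r; apply: le_trans h1; rewrite e le_eqVlt; apply/orP; left; apply/eqP.
  by field; rewrite !gt_eqF.
have {}h2 : 1 <= rho ^+ 2 + (nu + 1) / n * rho.
  have MM : 0 < M ^+ 2 by pos.
  rewrite -(ler_pM2r MM) mul1r; apply: le_trans h2 _; rewrite e le_eqVlt; apply/orP; left; apply/eqP.
  by field; rewrite !gt_eqF.
have i0 : 0 < n^-1 by pos.
have c1 : 0 <= (nu + 1) / n by nra.
rewrite -/rho; apply/andP; split.
  nra.
nra.
Qed.

End Bessel.

(** * The model Bessel equation *)

Section ModelSolution.
Variable R : realType.
Implicit Types (m k x y z : R).

(* The normalized solution of [U'' = (k^2 + (m^2 - m) / x^2) U]. *)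
Definition modU m k x : R := x `^ m * bes (m - 1 / 2) (k ^+ 2 * x ^+ 2 / 4).
Definition modV m k x : R := m * x `^ (m - 1) * bes (m - 1 / 2) (k ^+ 2 * x ^+ 2 / 4) +
  x `^ m * (bes1 (m - 1 / 2) (k ^+ 2 * x ^+ 2 / 4) * (k ^+ 2 * x / 2)).

Let zD k x : der x (fun x => k ^+ 2 * x ^+ 2 / 4) (k ^+ 2 * x / 2).
Proof.
have d := dvM (dv_cst (k ^+ 2) x) (dvX 2 (dv_id x)).
by apply: dv_eq (dvM d (dv_cst 4^-1 x)) _; field.
Qed.

Lemma modU_dv m k x : 0 <= m -> 0 < x -> der x (modU m k) (modV m k x).
Proof.
move=> m0 x0; have h : - (1 / 2) <= m - 1 / 2 by lra.
have d := @dv_comp R (bes (m - 1 / 2)) (fun x => k ^+ 2 * x ^+ 2 / 4) x _ _ (bes_dv _ h) (zD k x).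
by apply: dv_eq (dvM (dv_pow m x0 (dv_id x)) d) _; rewrite /modV; ring.
Qed.

Lemma modV_dv m k x : 0 <= m -> 0 < x ->
  der x (modV m k) ((k ^+ 2 + (m ^+ 2 - m) / x ^+ 2) * modU m k x).
Proof.
move=> m0 x0; have h : - (1 / 2) <= m - 1 / 2 by lra.
have h1 : - (1 / 2) <= m - 1 / 2 + 1 by lra.
have d := @dv_comp R (bes (m - 1 / 2)) (fun x => k ^+ 2 * x ^+ 2 / 4) x _ _ (bes_dv _ h) (zD k x).
have d1 := @dv_comp R (bes (m - 1 / 2 + 1)) (fun x => k ^+ 2 * x ^+ 2 / 4) x _ _ (bes_dv _ h1) (zD k x).
have d2 := dvM d1 (dv_cst (m - 1 / 2 + 1)^-1 x).
have d3 : der x (fun x => k ^+ 2 * x / 2) (k ^+ 2 / 2).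
  by apply: dv_eq (dvM (dvM (dv_cst (k ^+ 2) x) (dv_id x)) (dv_cst 2^-1 x)) _; ring.
have Dv := dvD (dvM (dvM (dv_cst m x) (dv_pow (m - 1) x0 (dv_id x))) d) (dvM (dv_pow m x0 (dv_id x)) (dvM d2 d3)).
apply: dv_eq Dv _; have := bes_ode (k ^+ 2 * x ^+ 2 / 4) h.
rewrite /modU /bes1; set M := bes (m - 1 / 2) _; set M1 := bes (m - 1 / 2 + 1) _; set M2 := bes (_ + 1 + 1) _ => E.
rewrite (_ : m - 1 - 1 = m - 2); last lra.
rewrite powRB1// powRB2//.
have p0 : m - 1 / 2 + 1 != 0 by rewrite gt_eqF; lra.
have p1 : m - 1 / 2 + 1 + 1 != 0 by rewrite gt_eqF; lra.
have x0' : x != 0 by rewrite gt_eqF.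
pose p := m - 1 / 2 + 1; rewrite -/p in E p0 p1 *.
have mp : m = p - 1 / 2 by rewrite /p; field.
clearbody p M M1 M2; rewrite -E mp; move: (x `^ _) => e.
by field; rewrite p0 p1.
Qed.

Lemma modU_gt0 m k x : 0 <= m -> 0 < x -> 0 < modU m k x.
Proof.
move=> m0 x0; rewrite mulr_gt0 ?powR_gt0//; apply: (@lt_le_trans _ _ 1) => //.
by apply: bes_ge1; [lra|rewrite divr_ge0// mulr_ge0// sqr_ge0].
Qed.

Lemma bes_cvg0 m k : 0 <= m -> bes (m - 1 / 2) (k ^+ 2 * x ^+ 2 / 4) @[x --> 0^'+] --> (1 : R).
Proof.
move=> m0; have h : - (1 / 2) <= m - 1 / 2 by lra.
have d := @dv_comp R (bes (m - 1 / 2)) (fun x => k ^+ 2 * x ^+ 2 / 4) 0 _ _ (bes_dv _ h) (zD k 0).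
have c := dv_cont d.
have e : bes (m - 1 / 2) (k ^+ 2 * 0 ^+ 2 / 4) = 1.
  by rewrite expr0n mulr0 mul0r bes_at0.
by rewrite -[X in _ --> X]e; apply: cvg_at_right_filter.
Qed.

(** For [m = k = 1] the model equation is [U'' = U] with data [0] and [1] at [0]; both
    [(V + U) exp (- x)] and [(V - U) exp x] are constant, and [U] is the hyperbolic sine. *)
Lemma bes_half y : 0 < y -> y * bes (1 / 2) (y ^+ 2 / 4) = (expR y - expR (- y)) / 2.
Proof.
move=> y0; pose U x := modU 1 1 x; pose V x := modV 1 1 x.
have dU x : 0 < x -> der x U (V x) by move=> x0; apply: modU_dv.
have dV x : 0 < x -> der x V (U x).
  by move=> x0; apply: dv_eq (modV_dv 1 _ x0) _ => //; rewrite expr1n subrr mul0r addr0 mul1r.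
have dE (x : R) : der x (fun x => expR x) (expR x) by exact: is_derive_expR.
have dE' (x : R) : der x (fun x => expR (- x)) (- expR (- x)).
  by apply: dv_eq (dv_exp (dvN (dv_id x))) _; rewrite mulrN1.
have U0 : U x @[x --> 0^'+] --> (0 : R).
  have H : x `^ 1 * bes (1 - 1 / 2) (1 ^+ 2 * x ^+ 2 / 4) @[x --> 0^'+] --> (0 * 1 : R).
    by apply: cvgM; [apply: powR_cvg0|exact: bes_cvg0].
  by rewrite mul0r in H.
have V0 : V x @[x --> 0^'+] --> (1 : R).
  have H : 1 * bes (1 - 1 / 2) (1 ^+ 2 * x ^+ 2 / 4) + x `^ 1 * (bes1 (1 - 1 / 2) (1 ^+ 2 * x ^+ 2 / 4) * (1 ^+ 2 * x / 2)) @[x --> 0^'+] -->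
     (1 * 1 + 0 * (bes1 (1 - 1 / 2) (1 ^+ 2 * 0 ^+ 2 / 4) * (1 ^+ 2 * 0 / 2)) : R).
    apply: cvgD; first by apply: cvgMr; exact: bes_cvg0.
    apply: cvgM; first exact: powR_cvg0.
    have h1 : - (1 / 2) <= (1 - 1 / 2 + 1 : R) by lra.
    apply: cvgM.
      apply: cvgMl; apply: cvg_at_right_filter.
      exact: dv_cont (@dv_comp R (bes (1 - 1 / 2 + 1)) (fun x => 1 ^+ 2 * x ^+ 2 / 4) 0 _ _ (bes_dv _ h1) (zD 1 0)).
    by apply: cvgMl; apply: cvgMr; apply: cvg_at_right_filter.
  have e11 : (1 : R) * 1 = 1 by rewrite mulr1.
  rewrite mul0r addr0 e11 in H; have b01 : (0 : R) < 1 by [].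
  apply: (cvg_right_eq b01 _ H) => x /andP[x0 _].
  by rewrite /V /modV subrr powRr0 mulr1.
have const (f : R -> R) (c : R) : (forall x, 0 < x -> der x f 0) -> f x @[x --> 0^'+] --> c -> f y = c.
  move=> df fc; have y1 : 0 < y + 1 by rewrite addr_gt0.
  apply: (@right_lim_cst R 0 (y + 1) f (f y) c y1 _ fc) => x xI.
  apply: (@dv_const R 0 (y + 1) f) => //; last by rewrite y0 ltrDl ltr01.
  by move=> z /andP[z0 _]; exact: df.
have E0 : expR x @[x --> 0^'+] --> (1 : R).
  by rewrite -[X in _ --> X]expR0; apply: cvg_at_right_filter; exact: dv_cont (dE 0).
have E0' : expR (- x) @[x --> 0^'+] --> (1 : R).
  by rewrite -[X in _ --> X]expR0 -[X in expR X]oppr0; apply: cvg_at_right_filter; exact: dv_cont (dE' 0).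
have h1 : (V y + U y) * expR (- y) = 1.
  apply: (const (fun x => (V x + U x) * expR (- x))) => [x x0|].
    by apply: dv_eq (dvM (dvD (dV x x0) (dU x x0)) (dE' x)) _; ring.
  have H : (V x + U x) * expR (- x) @[x --> 0^'+] --> (1 + 0) * (1 : R) by apply: cvgM => //; exact: cvgD.
  by rewrite addr0 mulr1 in H.
have h2 : (V y - U y) * expR y = 1.
  apply: (const (fun x => (V x - U x) * expR x)) => [x x0|].
    by apply: dv_eq (dvM (dvD (dV x x0) (dvN (dU x x0))) (dE x)) _; ring.
  have H : (V x - U x) * expR x @[x --> 0^'+] --> (1 - 0) * (1 : R) by apply: cvgM => //; exact: cvgB.
  by rewrite subr0 mulr1 in H.
have ee : expR (- y) * expR y = 1 by rewrite -expRD addNr expR0.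
have k1 : V y + U y = expR y.
  by rewrite -[LHS]mulr1 -ee mulrA h1 mul1r.
have k2 : V y - U y = expR (- y).
  by rewrite -[LHS]mulr1 -ee [_ * expR y]mulrC mulrA h2 mul1r.
have -> : y * bes (1 / 2) (y ^+ 2 / 4) = U y.
  rewrite /U /modU powRr1 ?ltW// expr1n; congr (_ * bes _ _); lra.
lra.
Qed.

End ModelSolution.

(** * Asymptotics of the Bessel series *)

Section BesselAsymptotics.
Variable R : realType.
Implicit Types (nu s n : R) (k j : nat).

(** With [y = 2 n] this is the asymptotic form [exp y / sqrt (2 pi y)] of the modified Bessel
    function [I_nu (y)], with a relative error of order [1 / n]. *)
Definition bes_asymp nu := exists2 C, 0 <= C & forall n, 1 <= n ->
  `|bes nu (n ^+ 2) * n `^ (nu + 1 / 2) * expR (- (2 * n)) - gam (nu + 1) / (2 * Num.sqrt pi)| <= C / n.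

Lemma sqrt_pi_gt0 : 0 < Num.sqrt pi :> R.
Proof. by rewrite sqrtr_gt0 pi_gt0. Qed.

Lemma bcoef_Gamma nu k : - (1 / 2) <= nu -> bcoef nu k * gam (nu + 1 + k%:R) = gam (nu + 1) / k`!%:R.
Proof.
move=> h; elim: k => [|k IH]; first by rewrite bcoef0 addr0 mul1r divr1.
have k0 : 0 <= k%:R :> R by [].
have p0 : 0 < nu + k.+1%:R by lra.
have -> : nu + 1 + k.+1%:R = (nu + 1 + k%:R) + 1 by rewrite -natr1; ring.
rewrite Gamma_rec; last lra.
have -> : nu + 1 + k%:R = nu + k.+1%:R by rewrite -natr1; ring.
have {}IH : bcoef nu k * gam (nu + k.+1%:R) = gam (nu + 1) / k`!%:R.
  by rewrite -IH; congr (_ * gam _); ring.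
rewrite bcoefS factS natrM.
have f0 : k`!%:R != 0 :> R by [].
have k1 : k.+1%:R != 0 :> R by [].
move: IH f0 k1 p0; move: (k.+1%:R) (k`!%:R) (gam (nu + 1)) (gam (nu + k.+1%:R)) (bcoef nu k) => K f g b a IH f0 k1 p0.
transitivity (a * b / K); first by field; rewrite k1 gt_eqF.
by rewrite IH; field; rewrite f0.
Qed.

(** The ratio of the coefficients of indices [nu] and [1/2] is, up to a constant, a ratio of Gamma
    values at arguments [s <= 1] apart, which [Gamma_young] bounds from both sides. The bounds are
    polynomials in [k] of degree at most two, so that they can be summed in closed form. *)
Lemma bcoef_sandwich nu k n : - (1 / 2) <= nu <= 1 / 2 -> 0 < n ->
  let s := 1 / 2 - nu in let c := gam (nu + 1) / gam (1 / 2 + 1) * n `^ (s - 1) in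
  c * ((nu + 1 + k%:R) * (2 - ((1 - s) * (k%:R + 3 / 2) + s * n) / n)) * bcoef (1 / 2) k <= bcoef nu k /\
  bcoef nu k <= c * (s * (nu + 1 + k%:R) + (1 - s) * n) * bcoef (1 / 2) k.
Proof.
move=> /andP[h1 h2] n0 s c; have k0 : 0 <= k%:R :> R by [].
pose a := nu + 1 + k%:R; have a12 : 1 / 2 <= a by rewrite /a; lra.
have as12 : 1 / 2 <= a + s by rewrite /s; lra.
have Ga := Gamma_pos a12; have Gb := Gamma_pos as12.
have G0 : 0 < gam (nu + 1) by apply: Gamma_pos; lra.
have G1 : 0 < gam (1 / 2 + 1) :> R by apply: Gamma_pos; lra.
have hh : - (1 / 2) <= (1 / 2 : R) by lra.
have e1 := bcoef_Gamma k h1; have e2 := bcoef_Gamma k hh.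
have es : 1 / 2 + 1 + k%:R = a + s by rewrite /a /s; lra.
rewrite es in e2; rewrite -/a in e1.
have b0 := bcoef_gt0 k hh.
have key : bcoef nu k = gam (nu + 1) / gam (1 / 2 + 1) * (gam (a + s) / gam a) * bcoef (1 / 2) k.
  have -> : bcoef nu k = gam (nu + 1) / k`!%:R / gam a by rewrite -e1 mulfK// gt_eqF.
  have -> : bcoef (1 / 2) k = gam (1 / 2 + 1) / k`!%:R / gam (a + s) by rewrite -e2 mulfK// gt_eqF.
  move: (gam (nu + 1)) (gam (1 / 2 + 1)) (gam a) (gam (a + s)) G0 G1 Ga Gb => g0 g1 ga gb *.
  by field; rewrite !gt_eqF.
have c0 : 0 < gam (nu + 1) / gam (1 / 2 + 1) by pos.
rewrite -/a key /c; set g := gam (nu + 1) / _ in c0 *.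
split; rewrite ler_wpM2r ?(ltW b0)// -mulrA ler_wpM2l ?(ltW c0)//; last first.
  by rewrite ler_pdivrMr//; apply: Gamma_young; rewrite /s; lra.
have s01 : 0 <= 1 - s <= 1 by rewrite /s; lra.
have := Gamma_young as12 n0 s01.
have -> : a + s + (1 - s) = a + 1 by ring.
rewrite Gamma_rec// (_ : 1 - s - 1 = - s); last lra.
rewrite (_ : 1 - (1 - s) = s); last lra.
have -> : k%:R + 3 / 2 = a + s by rewrite -es; lra.
set D := (1 - s) * (a + s) + s * n => H.
have D0 : 0 < D.
  have /andP[s0 s1] := s01; have [s2|s2] := eqVneq s 0.
    by rewrite /D s2; lra.
  by rewrite ltr_wpDl ?mulr_ge0 ?mulr_gt0 ?s2//; lra.
rewrite ler_pdivlMr//.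
have ns : n `^ (- s) = (n `^ s)^-1 by rewrite powRN.
have p0 := powR_gt0 s n0.
have {}H : a * gam a * n `^ s <= D * gam (a + s).
  rewrite ns in H; have := ler_wpM2r (ltW p0) H.
  have -> : (n `^ s)^-1 * D * gam (a + s) * n `^ s = D * gam (a + s) by field; rewrite gt_eqF.
  by [].
have a0 : 0 < a by lra.
(* The tangent inequality [2 - y <= 1 / y] replaces the reciprocal of [D], which is affine in [k],
   by a polynomial; it loses little since [D] is close to [n] when [k] is. *)
have tan : 2 - D / n <= n / D.
  rewrite -subr_ge0; have -> : n / D - (2 - D / n) = (n - D) ^+ 2 / (n * D) by field; rewrite !gt_eqF.
  by rewrite divr_ge0 ?sqr_ge0// ltW// mulr_gt0.
rewrite powRB1//.
have -> : n `^ s / n * (a * (2 - D / n)) * gam a = (n `^ s * a * gam a / n) * (2 - D / n) by ring.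
apply: (@le_trans _ _ ((n `^ s * a * gam a / n) * (n / D))).
  by rewrite ler_wpM2l// !mulr_ge0 ?invr_ge0 ?ltW.
have -> : n `^ s * a * gam a / n * (n / D) = a * gam a * n `^ s / D by field; rewrite !gt_eqF.
by rewrite ler_pdivrMr// [leRHS]mulrC.
Qed.

(** The terms of [bes (1/2) (n^2)] concentrate around [k = n], where the two bounds of
    [bcoef_sandwich] agree to leading order, so summing them gives a comparison with relative error
    [9 / n]. *)
Lemma bes_compare nu n : - (1 / 2) <= nu <= 1 / 2 -> 1 <= n ->
  let g := gam (nu + 1) / gam (1 / 2 + 1) in let s := 1 / 2 - nu in
  `|bes nu (n ^+ 2) - g * n `^ s * bes (1 / 2) (n ^+ 2)| <= 9 / n * (g * n `^ s * bes (1 / 2) (n ^+ 2)).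
Proof.
move=> h n1 /=; set g := gam (nu + 1) / _; set s := 1 / 2 - nu; have /andP[h1 h2] := h; have n0 : 0 < n by lra.
have hh : - (1 / 2) <= (1 / 2 : R) by lra.
pose z := n ^+ 2; have z0 : 0 < z by rewrite exprn_gt0.
have G0 : 0 < gam (nu + 1) by apply: Gamma_pos; lra.
have G1 : 0 < gam (1 / 2 + 1) :> R by apply: Gamma_pos; lra.
have g0 : 0 < g by rewrite divr_gt0.
pose M := bes (1 / 2) z; have M0 : 0 < M by apply: lt_le_trans (bes_ge1 hh (ltW z0)).
(* The mean of the index [k] under the weights [bcoef (1/2) k z^k]; the bounds on [bes_ratio] place
   it between [n - 3/2] and [n + 1/2]. *)
pose b := n * bes1 (1 / 2) z / M * n.
have bM : z * bes1 (1 / 2) z = b * M by rewrite /b /z; field; rewrite gt_eqF.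
have /andP[r1 r2] := bes_ratio hh n0; rewrite -/z -/M in r1 r2.
have b1 : n - 3 / 2 <= b.
  have := ler_wpM2r (ltW n0) r1; rewrite -/b mulrBl divfK; lra.
have b2 : b <= n + 1 / 2.
  have := ler_wpM2r (ltW n0) r2; rewrite -/b mulrDl.
  have -> : 1 / (2 * n) * n = 1 / 2 by field; rewrite gt_eqF.
  lra.
pose c := g * n `^ (s - 1); have c0 : 0 < c by rewrite mulr_gt0 ?powR_gt0.
have cn : c * n = g * n `^ s by rewrite /c powRB1// -mulrA divfK ?gt_eqF.
have P0 := @bes_psum R _ z hh; have P1 := @psum_k R _ z hh; have P2 := @psum_kk R _ z hh.
rewrite bM -/M in P0 P1 P2.
have s01 : 0 <= s <= 1 by rewrite /s; lra.
have up : bes nu z <= c * (s * (b * M) + (s * (nu + 1) + (1 - s) * n) * M).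
  apply: (psum_le (ltW z0) _ (@bes_psum R _ z h1) (psum_scale c (psum_add (psum_scale s P1) (psum_scale (s * (nu + 1) + (1 - s) * n) P0)))) => k.
  have [_ u] := bcoef_sandwich k h n0; apply: le_trans u _.
  by apply: le_of_eq; rewrite /c /g /s; ring.
pose al := nu + 1; pose sg := 1 - s.
have lo : c * (- (sg / n) * (z * M) + ((1 + sg - sg / n * (al + 1)) * (b * M) + (al * (1 + sg) - sg / n * (3 / 2 * al)) * M)) <= bes nu z.
  apply: (psum_le (ltW z0) _ (psum_scale c (psum_add (psum_scale (- (sg / n)) P2) (psum_add (psum_scale (1 + sg - sg / n * (al + 1)) P1) (psum_scale (al * (1 + sg) - sg / n * (3 / 2 * al)) P0)))) (@bes_psum R _ z h1)) => k.
  have [l _] := bcoef_sandwich k h n0; apply: le_trans l.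
  apply: le_of_eq; rewrite /c /g /al /sg /s; move: (bcoef _ k) => B.
  by field; rewrite !gt_eqF.
have -> : g * n `^ s * M = c * (n * M) by rewrite -cn; ring.
have -> : 9 / n * (c * (n * M)) = c * (9 * M) by field; rewrite gt_eqF.
rewrite -/z ler_norml; apply/andP; split.
  rewrite lerBrDr; apply: le_trans lo; rewrite addrC -mulrN -mulrDr ler_wpM2l ?(ltW c0)//.
  have -> : z * M = n * (n * M) by rewrite /z; ring.
  have -> : - (sg / n) * (n * (n * M)) + ((1 + sg - sg / n * (al + 1)) * (b * M) + (al * (1 + sg) - sg / n * (3 / 2 * al)) * M) =
     (- sg * n + (1 + sg) * (b + al) - sg / n * ((al + 1) * b + 3 / 2 * al)) * M by field; rewrite gt_eqF.
  have -> : n * M + - (9 * M) = (n - 9) * M by ring.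
  rewrite ler_wpM2r ?(ltW M0)//.
  have sg0 : 0 <= sg by rewrite /sg; lra.
  have sg1 : sg <= 1 by rewrite /sg; lra.
  have al0 : 1 / 2 <= al by rewrite /al; lra.
  have al1 : al <= 3 / 2 by rewrite /al; lra.
  have t1 : sg / n * ((al + 1) * b + 3 / 2 * al) <= 6.
    have t2 : (al + 1) * b + 3 / 2 * al <= 6 * n.
      have : (al + 1) * b <= (al + 1) * (n + 1 / 2) by nra.
      have : (al + 1) * (n + 1 / 2) <= 5 / 2 * (n + 1 / 2) by nra.
      lra.
    have t3 : 0 <= sg / n by pos.
    apply: le_trans (ler_wpM2l t3 t2) _.
    have -> : sg / n * (6 * n) = 6 * sg by field; rewrite gt_eqF.
    lra.
  have t4 : (1 + sg) * (n - 1) <= (1 + sg) * (b + al) by nra.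
  lra.
rewrite lerBlDr; apply: le_trans up _; rewrite -mulrDr ler_wpM2l ?(ltW c0)//.
have -> : s * (b * M) + (s * (nu + 1) + (1 - s) * n) * M = (s * (b + nu + 1) + (1 - s) * n) * M by ring.
have -> : 9 * M + n * M = (9 + n) * M by ring.
rewrite ler_wpM2r ?(ltW M0)//.
nra.
Qed.

Lemma bes_asymp_base nu : - (1 / 2) <= nu <= 1 / 2 -> bes_asymp nu.
Proof.
move=> h; have /andP[h1 h2] := h.
have G0 : 0 < gam (nu + 1) by apply: Gamma_pos; lra.
have sp := sqrt_pi_gt0.
have G1 : gam (1 / 2 + 1) = Num.sqrt pi / 2 :> R.
  by rewrite Gamma_rec// Gamma_half; lra.
pose K := gam (nu + 1) / (2 * Num.sqrt pi); have K0 : 0 < K by rewrite divr_gt0// mulr_gt0.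
(* [9 K / n] comes from the comparison with index [1/2], and [K / n] from [exp (- 4 n) <= 1 / n] in
   the hyperbolic sine. *)
exists (10 * K); first by rewrite mulr_ge0// ltW.
move=> n n1; have n0 : 0 < n by lra.
have := bes_compare h n1; rewrite /= G1.
set s := 1 / 2 - nu; set M := bes (1 / 2) _.
pose E := expR (- (2 * n)); have E0 : 0 < E by exact: expR_gt0.
have nM : n * M * E = (1 - E ^+ 2) / 4.
  have y0 : 0 < 2 * n by lra.
  have := bes_half y0; have -> : (2 * n) ^+ 2 / 4 = n ^+ 2 by field.
  rewrite -/M => H; have -> : n * M * E = (2 * n * M) * E / 2 by field.
  have eE : expR (2 * n) * E = 1 by rewrite -expRD subrr expR0.
  rewrite H -/E; have -> : (expR (2 * n) - E) / 2 * E / 2 = (expR (2 * n) * E - E ^+ 2) / 4 by field.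
  by rewrite eE.
have p0 := powR_gt0 (nu + 1 / 2) n0.
have ps : n `^ s * n `^ (nu + 1 / 2) = n.
  by rewrite -powR_add// (_ : s + (nu + 1 / 2) = 1) ?powRr1 ?ltW// /s; lra.
have E2 : E ^+ 2 <= 1 / n.
  have : E <= 1 / (1 + 2 * n).
    rewrite /E expRN -div1r ler_pdivrMr ?expR_gt0// mulrC mulrA mulr1 ler_pdivlMr; last by lra.
    by rewrite mul1r; exact: expR_ge1Dx.
  have e1 : E <= 1 by rewrite /E -[leRHS]expR0 ler_expR; lra.
  move=> e2; have : E ^+ 2 <= E by rewrite expr2 ler_piMl// ltW.
  have : 1 / (1 + 2 * n) <= 1 / n by rewrite !div1r lef_pV2 ?posrE//; move: e2 e1 ps p0 nM E0 n0 n1; glra.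
  lra.
have E20 : 0 <= E ^+ 2 by exact: sqr_ge0.
move=> H; pose T := bes nu (n ^+ 2) * n `^ (nu + 1 / 2) * E.
have {H} H : `|T - K * (1 - E ^+ 2)| <= 9 / n * (K * (1 - E ^+ 2)).
  have pE : 0 <= n `^ (nu + 1 / 2) * E by pos.
  have := ler_wpM2r pE H; rewrite -[X in `|_| * X](ger0_norm pE) -normrM.
  have e : gam (nu + 1) / (Num.sqrt pi / 2) * n `^ s * M * (n `^ (nu + 1 / 2) * E) = K * (1 - E ^+ 2).
    transitivity (gam (nu + 1) / (Num.sqrt pi / 2) * (n `^ s * n `^ (nu + 1 / 2)) * M * E); first by ring.
    rewrite ps; transitivity (gam (nu + 1) / (Num.sqrt pi / 2) * (n * M * E)); first by ring.
    by rewrite nM /K; field; rewrite gt_eqF.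
  rewrite mulrBl e -[leRHS]mulrA e.
  by rewrite (_ : bes nu (n ^+ 2) * (n `^ (nu + 1 / 2) * E) = T)// /T mulrA.
have -> : T - K = (T - K * (1 - E ^+ 2)) + - (K * E ^+ 2) by ring.
tri; rewrite normrN (ger0_norm (_ : 0 <= K * E ^+ 2)); last by rewrite mulr_ge0// ltW.
have k1 : K * E ^+ 2 <= K / n.
  nra.
have k2 : 9 / n * (K * (1 - E ^+ 2)) <= 9 / n * K.
  rewrite ler_wpM2l ?divr_ge0 ?(ltW n0)// ler_piMr; move: k1 H E20 E2 ps p0 nM E0 n0 n1 K0 G1; glra.
move: k2 k1 H; glra.
Qed.

(** The series of index [nu + 1] is [nu + 1] times the derivative of that of index [nu], and
    [bes_ratio] gives [n bes' / bes = 1 + O (1 / n)]; the factor [nu + 1] is the one in the Gamma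
    recursion. *)
Lemma bes_asympS nu : - (1 / 2) <= nu -> bes_asymp nu -> bes_asymp (nu + 1).
Proof.
move=> h [C C0 HC]; have p0 : 0 < nu + 1 by lra.
have G0 : 0 < gam (nu + 1) by apply: Gamma_pos; lra.
have sp := sqrt_pi_gt0.
pose K := gam (nu + 1) / (2 * Num.sqrt pi); have K0 : 0 < K by rewrite divr_gt0// mulr_gt0.
have n2 : 0 <= nu + 2 by lra.
exists ((nu + 1) * (2 * C + K * (nu + 2))); first by rewrite mulr_ge0 ?(ltW p0)// addr_ge0// mulr_ge0// ltW.
move=> n n1; have n0 : 0 < n by lra.
have h' : 1 / 2 <= nu + 1 by lra.
have := HC n n1; rewrite -/K; set T := bes nu _ * _ * _ => HT.
have /andP[r1 r2] := bes_ratio h n0.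
pose M := bes nu (n ^+ 2).
have M0 : 0 < M by apply: lt_le_trans (bes_ge1 h (sqr_ge0 n)).
set rho := n * bes1 _ _ / _ in r1 r2.
have -> : bes (nu + 1) (n ^+ 2) * n `^ (nu + 1 + 1 / 2) * expR (- (2 * n)) = (nu + 1) * (rho * T).
  have -> : nu + 1 + 1 / 2 = (nu + 1 / 2) + 1 by ring.
  rewrite powR_add// powRr1 ?ltW// /T /rho /bes1 -/M.
  by field; rewrite !gt_eqF.
rewrite Gamma_rec// -[(nu + 1) * gam _ / _]mulrA -/K -mulrBr normrM (ger0_norm (ltW p0)).
rewrite -[leRHS]mulrA ler_wpM2l ?(ltW p0)//.
have i0 : 0 < n^-1 by pos.
have in1 : n^-1 <= 1 by rewrite invf_le1.
have rr : `|rho - 1| <= (nu + 2) / n.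
  rewrite ler_norml mulrDl; apply/andP; split; first by rewrite mulrDl in r1; move: in1 i0 r2 r1 M0; glra.
  lra.
have rb : `|rho| <= 2.
  have rho0 : 0 <= rho.
    by apply: divr_ge0; [apply: mulr_ge0; [exact: ltW|exact: (bes1_ge0 h (sqr_ge0 n))]|exact: ltW].
  rewrite ger0_norm//; move: rho0 rr in1 i0 r2; glra.
have -> : rho * T - K = rho * (T - K) + K * (rho - 1) by ring.
tri.
rewrite [X in X + _ <= _]normrM [X in _ + X <= _]normrM (ger0_norm (ltW K0)) mulrDl -[2 * C / n]mulrA -[K * _ / n]mulrA.
by apply: lerD; [exact: ler_pM|rewrite ler_wpM2l// ltW].
Qed.

Lemma bes_asympP nu : - (1 / 2) <= nu -> bes_asymp nu.
Proof.
move=> h; pose j := Num.truncn (nu + 1 / 2).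
have nu0 : 0 <= nu + 1 / 2 by lra.
have /andP[j1 j2] := truncn_itv nu0.
have : - (1 / 2) <= nu - j%:R <= 1 / 2.
  have j1' : j%:R <= nu + 1 / 2 by exact: j1.
  have j2' : nu + 1 / 2 < j%:R + 1 by lra.
  lra.
have -> : nu = nu - j%:R + j%:R by rewrite subrK.
rewrite addrK; move: (nu - j%:R) => mu hmu; have /andP[m1 m2] := hmu.
elim: (j) => [|i IH]; first by rewrite addr0; exact: bes_asymp_base.
rewrite -natr1 addrA; apply: bes_asympS => //.
by have : 0 <= i%:R :> R by [exact: ler0n]; lra.
Qed.

End BesselAsymptotics.

(** * Estimates for the model solution *)

Section ModelBounds.
Variable R : realType.
Implicit Types (m k x y a s : R).

(** The lower bound for the logarithmic derivative interpolates between [m / x] for small [k x] and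
    growth at rate [k] for large [k x]; it is what lets the weight [modU^2] absorb the
    perturbation. *)
Lemma modV_ge m k x : 0 <= m -> 0 < k -> 0 < x ->
  (m / x + k * (k * x / (k * x + (2 * m + 2)))) * modU m k x <= modV m k x.
Proof.
move=> m0 k0 x0; have h : - (1 / 2) <= m - 1 / 2 by lra.
pose n := k * x / 2; have n0 : 0 < n by rewrite divr_gt0// mulr_gt0.
have z0 : 0 < n ^+ 2 by pos.
have zE : k ^+ 2 * x ^+ 2 / 4 = n ^+ 2 by rewrite /n; field.
have c2 := bes_riccati_ge h z0; have /andP[_ r2] := bes_ratio h n0.
rewrite /modU /modV zE; have b1 := bes1_ge0 h (ltW z0).
have M0 : 0 < bes (m - 1 / 2) (n ^+ 2) by apply: lt_le_trans (bes_ge1 h (ltW z0)).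
move: (bes _ _) (bes1 _ _) c2 r2 b1 M0 => M M1 c2 r2 b1 M0.
have nm : 0 < n + (m + 1) by lra.
have key : M <= (n + (m + 1)) * M1.
  have r3 : n * M1 <= (1 + 1 / (2 * n)) * M by rewrite -ler_pdivrMr.
  have r4 : n ^+ 2 * M1 ^+ 2 <= (n + 1 / 2) * M * M1.
    have := ler_wpM2l (ltW n0) (ler_wpM2r b1 r3).
    have -> : n * ((1 + 1 / (2 * n)) * M * M1) = (n + 1 / 2) * M * M1 by field; rewrite gt_eqF.
    lra.
  nra.
have e0 := powR_gt0 m x0.
rewrite powRB1// mulrDl.
have -> : m * (x `^ m / x) * M = m / x * (x `^ m * M) by field; rewrite gt_eqF.
rewrite lerD2l.
have -> : k * (k * x / (k * x + (2 * m + 2))) * (x `^ m * M) = x `^ m * (k * n) * (M / (n + (m + 1))).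
  have D1 : k * x + (2 * m + 2) != 0 by rewrite gt_eqF; have := mulr_gt0 k0 x0; move: h; glra.
  have D3 : k * x / 2 + (m + 1) = (k * x + (2 * m + 2)) / 2 by field.
  by rewrite /n D3; move: D1; move: (k * x + (2 * m + 2)) => D D1; field.
have -> : x `^ m * (M1 * (k ^+ 2 * x / 2)) = x `^ m * (k * n) * M1 by rewrite /n; ring.
by apply: ler_wpM2l; [rewrite !mulr_ge0// ltW|rewrite ler_pdivrMr// mulrC].
Qed.

Lemma modU_ge m k x : 0 <= m -> 0 < x -> x `^ m <= modU m k x.
Proof.
move=> m0 x0; rewrite -[leLHS]mulr1 ler_wpM2l ?powR_ge0//.
by apply: bes_ge1; [lra|rewrite divr_ge0// mulr_ge0// sqr_ge0].
Qed.

Definition besK m : R := 2 `^ m * gam (m + 1 / 2) / (2 * Num.sqrt pi).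

Lemma modUV_half m : 0 <= m -> exists2 C, 0 <= C & forall k, 4 <= k ->
  `|modU m k (1 / 2) * k `^ m * expR (- (k / 2)) - besK m| <= C / k /\
  `|modV m k (1 / 2) / (k * modU m k (1 / 2)) - 1| <= C / k.
Proof.
move=> m0; have h : - (1 / 2) <= m - 1 / 2 by lra.
have [C C0 HC] := bes_asympP h.
exists (2 `^ m * (4 * C) + (6 * m + 6)) => [|k k4]; first pos.
pose n := k / 4; have n1 : 1 <= n by rewrite /n; lra.
have n0 : 0 < n by lra.
have k0 : 0 < k by lra.
have zE : k ^+ 2 * (1 / 2) ^+ 2 / 4 = n ^+ 2 by rewrite /n; field.
have p2 := powR_gt0 m (ltr0n R 2).
split.
  have -> : modU m k (1 / 2) * k `^ m * expR (- (k / 2)) - besK m =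
     2 `^ m * (bes (m - 1 / 2) (n ^+ 2) * n `^ (m - 1 / 2 + 1 / 2) * expR (- (2 * n)) - gam (m - 1 / 2 + 1) / (2 * Num.sqrt pi)).
    rewrite /modU /besK zE subrK (_ : m - 1 / 2 + 1 = m + 1 / 2); last lra.
    have -> : 2 * n = k / 2 by rewrite /n; field.
    have pE : (1 / 2) `^ m * k `^ m = 2 `^ m * n `^ m.
      by rewrite -!powRM//; [congr (_ `^ _); rewrite /n; field|lra|lra].
    move: pE; move: (bes _ _) (expR _) (gam _) (2 * Num.sqrt pi)^-1 ((1 / 2) `^ m) (k `^ m) (2 `^ m) (n `^ m) => B E G S a b c f pE.
    by transitivity ((a * b) * B * E - c * G * S); [ring|rewrite pE; ring].
  rewrite normrM (gtr0_norm p2).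
  have h1 := HC n n1.
  have h2 : 0 <= (6 * m + 6) / k by pos.
  have := ler_wpM2l (ltW p2) h1.
  have -> : 2 `^ m * (C / n) = 2 `^ m * (4 * C) / k by rewrite /n; field; rewrite gt_eqF.
  lra.
have M0 : 0 < bes (m - 1 / 2) (n ^+ 2) by apply: lt_le_trans (bes_ge1 h (sqr_ge0 n)).
have /andP[r1 r2] := bes_ratio h n0.
have -> : modV m k (1 / 2) / (k * modU m k (1 / 2)) = 2 * m / k + n * bes1 (m - 1 / 2) (n ^+ 2) / bes (m - 1 / 2) (n ^+ 2).
  rewrite /modU /modV zE powRB1// /n; field; rewrite !gt_eqF//.
have e1 : (m - 1 / 2 + 1) / n = (4 * m + 2) / k by rewrite /n; field; rewrite gt_eqF.
have e2 : 1 / (2 * n) = 2 / k by rewrite /n; field; rewrite gt_eqF.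
rewrite e1 in r1; rewrite e2 in r2.
have q1 : 0 <= 2 `^ m * (4 * C) / k by pos.
rewrite [leRHS]mulrDl ler_norml; apply/andP.
lra.
Qed.

End ModelBounds.

(** * Normalized solutions for large negative spectral parameter *)

Section Asymptotics.
Variables (R : realType) (q : R -> R) (m d al : R).
Implicit Types (k x y a s : R).
Hypothesis qs : sing_pot m d al q.

Let b0 : (0 : R) < 3 / 4. Proof. lra. Qed.
Let m0 : 0 <= m. Proof. by case: qs. Qed.
Let d0 : 0 < d. Proof. by case: qs => _ []. Qed.
Let s0 : 0 < d + 2 * m - 1. Proof. by case: qs => _ []. Qed.
Let x1 x : 0 < x < 3 / 4 -> 0 < x < 1. Proof. lra. Qed.

Let p x := q x - (m ^+ 2 - m) / x ^+ 2.

(** [a] is small enough for the denominator of [g] not to spoil the monotonicity of the majorant,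
    [c] is the gain then left in [key_ineq], and [e < d] is the power of [k] gained by the
    perturbation. *)
Let a : R := Num.min 1 ((d + 2 * m - 1) / (4 * (2 * m + 2))).
Let c : R := Num.min ((d + 2 * m - 1) / 2) 1.
Let e : R := Num.min d 1 / 2.

Let a_gt0 : 0 < a.
Proof. by rewrite lt_min divr_gt0//; move: m0; lra. Qed.
Let c_gt0 : 0 < c.
Proof. by rewrite lt_min; move: s0; lra. Qed.
Let e_gt0 : 0 < e.
Proof. by rewrite divr_gt0// lt_min d0 ltr01. Qed.
Let e_lt : e < d /\ e <= 1 / 2.
Proof. by rewrite /e; have [h|h] := leP d 1; move: d0; lra. Qed.

(** [be] is a power of [x] for small [k x] and grows like [exp (2 k x)] for large [k x]. Integrating
    [be] times [x^(d-2)] thus gains a factor [x] in the first regime and [1 / k] in the second;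
    [be g] interpolates the two. *)
Let g k x := x `^ (d - 1) / (1 + a * (k * x)).
Let g' k x := g k x * ((d - 1) / x - a * k / (1 + a * (k * x))).

Let den k x : 0 < k -> 0 < x -> 0 < 1 + a * (k * x).
Proof. by move=> k0 x0; rewrite addr_gt0// !mulr_gt0. Qed.

Let gD k x : 0 < k -> 0 < x -> der x (g k) (g' k x).
Proof.
move=> k0 x0; have n0 : 1 + a * (k * x) != 0 by rewrite gt_eqF// den.
have dd : der x (fun x => 1 + a * (k * x)) (a * k).
  by apply: dv_eq (dvD (dv_cst 1 x) (dvM (dv_cst a x) (dv_lin k x))) _; ring.
apply: dv_eq (dvM (dv_pow (d - 1) x0 (dv_id x)) (@dvV R (fun x => 1 + a * (k * x)) x _ n0 dd)) _.
rewrite /g' /g (powRB1 (d - 1) x0); move: (x `^ _) => E.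
lra.
Qed.

Let g_gt0 k x : 0 < k -> 0 < x -> 0 < g k x.
Proof. by move=> k0 x0; rewrite divr_gt0 ?powR_gt0// den. Qed.

Let key_ineq y : 0 < y ->
  c * (1 + a * y) <= (d + 2 * m - 1) + 2 * (y ^+ 2 / (y + (2 * m + 2))) - a * y.
Proof.
move=> y0; set s := d + 2 * m - 1; pose M := 2 * m + 2; rewrite -/M.
have M0 : 0 < M by rewrite /M; move: m0; lra.
have yM : 0 < y + M by lra.
(* Tangent bound from [(y - a (y + M))^2 >= 0]; it replaces the rational function by an affine
   one. *)
have t : 2 * a * y - a ^+ 2 * (y + M) <= y ^+ 2 / (y + M).
  rewrite -subr_ge0; have -> : y ^+ 2 / (y + M) - (2 * a * y - a ^+ 2 * (y + M)) = (y - a * (y + M)) ^+ 2 / (y + M).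
    by field; rewrite gt_eqF.
  pos.
have a1 : a <= 1 by rewrite ge_min lexx.
have aM : 4 * (a * M) <= s.
  have : a <= s / (4 * M) by rewrite ge_min lexx orbT.
  by rewrite ler_pdivlMr; lra.
have c1 : c <= s / 2 by rewrite ge_min lexx.
have c2 : c <= 1 by rewrite ge_min lexx orbT.
have ay : 0 <= a * y by pos.
have aM0 : 0 <= a * M by pos.
have q1 : a ^+ 2 * y <= a * y by nra.
have q2 : a ^+ 2 * M <= a * M by nra.
have q3 : c * (a * y) <= a * y by nra.
lra.
Qed.

Let be k x := modU m k x ^+ 2.

Let be_gt0 k x : 0 < x -> 0 < be k x.
Proof. by move=> x0; rewrite exprn_gt0// modU_gt0. Qed.

Let beD k x : 0 < x -> der x (be k) (2 * modU m k x * modV m k x).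
Proof.
move=> x0; have dU := modU_dv k m0 x0.
by apply: dv_eq (dvX 2 dU) _.
Qed.

(** The right side is the derivative of [be g], so [be g] up to a constant is an admissible Volterra
    majorant [eta]. *)
Let beg_ge k x : 0 < k -> 0 < x ->
  c * (be k x * x `^ (d - 2)) <= 2 * modU m k x * modV m k x * g k x + be k x * g' k x.
Proof.
move=> k0 x0; have U0 := modU_gt0 k m0 x0; have V := modV_ge m0 k0 x0.
have y0 : 0 < k * x by pos.
have G0 := g_gt0 k0 x0; have D0 := den k0 x0.
have := ler_wpM2l (ltW (mulr_gt0 (mulr_gt0 (ltr0n R 2) U0) G0)) V.
have K := key_ineq y0.
have B0 := be_gt0 k x0; have bg : 0 <= be k x * g k x / x by rewrite divr_ge0 ?(ltW x0)// mulr_ge0// ltW.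
have := ler_wpM2l bg K.
have -> : be k x * g k x / x * (c * (1 + a * (k * x))) = c * (be k x * x `^ (d - 2)).
  by rewrite /g powRB1// powRB2//; field; rewrite !gt_eqF.
have -> : be k x * g k x / x * (d + 2 * m - 1 + 2 * ((k * x) ^+ 2 / (k * x + (2 * m + 2))) - a * (k * x)) =
  2 * modU m k x * g k x * ((m / x + k * (k * x / (k * x + (2 * m + 2)))) * modU m k x) +
  be k x * (g k x * ((d - 1) / x - a * k)).
  have yM : 0 < k * x + (2 * m + 2) by move: m0 y0; lra.
  by rewrite /be; field; rewrite !gt_eqF.
have : be k x * (g k x * ((d - 1) / x - a * k)) <= be k x * g' k x.
  rewrite ler_wpM2l ?(ltW (be_gt0 k x0))// ler_wpM2l ?(ltW G0)// lerD2l lerN2.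
  rewrite ler_pdivrMr//; apply: ler_peMr; first by rewrite mulr_ge0// ltW.
  by rewrite lerDl !mulr_ge0// ltW.
lra.
Qed.

(** Part of the denominator is traded for a negative power of [k], since [y^e <= 1 + y] for
    [0 < e <= 1]; the power of [x] stays integrable because [e < d]. *)
Let g_le k x : 0 < k -> 0 < x -> g k x <= (a * k) `^ (- e) * x `^ (d - e - 1).
Proof.
move=> k0 x0; have D0 := den k0 x0; have t0 : 0 < a * (k * x) by rewrite !mulr_gt0.
have te : (a * (k * x)) `^ e <= 1 + a * (k * x).
  have [e1 e2] := e_lt; have [t1|t1] := leP (a * (k * x)) 1.
    apply: (@le_trans _ _ 1); first by apply: powR_le1; [rewrite t0|exact: ltW].
    lra.
  apply: (@le_trans _ _ ((a * (k * x)) `^ 1)); last by rewrite powRr1 ?(ltW t0)// lerDr.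
  by apply: ler_powR; [lra|lra].
have ak : 0 < a * k by pos.
rewrite ler_pdivrMr//; apply: (@le_trans _ _ ((a * k) `^ (- e) * x `^ (d - e - 1) * (a * (k * x)) `^ e)); last first.
  by rewrite ler_wpM2l// mulr_ge0 ?powR_ge0.
rewrite mulrA (powRM _ (ltW ak) (ltW x0)) mulrACA -!powR_add//.
by rewrite addNr powRr0 mul1r (_ : d - e - 1 + e = d - 1) //; ring.
Qed.

Let p_bound : exists2 C, 0 <= C & forall x, 0 < x < 3 / 4 -> `|p x| <= C * x `^ (d - 2).
Proof.
case: qs => _ _ _ _ [C C0 HC]; exists (C * 16) => [|x xb]; first lra.
apply: le_trans (HC x (x1 xb)) _; rewrite -mulrA ler_wpM2l// mulrC ler_wpM2r ?powR_ge0//.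
have /andP[_ x34] := xb; rewrite -[leRHS]invrK lef_pV2 ?posrE ?exprn_gt0//; last lra.
have h2 : (1 / 4) ^+ 2 <= (1 - x) ^+ 2 by nra.
lra.
Qed.

(** For a Robin condition the zeroth approximation must carry the slope [al]. As [m = 0], the model
    solution dominates [(1 + k x)^2 / 4], so [1 / be] is at most [16 / (1 + k x)^2], whose integral
    is at most [16 / k]. *)
Let base k : 0 < k -> exists w0 : R -> R,
  [/\ forall x, 0 < x < 3 / 4 -> der x w0 (al / be k x),
      w0 x @[x --> 0^'+] --> (1 : R) & forall x, 0 < x < 3 / 4 -> `|w0 x - 1| <= `|al| * (16 / k)].
Proof.
move=> k0; case: qs => _ _ [mE|[alE _]] _ _; last first.
  exists (fun=> 1); split; first by move=> x _; rewrite alE mul0r; exact: dv_cst.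
    exact: cvg_cst.
  by move=> x _; rewrite subrr normr0 mulr_ge0// divr_ge0// ltW.
have be1 x : 0 < x -> 1 / be k x <= 16 / (1 + k * x) ^+ 2.
  move=> x0; have y0 : 0 < k * x by rewrite mulr_gt0.
  have B : 1 + k ^+ 2 * x ^+ 2 / 2 <= modU m k x.
    rewrite /modU mE powRr0 mul1r sub0r.
    have zE : k ^+ 2 * x ^+ 2 / 4 = (k * x / 2) ^+ 2 by field.
    have h1 : 0 <= k ^+ 2 * x ^+ 2 / 4 by pos.
    have PS : pseries (bcoef (- (1 / 2))) (k ^+ 2 * x ^+ 2 / 4) j @[j --> \oo] --> bes (- (1 / 2)) (k ^+ 2 * x ^+ 2 / 4) by exact: bes_psum.
    apply: (cvgr_to_ge PS); near=> j.
    have j2 : (2 <= j)%N by near: j; by [].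
    rewrite /pseries /series/= (@big_cat_nat _ _ _ 2)//= big_nat_recr//= big_nat1 bcoefS !bcoef0 expr0 expr1 mulr1.
    have -> : 1 / (1 * (- (1 / 2) + 1)) * (k ^+ 2 * x ^+ 2 / 4) = k ^+ 2 * x ^+ 2 / 2 :> R by field.
    rewrite lerDl; apply: sumr_ge0 => i _; rewrite mulr_ge0 ?exprn_ge0//; exact/ltW/bcoef_gt0.
  have s1 : (1 + k * x) ^+ 2 <= 4 * modU m k x.
    have := sqr_ge0 (1 - k * x).
    have B2 : 1 + (k * x) ^+ 2 / 2 <= modU m k x by rewrite exprMn.
    move: B2; lra.
  have U1 : 1 <= modU m k x by nra.
  rewrite ler_pdivrMr ?be_gt0// mulrAC ler_pdivlMr ?exprn_gt0 ?addr_gt0// mul1r /be.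
  have U2 : modU m k x <= modU m k x ^+ 2 by nra.
  lra.
have b01 := b0.
have [|x xb|x xb|x xb|T [dT T0 Tb]] := @prim_dominated R 0 (3 / 4) (fun x => 1 / be k x)
   (fun x => 16 / k * (1 - 1 / (1 + k * x))) (fun x => 16 / (1 + k * x) ^+ 2) b01.
- move=> x /andP[x0 _]; apply: cvgMr; apply: cvgV; first by rewrite gt_eqF// be_gt0.
  exact: dv_cont (beD k x0).
- have /andP[x0 _] := xb; have D0 : 1 + k * x != 0 by rewrite gt_eqF// addr_gt0// mulr_gt0.
  have dd := @dvV R (fun x => 1 + k * x) x _ D0 (dvD (dv_cst 1 x) (dv_lin k x)).
  apply: dv_eq (dvM (dv_cst (16 / k) x) (dvD (dv_cst 1 x) (dvN (dvM (dv_cst 1 x) dd)))) _.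
  by field; rewrite D0 gt_eqF.
- have /andP[x0 _] := xb; rewrite ger0_norm; first exact: be1.
  pos.
- have /andP[x0 _] := xb; have y0 : 0 < k * x by rewrite mulr_gt0.
  by rewrite mulr_ge0 ?divr_ge0 ?(ltW k0)// subr_ge0 ler_pdivrMr ?mul1r ?addr_gt0// lerDl ltW.
exists (fun x => 1 + al * T x); split.
- move=> x xb; apply: dv_eq (dvD (dv_cst 1 x) (dvM (dv_cst al x) (dT x xb))) _; ring.
- have H : 1 + al * T x @[x --> 0^'+] --> (1 + al * 0 : R).
    by apply: cvgD; [exact: cvg_cst|exact: cvgMr].
  by rewrite mulr0 addr0 in H.
- move=> x xb; rewrite addrAC subrr add0r normrM ler_wpM2l//; apply: le_trans (Tb x xb) _.
  have /andP[x0 _] := xb; have y0 : 0 < k * x by rewrite mulr_gt0.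
  rewrite ler_piMr ?divr_ge0 ?(ltW k0)// lerBlDr lerDl divr_ge0// addr_ge0// ltW.
Unshelve. all: by end_near. Qed.

(* Volterra perturbation of the model solution: [f = U w] with [w - 1] small. *)
Let perturbation : exists2 C, 0 <= C & forall k, 1 <= k -> exists w z : R -> R,
  [/\ forall x, 0 < x < 3 / 4 -> der x w (z x / be k x),
      forall x, 0 < x < 3 / 4 -> der x z (p x * be k x * w x),
      w x @[x --> 0^'+] --> (1 : R) /\ z x @[x --> 0^'+] --> al,
      forall x, 0 < x < 3 / 4 -> `|w x - 1| <= C * k `^ (- e) &
      forall x, 0 < x < 3 / 4 -> `|z x - al| <= C * (be k x * g k x)].
Proof.
have [C1 C10 HC1] := p_bound; have [e1 e2] := e_lt.
have de : 0 < d - e by lra.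
pose A := C1 / c; have A0 : 0 <= A by rewrite divr_ge0// ltW.
pose B := 1 + `|al| * 16; have B0 : 0 <= B by rewrite addr_ge0// mulr_ge0.
pose h1 := A * (a `^ (- e) / (d - e)); have h10 : 0 <= h1.
  by rewrite mulr_ge0// divr_ge0 ?powR_ge0// ltW.
pose E := expR h1; have E1 : 0 <= E by exact: expR_ge0.
exists (`|al| * 16 + B * (h1 * E) + B * (A * E)).
  pos.
move=> k k1; have k0 : 0 < k by lra.
have [w0 [dw0 w01 w0b]] := base k0.
have b01 := b0.
have cg x : 0 < x < 3 / 4 -> {for x, continuous (g k)} by move=> /andP[x0 _]; exact: dv_cont (gD k0 x0).
have dH x : 0 < x < 3 / 4 -> der x (fun x => (a * k) `^ (- e) * (x `^ (d - e) / (d - e))) ((a * k) `^ (- e) * x `^ (d - e - 1)).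
  move=> /andP[x0 _]; have nn : d - e != 0 by rewrite gt_eqF.
  apply: dv_eq (dvM (dv_cst ((a * k) `^ (- e)) x) (dvM (dv_pow (d - e) x0 (dv_id x)) (dv_cst (d - e)^-1 x))) _.
  by field.
have gH x : 0 < x < 3 / 4 -> `|g k x| <= (a * k) `^ (- e) * x `^ (d - e - 1).
  by move=> /andP[x0 _]; rewrite ger0_norm ?g_le// ltW// g_gt0.
have H0 x : 0 < x < 3 / 4 -> 0 <= (a * k) `^ (- e) * (x `^ (d - e) / (d - e)).
  by move=> _; rewrite mulr_ge0 ?powR_ge0// divr_ge0 ?powR_ge0// ltW.
have [F [dF F0 Fb]] := @prim_dominated R 0 (3 / 4) (g k) _ _ b01 cg dH gH H0.
have kE : (a * k) `^ (- e) = a `^ (- e) * k `^ (- e) by rewrite powRM// ltW.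
pose ke := k `^ (- e); have ke0 : 0 <= ke by exact: powR_ge0.
have ke1 : ke <= 1.
  rewrite /ke powRN invf_le1 ?powR_gt0//; rewrite -(powRr0 k); apply: ler_powR => //; exact: ltW.
have Fle x : 0 < x < 3 / 4 -> A * F x <= h1 * ke.
  move=> xb; have := ler_norm (F x) => h2; have := Fb x xb; rewrite kE -/ke => h3.
  have /andP[x0 x34] := xb.
  have x11 : x `^ (d - e) <= 1 by apply: powR_le1; [rewrite x0; lra|exact: ltW].
  have -> : h1 * ke = A * (a `^ (- e) * ke * (1 / (d - e))) by rewrite /h1; ring.
  rewrite ler_wpM2l//; apply: le_trans h2 _; apply: le_trans h3 _.
  by rewrite ler_wpM2l ?mulr_ge0 ?powR_ge0// ler_wpM2r// invr_ge0 ltW.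
have Fge x : 0 < x < 3 / 4 -> 0 <= F x.
  move=> xb; have /andP[x0 x34] := xb; apply: (cvgr_to_le F0); near=> y.
  have y0 : 0 < y by pos.
  have yx : y <= x by near: y; exact: nbhs_right_le.
  apply: (@dv_le R y x F (g k) yx) => t /andP[yt tx].
    by apply: dF; rewrite (lt_le_trans y0)//= (le_lt_trans tx).
  by apply: ltW; apply: g_gt0 => //; exact: lt_le_trans yt.
pose eta x := A * (be k x * g k x).
pose eta' x := A * (2 * modU m k x * modV m k x * g k x + be k x * g' k x).
have w0B x : 0 < x < 3 / 4 -> `|w0 x| <= B.
  move=> xb; have : `|w0 x| <= `|w0 x - 1| + `|1 : R| by rewrite -[X in `|X| <= _](subrK 1); exact: ler_normD.
  rewrite normr1 => hh; have := w0b x xb.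
  have : `|al| * (16 / k) <= `|al| * 16 by rewrite ler_wpM2l// ler_pdivrMr// ler_peMr.
  rewrite /B; move: hh; glra.
have pe x : 0 < x < 3 / 4 -> `|p x * be k x| <= eta' x.
  move=> xb; have /andP[x0 _] := xb; rewrite normrM (gtr0_norm (be_gt0 k x0)) /eta'.
  apply: (@le_trans _ _ (A * (c * (be k x * x `^ (d - 2))))); last by rewrite ler_wpM2l// beg_ge.
  have -> : A * (c * (be k x * x `^ (d - 2))) = C1 * x `^ (d - 2) * be k x by rewrite /A; field; rewrite gt_eqF.
  by rewrite ler_wpM2r ?(ltW (be_gt0 k x0))// HC1.
have cp x : 0 < x < 3 / 4 -> {for x, continuous p}.
  move=> xb; have /andP[x0 _] := xb; case: qs => _ _ _ cq _.
  apply: cvgB; first exact: cq (x1 xb).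
  apply: cvgMr; apply: cvgV; first by rewrite expf_neq0// gt_eqF.
  exact: exprn_continuous.
have cb x : 0 < x < 3 / 4 -> {for x, continuous (be k)}.
  by move=> /andP[x0 _]; exact: dv_cont (beD k x0).
have [||||||||w1 [z1 [dw1 dz1 w1b z1b]]] := @volterra R (3 / 4) B (be k) p (fun x => p x * be k x * w0 x)
   (fun x => A * F x) eta eta' b01 B0 _ cb cp.
- by move=> x /andP[x0 _]; exact: be_gt0.
- by move=> x xb; apply: cvgM; [apply: cvgM; [exact: cp|exact: cb]|exact: dv_cont (dw0 x xb)].
- move=> x xb; have /andP[x0 _] := xb; apply: dv_eq (dvM (dv_cst A x) (dF x xb)) _.
  by rewrite /eta mul0r add0r; field; rewrite gt_eqF// be_gt0.
- move=> x /andP[x0 _]; apply: dv_eq (dvM (dv_cst A x) (dvM (beD k x0) (gD k0 x0))) _.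
  by rewrite mul0r add0r.
- by rewrite -[X in _ --> X](mulr0 A); exact: cvgMr.
- by move=> x /andP[x0 _]; rewrite mulr_ge0// mulr_ge0 ?ltW ?be_gt0 ?g_gt0.
- exact: pe.
- move=> x xb; rewrite normrM mulrC; apply: ler_pM => //; [exact: w0B|exact: pe].
have EF x : 0 < x < 3 / 4 -> expR (A * F x) <= E.
  move=> xb; rewrite ler_expR; apply: le_trans (Fle x xb) _.
  by rewrite ler_piMr.
have z1E x : 0 < x < 3 / 4 -> `|z1 x| <= B * (A * E) * (be k x * g k x).
  move=> xb; have /andP[x0 _] := xb; apply: le_trans (z1b x xb) _; rewrite -mulrA ler_wpM2l// /eta.
  have bg : 0 <= be k x * g k x by pos.
  have -> : A * E * (be k x * g k x) = A * (be k x * g k x) * E by ring.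
  by apply: ler_wpM2l; [exact: mulr_ge0|exact: EF].
have em1 (t : R) : 0 <= t -> expR t - 1 <= t * expR t.
  move=> t0; have := expR_ge1Dx (- t); rewrite expRN => h3.
  have := ler_wpM2r (expR_ge0 t) h3; rewrite mulVf ?gt_eqF ?expR_gt0//; glra.
have w1E x : 0 < x < 3 / 4 -> `|w1 x| <= B * (h1 * E) * ke.
  move=> xb; apply: le_trans (w1b x xb) _; rewrite -mulrA ler_wpM2l//.
  have AF : 0 <= A * F x by rewrite mulr_ge0// Fge.
  apply: le_trans (em1 _ AF) _; rewrite [leRHS]mulrAC; apply: ler_pM => //; [exact: Fle|exact: EF].
exists (fun x => w0 x + w1 x), (fun x => al + z1 x); split.
- move=> x xb; apply: dv_eq (dvD (dw0 x xb) (dw1 x xb)) _; ring.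
- move=> x xb; apply: dv_eq (dvD (dv_cst al x) (dz1 x xb)) _; ring.
- split.
    have w1c : w1 x @[x --> 0^'+] --> (0 : R).
      apply: norm_cvg0; apply: (squeeze0 (fun x => B * (expR (A * F x) - 1))).
      + near=> x; rewrite normr_ge0/=; apply: w1b; apply/andP; split; near: x; first exact: nbhs_right_gt.
        exact: nbhs_right_lt.
      + exact: cvg_cst.
      + have H : B * (expR (A * F x) - 1) @[x --> 0^'+] --> (B * (expR (A * 0) - 1) : R).
          apply: cvgMr; apply: cvgB; last exact: cvg_cst.
          by apply: continuous_cvg; [exact: continuous_expR|exact: cvgMr].
        by rewrite mulr0 expR0 subrr mulr0 in H.
    by rewrite -[X in _ --> X]addr0; exact: cvgD.
  have z1c : z1 x @[x --> 0^'+] --> (0 : R).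
    apply: norm_cvg0; apply: (@squeeze_cvgr _ _ _ _ (fun=> 0)
       (fun x => B * (A * E) * (x `^ (d + 2 * m - 1) * bes (m - 1 / 2) (k ^+ 2 * x ^+ 2 / 4) ^+ 2))).
    + near=> x; have x0 : 0 < x by near: x; exact: nbhs_right_gt.
      have x34 : x < 3 / 4 by [].
      rewrite normr_ge0; apply: le_trans (z1E x _) _; first by rewrite x0.
      apply: ler_wpM2l; first pos.
      rewrite /be /modU.
      have -> : d + 2 * m - 1 = 2 * m + (d - 1) by ring.
      rewrite powR_add// powR_dbl// exprMn mulrAC ler_wpM2r ?sqr_ge0// ler_wpM2l ?sqr_ge0//.
      by rewrite ler_pdivrMr ?den// ler_peMr ?powR_ge0// lerDl !mulr_ge0// ltW.
    + exact: cvg_cst.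
    + have H : B * (A * E) * (x `^ (d + 2 * m - 1) * bes (m - 1 / 2) (k ^+ 2 * x ^+ 2 / 4) ^+ 2) @[x --> 0^'+] --> (B * (A * E) * (0 * (1 * 1)) : R).
        apply: cvgMr; apply: cvgM; first exact: powR_cvg0.
        by apply: cvgM; exact: bes_cvg0.
      by rewrite !mul0r mulr0 in H.
  by rewrite -[X in _ --> X]addr0; apply: cvgD => //; exact: cvg_cst.
- move=> x xb; have -> : w0 x + w1 x - 1 = (w0 x - 1) + w1 x by ring.
  tri; have h3 := w0b x xb; have h4 := w1E x xb.
  have h5 : `|al| * (16 / k) <= `|al| * 16 * ke.
    rewrite -mulrA ler_wpM2l// ler_wpM2l// -powR_inv1 ?(ltW k0)//; apply: ler_powR => //; lra.
  have h6 : 0 <= B * (A * E) * ke by pos.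
  by rewrite -/ke; move: h6 h5 h4 h3 xb; glra.
- move=> x xb; have /andP[x0 _] := xb; rewrite addrAC subrr add0r; apply: le_trans (z1E x xb) _.
  apply: ler_wpM2r; first by rewrite ltW// mulr_gt0 ?be_gt0 ?g_gt0.
  by rewrite lerDr; apply: addr_ge0; apply: mulr_ge0 => //; apply: mulr_ge0.
Unshelve. all: by end_near. Qed.

Let cq k x : 0 < x < 3 / 4 -> {for x, continuous (fun x => q x - - k ^+ 2)}.
Proof.
by move=> xb; case: qs => _ _ _ cq _; apply: cvgB; [exact: cq (x1 xb)|exact: cvg_cst].
Qed.

Let model_nsol k (w z : R -> R) :
  (forall x, 0 < x < 3 / 4 -> der x w (z x / be k x)) ->
  (forall x, 0 < x < 3 / 4 -> der x z (p x * be k x * w x)) ->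
  w x @[x --> 0^'+] --> (1 : R) -> z x @[x --> 0^'+] --> al ->
  nsol m al (3 / 4) (fun x => q x - - k ^+ 2) (fun x => modU m k x * w x) (fun x => modV m k x * w x + z x / modU m k x).
Proof.
move=> dw dz w1 z1; have b01 := b0.
have bc := bes_cvg0 k m0; have m1 : 0 <= m + 1 by move: m0; lra.
have bc1 := bes_cvg0 k m1.
split.
- split=> x xb; have /andP[x0 _] := xb; have U0 := modU_gt0 k m0 x0.
    apply: dv_eq (dvM (modU_dv k m0 x0) (dw x xb)) _.
    by rewrite /be; field; rewrite gt_eqF.
  have Un : modU m k x != 0 by rewrite gt_eqF.
  apply: dv_eq (dvD (dvM (modV_dv k m0 x0) (dw x xb)) (dvM (dz x xb) (dvV Un (modU_dv k m0 x0)))) _.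
  rewrite /be /p; move: (modU m k x) (modV m k x) Un => U V Un.
  by field; rewrite Un gt_eqF.
- have H : bes (m - 1 / 2) (k ^+ 2 * x ^+ 2 / 4) * w x @[x --> 0^'+] --> (1 * 1 : R) by exact: cvgM.
  rewrite mulr1 in H; apply: (cvg_right_eq b01 _ H) => x /andP[x0 _].
  by rewrite /modU; field; rewrite gt_eqF// powR_gt0.
- have H : x `^ (2 * m + 1) * (bes (m + 1 - 1 / 2) (k ^+ 2 * x ^+ 2 / 4) * (w x * (k ^+ 2 / (2 * m + 1)))) +
       z x / bes (m - 1 / 2) (k ^+ 2 * x ^+ 2 / 4) @[x --> 0^'+] --> (0 * (1 * (1 * (k ^+ 2 / (2 * m + 1)))) + al / 1 : R).
    apply: cvgD; last by apply: cvgM => //; apply: cvgV.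
    apply: cvgM; first by apply: powR_cvg0; move: m0; lra.
    by apply: cvgM => //; apply: cvgM => //; exact: cvg_cst.
  rewrite mul0r add0r divr1 in H; apply: (cvg_right_eq b01 _ H) => x /andP[x0 _].
  have B0 : 0 < bes (m - 1 / 2) (k ^+ 2 * x ^+ 2 / 4).
    have h : - (1 / 2) <= m - 1 / 2 by move: m0; lra.
    by apply: lt_le_trans (bes_ge1 h _); rewrite ?divr_ge0// mulr_ge0// sqr_ge0.
  rewrite /modU /modV /bes1 (_ : m - 1 / 2 + 1 = m + 1 - 1 / 2); last lra.
  rewrite [x `^ (2 * m + 1)]powR_add// powRr1 ?(ltW x0)// powR_dbl// (powRB1 m x0); have e0 := powR_gt0 m x0.
  have D0 : 0 < 2 * m + 1 by move: m0; lra.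
  have -> : m + 1 - 1 / 2 = (2 * m + 1) / 2 by field.
  move: (2 * m + 1) (bes _ _) (bes _ _) (x `^ _) B0 e0 D0 => D B' B E *.
  by field; rewrite !gt_eqF.
Qed.

Lemma prod_est (A B Ca Cb t u v : R) : 0 <= t <= 1 -> 0 <= Cb -> 0 <= Ca -> 0 <= A -> 0 <= B ->
  `|u - A| <= Ca * t -> `|v - B| <= Cb * t -> `|u * v - A * B| <= (Ca * (B + Cb) + A * Cb) * t.
Proof.
move=> /andP[t0 t1] b a' A0 B0 hu hv.
have -> : u * v - A * B = (u - A) * v + A * (v - B) by ring.
have vb : `|v| <= B + Cb.
  have : `|v| <= `|v - B| + `|B| by rewrite -[X in `|X| <= _](subrK B); exact: ler_normD.
  rewrite (ger0_norm B0); have : Cb * t <= Cb by rewrite ler_piMr.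
  lra.
tri; rewrite [X in X + _ <= _]normrM [X in _ + X <= _]normrM (ger0_norm A0).
have h1 : `|u - A| * `|v| <= (Ca * t) * (B + Cb) by exact: ler_pM.
nra.
Qed.

Lemma nsol_asymp : exists C k0 s : R, [/\ 0 <= C, 4 <= k0, 0 < s <= 1 / 2 &
  forall k, k0 <= k -> forall f h, nsol m al 1 (fun x => q x - - k ^+ 2) f h ->
  [/\ forall x, 0 < x < 3 / 4 -> 0 < f x,
   `|f (1 / 2) * k `^ m * expR (- (k / 2)) - besK m| <= C * k `^ (- s) &
   `|h (1 / 2) * k `^ (m - 1) * expR (- (k / 2)) - besK m| <= C * k `^ (- s)]].
Proof.
have [C2 C20 HC2] := perturbation; have [C1 C10 HC1] := modUV_half m0; have [e1 e2] := e_lt.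
have K0 : 0 <= besK m.
  rewrite /besK divr_ge0 ?mulr_ge0 ?powR_ge0 ?ltW ?sqrt_pi_gt0//; apply: Gamma_pos; move: m0; lra.
pose C3 := 2 * C2 + `|al|; have C30 : 0 <= C3 by rewrite addr_ge0 ?normr_ge0// mulr_ge0.
pose Ca := C1 * (1 + C2) + besK m * C2; have Ca0 : 0 <= Ca by apply: addr_ge0; apply: mulr_ge0 => //; exact: addr_ge0.
pose Cr := C1 * (1 + C2) + 1 * C2 + C3; have Cr0 : 0 <= Cr by apply: addr_ge0 => //; apply: addr_ge0; apply: mulr_ge0 => //; exact: addr_ge0.
pose Cb := C1 * (1 + Cr) + besK m * Cr; have Cb0 : 0 <= Cb by apply: addr_ge0; apply: mulr_ge0 => //; exact: addr_ge0.
(* Beyond this threshold [C2 k^(-e) <= 1/2], so the factor [w] is at least [1/2] and the solution is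
   positive. *)
exists (Ca + Cb), (4 + (2 * C2 + 1) `^ e^-1), e; split.
- by rewrite addr_ge0.
- by rewrite lerDl powR_ge0.
- by rewrite e_gt0.
move=> k kk0 f h n1; have pp : 0 <= (2 * C2 + 1) `^ e^-1 by exact: powR_ge0.
have k4 : 4 <= k by (move: pp kk0; glra).
have k1 : 1 <= k by (move: k4; glra).
have k0 : 0 < k by (move: k1; glra).
have [h1 h2] := HC1 k k4; have [w [z [dw dz [w1 z1] wb zb]]] := HC2 k k1.
pose t := k `^ (- e).
have t0 : 0 < t by exact: powR_gt0.
have t1 : t <= 1 by rewrite /t powRN invf_le1 ?powR_gt0// -(powRr0 k); apply: ler_powR => //; exact: ltW.
have t01 : 0 <= t <= 1 by rewrite (ltW t0).
have kt : k^-1 <= t by rewrite -powR_inv1 ?(ltW k0)// /t; apply: ler_powR => //; move: e2; glra.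
have n2 := model_nsol dw dz w1 z1.
have n1' : nsol m al (3 / 4) (fun x => q x - - k ^+ 2) f h.
  case: n1 => o1 f1 g1; split => //; apply: ode2_sub o1 => //; glra.
have fE := nsol_unique b0 (@cq k) n1' n2.
have wt : C2 * t <= 1 / 2.
  have ke : 2 * C2 + 1 <= k `^ e.
    have p0 : 0 <= 2 * C2 + 1 by rewrite addr_ge0// mulr_ge0.
    have {1}-> : 2 * C2 + 1 = ((2 * C2 + 1) `^ e^-1) `^ e by rewrite -powRrM mulVf ?gt_eqF// powRr1.
    apply: ge0_ler_powR => //; rewrite ?nnegrE//; [exact: ltW|exact: ltW|lra].
  rewrite /t powRN ler_pdivrMr ?powR_gt0//; move: ke; glra.
split.
- move=> x xb; have /andP[x0 _] := xb; rewrite (fE x xb).1 mulr_gt0 ?modU_gt0//.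
  by have := wb x xb; rewrite ler_norml -/t => /andP[]; move: x0 xb wt; glra.
- have hb : 0 < (1 / 2 : R) < 3 / 4 by exact: half_lt34.
  rewrite (fE _ hb).1.
  have -> : modU m k (1 / 2) * w (1 / 2) * k `^ m * expR (- (k / 2)) - besK m =
     (modU m k (1 / 2) * k `^ m * expR (- (k / 2))) * w (1 / 2) - besK m * 1 by ring.
  have h1' : `|modU m k (1 / 2) * k `^ m * expR (- (k / 2)) - besK m| <= C1 * t by apply: le_trans h1 _; rewrite ler_wpM2l.
  apply: le_trans (prod_est t01 C20 C10 K0 ler01 h1' (wb _ hb)) _.
  by rewrite ler_wpM2r ?(ltW t0)// lerDl.
- have hb : 0 < (1 / 2 : R) < 3 / 4 by exact: half_lt34.
  have h0 : 0 < (1 / 2 : R) by case/andP: hb.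
  have U0 := modU_gt0 k m0 h0.
  pose rho := z (1 / 2) / (k * be k (1 / 2)).
  rewrite (fE _ hb).2.
  have -> : (modV m k (1 / 2) * w (1 / 2) + z (1 / 2) / modU m k (1 / 2)) * k `^ (m - 1) * expR (- (k / 2)) - besK m =
     (modU m k (1 / 2) * k `^ m * expR (- (k / 2))) * (modV m k (1 / 2) / (k * modU m k (1 / 2)) * w (1 / 2) + rho) - besK m * 1.
    rewrite powRB1// /rho /be; move: (modU m k _) U0 (modV m k _) => U U0 V.
    by field; rewrite !gt_eqF.
  have h1' : `|modU m k (1 / 2) * k `^ m * expR (- (k / 2)) - besK m| <= C1 * t by apply: le_trans h1 _; rewrite ler_wpM2l.
  have h2' : `|modV m k (1 / 2) / (k * modU m k (1 / 2)) - 1| <= C1 * t by apply: le_trans h2 _; rewrite ler_wpM2l.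
  have h3 := prod_est t01 C20 C10 ler01 ler01 h2' (wb _ hb).
  have rb : `|rho| <= C3 * t.
    have B0 : 0 < be k (1 / 2) by exact: be_gt0.
    have -> : rho = (z (1 / 2) - al) / (k * be k (1 / 2)) + al / (k * be k (1 / 2)) by rewrite /rho; field; rewrite !gt_eqF.
    tri; have kB : 0 < k * be k (1 / 2) by exact: mulr_gt0.
    rewrite [X in X + _ <= _]normrM [X in _ + X <= _]normrM normfV (gtr0_norm kB).
    rewrite /C3 mulrDl; apply: lerD.
      have gb : `|z (1 / 2) - al| <= C2 * (be k (1 / 2) * 2).
        apply: le_trans (zb _ hb) _; rewrite ler_wpM2l// ler_wpM2l ?(ltW B0)//.
        have D0 := den k0 h0.
        rewrite ler_pdivrMr//; apply: (@le_trans _ _ 2); last first.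
          by rewrite ler_peMr// lerDl !mulr_ge0// ltW.
        have {2}-> : (2 : R) = (1 / 2) `^ (- 1) by rewrite powRN powRr1//; field.
        by apply: ger_powR; [exact: half_le1|move: d0; glra].
      have C22 : 0 <= 2 * C2 by exact: mulr_ge0.
      apply: (@le_trans _ _ (2 * C2 * k^-1)); last exact: ler_wpM2l.
      rewrite ler_pdivrMr//; apply: le_trans gb _.
      by apply: le_of_eq; field; rewrite gt_eqF.
    case: qs => _ _ [mE|[-> _]] _ _; last by rewrite normr0 !mul0r.
    have U1 : 1 <= modU m k (1 / 2).
      by have := @modU_ge R m k (1 / 2) m0 h0; rewrite [X in _ `^ X]mE powRr0.
    have B1 : 1 <= be k (1 / 2) by rewrite /be expr_ge1// ltW.
    apply: ler_wpM2l => //; apply: le_trans kt; rewrite lef_pV2 ?posrE//.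
    by apply: ler_peMr => //; exact: ltW.
  have h4 : `|modV m k (1 / 2) / (k * modU m k (1 / 2)) * w (1 / 2) + rho - 1| <= Cr * t.
    have -> : modV m k (1 / 2) / (k * modU m k (1 / 2)) * w (1 / 2) + rho - 1 =
       (modV m k (1 / 2) / (k * modU m k (1 / 2)) * w (1 / 2) - 1 * 1) + rho by ring.
    tri; rewrite /Cr [leRHS]mulrDl; exact: lerD.
  apply: le_trans (prod_est t01 Cr0 C10 K0 ler01 h1' h4) _.
  by rewrite ler_wpM2r ?(ltW t0)// lerDr.
Qed.

End Asymptotics.

(** * The Wronskian of the two normalized solutions *)

Section TwoEnds.
Variables (R : realType) (q : R -> R) (m0 d0 al0 m1 d1 al1 : R).
Implicit Types (x y lam : R) (f g : R -> R).
Hypothesis qs0 : sing_pot m0 d0 al0 q.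
Hypothesis qs1 : sing_pot m1 d1 al1 (fun x => q (1 - x)).
Variables (phi dphi ps dps : R -> R -> R).
Hypothesis phiN : forall lam, nsol m0 al0 1 (fun x => q x - lam) (phi lam) (dphi lam).
Hypothesis psN : forall lam, nsol m1 al1 1 (fun x => q (1 - x) - lam) (ps lam) (dps lam).

Definition refl f x : R := f (1 - x).
Definition nrefl f x : R := - f (1 - x).
Let psi lam := refl (ps lam).
Let dpsi lam := nrefl (dps lam).

Let b01 : (0 : R) < 1. Proof. by []. Qed.
Let I12 : 0 < (1 / 2 : R) < 1. Proof. lra. Qed.
Let I34 : 0 < (1 / 2 : R) < 3 / 4. Proof. lra. Qed.
Let sub34 x : 0 < x < 3 / 4 -> 0 < x < 1. Proof. lra. Qed.
Let half1 : 1 - 1 / 2 = 1 / 2 :> R. Proof. lra. Qed.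

Lemma in01_refl x : 0 < x < 1 -> 0 < 1 - x < 1. Proof. lra. Qed.

Lemma dv_refl f x a : der (1 - x) f a -> der x (refl f) (- a).
Proof.
move=> fa; have D : der x (fun y : R => 1 - y) (-1).
  by apply: dv_eq (dvD (dv_cst 1 x) (dvN (dv_id x))) _; rewrite add0r.
have E := @dv_comp R f (fun y => 1 - y) x a (-1) fa D; rewrite mulrN1 in E; by [].
Qed.

Lemma ode2_refl Q f g : ode2 0 1 (fun x => Q (1 - x)) f g -> ode2 0 1 Q (refl f) (nrefl g).
Proof.
move=> [df dg]; split => x x1; have x1' := in01_refl x1.
  exact: dv_refl (df _ x1').
apply: dv_eq (dvN (dv_refl (dg _ x1'))) _.
by rewrite opprK subKr.
Qed.

Lemma ode2_phi lam : ode2 0 1 (fun x => q x - lam) (phi lam) (dphi lam).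
Proof. by have [] := phiN lam. Qed.

Lemma ode2_ps lam : ode2 0 1 (fun x => q (1 - x) - lam) (ps lam) (dps lam).
Proof. by have [] := psN lam. Qed.

Lemma ode2_psi lam : ode2 0 1 (fun x => q x - lam) (psi lam) (dpsi lam).
Proof. by apply: (ode2_refl (Q := fun x => q x - lam)); exact: ode2_ps. Qed.

Lemma ode2_phi_refl lam : ode2 0 1 (fun x => q (1 - x) - lam) (refl (phi lam)) (nrefl (dphi lam)).
Proof.
apply: (ode2_refl (Q := fun x => q (1 - x) - lam)).
have [h1 h2] := ode2_phi lam; split => // x x1.
by apply: dv_eq (h2 x x1) _; rewrite subKr.
Qed.

Definition Wr lam x := psi lam x * dphi lam x - dpsi lam x * phi lam x.
Definition WW lam := Wr lam (1 / 2).

Lemma WrE lam x : 0 < x < 1 -> Wr lam x = WW lam.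
Proof. by move=> x1; exact: (wronskian_eq (ode2_psi lam) (ode2_phi lam)). Qed.

(** States that [W'] is minus the integral of [phi psi], written [A1 - A0]. The Wronskians [O0] and
    [O1] of one solution with the derivative in [lam] of the other vanish at their endpoint and have
    [- phi psi], up to reflection, as derivative; together they give [W'] at [1/2]. *)
Lemma WW_derive lam : exists Q A0 A1,
  [/\ forall x, 0 < x < 1 -> der x Q (phi lam x * psi lam x),
      Q x @[x --> 0^'+] --> A0, Q (1 - x) @[x --> 0^'+] --> A1 &
      der lam WW (- (A1 - A0))].
Proof.
have [fd [gd [C [dfd dgd C0 Hd Hq]]]] := nsol_dlambda qs0 (phiN lam).
have [fe [ge [D [dfe dge D0 He Hr]]]] := nsol_dlambda qs1 (psN lam).
have [dph ddph] := ode2_phi lam; have [dpp ddpp] := ode2_psi lam.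
have [dpr ddpr] := ode2_phi_refl lam; have [dpt ddpt] := ode2_ps lam.
have [|Q dQ] := @antiderivative R 0 1 (fun x => phi lam x * psi lam x) b01.
  by move=> x x1; apply: cvgM; [exact: dv_cont (dph x x1)|exact: dv_cont (dpp x x1)].
pose O0 x := psi lam x * gd x - dpsi lam x * fd x.
pose O1 x := refl (phi lam) x * ge x - nrefl (dphi lam) x * fe x.
have dO0 x : 0 < x < 3 / 4 -> der x O0 (- (phi lam x * psi lam x)).
  move=> xb; have x1 := sub34 xb.
  have Dv := dvD (dvM (dpp x x1) (dgd x xb)) (dvN (dvM (ddpp x x1) (dfd x xb))).
  by apply: dv_eq Dv _; ring.
have dO1 x : 0 < x < 3 / 4 -> der x O1 (- (refl (phi lam) x * ps lam x)).
  move=> xb; have x1 := sub34 xb.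
  have Dv := dvD (dvM (dpr x x1) (dge x xb)) (dvN (dvM (ddpr x x1) (dfe x xb))).
  by apply: dv_eq Dv _; ring.
have O0l := dlambda_wronskian_cvg qs0 (phiN lam) (ode2_psi lam) C0 Hd.
have O1l := dlambda_wronskian_cvg qs1 (psN lam) (ode2_phi_refl lam) D0 He.
have b34 : (0 : R) < 3 / 4 by lra.
have QO0 : forall x y, 0 < x < 3 / 4 -> 0 < y < 3 / 4 -> Q x + O0 x = Q y + O0 y.
  apply: (@dv_const R 0 (3 / 4) (fun x => Q x + O0 x)) => x xb.
  by apply: dv_eq (dvD (dQ x (sub34 xb)) (dO0 x xb)) _; rewrite subrr.
have QO1 : forall x y, 0 < x < 3 / 4 -> 0 < y < 3 / 4 -> refl Q x - O1 x = refl Q y - O1 y.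
  apply: (@dv_const R 0 (3 / 4) (fun x => refl Q x - O1 x)) => x xb.
  apply: dv_eq (dvD (dv_refl (dQ (1 - x) (in01_refl (sub34 xb)))) (dvN (dO1 x xb))) _.
  by rewrite /psi /refl subKr; ring.
exists Q, (Q (1 / 2) + O0 (1 / 2)), (Q (1 / 2) - O1 (1 / 2)); split => //.
- have H : (Q (1 / 2) + O0 (1 / 2)) - O0 x @[x --> 0^'+] --> (Q (1 / 2) + O0 (1 / 2)) - 0.
    by apply: cvgB => //; exact: cvg_cst.
  rewrite subr0 in H; apply: (cvg_right_eq b34 _ H) => x xb.
  by rewrite -(QO0 x (1 / 2) xb I34) addrK.
- have H : (Q (1 / 2) - O1 (1 / 2)) + O1 x @[x --> 0^'+] --> (Q (1 / 2) - O1 (1 / 2)) + 0.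
    by apply: cvgD => //; exact: cvg_cst.
  rewrite addr0 in H; apply: (cvg_right_eq b34 _ H) => x xb.
  have := QO1 x (1 / 2) xb I34; rewrite /refl half1 => <-.
  lra.
have dph0 : der lam (fun l => phi l (1 / 2)) (fd (1 / 2)).
  by apply: dv_of_quad; exists C => s s1; have [] := Hq s _ _ s1 (phiN _).
have dph1 : der lam (fun l => dphi l (1 / 2)) (gd (1 / 2)).
  by apply: dv_of_quad; exists C => s s1; have [] := Hq s _ _ s1 (phiN _).
have dps0 : der lam (fun l => psi l (1 / 2)) (fe (1 / 2)).
  rewrite /psi /refl half1.
  by apply: dv_of_quad; exists D => s s1; have [] := Hr s _ _ s1 (psN _).
have dps1 : der lam (fun l => dpsi l (1 / 2)) (- ge (1 / 2)).
  rewrite /dpsi /nrefl half1; apply: (@dvN R (fun l => dps l (1 / 2))).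
  by apply: dv_of_quad; exists D => s s1; have [] := Hr s _ _ s1 (psN _).
have Dv := dvD (dvM dps0 dph1) (dvN (dvM dps1 dph0)).
apply: dv_eq Dv _; rewrite /O0 /O1 /refl /nrefl half1; ring.
Qed.

Lemma WW_zero lam : WW lam = 0 -> exists2 c, c != 0 &
  forall x, 0 < x < 1 -> psi lam x = c * phi lam x /\ dpsi lam x = c * dphi lam x.
Proof.
move=> W0; have [|c Hc] := wronskian_prop qs0 (phiN lam) (ode2_psi lam).
  by move=> x x1; exact: etrans (WrE lam x1) W0.
exists c => //; apply/eqP => c0.
have [x1 [x10 x11 fb]] := nsol_pos_near b01 (psN lam).
have /andP[h _] := fb x1 ltac:(lra).
have [+ _] := Hc (1 - x1) ltac:(lra).
rewrite c0 mul0r /psi /refl subKr => p0.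
by have := powR_gt0 m1 x10; lra.
Qed.

(** At a zero [psi] is a nonzero multiple [c phi], so [W'] is [- c] times the integral of [phi^2];
    were it zero, a monotone primitive of [phi^2] would be constant although [phi] does not vanish
    near [0]. *)
Lemma WW_simple lam : WW lam = 0 -> exists2 D, D != 0 & der lam WW D.
Proof.
move=> W0; have [Q [A0 [A1 [dQ Q0 Q1 dW]]]] := WW_derive lam.
exists (- (A1 - A0)) => //; rewrite oppr_eq0 subr_eq0; apply/eqP => A01.
have [c c0 Hc] := WW_zero W0.
pose P x := Q x / c.
have dP x : 0 < x < 1 -> der x P (phi lam x ^+ 2).
  move=> x1; apply: dv_eq (dvM (dQ x x1) (dv_cst c^-1 x)) _.
  by have [-> _] := Hc x x1; field.
have mono x y : 0 < x -> x <= y -> y < 1 -> P x <= P y.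
  move=> x0 xy y1.
  apply: (@dv_le R x y P (fun t => phi lam t ^+ 2) xy) => t /andP[xt ty]; last exact: sqr_ge0.
  by apply: dP; rewrite (lt_le_trans x0)//= (le_lt_trans ty).
have P0 : P x @[x --> 0^'+] --> A0 / c by exact: cvgMl.
have P1 : P (1 - x) @[x --> 0^'+] --> A0 / c by rewrite -A01; exact: cvgMl.
have Pc x : 0 < x < 1 -> P x = A0 / c.
  move=> /andP[x0 x1]; apply/eqP; rewrite eq_le; apply/andP; split.
    move: P1 => /cvgr_to_ge; apply; near=> y; apply: mono => //.
      have : y <= 1 - x by near: y; apply: nbhs_right_le; lra.
      lra.
    have y0 : 0 < y by [].
    lra.
  move: P0 => /cvgr_to_le; apply; near=> y.
  by apply: mono => //; near: y; exact: nbhs_right_le.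
have [x1 [x10 x11 fb]] := nsol_pos_near b01 (phiN lam).
have x1I : 0 < x1 < 1 by rewrite x10.
have D0 : der x1 P 0.
  by apply: (dv_near x1I _ (dv_cst (A0 / c) x1)) => y y1; rewrite Pc.
have D1 := dP x1 x1I.
have E : phi lam x1 ^+ 2 = 0 by case: D0 => _ <-; case: D1 => _ <-.
have /andP[h _] := fb x1 ltac:(lra).
move/eqP: E; rewrite sqrf_eq0 => /eqP E; rewrite E in h.
by have := powR_gt0 m0 x10; lra.
Unshelve. all: by end_near. Qed.

(** * The Green function and its discretized resolvent identity *)

Section GreenFunction.
Implicit Types (z mu : R) (n i j k : nat).
Local Notation W := WW.
Let Ophi := ode2_phi.
Let Opsi := ode2_psi.

Lemma bvH'_ge x : 0 < x < 1 -> x `^ (- (1 / 2)) <= bvH' x /\ (1 - x) `^ (- (1 / 2)) <= bvH' x.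
Proof. by move=> _; rewrite lerDl lerDr !powR_ge0. Qed.

Lemma nsol_growth_weak m d al Q f g lam : sing_pot m d al Q ->
  nsol m al 1 (fun x => Q x - lam) f g -> exists2 C, 0 <= C &
  forall x, 0 < x <= 1 / 2 -> `|f x| <= C /\ `|g x| <= C * x `^ (- (1 / 2)).
Proof.
move=> qs fg; have [C C0 HC] := nsol_growth qs fg; exists C => // x x12.
have [h1 h2 h3] := HC x x12; have x1 : 0 < x <= 1 by case/andP: x12 => -> /=; lra.
have m_ge0 : 0 <= m by case: qs.
split; first by apply: le_trans h1 _; rewrite -[leRHS]mulr1 ler_wpM2l// powR_le1.
case: qs => _ _ [mE|[_ mE]] _ _.
  apply: le_trans (h3 mE) _; rewrite -[leLHS]mulr1 ler_wpM2l//.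
  by apply: powR_ge1.
apply: le_trans (h2 mE) _; rewrite ler_wpM2l//.
by apply: ger_powR; move: mE m_ge0 x1; glra.
Qed.

Let GB C lam z x := [/\ `|phi lam z * psi lam x| <= C, `|dphi lam z * psi lam x| <= C * bvH' z &
  `|phi lam z * dpsi lam x| <= C * bvH' x].

(** If both points lie in the same half, the bounds at that endpoint apply, directly or after
    reflection; if they are separated by [1/2], each factor is the solution normalized at its own
    endpoint. *)
Lemma green_bound lam : exists2 C, 0 <= C & forall z x, 0 < z -> z <= x -> x < 1 -> GB C lam z x.
Proof.
have [C C0 HC] := green_bounds qs0 (phiN lam) (ode2_psi lam).
have [D D0 HD] := green_bounds qs1 (psN lam) (ode2_phi_refl lam).
have [E E0 HE] := nsol_growth_weak qs0 (phiN lam).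
have [F F0 HF] := nsol_growth_weak qs1 (psN lam).
pose B := C + D + E * F.
have EF0 : 0 <= E * F by pos.
have B0 : 0 <= B by pos.
exists B => // z x z0 zx x1.
have zI : 0 < z < 1 by (move: x1 zx z0; glra).
have xI : 0 < x < 1 by (move: zI x1 zx; glra).
have [z2 z3] := bvH'_ge zI; have [x2 x3] := bvH'_ge xI.
have [pz px] := (powR_ge0 z (- (1 / 2)), powR_ge0 x (- (1 / 2))).
have [pz' px'] := (powR_ge0 (1 - z) (- (1 / 2)), powR_ge0 (1 - x) (- (1 / 2))).
have up (c a b : R) : 0 <= c -> c <= B -> 0 <= a -> a <= b -> c * a <= B * b.
  by move=> *; exact: ler_pM.
have [x12|/ltW x12] := leP x (1 / 2).
  have [h1 h2 h3] := HC z x z0 zx x12; have CB : C <= B by rewrite /B; lra.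
  by split; [exact: le_trans h1 CB|apply: le_trans h2 _; exact: up|apply: le_trans h3 _; exact: up].
have [z12|/ltW z12] := leP (1 / 2) z.
  have DB : D <= B by rewrite /B; lra.
  have a1 : 0 < 1 - x by rewrite subr_gt0.
  have a2 : 1 - x <= 1 - z by rewrite lerD2l lerN2.
  have a3 : 1 - z <= 1 / 2 by (move: z12; glra).
  have [] := HD _ _ a1 a2 a3; rewrite /refl /nrefl subKr mulrN normrN => h1 h2 h3.
  split; rewrite mulrC.
  - exact: le_trans h1 DB.
  - by apply: le_trans h3 _; exact: up.
  - by rewrite mulNr normrN; apply: le_trans h2 _; exact: up.
have FB : E * F <= B by rewrite /B; lra.
have z4 : 0 < z <= 1 / 2 by rewrite z0.
have x4 : 0 < 1 - x <= 1 / 2 by lra.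
have [e1 e2] := HE z z4; have [f1 f2] := HF (1 - x) x4.
rewrite /GB /psi /dpsi /refl mulrN normrN !normrM; split.
- by apply: le_trans FB; exact: ler_pM.
- apply: (@le_trans _ _ (E * F * z `^ (- (1 / 2)))); last exact: up.
  by rewrite mulrAC; exact: ler_pM.
- apply: (@le_trans _ _ (E * F * (1 - x) `^ (- (1 / 2)))); last exact: up.
  by rewrite -mulrA; exact: ler_pM.
Qed.

Let green_bound2 lam mu : exists2 C, 0 <= C & forall z x, 0 < z -> z <= x -> x < 1 ->
  GB C lam z x /\ GB C mu z x.
Proof.
have [C C0 HC] := green_bound lam; have [D D0 HD] := green_bound mu.
exists (C + D) => [|z x z0 zx x1]; first lra.
have [h1 h2 h3] := HC z x z0 zx x1; have [h4 h5 h6] := HD z x z0 zx x1.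
have [bz bx] := (bvH'_ge0 z, bvH'_ge0 x).
have CC := mulr_ge0 C0 bz; have DD := mulr_ge0 D0 bz.
have CC' := mulr_ge0 C0 bx; have DD' := mulr_ge0 D0 bx.
by rewrite /GB !mulrDl; split; split; apply: le_trans (_ : _ <= _ ) _; try eassumption; rewrite ?lerDl ?lerDr.
Qed.

Lemma wronskian_phi_cvg lam mu : phi lam x * dphi mu x - dphi lam x * phi mu x @[x --> 0^'+] --> (0 : R).
Proof. by have := nsol_wronskian (phiN lam) (phiN mu); rewrite subrr. Qed.

Lemma wronskian_psi_cvg lam mu :
  psi lam (1 - x) * dpsi mu (1 - x) - dpsi lam (1 - x) * psi mu (1 - x) @[x --> 0^'+] --> (0 : R).
Proof.
have H : ps mu x * dps lam x - dps mu x * ps lam x @[x --> 0^'+] --> (0 : R).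
  by have := nsol_wronskian (psN mu) (psN lam); rewrite subrr.
apply: (cvg_right_eq b01 _ H) => x _; rewrite /psi /dpsi /refl /nrefl subKr; ring.
Qed.

(** Integral kernel of [(L - lam)^-1]. *)
Definition Gr lam x y : R := phi lam (Num.min x y) * psi lam (Num.max x y) / W lam.

Lemma Gr_sym lam x y : Gr lam x y = Gr lam y x.
Proof. by rewrite /Gr minC maxC. Qed.

Lemma Gr_le lam x y : x <= y -> Gr lam x y = phi lam x * psi lam y / W lam.
Proof. by move=> xy; rewrite /Gr min_l// max_r. Qed.

Lemma Gr_bound lam : exists2 C, 0 <= C &
  forall x y, 0 < x < 1 -> 0 < y < 1 -> `|Gr lam x y| <= C.
Proof.
have [C C0 HC] := green_bound lam; exists (C * `|(W lam)^-1|) => [|x y]; first pos.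
wlog xy : x y / x <= y => [H x1 y1|/andP[x0 _] /andP[_ y1]].
  by have [xy|/ltW xy] := leP x y; [|rewrite Gr_sym]; exact: H.
have [h _ _] := HC x y x0 xy y1.
by rewrite Gr_le// normrM ler_wpM2r.
Qed.

Section ResolventSum.
Variables (lam mu : R) (n i j : nat).
Hypotheses (i0 : (0 < i)%N) (ij : (i <= j)%N) (jn : (j <= n)%N) (ne : lam != mu).
Variable C : R.
Hypothesis C0 : 0 <= C.
Hypothesis HC : forall z x, 0 < z -> z <= x -> x < 1 -> GB C lam z x /\ GB C mu z x.
Let xi : R := xg R n i.
Let xj : R := xg R n j.
Let xiI : 0 < xi < 1. Proof. by apply: xg_in => //; exact: leq_trans jn. Qed.
Let xjI : 0 < xj < 1. Proof. by apply: xg_in => //; exact: leq_trans ij. Qed.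
Let xij : xi <= xj. Proof. exact: xg_le. Qed.
Let w (f1 g1 f2 g2 : R -> R) z := f1 z * g2 z - g1 z * f2 z.
Let A := w (phi lam) (dphi lam) (phi mu) (dphi mu).
Let B := w (psi lam) (dpsi lam) (phi mu) (dphi mu).
Let D := w (psi lam) (dpsi lam) (psi mu) (dpsi mu).
Let h := hg R n.
Let S := 2 * C * C.
Let S0 : 0 <= S. Proof. pos. Qed.
Let CS : C * C <= S. Proof. by have := mulr_ge0 C0 C0; rewrite /S; lra. Qed.
Let l0 : lam - mu != 0. Proof. by rewrite subr_eq0. Qed.

Let prod f1 f2 (c z : R) := f1 z * f2 z * c.
Let dprod f1 g1 f2 g2 (c z : R) := (g1 z * f2 z + f1 z * g2 z) * c.
Let antid f1 g1 f2 g2 (c z : R) := w f1 g1 f2 g2 z * (c / (lam - mu)).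

(** Common to the three ranges of integration: the Wronskian of a solution at [lam] and one at [mu],
    divided by [lam - mu], is a primitive of their product. [a] and [b] are the factors of the Green
    functions frozen at the two outer points. *)
Let pair f1 g1 f2 g2 (a b z : R) : ode2 0 1 (fun x => q x - lam) f1 g1 ->
  ode2 0 1 (fun x => q x - mu) f2 g2 -> 0 < z < 1 ->
  `|g1 z * a| <= C * bvH' z -> `|f2 z * b| <= C -> `|f1 z * a| <= C -> `|g2 z * b| <= C * bvH' z ->
  [/\ der z (antid f1 g1 f2 g2 (a * b)) (prod f1 f2 (a * b) z),
   der z (prod f1 f2 (a * b)) (dprod f1 g1 f2 g2 (a * b) z) &
   `|dprod f1 g1 f2 g2 (a * b) z| <= S * bvH' z].
Proof.
move=> o1 o2 z1 h1 h2 h3 h4; have [[D1 _] [D2 _]] := (o1, o2); split.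
- apply: dv_eq (dvM (wronskian_const o1 o2 z1) (dv_cst (a * b / (lam - mu)) z)) _.
  by rewrite /prod; field.
- by apply: dv_eq (dvM (dvM (D1 z z1) (D2 z z1)) (dv_cst (a * b) z)) _; rewrite /dprod; ring.
have -> : dprod f1 g1 f2 g2 (a * b) z = (g1 z * a) * (f2 z * b) + (f1 z * a) * (g2 z * b) by rewrite /dprod; ring.
tri; rewrite !normrM.
have -> : S * bvH' z = C * bvH' z * C + C * (C * bvH' z) by rewrite /S; ring.
by apply: lerD; apply: ler_pM; rewrite -normrM.
Qed.

Let quad_fin (a b c s K : R) : `|a * (c / (lam - mu)) - b * (c / (lam - mu)) - s| <= K ->
  `|(lam - mu) * s - (a - b) * c| <= `|lam - mu| * K.
Proof.
have -> : (lam - mu) * s - (a - b) * c = - ((lam - mu) * (a * (c / (lam - mu)) - b * (c / (lam - mu)) - s)) by field.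
by move=> H; rewrite normrN normrM ler_wpM2l.
Qed.

Lemma resolvent_left : `|(lam - mu) * (h * \sum_(0 <= k < i)
    phi lam (xg R n k.+1) * phi mu (xg R n k.+1) * (psi lam xi * psi mu xj)) -
  (A xi - 0) * (psi lam xi * psi mu xj)| <= `|lam - mu| * (h * (4 * S)).
Proof.
apply: quad_fin; apply: (@quad_left R n (prod (phi lam) (phi mu) (psi lam xi * psi mu xj)) (dprod (phi lam) (dphi lam) (phi mu) (dphi mu) (psi lam xi * psi mu xj))
  (antid (phi lam) (dphi lam) (phi mu) (dphi mu) (psi lam xi * psi mu xj)) _ S0 _ _ i0 (leq_trans ij jn)).
  by apply: cvgMl; exact: wronskian_phi_cvg.
move=> z /andP[z0 zi]; have /andP[_ xi1] := xiI; have /andP[_ xj1] := xjI.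
have z1 : 0 < z < 1 by rewrite z0; exact: le_lt_trans xi1.
have [[g1 g2 _] _] := HC z0 zi xi1; have [_ [g4 g5 _]] := HC z0 (le_trans zi xij) xj1.
exact: pair.
Qed.

Lemma resolvent_mid : `|(lam - mu) * (h * \sum_(i <= k < j)
    psi lam (xg R n k.+1) * phi mu (xg R n k.+1) * (phi lam xi * psi mu xj)) -
  (B xj - B xi) * (phi lam xi * psi mu xj)| <= `|lam - mu| * (h * (4 * S)).
Proof.
apply: quad_fin; apply: le_trans (@quad_sum R n (prod (psi lam) (phi mu) (phi lam xi * psi mu xj)) (dprod (psi lam) (dpsi lam) (phi mu) (dphi mu) (phi lam xi * psi mu xj))
  (antid (psi lam) (dpsi lam) (phi mu) (dphi mu) (phi lam xi * psi mu xj)) _ S0 _ _ i0 ij jn _) _.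
  move=> z /andP[zi zj]; have /andP[xi0 _] := xiI; have /andP[_ xj1] := xjI.
  have z0 : 0 < z by exact: lt_le_trans zi.
  have z1 : z < 1 by exact: le_lt_trans xj1.
  have [[g1 _ g2] _] := HC xi0 zi z1; have [_ [g4 g5 _]] := HC z0 zj xj1.
  by apply: pair => //; [rewrite z0|rewrite mulrC|rewrite mulrC].
rewrite ler_wpM2l ?(ltW (hg_gt0 R n))//.
have /andP[_ b1] := bvH_bound xjI; have /andP[b2 _] := bvH_bound xiI.
by have := ler_wpM2l S0 b1; have := ler_wpM2l S0 b2; lra.
Qed.

Lemma resolvent_right : `|(lam - mu) * (h * \sum_(j <= k < n)
    psi lam (xg R n k.+1) * psi mu (xg R n k.+1) * (phi lam xi * phi mu xj)) -
  (0 - D xj) * (phi lam xi * phi mu xj)| <= `|lam - mu| * (h * (5 * S)).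
Proof.
apply: quad_fin; apply: (@quad_right R n (prod (psi lam) (psi mu) (phi lam xi * phi mu xj)) (dprod (psi lam) (dpsi lam) (psi mu) (dpsi mu) (phi lam xi * phi mu xj))
  (antid (psi lam) (dpsi lam) (psi mu) (dpsi mu) (phi lam xi * phi mu xj)) _ S0 _ _ (leq_trans i0 ij) jn).
- by apply: cvgMl; exact: wronskian_psi_cvg.
- move=> z /andP[zj z1]; have /andP[xi0 _] := xiI; have /andP[xj0 _] := xjI.
  have [[g1 _ g2] _] := HC xi0 (le_trans xij zj) z1; have [_ [g4 _ g5]] := HC xj0 zj z1.
  by apply: pair => //; [rewrite (lt_le_trans xj0)|rewrite mulrC..].
- move=> z /andP[zj z1]; have /andP[xi0 _] := xiI; have /andP[xj0 _] := xjI.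
  have [[g1 _ _] _] := HC xi0 (le_trans xij zj) z1; have [_ [g4 _ _]] := HC xj0 zj z1.
  have -> : prod (psi lam) (psi mu) (phi lam xi * phi mu xj) z = (phi lam xi * psi lam z) * (phi mu xj * psi mu z) by rewrite /prod; ring.
  by apply: le_trans CS; rewrite normrM; exact: ler_pM.
Qed.

(** The product of the Green functions is summed below [xi], between [xi] and [xj], and above [xj].
    Each sum is a difference of Wronskians up to quadrature error; those at the endpoints vanish,
    and the interior ones combine into [Gr lam - Gr mu]. The constant is [13 = 4 + 4 + 5]. *)
Lemma resolvent_sum_le : W lam != 0 -> W mu != 0 ->
  `|(lam - mu) * (h * \sum_(0 <= k < n) Gr lam xi (xg R n k.+1) * Gr mu (xg R n k.+1) xj) -
    (Gr lam xi xj - Gr mu xi xj)| <= `|lam - mu| * (h * (13 * S)) / `|W lam * W mu|.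
Proof.
move=> Wl Wm; have ml := mulf_neq0 Wl Wm.
have [e1 e2 e3] := And3 resolvent_left resolvent_mid resolvent_right.
have prodK (a b : R) : a / W lam * (b / W mu) * (W lam * W mu) = a * b.
  by move: (W lam) (W mu) Wl Wm => w1 w2 ? ?; field; apply/andP.
rewrite ler_pdivlMr ?normr_gt0// -normrM.
have wl := WrE lam xiI; have wm := WrE mu xjI.
have E : (\sum_(0 <= k < n) Gr lam xi (xg R n k.+1) * Gr mu (xg R n k.+1) xj) * (W lam * W mu) =
  \sum_(0 <= k < i) phi lam (xg R n k.+1) * phi mu (xg R n k.+1) * (psi lam xi * psi mu xj) +
  (\sum_(i <= k < j) psi lam (xg R n k.+1) * phi mu (xg R n k.+1) * (phi lam xi * psi mu xj) +
   \sum_(j <= k < n) psi lam (xg R n k.+1) * psi mu (xg R n k.+1) * (phi lam xi * phi mu xj)).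
  rewrite (@big_cat_nat _ _ _ i)//=; last exact: leq_trans ij jn.
  rewrite (@big_cat_nat _ _ _ j i n)//= [LHS]mulrDl [X in _ + X]mulrDl !mulr_suml.
  congr (_ + (_ + _)); apply: eq_big_nat => k /andP[k1 k2].
  - rewrite Gr_sym !Gr_le; [by rewrite prodK; ring| |]; apply: xg_le => //.
    exact: leq_trans ij.
  - rewrite !Gr_le; [by rewrite prodK; ring| |]; apply: xg_le => //.
    exact: leqW.
  - rewrite [Gr mu _ _]Gr_sym !Gr_le; [by rewrite prodK; ring| |]; apply: xg_le.
      exact: leqW.
    by apply: leqW; exact: leq_trans k1.
set T := \sum_(0 <= k < n) _ in E *.
set T1 := \sum_(0 <= k < i) _ in e1 E; set T2 := \sum_(i <= k < j) _ in e2 E.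
set T3 := \sum_(j <= k < n) _ in e3 E.
have -> : ((lam - mu) * (h * T) - (Gr lam xi xj - Gr mu xi xj)) * (W lam * W mu) =
  ((lam - mu) * (h * T1) - (A xi - 0) * (psi lam xi * psi mu xj)) +
  (((lam - mu) * (h * T2) - (B xj - B xi) * (phi lam xi * psi mu xj)) +
  ((lam - mu) * (h * T3) - (0 - D xj) * (phi lam xi * phi mu xj))).
  have -> : ((lam - mu) * (h * T) - (Gr lam xi xj - Gr mu xi xj)) * (W lam * W mu) =
     (lam - mu) * h * (T * (W lam * W mu)) - (Gr lam xi xj - Gr mu xi xj) * (W lam * W mu) by ring.
  rewrite E !Gr_le//.
  have -> : (phi lam xi * psi lam xj / W lam - phi mu xi * psi mu xj / W mu) * (W lam * W mu) =
    phi lam xi * psi lam xj * W mu - phi mu xi * psi mu xj * W lam.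
    by move: (W lam) (W mu) Wl Wm => w1 w2 ? ?; field; apply/andP.
  by rewrite -wl -wm /Wr -/(psi lam) -/(psi mu) /A /B /D /w; ring.
tri.
have -> : `|lam - mu| * (h * (13 * S)) = `|lam - mu| * (h * (4 * S)) + (`|lam - mu| * (h * (4 * S)) + `|lam - mu| * (h * (5 * S))).
  lra.
apply: lerD => //; tri; lra.
Qed.

End ResolventSum.

Lemma resolvent_sum lam mu : W lam != 0 -> W mu != 0 -> exists2 C, 0 <= C &
  forall n i j, (0 < i <= n)%N -> (0 < j <= n)%N ->
  `|(lam - mu) * (hg R n * \sum_(0 <= k < n) Gr lam (xg R n i) (xg R n k.+1) * Gr mu (xg R n k.+1) (xg R n j)) -
    (Gr lam (xg R n i) (xg R n j) - Gr mu (xg R n i) (xg R n j))| <= C * hg R n.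
Proof.
move=> Wl Wm; have [<-|ne] := eqVneq lam mu.
  by exists 0 => // n i j _ _; rewrite !subrr !mul0r subrr normr0.
have [C C0 HC] := green_bound2 lam mu.
pose K := `|lam - mu| * (13 * (2 * C * C)) / `|W lam * W mu|.
have K0 : 0 <= K by pos.
exists K => // n i j /andP[i0 iN] /andP[j0 jN].
have [ij|/ltnW ij] := leqP i j.
  apply: le_trans (resolvent_sum_le i0 ij jN ne C0 HC Wl Wm) _.
  by apply: le_of_eq; rewrite /K; ring.
have HC' z x : 0 < z -> z <= x -> x < 1 -> GB C mu z x /\ GB C lam z x.
  by move=> z0 zx x1; have [] := HC z x z0 zx x1.
rewrite eq_sym in ne.
have := resolvent_sum_le j0 ij iN ne C0 HC' Wm Wl.
have -> : \sum_(0 <= k < n) Gr lam (xg R n i) (xg R n k.+1) * Gr mu (xg R n k.+1) (xg R n j) =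
  \sum_(0 <= k < n) Gr mu (xg R n j) (xg R n k.+1) * Gr lam (xg R n k.+1) (xg R n i).
  by apply: eq_bigr => k _; rewrite mulrC Gr_sym [X in _ * X]Gr_sym.
rewrite (Gr_sym lam (xg R n i)) (Gr_sym mu (xg R n i)).
set T := \sum_(_ <= _ < _) _; set a := Gr lam _ _; set b := Gr mu _ _ => H.
have -> : (lam - mu) * (hg R n * T) - (a - b) = - ((mu - lam) * (hg R n * T) - (b - a)) by ring.
rewrite normrN; apply: le_trans H _; rewrite distrC [W mu * _]mulrC.
by apply: le_of_eq; rewrite /K; ring.
Qed.

(* [T] is the trace of the resolvent. *)
Lemma green_trace lam : W lam != 0 -> exists T C, [/\ der lam W (- (T * W lam)), 0 <= C &
  forall n, (0 < n)%N ->
   `|hg R n * \sum_(0 <= k < n) Gr lam (xg R n k.+1) (xg R n k.+1) - T| <= C * hg R n].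
Proof.
move=> Wl; have [Q [A0 [A1 [dQ cQ0 cQ1 dW]]]] := WW_derive lam.
have [C C0 HC] := green_bound lam.
pose f z := phi lam z * psi lam z.
pose f' z := dphi lam z * psi lam z + phi lam z * dpsi lam z.
have H z : 0 < z < 1 -> [/\ der z Q (f z), der z f (f' z) & `|f' z| <= 2 * C * bvH' z].
  move=> z1; split; first exact: dQ.
    have [p1 _] := ode2_phi lam; have [p2 _] := ode2_psi lam; exact: dvM (p1 z z1) (p2 z z1).
  have /andP[z0 z1'] := z1; have [_ g1 g2] := HC z z z0 (lexx z) z1'.
  tri; rewrite -mulrA mulrDl mul1r; lra.
have fC z : 0 < z < 1 -> `|f z| <= 2 * C.
  by move=> /andP[z0 z1]; have [g _ _] := HC z z z0 (lexx z) z1; lra.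
have C2 : 0 <= 2 * C by pos.
exists ((A1 - A0) / W lam), (9 * (2 * C) / `|W lam|); split.
- by rewrite divfK.
- pos.
move=> n n0; have /andP[xn0 xn1] : 0 < xg R n n < 1 by exact: xg_in.
have h1 : `|Q (xg R n n) - A0 - hg R n * \sum_(0 <= k < n) f (xg R n k.+1)| <= hg R n * (4 * (2 * C)).
  apply: (@quad_left R n f f' Q _ C2 n A0 n0 (leqnn n) cQ0) => z /andP[z0 zn].
  by apply: H; lra.
have h2 : `|A1 - Q (xg R n n) - hg R n * \sum_(n <= k < n) f (xg R n k.+1)| <= hg R n * (5 * (2 * C)).
  have i z : xg R n n <= z < 1 -> 0 < z < 1 by lra.
  apply: (@quad_right R n f f' Q _ C2 n A1 n0 (leqnn n) cQ1) => z /i.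
    exact: H.
  exact: fC.
rewrite big_geq// mulr0 subr0 in h2.
have -> : hg R n * \sum_(0 <= k < n) Gr lam (xg R n k.+1) (xg R n k.+1) - (A1 - A0) / W lam =
  - ((A1 - Q (xg R n n)) + (Q (xg R n n) - A0 - hg R n * \sum_(0 <= k < n) f (xg R n k.+1))) / W lam.
  rewrite (eq_bigr (fun k => f (xg R n k.+1) / W lam)) => [|k _]; last by rewrite Gr_le.
  rewrite -mulr_suml mulrA; move: (W lam)^-1 => iw; ring.
rewrite normrM normrN normfV [leRHS]mulrAC ler_wpM2r ?invr_ge0//.
tri; apply: le_trans (lerD h2 h1) _.
lra.
Qed.

End GreenFunction.

(** * The trace of the resolvent as a limit of matrices *)

Section TraceFormula.
Implicit Types (z mu t : R) (n : nat).
Local Notation W := WW.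
Variable lb : R.
Hypothesis Wlb : 0 < W lb.
Hypothesis phi0 : forall x, 0 < x < 1 -> 0 < phi lb x.
Hypothesis ps0 : forall x, 0 < x < 1 -> 0 < ps lb x.

Let h n : R := hg R n.+1.
Let X n (i : nat) : R := xg R n.+1 i.+1.
(** Quadrature matrix of the integral operator with kernel [Gr lam] on the interior grid points;
    matrix products become quadratures of kernel compositions, and the trace becomes one of the
    diagonal. *)
Definition Gmx lam n : 'M[R]_n.+1 := \matrix_(i, j) (h n * Gr lam (X n i) (X n j)).

Let XI n (i : nat) : (i < n.+1)%N -> 0 < X n i < 1. Proof. by move=> i_n; exact: xg_in. Qed.
Let XI' n (i : 'I_n.+1) : 0 < X n i < 1. Proof. exact: XI. Qed.
Let h0 n : 0 < h n. Proof. pos. Qed.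
Let nh n : n.+1%:R * h n <= 1.
Proof. by rewrite ler_pdivrMr ?ltr0n// mul1r ler_nat. Qed.
Let h1 n : h n <= 1.
Proof. by rewrite invf_le1 ?ltr0n// ler1n. Qed.

Lemma Gmx_sym n : (Gmx lb n)^T = Gmx lb n.
Proof. by apply/matrixP => i j; rewrite !mxE Gr_sym. Qed.

Let psi0 x : 0 < x < 1 -> 0 < psi lb x.
Proof. by move=> /andP[x0 x1]; apply: ps0; lra. Qed.

(** After division by [psi] at both points the kernel is [r (min i j) / W] with [r = phi / psi],
    which is nondecreasing because its derivative is [W / psi^2 > 0]. *)
Lemma Gmx_psd n (v : 'I_n.+1 -> R) : 0 <= \sum_i \sum_j v i * Gmx lb n i j * v j.
Proof.
pose r k := phi lb (X n k) / psi lb (X n k).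
pose w k := v (inord k) * psi lb (X n k).
have rm i j : (i <= j)%N -> (j < n.+1)%N -> r i <= r j.
  move=> ij jn; have Xij : X n i <= X n j by exact: xg_le.
  have dr x : X n i <= x <= X n j -> der x (fun x => phi lb x / psi lb x) (W lb / psi lb x ^+ 2).
    move=> /andP[ix xj]; have /andP[Xi0 _] := XI (leq_ltn_trans ij jn); have /andP[_ Xj1] := XI jn.
    have x1 : 0 < x < 1 by lra.
    have [dp _] := ode2_phi lb; have [ds _] := ode2_psi lb.
    have nz : psi lb x != 0 by rewrite gt_eqF// psi0.
    apply: dv_eq (dvM (dp x x1) (dvV nz (ds x x1))) _.
    rewrite -(WrE lb x1) /Wr; move: (phi lb x) (dphi lb x) (dpsi lb x) (psi lb x) nz => a b c d d0'.
    by field.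
  apply: (dv_le Xij dr) => x _; apply: divr_ge0; [exact: ltW|pos].
have -> : \sum_i \sum_j v i * Gmx lb n i j * v j =
   h n / W lb * \sum_(i < n.+1) \sum_(j < n.+1) w i * w j * r (minn i j).
  rewrite mulr_sumr; apply: eq_bigr => i _; rewrite mulr_sumr; apply: eq_bigr => j _.
  rewrite mxE /w !inord_val.
  have nz k : (k < n.+1)%N -> psi lb (X n k) != 0 by move=> kn; rewrite gt_eqF// psi0// XI.
  have [ni nj] := (nz i (ltn_ord i), nz j (ltn_ord j)).
  have Wn : W lb != 0 by rewrite gt_eqF.
  have [ij|/ltnW ij] := leqP i j.
    rewrite Gr_le; last exact: xg_le.
    rewrite /r; move: (W lb) (phi lb (X n i)) (psi lb (X n i)) (psi lb (X n j)) Wn ni nj => ? ? ? ? ? ? ?.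
    by field; apply/andP.
  rewrite Gr_sym Gr_le; last exact: xg_le.
  rewrite /r; move: (W lb) (phi lb (X n j)) (psi lb (X n i)) (psi lb (X n j)) Wn ni nj => ? ? ? ? ? ? ?.
  by field; apply/andP.
apply: mulr_ge0; first by rewrite divr_ge0// ltW.
apply: min_psd => [i i_n|i j ij jn]; last exact: rm.
by apply: divr_ge0; apply: ltW; [apply: phi0|apply: psi0]; exact: XI.
Qed.

Let sum_ord (F : nat -> R) n : \sum_(i < n.+1) F i = \sum_(0 <= k < n.+1) F k.
Proof. by rewrite big_mkord. Qed.

Lemma Gmx_trace lam : W lam != 0 -> exists T C, [/\ der lam W (- (T * W lam)), 0 <= C &
  forall n, `|\tr (Gmx lam n) - T| <= C * h n].
Proof.
move=> Wl; have [T [C [dW C0 HC]]] := green_trace Wl.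
exists T, C; split => // n; have := HC n.+1 (ltn0Sn n).
rewrite -sum_ord mulr_sumr /mxtrace.
by under [in X in _ -> X]eq_bigr do rewrite mxE.
Qed.

(** Entries of size [h] and [h^2] are what is needed: a diagonal entry in an orthonormal basis costs
    a factor equal to the matrix size, at most [1 / h], so those of [E] are still of order [h]. *)
Lemma Gmx_resolvent lam : W lam != 0 -> exists2 C, 0 <= C & forall n, exists E,
  [/\ (1%:M - (lam - lb) *: Gmx lb n) *m Gmx lam n = Gmx lb n + E,
      forall i j, `|Gmx lam n i j| <= C * h n & forall i j, `|E i j| <= C * h n ^+ 2].
Proof.
move=> Wl; have Wn : W lb != 0 by rewrite gt_eqF.
have [C C0 HC] := resolvent_sum Wn Wl.
have [D D0 HD] := Gr_bound lam.
exists (C + D) => [|n]; first lra.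
exists ((1%:M - (lam - lb) *: Gmx lb n) *m Gmx lam n - Gmx lb n); split.
- by rewrite addrCA subrr addr0.
- move=> i j; rewrite mxE normrM (ger0_norm (ltW (h0 n))) mulrC ler_wpM2r ?(ltW (h0 n))//.
  by apply: le_trans (HD _ _ (XI' i) (XI' j)) _; rewrite lerDr.
move=> i j; rewrite mulmxBl mul1mx -scalemxAl !mxE.
have := HC n.+1 i.+1 j.+1 (ltn_ord i) (ltn_ord j).
rewrite -sum_ord -/(X n i) -/(X n j).
under [in X in X -> _]eq_bigr => k _ do rewrite -/(X n k).
set S := \sum_(_ < _) _; set a := Gr lb _ _; set b := Gr lam _ _ => H.
have -> : \sum_k Gmx lb n i k * Gmx lam n k j = h n ^+ 2 * S.
  by rewrite mulr_sumr; apply: eq_bigr => k _; rewrite !mxE; ring.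
have -> : h n * b + - ((lam - lb) * (h n ^+ 2 * S)) + - (h n * a) = h n * ((lb - lam) * (h n * S) - (a - b)) by ring.
have hn := ltW (h0 n).
rewrite normrM (ger0_norm hn) (_ : (C + D) * h n ^+ 2 = h n * ((C + D) * h n)); last by ring.
by rewrite ler_wpM2l//; apply: le_trans H _; rewrite ler_wpM2r// lerDl.
Qed.

Definition eigen_data n (th : nat -> R) (d : nat -> 'M[R]_n.+1 -> R) :=
  [/\ forall k, 0 <= th k, forall i j : nat, (i <= j)%N -> th j <= th i,
      forall k : nat, (n.+1 <= k)%N -> th k = 0,
      forall k (B E F : 'M[R]_n.+1) t, (k < n.+1)%N -> (1%:M - t *: Gmx lb n) *m B = E + F ->
        (1 - t * th k) * d k B = d k E + d k F &
      (forall k, (k < n.+1)%N -> d k (Gmx lb n) = th k) /\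
      (forall B, \tr B = \sum_(0 <= k < n.+1) d k B) /\
      forall (k : nat) (B : 'M[R]_n.+1) (M : R), (k < n.+1)%N -> (forall i j, `|B i j| <= M) -> `|d k B| <= n.+1%:R * M].

(** The first conclusion, from the boundedness of the discrete resolvent at [lam], prevents
    eigenvalues from accumulating at [1 / (lam - lb)]; the second is the trace formula with an error
    that vanishes with the step. *)
Lemma trace_finite Ts S C lam : 0 <= C -> W lam != 0 ->
  (forall n, `|\tr (Gmx lb n) - Ts| <= C * h n) -> (forall n, \tr (Gmx lb n) <= S) ->
  exists T D, [/\ der lam W (- (T * W lam)), 0 <= D &
   forall n th d, @eigen_data n th d ->
   (forall k, (k < n.+1)%N -> th k <= D * `|1 - (lam - lb) * th k| + D * h n) /\
   forall K e, 0 < e -> (K <= n.+1)%N -> `|(lam - lb) * th K| <= 1 / 2 ->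
     (forall k, (k < K)%N -> e <= `|1 - (lam - lb) * th k|) ->
     `|T - Ts - \sum_(0 <= k < K) (lam - lb) * th k ^+ 2 / (1 - (lam - lb) * th k)| <=
       2 * `|lam - lb| * th K * S + (D + `|lam - lb| * S * D * (e^-1 + 2)) * h n].
Proof.
move=> C0 Wl trC trS.
have [T [D1 [dW D10 trB]]] := Gmx_trace Wl.
have [D2 D20 HE] := Gmx_resolvent Wl.
exists T, (C + D1 + D2); split => //; first lra.
move=> n th d [th0 thm thn dE [dA [dtr dM]]].
have [E [EE Bb Eb]] := HE n; pose t := lam - lb; rewrite -/t in EE *.
have hn := ltW (h0 n).
have eb k : (k < n.+1)%N -> `|d k E| <= D2 * h n.
  move=> kn; apply: le_trans (dM _ _ _ kn Eb) _.
  rewrite (_ : _ * (D2 * h n ^+ 2) = (n.+1%:R * h n) * (D2 * h n)); last by ring.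
  by rewrite -[leRHS]mul1r ler_wpM2r// mulr_ge0.
have bb k : (k < n.+1)%N -> `|d k (Gmx lam n)| <= D2.
  move=> kn; apply: le_trans (dM _ _ _ kn Bb) _.
  rewrite (_ : _ * (D2 * h n) = (n.+1%:R * h n) * D2); last by ring.
  by rewrite -[leRHS]mul1r ler_wpM2r.
have dB k : (k < n.+1)%N -> (1 - t * th k) * d k (Gmx lam n) = th k + d k E.
  by move=> kn; rewrite (dE _ _ _ _ _ kn EE) dA.
have trA : \tr (Gmx lb n) = \sum_(0 <= k < n.+1) th k.
  by rewrite dtr; apply: eq_big_nat => k /andP[_ kn]; rewrite dA.
split.
  move=> k kn; have tE : th k = (1 - t * th k) * d k (Gmx lam n) - d k E.
    by rewrite dB// addrK.
  set u := 1 - t * th k in tE *; rewrite tE.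
  apply: le_trans (ler_norm _) _; apply: le_trans (ler_normB _ _) _; rewrite normrM; apply: lerD.
    by rewrite mulrC ler_wpM2r//; apply: le_trans (bb k kn) _; rewrite lerDr addr_ge0.
  by apply: le_trans (eb k kn) _; rewrite ler_wpM2r// lerDr addr_ge0.
move=> K e e0 Kn tK ke.
have Dh : 0 <= D2 * h n by pos.
have thS : \sum_(0 <= k < n.+1) th k <= S by rewrite -trA.
have main := finite_trace th0 thm Dh dB eb thS Kn e0 tK ke.
rewrite -!dtr -trA in main.
have trE : `|\tr E| <= D2 * h n.
  rewrite /mxtrace; apply: le_trans (ler_norm_sum _ _ _) _.
  apply: (@le_trans _ _ (\sum_(i < n.+1) D2 * h n ^+ 2)); first by apply: ler_sum => i _.
  rewrite sumr_const card_ord -mulr_natl (_ : _ * (D2 * h n ^+ 2) = (n.+1%:R * h n) * (D2 * h n)); last by ring.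
  by rewrite -[leRHS]mul1r ler_wpM2r.
set s := \sum_(0 <= k < K) _ in main *.
have -> : T - Ts - s = (\tr (Gmx lam n) - \tr (Gmx lb n) - \tr E - s) +
  (\tr E + ((\tr (Gmx lb n) - Ts) - (\tr (Gmx lam n) - T))) by ring.
tri.
have h2 : `|\tr E + ((\tr (Gmx lb n) - Ts) - (\tr (Gmx lam n) - T))| <= (C + D1 + D2) * h n.
  tri; rewrite [leRHS]mulrDl [leRHS]addrC; apply: lerD => //.
  by apply: le_trans (ler_normB _ _) _; rewrite mulrDl; apply: lerD.
apply: le_trans (lerD main h2) _.
have S0 : 0 <= S by apply: le_trans thS; apply: sumr_ge0.
have tS : 0 <= `|t| * S by pos.
have e2 : 0 <= e^-1 + 2 by pos.
have : `|t| * S * (D2 * h n) * (e^-1 + 2) <= `|t| * S * ((C + D1 + D2) * h n) * (e^-1 + 2).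
  by rewrite ler_wpM2r// ler_wpM2l// ler_wpM2r// lerDr addr_ge0.
glra.
Qed.

(** The limit is taken rank by rank. The traces converge to [Ts], but partial sums only pass to the
    limit as inequalities, so the sum of the [th k] is merely bounded by [Ts] at this stage. *)
Lemma trace_formula : exists (th : nat -> R) (Ts S : R),
  [/\ forall k, 0 <= th k, forall i j, (i <= j)%N -> th j <= th i,
      forall K, \sum_(0 <= k < K) th k <= Ts /\ th K * K.+1%:R <= S, 0 <= S &
  forall lam, W lam != 0 -> (forall k, (lam - lb) * th k != 1) /\
   exists2 T, der lam W (- (T * W lam)) & forall K, `|(lam - lb) * th K| <= 1 / 3 ->
    `|T - Ts - \sum_(0 <= k < K) (lam - lb) * th k ^+ 2 / (1 - (lam - lb) * th k)| <= 2 * `|lam - lb| * th K * S].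
Proof.
have Wn : W lb != 0 by rewrite gt_eqF.
have [Ts [C [_ C0 trC]]] := Gmx_trace Wn.
have trS n : \tr (Gmx lb n) <= Ts + C.
  have := trC n; rewrite ler_norml => /andP[_ t2]; have := ler_wpM2l C0 (h1 n); lra.
have /choice[th Hth] : forall n, exists th : nat -> R, exists d, @eigen_data n th d.
  by move=> n; exact: (psd_spectral (Gmx_sym n) (@Gmx_psd n)).
have thE n K : \sum_(0 <= k < K) th n k <= \tr (Gmx lb n).
  have [d [th0 thm thn _ [dA [dtr _]]]] := Hth n.
  have -> : \tr (Gmx lb n) = \sum_(0 <= k < n.+1) th n k.
    by rewrite dtr; apply: eq_big_nat => k /andP[_ kn]; rewrite dA.
  have [Kn|/ltnW Kn] := leqP K n.+1.
    by rewrite [leRHS](@big_cat_nat _ _ _ K)//= lerDl sumr_ge0.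
  rewrite (@big_cat_nat _ _ _ n.+1)//= [X in _ + X]big_nat_cond [X in _ + X]big1 ?addr0// => k /andP[/andP[nk _] _].
  exact: thn.
have th0 n k : 0 <= th n k by have [d []] := Hth n.
have thm n i j : (i <= j)%N -> th n j <= th n i by have [d [_ + _ _ _]] := Hth n; apply.
have thS n K : th n K * K.+1%:R <= Ts + C.
  apply: le_trans (trS n); apply: le_trans (thE n K.+1).
  rewrite big_mkord mulr_natr -[X in _ *+ X](card_ord K.+1) -sumr_const.
  by apply: ler_sum => i _; apply: thm; rewrite -ltnS.
(* One ultrafilter makes all the bounded sequences [th n k] converge at once, in place of a diagonal
   extraction. *)
have [U [UU sU]] := ultraFilterLemma (@eventually_filter).
have S0 : 0 <= Ts + C by apply: le_trans (thS 0 0); rewrite mulr1.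
have /choice[ll Hl] : forall k, exists l : R, th n k @[n --> U] --> l.
  move=> k; apply: (@ultra_cvg R U _ (Ts + C)) => n; rewrite th0/=.
  by apply: le_trans (thS n k); rewrite ler_peMr// ler1n.
have hU : h n @[n --> U] --> (0 : R).
  apply: (cvg_trans (cvg_app _ sU)); rewrite /h /hg.
  by have := @cvg_harmonic R; rewrite -(cvg_shiftS (@harmonic R)).
have ge_lim (u : nat -> R) l a : u n @[n --> U] --> l -> (\forall n \near U, a <= u n) -> a <= l.
  by move=> ul; exact: (cvgr_to_ge ul).
have le_lim (u : nat -> R) l a : u n @[n --> U] --> l -> (\forall n \near U, u n <= a) -> l <= a.
  by move=> ul; exact: (cvgr_to_le ul).
have sum_lim (u : nat -> nat -> R) (l : nat -> R) K : (forall k, (k < K)%N -> u n k @[n --> U] --> l k) ->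
   \sum_(0 <= k < K) u n k @[n --> U] --> \sum_(0 <= k < K) l k.
  elim: K => [|K IH] ul.
    by under eq_cvg do rewrite big_geq//; rewrite big_geq//; exact: cvg_cst.
  under eq_cvg do rewrite big_nat_recr//=; rewrite big_nat_recr//=.
  by apply: cvgD; [apply: IH => k kK; apply: ul; exact: leqW|exact: ul].
have large K : \forall n \near U, (K <= n)%N by apply: sU; exact: nbhs_infty_ge.
have trU : \tr (Gmx lb n) @[n --> U] --> Ts.
  apply/cvgrPdist_le => e e0; have : C * h n @[n --> U] --> C * 0 by exact: cvgMr.
  rewrite mulr0 => /cvgr_le /(_ e e0); apply: filterS => n; rewrite distrC; exact: le_trans.
exists ll, Ts, (Ts + C); split => //.
- by move=> k; apply: (ge_lim _ _ _ (Hl k)); near=> n.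
- move=> i j ij; rewrite -subr_ge0; apply: (ge_lim (fun n => th n i - th n j)); first exact: cvgB.
  by near=> n; rewrite subr_ge0 thm.
- move=> K; split; last first.
    by apply: (le_lim (fun n => th n K * K.+1%:R)); [exact: cvgMl|near=> n].
  rewrite -subr_ge0; apply: (ge_lim (fun n => \tr (Gmx lb n) - \sum_(0 <= k < K) th n k)).
    by apply: cvgB => //; exact: sum_lim.
  by near=> n; rewrite subr_ge0.
move=> lam Wl; have [T [D [dW D0 HT]]] := trace_finite C0 Wl trC trS.
set t := lam - lb in HT *.
have HT' n := let: ex_intro d dd := Hth n in HT n (th n) d dd.
have den_lim k : 1 - t * th n k @[n --> U] --> 1 - t * ll k.
  by apply: cvgB; [exact: cvg_cst|exact: cvgMr].
(* If the limit eigenvalue were [1 / t], the bound [th k <= D |1 - t th k| + D h] would force it to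
   be [0] in the limit. *)
have ne1 k : t * ll k != 1.
  apply/eqP => tl.
  have H : D * `|1 - t * th n k| + D * h n - th n k @[n --> U] --> D * `|1 - t * ll k| + D * 0 - ll k.
    by apply: cvgB => //; apply: cvgD; [apply: cvgMr; exact: cvg_norm|exact: cvgMr].
  have : 0 <= D * `|1 - t * ll k| + D * 0 - ll k.
    apply: (ge_lim _ _ _ H); near=> n; rewrite subr_ge0.
    have [HT1 _] := HT' n; apply: HT1; near: n; exact: large.
  rewrite tl subrr normr0 !mulr0 !add0r oppr_ge0 => l0.
  have l1 : 0 <= ll k by apply: (ge_lim _ _ _ (Hl k)); near=> n.
  have l2 : ll k = 0 by (move: l1 l0; glra).
  by rewrite l2 mulr0 in tl; move/eqP: tl; rewrite eq_sym oner_eq0.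
split => //; exists T => // K tK.
have [e e0 He] : exists2 e, 0 < e & \forall n \near U, forall k, (k < K)%N -> e <= `|1 - t * th n k|.
  elim: (K) => [|L [e e0 He]]; first by exists 1 => //; near=> n.
  have d0' : 0 < `|1 - t * ll L| by rewrite normr_gt0 subr_eq0 eq_sym.
  exists (Num.min e (`|1 - t * ll L| / 2)).
    by rewrite lt_min e0 divr_gt0.
  have He2 : \forall n \near U, `|1 - t * ll L| / 2 <= `|1 - t * th n L|.
    have dl : `|1 - t * th n L| @[n --> U] --> `|1 - t * ll L| by apply: cvg_norm; by [].
    by move: dl => /cvgr_ge; apply; move: d0'; glra.
  near=> n => k; rewrite ltnS leq_eqVlt ge_min => /predU1P[->|kL].
    by apply/orP; right; near: n.
  by apply/orP; left; move: k kL; near: n.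
have H : `|T - Ts - \sum_(0 <= k < K) t * th n k ^+ 2 / (1 - t * th n k)| -
   (2 * `|t| * th n K * (Ts + C) + (D + `|t| * (Ts + C) * D * (e^-1 + 2)) * h n) @[n --> U] -->
   `|T - Ts - \sum_(0 <= k < K) t * ll k ^+ 2 / (1 - t * ll k)| -
   (2 * `|t| * ll K * (Ts + C) + (D + `|t| * (Ts + C) * D * (e^-1 + 2)) * 0).
  apply: cvgB; last by apply: cvgD; [apply: cvgMl; exact: cvgMr|exact: cvgMr].
  apply: cvg_norm; apply: cvgB; first exact: cvg_cst.
  apply: sum_lim => k _; apply: cvgM; first by apply: cvgMr; apply: cvgM.
  by apply: cvgV => //; rewrite subr_eq0 eq_sym.
rewrite mulr0 addr0 in H; rewrite -subr_le0; apply: (le_lim _ _ _ H).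
near=> n; rewrite subr_le0; have [_ HT2] := HT' n; apply: HT2 => //.
- by near: n; apply: filterS (large K) => n; exact: leqW.
- near: n; have tl : `|t * th n K| @[n --> U] --> `|t * ll K| by apply: cvg_norm; exact: cvgMr.
  by move: tl => /cvgr_le; apply; lra.
- near: n; exact: He.
Unshelve. all: by end_near. Qed.

End TraceFormula.

Local Notation W := WW.

Lemma besK_gt0 m : 0 <= m -> 0 < besK m :> R.
Proof.
move=> h; rewrite divr_gt0 ?mulr_gt0 ?sqrt_pi_gt0//.
by apply: Gamma_pos; lra.
Qed.

Let WE lam : W lam = ps lam (1 / 2) * dphi lam (1 / 2) + dps lam (1 / 2) * phi lam (1 / 2).
Proof.
by rewrite /WW /Wr /psi /dpsi /refl /nrefl half1 mulNr opprK.
Qed.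

Lemma WW_asymp : exists C k0 s : R, [/\ 0 <= C, 4 <= k0, 0 < s &
  forall k, k0 <= k ->
  [/\ forall x, 0 < x < 3 / 4 -> 0 < phi (- k ^+ 2) x, forall x, 0 < x < 3 / 4 -> 0 < ps (- k ^+ 2) x, 0 < W (- k ^+ 2) &
   `|W (- k ^+ 2) * (k `^ (m0 + m1 - 1) * expR (- k)) - 2 * (besK m0 * besK m1)| <= C * k `^ (- s)]].
Proof.
have [C0 [k0 [s0 [C00 k04 /andP[s00 s01] H0]]]] := nsol_asymp qs0.
have [C1 [k1 [s1 [C10 k14 /andP[s10 s11] H1]]]] := nsol_asymp qs1.
have p0 : 0 <= m0 by case: qs0.
have p1 : 0 <= m1 by case: qs1.
have B0 := besK_gt0 p0; have B1 := besK_gt0 p1.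
pose s := Num.min s0 s1; have s_gt0 : 0 < s by rewrite lt_min s00.
pose D1 := C1 * (besK m0 + C0) + besK m1 * C0.
have D10 : 0 <= D1 by apply: addr_ge0; apply: mulr_ge0 => //; [apply: addr_ge0 => //; exact: ltW|exact: ltW].
pose C := 2 * D1; have CC : 0 <= C by rewrite mulr_ge0.
pose P := 2 * (besK m0 * besK m1); have PP : 0 < P by apply: mulr_gt0 => //; exact: mulr_gt0.
(* The last summand makes [C k^(-s) < P], so that the asymptotic formula forces [W (- k^2) > 0]. *)
exists C, (k0 + k1 + ((C + 1) / P) `^ s^-1), s.
have pw : 0 <= ((C + 1) / P) `^ s^-1 by pos.
split => //; first by lra.
move=> k hk.
have kk0 : k0 <= k by lra.
have kk1 : k1 <= k by lra.
have kp : 0 < k by lra.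
have k1' : 1 <= k by lra.
have [f0 fb gb] := H0 k kk0 _ _ (phiN (- k ^+ 2)).
have [h0 hb ib] := H1 k kk1 _ _ (psN (- k ^+ 2)).
pose t := k `^ (- s).
have t0 : 0 < t by pos.
have t1 : t <= 1 by rewrite /t powRN invf_le1 ?powR_gt0// -(powRr0 k); apply: ler_powR => //; exact: ltW.
have t01 : 0 <= t <= 1 by rewrite (ltW t0).
have st0 : k `^ (- s0) <= t by apply: ler_powR => //; rewrite lerN2 ge_min lexx.
have st1 : k `^ (- s1) <= t by apply: ler_powR => //; rewrite lerN2 ge_min lexx orbT.
have {}fb := le_trans fb (ler_wpM2l C00 st0); have {}gb := le_trans gb (ler_wpM2l C00 st0).
have {}hb := le_trans hb (ler_wpM2l C10 st1); have {}ib := le_trans ib (ler_wpM2l C10 st1).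
have E1 := prod_est t01 C00 C10 (ltW B1) (ltW B0) hb gb.
have E2 := prod_est t01 C00 C10 (ltW B1) (ltW B0) ib fb.
rewrite -/D1 in E1 E2.
have main : `|W (- k ^+ 2) * (k `^ (m0 + m1 - 1) * expR (- k)) - P| <= C * t.
  have -> : W (- k ^+ 2) * (k `^ (m0 + m1 - 1) * expR (- k)) - P =
   (ps (- k ^+ 2) (1 / 2) * k `^ m1 * expR (- (k / 2)) * (dphi (- k ^+ 2) (1 / 2) * k `^ (m0 - 1) * expR (- (k / 2))) - besK m1 * besK m0) +
   (dps (- k ^+ 2) (1 / 2) * k `^ (m1 - 1) * expR (- (k / 2)) * (phi (- k ^+ 2) (1 / 2) * k `^ m0 * expR (- (k / 2))) - besK m1 * besK m0).
    rewrite WE (powRB1 (m0 + m1)) // (powRB1 m0)// (powRB1 m1)// powR_add//.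
    have -> : expR (- k) = expR (- (k / 2)) ^+ 2 by rewrite expr2 -expRD; congr expR; field.
    rewrite /P; move: (expR _) (k `^ m0) (k `^ m1) => e a b.
    by field; rewrite gt_eqF.
  tri; have -> : C * t = D1 * t + D1 * t by rewrite /C; ring.
  exact: lerD.
split=> //.
have pe : 0 < k `^ (m0 + m1 - 1) * expR (- k) by pos.
rewrite -(pmulr_lgt0 _ pe).
have : C * t < P.
  have q0 : 0 <= (C + 1) / P by rewrite divr_ge0 ?addr_ge0// ltW.
  have ke : (C + 1) / P <= k `^ s.
    have -> : (C + 1) / P = (((C + 1) / P) `^ s^-1) `^ s by rewrite -powRrM mulVf ?gt_eqF// powRr1.
    apply: ge0_ler_powR => //; rewrite ?nnegrE//; [pos|exact: ltW|lra].
  rewrite /t powRN ltr_pdivrMr ?powR_gt0//.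
  by move: ke; rewrite ler_pdivrMr//; glra.
by move: main; rewrite ler_norml => /andP[]; glra.
Qed.

(** Where [psi > 0] the ratio [phi / psi] increases, its derivative being [W / psi^2]; positivity of
    [phi] thus propagates from [1/2] to the far endpoint, and symmetrically for [psi]. *)
Let positive lam : (forall x, 0 < x < 3 / 4 -> 0 < phi lam x) -> (forall x, 0 < x < 3 / 4 -> 0 < ps lam x) ->
  0 < W lam -> (forall x, 0 < x < 1 -> 0 < phi lam x) /\ (forall x, 0 < x < 1 -> 0 < ps lam x).
Proof.
move=> f0 h0 W0; have [dph ddph] := ode2_phi lam; have [dpp ddpp] := ode2_psi lam.
set p := psi lam in dpp ddpp; set dp := dpsi lam in dpp ddpp.
have p0 x : 1 / 4 < x < 1 -> 0 < p x by move=> h; apply: h0; lra.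
have Wx x : 0 < x < 1 -> p x * dphi lam x - dp x * phi lam x = W lam by move=> h; exact: (WrE).
have h12 : 0 < phi lam (1 / 2) by apply: f0; lra.
have p12 : 0 < p (1 / 2) by apply: p0; lra.
split => x x1.
  have [x12|x12] := ltP x (1 / 2); first by apply: f0; lra.
  have px : 0 < p x by apply: p0; lra.
  have h : phi lam (1 / 2) / p (1 / 2) <= phi lam x / p x.
    apply: (@dv_le R (1 / 2) x (fun y => phi lam y / p y) (fun y => W lam / p y ^+ 2) x12) => y.
      move=> /andP[y1 y2]; have y01 : 0 < y < 1 by lra.
      have py : p y != 0 by rewrite gt_eqF// p0; move: y01 y1; glra.
      apply: dv_eq (dvM (dph y y01) (dvV py (dpp y y01))) _.
      by rewrite -(Wx y y01); field.
    by move=> /andP[y1 y2]; rewrite divr_ge0 ?sqr_ge0// ltW.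
  have : 0 < phi lam x / p x by apply: lt_le_trans h; rewrite divr_gt0.
  by rewrite pmulr_lgt0// invr_gt0.
have -> : ps lam x = p (1 - x) by rewrite /p /psi /refl subKr.
have [x12|x12] := ltP x (1 / 2); first by apply: p0; lra.
have {}x1 := in01_refl x1; have {x12} : 1 - x <= 1 / 2 by lra.
move: (1 - x) x1 => y y1 y12; have [y0 yl] := andP y1.
have fy : 0 < phi lam y by apply: f0; lra.
have h : - (p y / phi lam y) <= - (p (1 / 2) / phi lam (1 / 2)).
  apply: (@dv_le R y (1 / 2) (fun y => - (p y / phi lam y)) (fun y => W lam / phi lam y ^+ 2) y12) => z.
    move=> /andP[z1 z2]; have z01 : 0 < z < 1 by lra.
    have pz : phi lam z != 0 by rewrite gt_eqF// f0; move: z01 z2; glra.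
    apply: dv_eq (dvN (dvM (dpp z z01) (dvV pz (dph z z01)))) _.
    by rewrite -(Wx z z01); field.
  nra.
rewrite lerN2 in h.
have : 0 < p y / phi lam y by apply: lt_le_trans h; rewrite divr_gt0.
by rewrite pmulr_lgt0// invr_gt0.
Qed.

Lemma spectral_data : exists (C k0 s lb : R) (th : nat -> R) (Ts : R),
  [/\ [/\ 0 < s, 0 < k0 & forall k, k0 <= k ->
     `|W (- k ^+ 2) * (k `^ (m0 + m1 - 1) * expR (- k)) - 2 * (besK m0 * besK m1)| <= C * k `^ (- s)],
   lb < 0 /\ forall lam, lam <= lb -> 0 < W lam,
   [/\ forall i, 0 <= th i, forall i j, (i <= j)%N -> th j <= th i & forall K, \sum_(0 <= i < K) th i <= Ts],
   forall lam, (W lam = 0 <-> exists i, (lam - lb) * th i = 1) /\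
     forall i j, (lam - lb) * th i = 1 -> (lam - lb) * th j = 1 -> i = j &
   forall lam, W lam != 0 -> \prod_(0 <= i < K) (1 - (lam - lb) * th i) @[K --> \oo] --> W lam / W lb].
Proof.
have [C [k0 [s [C0 k04 s0 H]]]] := WW_asymp.
have kp : 0 < k0 by lra.
(* Every [lam <= lb] is [- k^2] with [k >= k0], so [W > 0] on the whole half line below [lb]. *)
pose lb := - k0 ^+ 2.
have [f0 h0 Wlb Wb0] := H k0 (lexx _); rewrite -/lb in f0 h0 Wlb.
have Wneg lam : lam <= lb -> 0 < W lam.
  move=> h; have h1 : 0 <= - lam by rewrite oppr_ge0 (le_trans h)// oppr_le0 sqr_ge0.
  have k0l : k0 <= Num.sqrt (- lam).
    by rewrite -(ger0_norm (ltW kp)) -sqrtr_sqr ler_wsqrtr// lerNr.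
  by have [_ _ +  _] := H _ k0l; rewrite sqr_sqrtr// opprK.
have [fp hp] := positive f0 h0 Wlb.
have [th [Ts [S [th0 thm thTS S0 Htr]]]] := trace_formula Wlb fp hp.
have thT K : \sum_(0 <= k < K) th k <= Ts by case: (thTS K).
have thS K : th K * K.+1%:R <= S by case: (thTS K).
have Wsimple lam : W lam = 0 -> exists2 D, D != 0 & der lam W D.
  exact: (WW_simple).
have p0 : 0 <= m0 by case: qs0.
have p1 : 0 <= m1 by case: qs1.
pose P := 2 * (besK m0 * besK m1); have PP : 0 < P by apply: mulr_gt0 => //; apply: mulr_gt0; exact: besK_gt0.
have growth (g : R) : 0 < g -> exists2 lam, lam <= lb & W lam < W lb * expR (g * (lb - lam)).
  (* [W (- k^2)] is at most [(P + C) exp (2 k)], so it is enough that [A + 2 k < g k^2]; the choice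
     of [k] gives [g k >= 3 + |A|], which suffices as [k >= 1]. *)
  move=> g0; pose A := ln ((P + C) / W lb) + g * k0 ^+ 2.
  have PC : 0 < P + C by lra.
  pose k := k0 + (3 + `|A|) / g; have gA : 0 <= (3 + `|A|) / g by rewrite divr_ge0 ?addr_ge0// ltW.
  have kk0 : k0 <= k by rewrite /k; move: gA; glra.
  have k1 : 1 <= k by lra.
  have k00 : 0 < k by (move: k1; glra).
  exists (- k ^+ 2); first by rewrite lerN2 ler_pXn2r ?nnegrE ?(ltW k00) ?(ltW kp).
  have [_ _ _ Wk] := H k kk0.
  have t1 : k `^ (- s) <= 1 by rewrite powRN invf_le1 ?powR_gt0// -(powRr0 k); apply: ler_powR => //; exact: ltW.
  have up : W (- k ^+ 2) * (k `^ (m0 + m1 - 1) * expR (- k)) <= P + C.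
    have := ler_wpM2l C0 t1; move: Wk; rewrite -/P ler_norml => /andP[_]; glra.
  have up2 : W (- k ^+ 2) <= (P + C) * (k * expR k).
    have e : expR k * expR (- k) = 1 by rewrite -expRD subrr expR0.
    have pk : k * k `^ (m0 + m1 - 1) = k `^ (m0 + m1) by rewrite powRB1//; field; rewrite gt_eqF.
    have W0 : 0 < W (- k ^+ 2) by have [_ _ + _] := H k kk0.
    have ke : 0 <= k * expR k by pos.
    have := ler_wpM2r ke up.
    have -> : W (- k ^+ 2) * (k `^ (m0 + m1 - 1) * expR (- k)) * (k * expR k) = W (- k ^+ 2) * ((k * k `^ (m0 + m1 - 1)) * (expR k * expR (- k))) by ring.
    rewrite e pk mulr1; apply: le_trans; rewrite ler_peMr ?(ltW W0)//.
    by rewrite -(powRr0 k); apply: ler_powR => //; pos.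
  have up3 : W (- k ^+ 2) <= (P + C) * expR (2 * k).
    apply: le_trans up2 _; apply: ler_wpM2l; first exact: ltW.
    have -> : expR (2 * k) = expR k * expR k by rewrite -expRD; congr expR; ring.
    apply: ler_wpM2r; first exact: expR_ge0.
    by have := expR_ge1Dx k; glra.
  apply: le_lt_trans up3 _.
  have -> : P + C = W lb * expR (ln ((P + C) / W lb)).
    by rewrite lnK ?posrE ?divr_gt0//; field; rewrite gt_eqF.
  rewrite -mulrA ltr_pM2l// -expRD ltr_expR /lb.
  have gk : (3 + `|A|) <= g * k.
    rewrite mulrDr; have -> : g * ((3 + `|A|) / g) = 3 + `|A| by field; rewrite gt_eqF.
    nra.
  have gkk : (3 + `|A|) * k <= g * k * k by rewrite ler_wpM2r// ltW.
  have Ak : `|A| <= `|A| * k by rewrite ler_peMr.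
  have := ler_norm A; rewrite /A in gkk *; move: gkk Ak; rewrite !expr2; lra.
exists C, k0, s, lb, th, Ts; split => //.
- by split => // k hk; have [] := H k hk.
- by split => //; rewrite oppr_lt0 exprn_gt0.
- move=> lam; split; first split => [/(zero_index th0 thm thT thS S0 Wsimple Htr)[i Hi _]|[i Hi]]; first by exists i.
  by apply/eqP/negP => /negP/Htr[/(_ i)]; rewrite Hi eqxx.
  move=> i j Hi Hj.
  have W0 : W lam = 0 by apply/eqP/negP => /negP/Htr[/(_ i)]; rewrite Hi eqxx.
  have [n _ u] := zero_index th0 thm thT thS S0 Wsimple Htr W0.
  by rewrite (u i Hi) (u j Hj).
- by move=> lam Wn; exact: (product_formula Wneg th0 thm thT thS S0 Wsimple Htr growth Wn).
Qed.

End TwoEnds.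

(** * Complex differentiability from quadratic estimates *)

Section ComplexDerivative.
Variable R : realType.
Implicit Types (f g : Cx R -> Cx R) (s z D : Cx R).

Lemma cdv_eq f s D D' : der s f D' -> D' = D -> der s f D.
Proof. by move=> ? <-. Qed.

Lemma cdv_cst (c : Cx R) s : der s (fun=> c) 0.
Proof. exact: (is_derive_cst c s 1). Qed.

Lemma cdv_id s : der s (fun z : Cx R => z) 1.
Proof. exact: (is_derive_id s 1). Qed.

Lemma cdvD f g s a b : der s f a -> der s g b -> der s (fun z => f z + g z) (a + b).
Proof. by move=> fa gb; exact: (is_deriveD fa gb). Qed.

Lemma cdvM f g s a b : der s f a -> der s g b ->
  der s (fun z => f z * g z) (a * g s + f s * b).
Proof.
move=> fa gb; apply: cdv_eq (is_deriveM fa gb) _.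
by rewrite /GRing.scale/= addrC [g s * a]mulrC.
Qed.

Lemma cdvV f s a : f s != 0 -> der s f a -> der s (fun z => (f z)^-1) (- (a / f s ^+ 2)).
Proof.
move=> f0 fa; have df : derivable f s 1 by [].
apply: DeriveDef; first exact: derivableV.
by rewrite deriveV// derive_val scaleNr mulrC.
Qed.

Lemma normc_le (w : R[i]) c : `|Re w| <= c -> `|Im w| <= c -> `|w| <= (2 * c)%:C%C.
Proof.
move=> h1 h2; rewrite normc_def lecR.
have c0 : 0 <= c by apply: le_trans h1.
rewrite -[leRHS]ger0_norm ?mulr_ge0// -sqrtr_sqr ler_wsqrtr//.
rewrite -[_ ^+ 2](real_normK (num_real (Re w))) -[X in _ + X](real_normK (num_real (Im w))).
have e1 : `|Re w| ^+ 2 <= c ^+ 2 by rewrite ler_pXn2r ?nnegrE.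
have e2 : `|Im w| ^+ 2 <= c ^+ 2 by rewrite ler_pXn2r.
have := sqr_ge0 c; lra.
Qed.

(** The hypothesis is split into real and imaginary parts because the transforms below are built
    from pairs of real integrals. *)
Lemma cdv_of_quad f s D (r K : R) : 0 < r -> 0 <= K ->
  (forall h : R[i], `|Re h| <= r -> `|Im h| <= r ->
    `|Re (f (s + h) - f s - h * D)| <= K * (Re h ^+ 2 + Im h ^+ 2) /\
    `|Im (f (s + h) - f s - h * D)| <= K * (Re h ^+ 2 + Im h ^+ 2)) ->
  der s f D.
Proof.
move=> r0 K0 H.
have key : (fun h : Cx R => h^-1 *: (f (h *: 1 + s) - f s)) @ (0 : Cx R)^' --> D.
  apply/cvgrPdist_le => e e0.
  have K1 : 0 < (2 * K + 1)%:C%C by rewrite ltcR; lra.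
  have eK : 0 < e / (2 * K + 1)%:C%C by pos.
  near=> h.
  have h0 : h != 0 by near: h; exact: nbhs_dnbhs_neq.
  have hr : `|h| <= r%:C%C by near: h; apply: dnbhs0_le; rewrite ltcR.
  have he : `|h| <= e / (2 * K + 1)%:C%C by near: h; exact: dnbhs0_le.
  have hn : 0 < `|h| by rewrite normr_gt0.
  have rer : `|Re h| <= r by rewrite -lecR; apply: le_trans hr; exact: normc_ge_Re.
  have imr : `|Im h| <= r.
    by rewrite -lecR; apply: le_trans hr; rewrite normc_def lecR -sqrtr_sqr ler_wsqrtr// lerDr sqr_ge0.
  have [b1 b2] := H h rer imr.
  have -> : D - h^-1 *: (f (h *: 1 + s) - f s) = - (h^-1 * (f (s + h) - f s - h * D)).
    rewrite /GRing.scale/= mulr1 [h + s]addrC.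
    rewrite [h^-1 * (_ - h * D)]mulrBr (_ : h^-1 * (h * D) = D) ?opprB//.
    by rewrite mulrA mulVf// mul1r.
  rewrite normrN normrM normfV ler_pdivrMl//.
  apply: le_trans (normc_le b1 b2) _.
  rewrite mulrA rmorphM/= add_Re2_Im2 [leLHS]mulrCA ler_pM2l//.
  have K2 : 0 <= (2 * K)%:C%C by rewrite ler0c mulr_ge0.
  apply: le_trans (ler_wpM2l K2 he) _.
  rewrite mulrCA ler_piMr ?(ltW e0)// ler_pdivrMr// mul1r lecR; lra.
have H1 : derivable f s 1 by apply/cvg_ex; exists D; by [].
by apply: DeriveDef => //; exact: cvg_lim key.
Unshelve. all: by end_near. Qed.

Lemma taylor2 (p p1 p2 : R -> R) (M : R) : (forall t : R, 0 <= t <= 1 -> der t p (p1 t)) ->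
  (forall t : R, 0 <= t <= 1 -> der t p1 (p2 t)) -> (forall t : R, 0 <= t <= 1 -> `|p2 t| <= M) ->
  `|p 1 - p 0 - p1 0| <= M.
Proof.
move=> d1 d2 b2; have M0 : 0 <= M by apply: le_trans (b2 0 _); rewrite ?lexx ?ler01.
have b1 (t : R) : 0 <= t <= 1 -> `|p1 t - p1 0| <= M.
  move=> /andP[t0 t1]; have := @dv_le_norm R 0 t p1 p2 (fun t : R => M * t) (fun=> M) t0.
  rewrite mulr0 subr0 => H; apply: le_trans (H _ _ _) _.
  - by move=> x /andP[x0 xt]; apply: d2; rewrite x0 (le_trans xt).
  - by move=> x _; exact: dv_lin.
  - by move=> x /andP[x0 xt]; apply: b2; rewrite x0 (le_trans xt).
  - by rewrite ler_piMr.
have := @dv_le_norm R 0 1 (fun t => p t - p1 0 * t) (fun t => p1 t - p1 0) (fun t : R => M * t) (fun=> M) ler01.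
rewrite !mulr0 !mulr1 !subr0 => H.
have -> : p 1 - p 0 - p1 0 = p 1 - p1 0 - p 0 by ring.
apply: H => // t t1; last exact: dv_lin.
exact: dvD (d1 t t1) (dvN (dv_lin _ t)).
Qed.

(** Real and imaginary parts of [exp w - 1 - w] for [w = - x + i y], estimated by a second order
    Taylor expansion along the real segment from [0] to [w]. *)
Lemma exp_est (x y : R) : `|expR (- x) * cos y - 1 + x| <= 2 * (x ^+ 2 + y ^+ 2) * expR `|x| /\
  `|expR (- x) * sin y - y| <= 2 * (x ^+ 2 + y ^+ 2) * expR `|x|.
Proof.
pose E t := expR (- (x * t)); pose C t := cos (y * t); pose S t := sin (y * t).
have dE (t : R) : der t E (- x * E t).
  by apply: dv_eq (dv_exp (dvN (dv_lin x t))) _; rewrite mulrC.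
have dC (t : R) : der t C (- y * S t).
  by apply: dv_eq (dv_comp (is_derive_cos (y * t)) (dv_lin y t)) _; rewrite mulNr mulrC mulNr.
have dS (t : R) : der t S (y * C t).
  by apply: dv_eq (dv_comp (is_derive_sin (y * t)) (dv_lin y t)) _; rewrite mulrC.
have bE (t : R) : 0 <= t <= 1 -> E t <= expR `|x|.
  move=> /andP[t0 t1]; rewrite ler_expR -mulrN; apply: le_trans (ler_norm _) _.
  by rewrite normrM normrN (ger0_norm t0) ler_piMr.
have E0 (t : R) : 0 <= E t by pos.
have E00 : E 0 = 1 by rewrite /E mulr0 oppr0 expR0.
have C00 : C 0 = 1 by rewrite /C mulr0 cos0.
have S00 : S 0 = 0 by rewrite /S mulr0 sin0.
have xy : `|x ^+ 2 - y ^+ 2| + `|2 * x * y| <= 2 * (x ^+ 2 + y ^+ 2).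
  have h1 : `|x ^+ 2 - y ^+ 2| <= x ^+ 2 + y ^+ 2.
    by rewrite ler_norml; have := sqr_ge0 x; have := sqr_ge0 y; lra.
  have h2 : `|2 * x * y| <= x ^+ 2 + y ^+ 2.
    by rewrite ler_norml; have := sqr_ge0 (x + y); have := sqr_ge0 (x - y); lra.
  lra.
have bd (t u v : R) : 0 <= t <= 1 -> `|u| <= 1 -> `|v| <= 1 ->
   `|E t * ((x ^+ 2 - y ^+ 2) * u + 2 * x * y * v)| <= 2 * (x ^+ 2 + y ^+ 2) * expR `|x|.
  move=> t1 u1 v1; rewrite normrM (ger0_norm (E0 t)) mulrC; apply: ler_pM => //; last exact: bE.
  apply: le_trans xy; tri.
  by apply: lerD; rewrite normrM ler_piMr.
split.
  have := @taylor2 (fun t => E t * C t) (fun t => - x * E t * C t + E t * (- y * S t))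
     (fun t => E t * ((x ^+ 2 - y ^+ 2) * C t + 2 * x * y * S t)) (2 * (x ^+ 2 + y ^+ 2) * expR `|x|).
  rewrite E00 C00 S00 /E /C !mulr1 !mulr0 addr0 opprK; apply => t t1.
  - exact: dvM.
  - apply: dv_eq (dvD (dvM (dvM (dv_cst (- x) t) (dE t)) (dC t)) (dvM (dE t) (dvM (dv_cst (- y) t) (dS t)))) _.
    by rewrite /E /C; ring.
  - by apply: bd => //; [exact: cos_max|exact: sin_max].
have := @taylor2 (fun t => E t * S t) (fun t => - x * E t * S t + E t * (y * C t))
     (fun t => E t * ((x ^+ 2 - y ^+ 2) * S t + 2 * x * y * - C t)) (2 * (x ^+ 2 + y ^+ 2) * expR `|x|).
rewrite E00 C00 S00 /E /S !mulr1 !mulr0 add0r mul1r subr0; apply => t t1.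
- exact: dvM.
- apply: dv_eq (dvD (dvM (dvM (dv_cst (- x) t) (dE t)) (dS t)) (dvM (dE t) (dvM (dv_cst y t) (dC t)))) _.
  by rewrite /E /S; ring.
- by apply: bd => //; [exact: sin_max|rewrite normrN; exact: cos_max].
Qed.

Lemma cdv_exp (w s : Cx R) : der s (fun z : Cx R => cexp (w * z) : Cx R) (w * cexp (w * s)).
Proof.
pose r := `|Re w| + `|Im w|; have r0 : 0 <= r by rewrite addr_ge0.
pose E := expR (Re (w * s)); have E0 : 0 <= E by pos.
pose K := 4 * E * ((Re w ^+ 2 + Im w ^+ 2) * expR r).
have K0 : 0 <= K by pos.
apply: (@cdv_of_quad _ _ _ 1 K ltr01 K0) => h hr hi.
pose x := - Re (w * h); pose y := Im (w * h).
have [p1 p2] := exp_est x y.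
set P := expR (- x) * cos y - 1 + x in p1; set Q := expR (- x) * sin y - y in p2.
set M := 2 * (x ^+ 2 + y ^+ 2) * expR `|x| in p1 p2.
have xr : `|x| <= r.
  rewrite normrN /r; move: hr hi; clear; case: w h => [w1 w2] [h1 h2] /= hr hi.
  apply: le_trans (ler_normB _ _) _; rewrite !normrM; apply: lerD; exact: ler_piMr.
have xy : x ^+ 2 + y ^+ 2 = (Re w ^+ 2 + Im w ^+ 2) * (Re h ^+ 2 + Im h ^+ 2).
  by rewrite /x /y; case: (w) (h) => [w1 w2] [h1 h2] /=; ring.
have MK : 2 * E * M <= K * (Re h ^+ 2 + Im h ^+ 2).
  have -> : K * (Re h ^+ 2 + Im h ^+ 2) = 2 * E * (2 * (x ^+ 2 + y ^+ 2) * expR r) by rewrite xy /K; ring.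
  apply: ler_wpM2l; first by rewrite mulr_ge0.
  by apply: ler_wpM2l; [rewrite mulr_ge0// addr_ge0// sqr_ge0|rewrite ler_expR].
have est (u v : R) : `|u| <= 1 -> `|v| <= 1 -> `|E * (u * P + v * Q)| <= K * (Re h ^+ 2 + Im h ^+ 2).
  move=> u1 v1; apply: le_trans MK; rewrite normrM (ger0_norm E0) [2 * E]mulrC -mulrA ler_wpM2l//.
  tri; rewrite mulrDl mul1r.
  by apply: lerD; rewrite normrM -[M]mul1r; exact: ler_pM.
have e : cexp (w * (s + h)) - cexp (w * s) - h * (w * cexp (w * s)) =
   Complex (E * (cos (Im (w * s)) * P + - sin (Im (w * s)) * Q)) (E * (sin (Im (w * s)) * P + cos (Im (w * s)) * Q)).
  rewrite mulrDr /cexp mulrA [h * w]mulrC /P /Q /x /y /E.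
  case: (w * s) (w * h) => [a b] [c d] /=; rewrite opprK expRD cosD sinD.
  apply/eqP; rewrite eq_complex /=; apply/andP; split; apply/eqP; ring.
rewrite e; split => /=; apply: est; rewrite ?normrN ?cos_max ?sin_max//.
Qed.

End ComplexDerivative.

(** * Holomorphic dependence for sums and integrals at once *)

Section Functional.
Variables (R : realType) (T : Type) (V : (T -> R) -> R -> Prop) (Cf : (T -> R) -> Prop).
Implicit Types (f g l : T -> R) (a b s t : R).

(* [V f I] reads ``the integral of [f] is [I]'', [Cf] the class of functions for which domination implies integrability. *)
Definition functional := [/\
  forall f g I J a b, V f I -> V g J -> V (fun x => a * f x + b * g x) (a * I + b * J),
  forall f g I J, V f I -> V g J -> (forall x, f x <= g x) -> I <= J &
  forall f g J, Cf f -> V g J -> (forall x, `|f x| <= g x) -> exists I, V f I].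

Definition cV (f : T -> R[i]) (I : R[i]) :=
  V (fun x => Re (f x)) (Re I) /\ V (fun x => Im (f x)) (Im I).

Hypothesis Vf : functional.

Let Vlin f g I J a b : V f I -> V g J -> V (fun x => a * f x + b * g x) (a * I + b * J).
Proof. by case: Vf => + _ _; exact. Qed.
Let Vmono f g I J : V f I -> V g J -> (forall x, f x <= g x) -> I <= J.
Proof. by case: Vf => _ + _; exact. Qed.

Lemma V_unique f I J : V f I -> V f J -> I = J.
Proof.
by move=> h1 h2; apply: le_anti; rewrite (Vmono h1 h2)// (Vmono h2 h1).
Qed.

Lemma V_bound f g I J : V f I -> V g J -> (forall x, `|f x| <= g x) -> `|I| <= J.
Proof.
move=> fI gJ fg; rewrite ler_norml; apply/andP; split.
  have h := Vlin (-1) 0 gJ gJ; rewrite mul0r addr0 mulN1r in h.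
  by apply: (Vmono h fI) => x; rewrite mul0r addr0 mulN1r; have := fg x; rewrite ler_norml => /andP[].
by apply: (Vmono fI gJ) => x; apply: le_trans (fg x); exact: ler_norm.
Qed.

Lemma cV_unique (f : T -> R[i]) I J : cV f I -> cV f J -> I = J.
Proof.
by case: I J => I1 I2 [J1 J2] [/= a1 a2] [/= b1 b2]; rewrite (V_unique a1 b1) (V_unique a2 b2).
Qed.

Lemma cV_lin (f g : T -> R[i]) I J (a b : R[i]) : cV f I -> cV g J -> cV (fun x => a * f x + b * g x) (a * I + b * J).
Proof.
case: a b I J => a1 a2 [b1 b2] [I1 I2] [J1 J2] [/= f1 f2] [/= g1 g2]; split.
  have h := Vlin 1 1 (Vlin a1 (- a2) f1 f2) (Vlin b1 (- b2) g1 g2).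
  rewrite (_ : _ + _ = a1 * I1 + - a2 * I2 + (b1 * J1 + - b2 * J2)) in h; last lra.
  rewrite (_ : Re _ = a1 * I1 + - a2 * I2 + (b1 * J1 + - b2 * J2)); last by rewrite /=; ring.
  congr (V _ _): h; apply/funext => x; case: (f x) (g x) => u1 u2 [v1 v2] /=; ring.
have h := Vlin 1 1 (Vlin a1 a2 f2 f1) (Vlin b1 b2 g2 g1).
rewrite (_ : _ + _ = a1 * I2 + a2 * I1 + (b1 * J2 + b2 * J1)) in h; last lra.
rewrite (_ : Im _ = a1 * I2 + a2 * I1 + (b1 * J2 + b2 * J1)); last by [].
congr (V _ _): h; apply/funext => x; case: (f x) (g x) => u1 u2 [v1 v2] /=; ring.
Qed.

Variables (f l : T -> R) (P : R -> Prop).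
Hypothesis Cfl : forall u : R -> R, continuous u -> Cf (fun x => f x * u (l x)).
Hypothesis Popen : forall s, P s -> exists2 r : R, 0 < r & forall t, `|t - s| <= r -> P t.
Hypothesis Maj : forall s, P s -> exists g J, V g J /\ forall x, `|f x| * expR (- (s * l x)) <= g x.

(** Domination at [s - r] and [s + r] controls [exp (r |l|)]. Half of that exponent absorbs the
    factor [l^2] and the other half remains for the increment of [z], as the quadratic remainder
    requires. *)
Let Majt s : P s -> exists (r : R) g J, [/\ 0 < r, V g J &
  forall x, `|f x| * (expR (- (s * l x)) * (l x ^+ 2 * expR (r * `|l x|) + 1 + `|l x|)) <= g x].
Proof.
move=> Ps; have [r r0 Hr] := Popen Ps; pose e := r / 2; have e0 : 0 < e by rewrite divr_gt0.
have P1 : P (s - r) by apply: Hr; rewrite addrAC subrr add0r normrN gtr0_norm.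
have P2 : P (s + r) by apply: Hr; rewrite addrAC subrr add0r gtr0_norm.
have P0 : P s by [].
have [g1 [J1 [V1 h1]]] := Maj P1; have [g2 [J2 [V2 h2]]] := Maj P2; have [g0 [J0 [V0 h0]]] := Maj P0.
pose K := 2 / e ^+ 2 + 1 / e; have K0 : 0 <= K by rewrite addr_ge0 ?divr_ge0 ?sqr_ge0 ?ltW.
exists e, (fun x => 1 * (K * g1 x + K * g2 x) + 1 * g0 x), (1 * (K * J1 + K * J2) + 1 * J0).
have V12 := Vlin 1 1 (Vlin K K V1 V2) V0; split => // x.
have y0 : 0 <= `|l x| by []; set y := `|l x| in y0 *.
have ey : 0 <= e * y by pos.
have q1 : l x ^+ 2 <= 2 / e ^+ 2 * expR (e * y).
  rewrite -(real_normK (num_real (l x))) -/y mulrAC ler_pdivlMr ?exprn_gt0// -exprMn mulrC.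
  have := expR_ge1Dxn 1 ey; rewrite (_ : 2`! = 2)%N//; lra.
have q2 : y <= 1 / e * expR (e * y).
  by rewrite mulrAC ler_pdivlMr; have := expR_ge1Dx (e * y); lra.
have re : expR (e * y) * expR (e * y) = expR (r * y) by rewrite -expRD; congr expR; rewrite /e; field.
have eu : expR (e * y) <= expR (r * y) by rewrite ler_expR ler_wpM2r /e; lra.
have er : expR (r * y) <= expR (r * l x) + expR (- (r * l x)).
  have [h|h] := leP 0 (l x).
    by rewrite /y ger0_norm// lerDl.
  by rewrite /y ltr0_norm// mulrN lerDr.
have b : l x ^+ 2 * expR (e * y) + 1 + y <= K * (expR (r * l x) + expR (- (r * l x))) + 1.
  have h3 : l x ^+ 2 * expR (e * y) <= 2 / e ^+ 2 * expR (r * y).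
    by rewrite -re mulrA ler_wpM2r.
  have h4 : y <= 1 / e * expR (r * y).
    by apply: le_trans q2 _; rewrite ler_wpM2l// divr_ge0// ltW.
  have h5 : K * expR (r * y) <= K * (expR (r * l x) + expR (- (r * l x))) by nra.
  have h6 : K * expR (r * y) = 2 / e ^+ 2 * expR (r * y) + 1 / e * expR (r * y) by rewrite mulrDl.
  lra.
apply: le_trans (ler_wpM2l (normr_ge0 _) (ler_wpM2l (expR_ge0 _) b)) _.
have -> : `|f x| * (expR (- (s * l x)) * (K * (expR (r * l x) + expR (- (r * l x))) + 1)) =
  1 * (K * (`|f x| * expR (- ((s - r) * l x))) + K * (`|f x| * expR (- ((s + r) * l x)))) + 1 * (`|f x| * expR (- (s * l x))).
  have -> : expR (- ((s - r) * l x)) = expR (- (s * l x)) * expR (r * l x) by rewrite -expRD; congr expR; ring.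
  have -> : expR (- ((s + r) * l x)) = expR (- (s * l x)) * expR (- (r * l x)) by rewrite -expRD; congr expR; ring.
  lra.
rewrite !mul1r; apply: lerD; last exact: h0.
by apply: lerD; rewrite ler_wpM2l.
Qed.

Definition mel (z : R[i]) x : R[i] := (f x)%:C%C * cexp (- (z * (l x)%:C%C)).

Let cE s t y : R := expR (- (s * y)) * cos (t * y).
Let sE s t y : R := - (expR (- (s * y)) * sin (t * y)).

Let melRe z x : Re (mel z x) = f x * cE (Re z) (Im z) (l x).
Proof.
by case: z => s t; rewrite /cexp/= !mulr0 !mul0r !subr0 add0r cosN.
Qed.
Let melIm z x : Im (mel z x) = f x * sE (Re z) (Im z) (l x).
Proof.
by case: z => s t; rewrite /cexp/= !mulr0 !mul0r !subr0 ?addr0 ?add0r sinN mulrN.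
Qed.

Let melV z I : cV (mel z) I -> V (fun x => f x * cE (Re z) (Im z) (l x)) (Re I) /\
  V (fun x => f x * sE (Re z) (Im z) (l x)) (Im I).
Proof.
by case=> v1 v2; split; [congr (V _ _): v1|congr (V _ _): v2]; apply/funext => x.
Qed.

Let cE_cont s t : continuous (cE s t).
Proof.
move=> y; apply: cvgM; apply: continuous_comp.
- by apply: cvgN; apply: cvgMr; exact: cvg_id.
- exact: continuous_expR.
- by apply: cvgMr.
- exact: continuous_cos.
Qed.
Let sE_cont s t : continuous (sE s t).
Proof.
move=> y; apply: cvgN; apply: cvgM; apply: continuous_comp.
- by apply: cvgN; apply: cvgMr.
- exact: continuous_expR.
- by apply: cvgMr.
- exact: continuous_sin.
Qed.
Let cE_le s t y : `|cE s t y| <= expR (- (s * y)).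
Proof. by rewrite normrM ger0_norm ?expR_ge0// ler_piMr ?expR_ge0// cos_max. Qed.
Let sE_le s t y : `|sE s t y| <= expR (- (s * y)).
Proof. by rewrite normrN normrM ger0_norm ?expR_ge0// ler_piMr ?expR_ge0// sin_max. Qed.

Lemma mel_exists z : P (Re z) -> exists I, cV (mel z) I.
Proof.
case: Vf => _ _ Vd Pz; have [g [J [Vg h]]] := Maj Pz.
have b (u : R -> R) : (forall y, `|u y| <= expR (- (Re z * y))) -> forall x, `|f x * u (l x)| <= g x.
  by move=> bu x; apply: le_trans (h x); rewrite normrM ler_wpM2l.
have [I1 V1] := Vd _ g J (Cfl (@cE_cont (Re z) (Im z))) Vg (b _ (cE_le _ _)).
have [I2 V2] := Vd _ g J (Cfl (@sE_cont (Re z) (Im z))) Vg (b _ (sE_le _ _)).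
by exists (Complex I1 I2); split; [congr (V _ _): V1|congr (V _ _): V2]; apply/funext => x.
Qed.

(** Differentiation under the sign: the derivative is the transform with the extra factor [- l], and
    [exp_est] bounds the remainder by the square of the increment. It is applied to integrals for
    Mellin transforms and to series for Dirichlet series. *)
Theorem holomorphic_transform : exists Lam : Cx R -> Cx R,
  forall z : Cx R, P (Re z) -> cV (mel z) (Lam z) /\ derivable Lam z 1.
Proof.
have /choice[Lam HL] : forall z : Cx R, exists I : Cx R, P (Re z) -> cV (mel z) I.
  move=> z; have [Pz|nPz] := pselect (P (Re z)); last by exists 0.
  by have [I HI] := mel_exists Pz; exists I.
exists Lam => z Pz; split; first exact: HL.
have [r [g [J [r0 Vg Hg]]]] := Majt Pz.
have [r1 r10 Hr1] := Popen Pz.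
case: Vf => _ _ Vd.
move: z Pz Hg r10 Hr1 => [s t] /= Pz Hg r10 Hr1.
have lE (y : R) : 0 <= y ^+ 2 * expR (r * `|y|) by pos.
have cl u : continuous u -> continuous (fun y : R => - y * u y).
  by move=> cu y; apply: cvgM; [apply: cvgN; by []|exact: cu].
have bl (u : R -> R) : (forall y, `|u y| <= expR (- (s * y))) -> forall x, `|f x * (- l x * u (l x))| <= g x.
  move=> bu x; apply: le_trans (Hg x); rewrite normrM ler_wpM2l// normrM normrN mulrC.
  by apply: ler_pM => //; rewrite lerDr addr_ge0.
have [D1 VD1] := Vd _ g J (Cfl (cl _ (@cE_cont s t))) Vg (bl _ (cE_le s t)).
have [D2 VD2] := Vd _ g J (Cfl (cl _ (@sE_cont s t))) Vg (bl _ (sE_le s t)).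
have J0 : 0 <= J.
  by have := V_bound VD1 Vg (bl _ (cE_le s t)); apply: le_trans.
pose rr := Num.min r r1; have rr0 : 0 < rr by rewrite lt_min r0.
have Q : 0 <= 4 * J by pos.
have [] // := @cdv_of_quad R Lam (Complex s t) (Complex D1 D2) rr (4 * J) rr0 Q.
move=> [a b] /= arr _; have ar : `|a| <= r by apply: le_trans arr _; rewrite ge_min lexx.
have Psa : P (s + a) by apply: Hr1; rewrite addrAC subrr add0r; apply: le_trans arr _; rewrite ge_min lexx orbT.
have := melV (HL (Complex (s + a) (t + b)) Psa); have := melV (HL (Complex s t) Pz).
have -> : (Complex s t : R[i]) + Complex a b = Complex (s + a) (t + b) by [].
case: (Lam _) => A B /= [VA VB]; case: (Lam _) => A' B' /= [VA' VB'].
have Vg4 := Vlin (4 * (a ^+ 2 + b ^+ 2)) 0 Vg Vg.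
have e4 : 4 * J * (a ^+ 2 + b ^+ 2) = 4 * (a ^+ 2 + b ^+ 2) * J + 0 * J by ring.
have est x (u v : R) : `|u| <= 1 -> `|v| <= 1 ->
   `|f x * expR (- (s * l x)) * (u * (expR (- (a * l x)) * cos (b * l x) - 1 + a * l x) +
       v * (expR (- (a * l x)) * sin (b * l x) - b * l x))| <= 4 * (a ^+ 2 + b ^+ 2) * g x + 0 * g x.
  move=> u1 v1; have [p1 p2] := exp_est (a * l x) (b * l x).
  rewrite mul0r addr0 normrM normrM (ger0_norm (expR_ge0 _)).
  set M := 2 * ((a * l x) ^+ 2 + (b * l x) ^+ 2) * expR `|a * l x| in p1 p2.
  have uv : `|u * (expR (- (a * l x)) * cos (b * l x) - 1 + a * l x) + v * (expR (- (a * l x)) * sin (b * l x) - b * l x)| <= 2 * M.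
    tri; rewrite mulrDl mul1r.
    by apply: lerD; rewrite normrM -[M]mul1r; exact: ler_pM.
  apply: le_trans (ler_wpM2l (mulr_ge0 (normr_ge0 _) (expR_ge0 _)) uv) _.
  have M2 : 2 * M <= 4 * (a ^+ 2 + b ^+ 2) * (l x ^+ 2 * expR (r * `|l x|)).
    have -> : 2 * M = 4 * (a ^+ 2 + b ^+ 2) * (l x ^+ 2 * expR `|a * l x|) by rewrite /M; ring.
    apply: ler_wpM2l; first by rewrite mulr_ge0// addr_ge0 ?sqr_ge0.
    by rewrite ler_wpM2l ?sqr_ge0// ler_expR normrM ler_wpM2r.
  apply: le_trans (ler_wpM2l (mulr_ge0 (normr_ge0 _) (expR_ge0 _)) M2) _.
  rewrite mulrCA; apply: ler_wpM2l; first pos.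
  apply: le_trans (Hg x); rewrite -mulrA ler_wpM2l// ler_wpM2l ?expR_ge0//.
  by rewrite -addrA lerDl.
have sp x : expR (- ((s + a) * l x)) = expR (- (s * l x)) * expR (- (a * l x)) by rewrite -expRD; congr expR; ring.
have ang x : (t + b) * l x = t * l x + b * l x by rewrite mulrDl.
rewrite e4; split.
  have VV := Vlin 1 1 (Vlin 1 (-1) VA' VA) (Vlin (- a) b VD1 VD2).
  have := V_bound VV Vg4; rewrite (_ : 1 * (1 * A' + -1 * A) + 1 * (- a * D1 + b * D2) = A' - A - (a * D1 - b * D2)); last lra.
  apply=> x; rewrite /cE /sE sp ang cosD.
  have h1 : `|- sin (t * l x)| <= 1 by rewrite normrN sin_max.
  have := est x _ _ (cos_max (t * l x)) h1.
  by congr (`|_| <= _); ring.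
have VV := Vlin 1 1 (Vlin 1 (-1) VB' VB) (Vlin (- a) (- b) VD2 VD1).
have := V_bound VV Vg4; rewrite (_ : 1 * (1 * B' + -1 * B) + 1 * (- a * D2 + - b * D1) = B' - B - (a * D2 + b * D1)); last lra.
apply=> x; rewrite /cE /sE sp ang sinD.
have h1 : `|- sin (t * l x)| <= 1 by rewrite normrN sin_max.
have h2 : `|- cos (t * l x)| <= 1 by rewrite normrN cos_max.
have := est x _ _ h1 h2.
by congr (`|_| <= _); ring.
Qed.

End Functional.

(** * Mellin transforms on the real line *)

Section LogIntegral.
Variable R : realType.
Implicit Types (f g F : R -> R) (t u a b I J : R) (z : R[i]).

(* The integral of [f] over the line, computed in the variable [u = expR t]. *)
Definition intE f I := exists F A B, [/\ forall u, 0 < u -> der u F (f (ln u) / u),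
  F u @[u --> 0^'+] --> A, F u @[u --> +oo] --> B & I = B - A].

Let cont_div f : continuous f -> forall u, 0 < u -> {for u, continuous (fun u => f (ln u) / u)}.
Proof.
move=> cf u u0; apply: cvgM; last by apply: cvgV; [rewrite gt_eqF|by []].
apply: continuous_comp; last exact: cf.
exact: continuous_ln.
Qed.

Lemma intE_mono f g I J : intE f I -> intE g J -> (forall t, f t <= g t) -> I <= J.
Proof.
move=> [F [A [B [dF FA FB ->]]]] [G [A' [B' [dG GA GB ->]]]] fg.
have mono x y : 0 < x -> x <= y -> G x - F x <= G y - F y.
  move=> x0 xy; apply: (@dv_le R x y (fun u => G u - F u) (fun u => g (ln u) / u - f (ln u) / u) xy) => z /andP[xz _].
    have z0 : 0 < z by lra.
    exact: dvD (dG z z0) (dvN (dF z z0)).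
  have z0 : 0 < z by lra.
  by rewrite -mulrBl divr_ge0 ?subr_ge0// ltW.
have l0 : G u - F u @[u --> 0^'+] --> A' - A by exact: cvgB.
have l1 : G u - F u @[u --> +oo] --> B' - B by exact: cvgB.
have h y : 0 < y -> A' - A <= G y - F y.
  move=> y0; apply: (cvgr_to_le l0); near=> x; apply: mono.
    by [].
  by near: x; exact: nbhs_right_le.
have : A' - A <= B' - B.
  by apply: (cvgr_to_ge l1); near=> y; apply: h; near: y; exact: nbhs_pinfty_gt.
lra.
Unshelve. all: by end_near. Qed.

Lemma intE_lin f g I J a b : intE f I -> intE g J -> intE (fun t => a * f t + b * g t) (a * I + b * J).
Proof.
move=> [F [A [B [dF FA FB ->]]]] [G [A' [B' [dG GA GB ->]]]].
exists (fun u => a * F u + b * G u), (a * A + b * A'), (a * B + b * B'); split.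
- move=> u u0; apply: dv_eq (dvD (dvM (dv_cst a u) (dF u u0)) (dvM (dv_cst b u) (dG u u0))) _.
  lra.
- by apply: cvgD; exact: cvgMr.
- by apply: cvgD; exact: cvgMr.
- ring.
Qed.

Let intE_dom_ge0 f g J : continuous f -> intE g J -> (forall t, 0 <= f t <= g t) -> exists I, intE f I.
Proof.
move=> cf [G [A [B [dG GA GB _]]]] fg.
have mono (x y : R) : 0 < x -> x <= y -> G x <= G y.
  move=> x0 xy; apply: (@dv_le R x y G _ xy) => z /andP[xz _]; have z0 : 0 < z by lra.
    exact: dG z z0.
  have /andP[h1 h2] := fg (ln z); rewrite divr_ge0 ?(ltW z0)//; lra.
have lo (y : R) : 0 < y -> A <= G y.
  move=> y0; apply: (cvgr_to_le GA); near=> x; apply: mono.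
    by [].
  by near: x; exact: nbhs_right_le.
have hi (x : R) : 0 < x -> G x <= B.
  move=> x0; apply: (cvgr_to_ge GB); near=> y; have xy : x <= y by near: y; apply: nbhs_pinfty_ge; exact: num_real.
  exact: mono.
have [|u u0|u u0|F [A' [B' [dF FA FB]]]] := @primitive_limits R (fun u => f (ln u) / u) G (fun u => g (ln u) / u) (`|A| + `|B|) _ dG.
- exact: cont_div.
- have /andP[h1 h2] := fg (ln u); rewrite divr_ge0 ?(ltW u0)//= ler_wpM2r// invr_ge0 ltW//.
- have := lo u u0; have := hi u u0; have := ler_norm B; have := ler_norm (- A); rewrite normrN.
  have := normr_ge0 A; have := normr_ge0 B; rewrite ler_norml; lra.
by exists (B' - A'), F, A', B'.
Unshelve. all: by end_near. Qed.

Lemma intE_functional : functional intE (fun f => continuous f).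
Proof.
split; [by move=> *; exact: intE_lin|exact: intE_mono|move=> f g J cf gJ fg].
have cabs : continuous (fun t => `|f t|).
  by move=> t; apply: continuous_comp; [exact: cf|exact: norm_continuous].
have [|t|I1 H1] := @intE_dom_ge0 (fun t => (`|f t| + f t) / 2) g J _ gJ.
- by move=> t; apply: cvgMl; apply: cvgD; [exact: cabs|exact: cf].
- have := ler_norm (f t); have := ler_norm (- f t); rewrite normrN; have := fg t; lra.
have [|t|I2 H2] := @intE_dom_ge0 (fun t => (`|f t| - f t) / 2) g J _ gJ.
- by move=> t; apply: cvgMl; apply: cvgB; [exact: cabs|exact: cf].
- have := ler_norm (f t); have := ler_norm (- f t); rewrite normrN; have := fg t; lra.
exists (1 * I1 + -1 * I2); have := intE_lin 1 (-1) H1 H2.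
by congr (intE _ _); apply/funext => t; field.
Qed.

Lemma intE_shift f I a : intE f I -> intE (fun t => f (t + a)) I.
Proof.
move=> [F [A [B [dF FA FB IE]]]]; have e0 := expR_gt0 a.
exists (fun u => F (expR a * u)), A, B; split => //.
- move=> u u0; have v0 : 0 < expR a * u by rewrite mulr_gt0.
  apply: dv_eq (dv_comp (dF _ v0) (dv_lin (expR a) u)) _.
  by rewrite lnM ?posrE// expRK addrC; field; rewrite !gt_eqF.
- apply/cvgrPdist_le => e e1; move/cvgrPdist_le: FA => /(_ e e1); rewrite !near_withinE.
  move=> /nbhs_ballP[r r0 Hr]; apply/nbhs_ballP; exists (r / expR a); first pos.
  move=> u; rewrite /ball/= sub0r normrN => ur u0; apply: Hr; last by rewrite mulr_gt0.
  by rewrite /ball/= sub0r normrN normrM (gtr0_norm e0) mulrC -ltr_pdivlMr.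
- apply/cvgrPdist_le => e e1; move/cvgrPdist_le: FB => /(_ e e1) [M [Mr HM]].
  exists (M / expR a); split; first exact: num_real.
  by move=> u; rewrite ltr_pdivrMr// mulrC => h; exact: HM.
Qed.

(** The logistic density: comparable with [exp (- d |t|)] on both sides, smooth, and with an
    explicit primitive. It is the standard dominating function here. *)
Definition wd (d t : R) : R := expR (d * t) / (1 + expR (d * t)) ^+ 2.

Lemma pow_cvg0y d : 0 < d -> u `^ (- d) @[u --> +oo] --> (0 : R).
Proof.
move=> d0; apply/cvgrPdist_le => e e0; near=> u; have u0 : 0 < u by [].
rewrite sub0r normrN ger0_norm ?powR_ge0//.
rewrite powRN -[e]invrK lef_pV2 ?posrE ?invr_gt0 ?powR_gt0//.
have -> : e^-1 = ((e^-1) `^ d^-1) `^ d by rewrite -powRrM mulVf ?gt_eqF// powRr1// invr_ge0 ltW.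
by apply: ge0_ler_powR; rewrite ?nnegrE ?powR_ge0 ?ltW.
Unshelve. all: by end_near. Qed.

Lemma intE_wd d : 0 < d -> intE (wd d) (1 / d).
Proof.
move=> d0; exists (fun u => - (1 / d) * (1 + u `^ d)^-1), (- (1 / d) * (1 + 0)^-1), (- (1 / d) * 0).
have pe u : 0 < u -> expR (d * ln u) = u `^ d by move=> u0; rewrite /powR gt_eqF.
split.
- move=> u u0; have n0 : 1 + u `^ d != 0 by rewrite gt_eqF// ltr_wpDr// powR_ge0.
  apply: dv_eq (dvM (dv_cst (- (1 / d)) u) (@dvV R (fun u => 1 + u `^ d) u _ n0 (dvD (dv_cst 1 u) (dv_pow d u0 (dv_id u))))) _.
  rewrite /wd pe// powRB1//; move: (u `^ d) n0 => p n0.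
  by field; rewrite n0 !gt_eqF.
- apply: cvgMr; apply: cvgV; first by rewrite addr0 oner_neq0.
  by apply: cvgD; [exact: cvg_cst|exact: powR_cvg0].
- apply: cvgMr; apply: norm_cvg0; apply: (squeeze0 (fun u => u `^ (- d))).
  + near=> u; have u0 : 0 < u by near: u; exact: nbhs_pinfty_gt.
    have p0 := powR_gt0 d u0.
    rewrite normr_ge0/= ger0_norm ?invr_ge0 ?addr_ge0 ?(ltW p0)// powRN lef_pV2 ?posrE ?ltr_wpDl//.
    by rewrite lerDr.
  + exact: cvg_cst.
  + exact: pow_cvg0y.
- by rewrite addr0 invr1 mulr0 mulr1 opprK add0r.
Unshelve. all: by end_near. Qed.

Lemma exp_abs_le d t : 0 <= d -> expR (- (d * `|t|)) <= 4 * wd d t.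
Proof.
move=> d0; have e0 := expR_gt0 (d * t); set E := expR _ in e0 *.
have -> : 4 * wd d t = 4 * E / (1 + E) ^+ 2 by rewrite mulrA.
rewrite ler_pdivlMr ?exprn_gt0 ?addr_gt0//.
have [t0|t0] := leP 0 t.
  rewrite ger0_norm// expRN -/E ler_pdivrMl//.
  have E1 : 1 <= E by rewrite -[leLHS]expR0 ler_expR mulr_ge0.
  have : (1 + E) ^+ 2 <= (2 * E) ^+ 2 by nra.
  lra.
rewrite ltr0_norm// mulrN opprK -/E.
have E1 : E <= 1 by rewrite -[leRHS]expR0 ler_expR mulr_ge0_le0// ltW.
have : (1 + E) ^+ 2 <= 2 ^+ 2 by nra.
nra.
Qed.

Lemma intE_exact F g (C c : R) : 0 < c -> (forall t, der t F (g t)) ->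
  (forall t, `|F t| <= C * expR (- (c * `|t|))) -> intE g 0.
Proof.
move=> c0 dF Fb; have C0 : 0 <= C.
  by have := Fb 0; rewrite normr0 mulr0 oppr0 expR0 mulr1; apply: le_trans.
exists (fun u => F (ln u)), 0, 0; split; last lra.
- move=> u u0; apply: dv_eq (dv_comp (dF (ln u)) (dv_ln u0 (dv_id u))) _.
  lra.
- apply: norm_cvg0; apply: (squeeze0 (fun u => C * u `^ c)).
  + near=> u; have u0 : 0 < u by near: u; exact: nbhs_right_gt.
    rewrite normr_ge0; apply: le_trans (Fb _) _; rewrite ler_wpM2l// /powR gt_eqF// ler_expR.
    by have := ler_wpM2l (ltW c0) (ler_norm (- ln u)); rewrite normrN; lra.
  + exact: cvg_cst.
  + by rewrite -[X in _ --> X](mulr0 C); apply: cvgMr; exact: powR_cvg0.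
- apply: norm_cvg0; apply: (squeeze0 (fun u => C * u `^ (- c))).
  + near=> u; have u0 : 0 < u by near: u; exact: nbhs_pinfty_gt.
    rewrite normr_ge0; apply: le_trans (Fb _) _; rewrite ler_wpM2l// /powR gt_eqF// ler_expR.
    by have := ler_wpM2l (ltW c0) (ler_norm (ln u)); lra.
  + exact: cvg_cst.
  + by rewrite -[X in _ --> X](mulr0 C); apply: cvgMr; exact: pow_cvg0y.
Unshelve. all: by end_near. Qed.

Definition cint := cV intE.
Definition tmel f z t : R[i] := mel f (fun x => x) z t.

(** [a] and [c] are the centre and half width of the strip [|Re z - a| < c] in which the transform
    of [f] converges absolutely. *)
Definition exp_dom f (a c C : R) := forall t, `|f t| <= C * expR (a * t - c * `|t|).

Lemma exp_dom_shift f a c C s : exp_dom f a c C -> `|s - a| < c ->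
  exists2 d, 0 < d & forall t, `|f t| * expR (- (s * t)) <= C * expR (- (d * `|t|)).
Proof.
move=> Hf sa; exists (c - `|s - a|); first lra.
move=> t; have C0 : 0 <= C by have := Hf 0; rewrite normr0 !mulr0 subr0 expR0 mulr1; apply: le_trans.
apply: le_trans (ler_wpM2r (expR_ge0 _) (Hf t)) _; rewrite -mulrA ler_wpM2l// -expRD ler_expR.
have : (a - s) * t <= `|s - a| * `|t|.
  by rewrite -normrM -normrN -mulNr opprB; exact: ler_norm.
lra.
Qed.

Theorem mellin_holomorphic f a c C : continuous f -> exp_dom f a c C -> exists Lam : Cx R -> Cx R,
  forall z : Cx R, `|Re z - a| < c -> cint (tmel f z) (Lam z) /\ derivable Lam z 1.
Proof.
move=> cf Hf.
apply: (@holomorphic_transform R R intE (fun f => continuous f) intE_functional f (fun x => x) (fun s => `|s - a| < c)).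
- by move=> u cu t; apply: cvgM; [exact: cf|exact: cu].
- move=> s sa; exists ((c - `|s - a|) / 2); first lra.
  move=> t ts; have -> : t - a = (t - s) + (s - a) by ring.
  apply: le_lt_trans (ler_normD _ _) _; lra.
move=> s sa; have [d d0 Hd] := exp_dom_shift Hf sa.
exists (fun t => C * 4 * wd d t + 0 * wd d t), (C * 4 * (1 / d) + 0 * (1 / d)); split.
  by apply: intE_lin; exact: intE_wd.
move=> t; have C0 : 0 <= C by have := Hf 0; rewrite normr0 !mulr0 subr0 expR0 mulr1; apply: le_trans.
rewrite mul0r addr0 -mulrA; apply: le_trans (Hd t) _; rewrite ler_wpM2l//.
by apply: exp_abs_le; lra.
Qed.

Lemma cint_lin (f g : R -> R[i]) (I J a b : R[i]) : cint f I -> cint g J -> cint (fun x => a * f x + b * g x) (a * I + b * J).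
Proof. exact: (cV_lin intE_functional). Qed.

Lemma cint_unique (f : R -> R[i]) (I J : R[i]) : cint f I -> cint f J -> I = J.
Proof. exact: (cV_unique intE_functional). Qed.

Lemma cexpD (x y : R[i]) : cexp (x + y) = cexp x * cexp y.
Proof.
case: x y => [a b] [c d]; rewrite /cexp /= expRD cosD sinD.
by apply/eqP; rewrite eq_complex /=; apply/andP; split; apply/eqP; ring.
Qed.

Lemma cexp0 : cexp 0 = 1 :> R[i].
Proof. by rewrite /cexp expR0 cos0 sin0 mulr1 mulr0. Qed.

(* Integration by parts: the total derivative of [f t * expR (- z t)] integrates to [0]. *)
Lemma tmel_parts f g (a b c C : R) z (I : R[i]) : (forall t, der t f (a * f t + g t)) ->
  exp_dom f b c C -> `|Re z - b| < c -> z != a%:C%C ->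
  cint (tmel g z) I -> cint (tmel f z) (I / (z - a%:C%C)).
Proof.
move=> df Hf zb za gI; have za0 : z - a%:C%C != 0 by rewrite subr_eq0.
have [d d0 Hd] := exp_dom_shift Hf zb.
pose G t : R[i] := tmel g z t + - (z - a%:C%C) * tmel f z t.
have E : cint G 0.
  move: z @G zb Hd {gI za za0} => [s y] G /= zb Hd.
  pose F1 t := f t * (expR (- (s * t)) * cos (y * t)); pose F2 t := f t * - (expR (- (s * t)) * sin (y * t)).
  have dE t : der t (fun t => expR (- (s * t))) (- s * expR (- (s * t))).
    by apply: dv_eq (dv_exp (dvN (dv_lin s t))) _; rewrite mulrC.
  have dC t : der t (fun t => cos (y * t)) (- y * sin (y * t)).
    by apply: dv_eq (dv_comp (is_derive_cos (y * t)) (dv_lin y t)) _; rewrite mulNr mulrC mulNr.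
  have dS t : der t (fun t => sin (y * t)) (y * cos (y * t)).
    by apply: dv_eq (dv_comp (is_derive_sin (y * t)) (dv_lin y t)) _; rewrite mulrC.
  have d1 t : der t F1 (Re (G t)).
    apply: dv_eq (dvM (df t) (dvM (dE t) (dC t))) _.
    rewrite /G /tmel /mel /cexp /= !mulr0 !mul0r !subr0 !add0r cosN sinN; ring.
  have d2 t : der t F2 (Im (G t)).
    apply: dv_eq (dvM (df t) (dvN (dvM (dE t) (dS t)))) _.
    rewrite /G /tmel /mel /cexp /= !mulr0 !mul0r !subr0 !add0r cosN sinN; ring.
  split; [apply: (@intE_exact F1 _ C d)|apply: (@intE_exact F2 _ C d)] => // t; apply: le_trans (Hd t).
    rewrite normrM ler_wpM2l// normrM (ger0_norm (expR_ge0 _)) ler_piMr ?expR_ge0//; exact: cos_max.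
  rewrite normrM ler_wpM2l// normrN normrM (ger0_norm (expR_ge0 _)) ler_piMr ?expR_ge0//; exact: sin_max.
have := cint_lin ((z - a%:C%C)^-1) (- (z - a%:C%C)^-1) gI E.
rewrite mulr0 addr0 mulrC; congr (cint _ _); apply/funext => t; rewrite /G.
by field.
Qed.

Lemma tmel_shift f a z (I : R[i]) : cint (tmel f z) I -> cint (tmel (fun t => f (t + a)) z) (cexp (z * a%:C%C) * I).
Proof.
move=> [h1 h2]; have H : cint (fun t => tmel f z (t + a)) I by split; [exact: intE_shift h1|exact: intE_shift h2].
have := cint_lin (cexp (z * a%:C%C)) 0 H H; rewrite mul0r addr0; congr (cint _ _); apply/funext => t.
rewrite mul0r addr0 mulrCA; congr (_ * _); rewrite -cexpD; congr cexp.
by rewrite rmorphD; ring.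
Qed.

End LogIntegral.

(** * Series as a functional and Dirichlet series *)

Section Sums.
Variable R : realType.
Implicit Types (f g : nat -> R) (I J a b : R).

Definition sumE f I := \sum_(0 <= k < K) f k @[K --> \oo] --> I.

Let sumE_dom_ge0 f g J : sumE g J -> (forall k, 0 <= f k <= g k) -> exists I, sumE f I.
Proof.
move=> gJ fg; exists (limn (series f)); rewrite /sumE.
apply: (@series_le_cvg R f g) => //.
- by move=> n; case/andP: (fg n).
- by move=> n; have /andP[h1 h2] := fg n; lra.
- by move=> n; case/andP: (fg n).
- by apply/cvg_ex; exists J.
Qed.

Lemma sumE_lin f g I J a b : sumE f I -> sumE g J -> sumE (fun t => a * f t + b * g t) (a * I + b * J).
Proof.
move=> fI gJ; rewrite /sumE.
have -> : (fun K => \sum_(0 <= k < K) (a * f k + b * g k)) = (fun K => a * (\sum_(0 <= k < K) f k) + b * (\sum_(0 <= k < K) g k)).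
  by apply/funext => K; rewrite big_split !mulr_sumr.
by apply: cvgD; exact: cvgMr.
Qed.

Lemma sumE_functional : functional sumE (fun=> True).
Proof.
split; [by move=> *; exact: sumE_lin| |].
  move=> f g I J fI gJ fg; have H : (\sum_(0 <= k < K) g k) - (\sum_(0 <= k < K) f k) @[K --> \oo] --> J - I by exact: cvgB.
  rewrite -subr_ge0; apply: (cvgr_to_ge H); near=> K; rewrite subr_ge0; exact: ler_sum.
move=> f g J _ gJ fg.
have [t|I1 H1] := @sumE_dom_ge0 (fun t => (`|f t| + f t) / 2) g J gJ.
  have := ler_norm (f t); have := ler_norm (- f t); rewrite normrN; have := fg t; lra.
have [t|I2 H2] := @sumE_dom_ge0 (fun t => (`|f t| - f t) / 2) g J gJ.
  have := ler_norm (f t); have := ler_norm (- f t); rewrite normrN; have := fg t; lra.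
exists (1 * I1 + -1 * I2); have := @sumE_lin _ _ _ _ 1 (-1) H1 H2.
by congr (sumE _ _); apply/funext => t; field.
Unshelve. all: by end_near. Qed.

(* [ka ^ z], with the convention [0 ^ z = 0]. *)
Definition cpw (ka : R) (z : R[i]) : R[i] := if 0 < ka then cexp (z * (ln ka)%:C%C) else 0.

Lemma dirichlet_holomorphic (ka : nat -> R) (M s0 J : R) : (forall k, 0 <= ka k <= M) -> 0 < s0 ->
  sumE (fun k => ka k `^ s0) J -> exists Lam : Cx R -> Cx R,
  forall z : Cx R, s0 < Re z -> cV sumE (fun k => cpw (ka k) z) (Lam z) /\ derivable Lam z 1.
Proof.
move=> kM s00 HJ; pose f k : R := if 0 < ka k then 1 else 0.
have melE z : mel f (fun k => - ln (ka k)) z = fun k => cpw (ka k) z.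
  apply/funext => k; rewrite /mel /cpw /f; case: ifP => _; last by rewrite mul0r.
  by rewrite mul1r rmorphN mulrN opprK.
have [|s ss|s ss|Lam HL] := @holomorphic_transform R nat sumE (fun=> True) sumE_functional f (fun k => - ln (ka k)) (fun s => s0 < s).
- by [].
- exists ((s - s0) / 2); first by rewrite divr_gt0// subr_gt0.
  by move=> t; rewrite ler_norml => /andP[]; lra.
- pose M1 := M + 1; pose C := M1 `^ (s - s0).
  have M0 : 0 <= M by have /andP[h1 h2] := kM 0%N; lra.
  exists (fun k => C * ka k `^ s0 + 0 * ka k `^ s0), (C * J + 0 * J); split; first exact: sumE_lin.
  move=> k; rewrite mul0r addr0 /f; case: ifP => k0; last by rewrite normr0 mul0r mulr_ge0 ?powR_ge0.
  rewrite normr1 mul1r mulrN opprK.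
  have -> : expR (s * ln (ka k)) = ka k `^ (s - s0) * ka k `^ s0.
    by rewrite -powR_add// subrK /powR gt_eqF.
  rewrite ler_wpM2r ?powR_ge0//; apply: ge0_ler_powR; rewrite ?nnegrE ?subr_ge0 ?(ltW ss) ?(ltW k0)//.
    by rewrite /M1 addr_ge0.
  by have /andP[_ h] := kM k; rewrite /M1; lra.
exists Lam => z sz; have [h1 h2] := HL z sz; split => //.
by rewrite -melE.
Qed.

End Sums.

Section Connected.
Variable R : realType.

Definition segment_convex (U : set (Cx R)) := forall x y : Cx R, U x -> U y ->
  forall t : R, 0 <= t <= 1 -> U (x + (t%:C%C : Cx R) * (y - x)).

Lemma convex_connected (U : set (Cx R)) (a : Cx R) : U a -> segment_convex U -> connected U.
Proof.
move=> Ua cU.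
pose S (y : Cx R) : set (Cx R) := (fun t : R => a + (t%:C%C : Cx R) * (y - a)) @` `[0, 1]%classic.
have -> : U = \bigcup_(y in U) S y.
  apply/seteqP; split => [y Uy|z [y Uy [t /=]]].
    exists y => //; exists 1; first by rewrite /= in_itv/= ler01 lexx.
    by rewrite mul1r addrC subrK.
  by rewrite in_itv => t01 <-; exact: cU.
apply: bigcup_connected.
  exists a => y Uy; exists 0; first by rewrite /= in_itv/= lexx ler01.
  by rewrite mul0r addr0.
move=> y Uy; apply: connected_continuous_connected; first exact: segment_connected.
apply: continuous_subspaceT => t; apply: cvgD; first exact: cvg_cst.
apply: cvgM; last exact: cvg_cst.
apply/cvgrPdist_le => e e0; have re : 0 < Re e by move: e0; rewrite ltcE => /andP[_].
have ie : Im e = 0 by move: e0; rewrite ltcE => /andP[/eqP].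
near=> u; rewrite -rmorphB normc_def/= expr0n/= addr0 sqrtr_sqr.
have -> : e = (Re e)%:C%C by case: (e) ie => [e1 e2] /= ->.
rewrite lecR; near: u.
by apply: (@cvgr_dist_le _ _ _ _ _ id t).
Unshelve. all: by end_near. Qed.

End Connected.

(** * Continuation of the zeta function of the positive spectrum *)

Section Continuation.
Variables (R : realType) (ka : nat -> R) (L : R -> R) (S1 kp c del C0 : R).
Implicit Types (t s a b : R) (z : Cx R) (K k : nat).
Hypothesis ka0 : forall k, 0 <= ka k.
Hypothesis kaS : forall K, \sum_(0 <= k < K) ka k <= S1.
Hypothesis HL : forall t, sumE (fun k => ln (1 + ka k * expR t)) (L t).
Hypothesis Lc : continuous L.
Hypothesis del0 : 0 < del <= 1 / 2.
Hypothesis asy : forall t, 0 <= t -> `|L t - expR (t / 2) - kp * t - c| <= C0 * expR (- (del * t)).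

Let b1 t : R := ln (1 + expR t).
Let b2 t : R := expR t / (1 + expR t).
Let b3 t : R := wd 1 t.

Let den t : 0 < 1 + expR t. Proof. by []. Qed.

Let db1 t : der t b1 (0 * b1 t + b2 t).
Proof.
apply: dv_eq (@dv_ln R (fun t => 1 + expR t) t _ (den t) (dvD (dv_cst 1 t) (dv_exp (dv_id t)))) _.
by rewrite mulr1 add0r mul0r add0r.
Qed.

Let db2e t : der t b2 (b3 t).
Proof.
have n0 : 1 + expR t != 0 by [].
apply: dv_eq (dvM (dv_exp (dv_id t)) (@dvV R (fun t => 1 + expR t) t _ n0 (dvD (dv_cst 1 t) (dv_exp (dv_id t))))) _.
by rewrite /b3 /wd mul1r; move: n0; move: (expR t) => E n0; field.
Qed.

Let db2 t : der t b2 (0 * b2 t + b3 t).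
Proof. by rewrite mul0r add0r. Qed.

Let b1_ge0 t : 0 <= b1 t.
Proof. by rewrite ln_ge0// lerDl. Qed.

Let b1_leE t : b1 t <= expR t.
Proof. by rewrite -[leRHS]expRK ler_ln ?posrE ?expR_gt0// expR_ge1Dx. Qed.

Let b1_le a t : 0 < a <= 1 -> b1 t <= 1 / a * expR (a * t).
Proof.
move=> /andP[a0 a1]; have a1' : 1 <= 1 / a by rewrite ler_pdivlMr// mul1r.
have [t0|t0] := leP 0 t.
  have h : b1 t <= 1 + t.
    rewrite -[leRHS]expRK ler_ln ?posrE ?expR_gt0//.
    have := ler_wpM2l (expR_ge0 t) (expR_ge1Dx 1); rewrite -expRD.
    have : 1 <= expR t by rewrite -[leLHS]expR0 ler_expR.
    by rewrite [t + 1]addrC; lra.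
  apply: le_trans h _; rewrite mulrAC mul1r ler_pdivlMr// mulrDl mul1r.
  by have := expR_ge1Dx (a * t); lra.
apply: le_trans (b1_leE t) _.
apply: (@le_trans _ _ (expR (a * t))); last by rewrite ler_peMl.
by rewrite ler_expR; have := mulr_ge0_le0 (eqbRL (subr_ge0 _ _) a1 : 0 <= 1 - a) (ltW t0); lra.
Qed.

Let b2_ge0 t : 0 <= b2 t.
Proof. pos. Qed.

Let b2_le a t : 0 <= a <= 1 -> b2 t <= expR (a * t).
Proof.
move=> /andP[a0 a1]; have [t0|t0] := leP 0 t.
  apply: (@le_trans _ _ 1); first by rewrite ler_pdivrMr// mul1r lerDr.
  by rewrite -[leLHS]expR0 ler_expR mulr_ge0.
apply: (@le_trans _ _ (expR t)); first by rewrite ler_pdivrMr// ler_peMr ?expR_ge0// lerDl.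
by rewrite ler_expR; have := mulr_ge0_le0 (eqbRL (subr_ge0 _ _) a1 : 0 <= 1 - a) (ltW t0); lra.
Qed.

Let b3_ge0 t : 0 <= b3 t.
Proof. pos. Qed.

Let wd_le d t : wd d t <= expR (- (d * `|t|)).
Proof.
rewrite /wd; have e0 := expR_gt0 (d * t); have d0 : 0 < 1 + expR (d * t) by [].
have h1 : expR (d * t) / (1 + expR (d * t)) ^+ 2 <= expR (d * t).
  by rewrite ler_pdivrMr ?exprn_gt0// ler_peMr ?(ltW e0)// expr_ge1 ?(ltW d0)// lerDl.
have h2 : expR (d * t) / (1 + expR (d * t)) ^+ 2 <= expR (- (d * t)).
  rewrite ler_pdivrMr ?exprn_gt0// expRN [leRHS]mulrC ler_pdivlMr// -expr2 ler_pXn2r ?nnegrE ?(ltW d0)//.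
  lra.
have [t0|t0] := leP 0 t; first by rewrite ger0_norm.
by rewrite ltr0_norm// mulrN opprK.
Qed.

Let exp_split (s d t : R) : s * t - d * `|t| = if 0 <= t then (s - d) * t else (s + d) * t.
Proof.
case: ifPn => t0; first by rewrite ger0_norm//; ring.
by rewrite ltr0_norm ?ltNge//; ring.
Qed.

Let b1_dom s : 0 < s < 1 -> exists d C, 0 < d /\ exp_dom b1 s d C.
Proof.
move=> /andP[s0 s1]; pose d := Num.min s (1 - s) / 2.
have m1 : Num.min s (1 - s) <= s by rewrite ge_min lexx.
have m2 : Num.min s (1 - s) <= 1 - s by rewrite ge_min lexx orbT.
have m0 : 0 < Num.min s (1 - s) by rewrite lt_min s0 subr_gt0.
have d0 : 0 < d by pos.
have sd : 0 < s - d by rewrite /d; lra.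
exists d, (1 / (s - d)); split => // t; rewrite ger0_norm// exp_split; case: ifPn => t0.
  by apply: b1_le; lra.
apply: le_trans (b1_le t (_ : 0 < s + d <= 1)) _; first by rewrite /d; lra.
by rewrite ler_wpM2r ?expR_ge0// !div1r lef_pV2 ?posrE; lra.
Qed.

Let b2_dom s : 0 < s < 1 -> exists d, 0 < d /\ exp_dom b2 s d 1.
Proof.
move=> /andP[s0 s1]; pose d := Num.min s (1 - s) / 2.
have m1 : Num.min s (1 - s) <= s by rewrite ge_min lexx.
have m2 : Num.min s (1 - s) <= 1 - s by rewrite ge_min lexx orbT.
have m0 : 0 < Num.min s (1 - s) by rewrite lt_min s0 subr_gt0.
have d0 : 0 < d by pos.
exists d; split => // t; rewrite ger0_norm// mul1r exp_split; case: ifPn => t0; apply: b2_le; rewrite /d; apply/andP; lra.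
Qed.

Let b3_cont : continuous b3.
Proof.
move=> t; have n0 : (1 + expR (1 * t)) ^+ 2 != 0 by [].
have dE := dvD (dv_cst 1 t) (dv_exp (dv_lin 1 t)).
exact: (dv_cont (dvM (dv_exp (dv_lin 1 t)) (@dvV R (fun t => (1 + expR (1 * t)) ^+ 2) t _ n0 (dvX 2 dE)))).
Qed.

Let b3_dom : exp_dom b3 0 1 1.
Proof.
by move=> t; rewrite ger0_norm// mul1r mul0r sub0r; exact: wd_le.
Qed.

(** [p1] has the leading behaviour [exp (t / 2)] of [L] at plus infinity and satisfies
    [p1' = p1 / 2 + f2]; its transform is that of [f2] divided by [z - 1/2], which isolates the
    pole. *)
Let f2 t : R := expR (t / 2) * b3 t.
Let p1 t : R := expR (t / 2) * b2 t.

Let dexp2 t : der t (fun t => expR (t / 2)) (1 / 2 * expR (t / 2)).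
Proof.
apply: dv_eq (dv_exp (dvM (dv_id t) (dv_cst 2^-1 t))) _.
lra.
Qed.

Let f2_cont : continuous f2.
Proof. by move=> t; apply: cvgM; [exact: dv_cont (dexp2 t)|exact: b3_cont]. Qed.

Let f2_dom : exp_dom f2 (1 / 2) 1 1.
Proof.
move=> t; rewrite /f2 mul1r ger0_norm; last pos.
rewrite expRD (_ : t / 2 = 1 / 2 * t); last by rewrite mulrC mul1r.
by rewrite ler_wpM2l ?expR_ge0//; exact: wd_le.
Qed.

Let dp1 t : der t p1 (1 / 2 * p1 t + f2 t).
Proof. by apply: dv_eq (dvM (dexp2 t) (db2e t)) _; rewrite /p1 /f2; ring. Qed.

Let p1_dom s : 1 / 2 < s < 3 / 2 -> exists d, 0 < d /\ exp_dom p1 s d 1.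
Proof.
move=> s1; have s2 : 0 < s - 1 / 2 < 1 by lra.
have [d [d0 Hd]] := b2_dom s2; exists d; split => // t.
rewrite normrM (ger0_norm (expR_ge0 _)) mul1r.
apply: le_trans (ler_wpM2l (expR_ge0 _) (Hd t)) _; rewrite mul1r -expRD ler_expR; lra.
Qed.

Let Cnn (f : R -> R) a d C : exp_dom f a d C -> 0 <= C.
Proof. by move=> /(_ 0); rewrite normr0 !mulr0 subr0 expR0 mulr1; apply: le_trans. Qed.

Let C00 : 0 <= C0.
Proof. have h := asy (lexx 0); have e : expR (- (del * 0)) = 1 by rewrite mulr0 oppr0 expR0.
by rewrite e mulr1 in h; exact: le_trans h. Qed.

Let LK K t : R := \sum_(0 <= k < K) ln (1 + ka k * expR t).

Let term_ge0 k t : 0 <= ln (1 + ka k * expR t).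
Proof. by rewrite ln_ge0// lerDl mulr_ge0. Qed.

Let term_le k t : ln (1 + ka k * expR t) <= ka k * expR t.
Proof.
rewrite -[leRHS]expRK ler_ln ?posrE ?expR_gt0//; first exact: expR_ge1Dx.
by rewrite ltr_pwDl// mulr_ge0.
Qed.

Let sums : exists2 S : R, \sum_(0 <= k < K) ka k @[K --> \oo] --> S & forall K, \sum_(0 <= k < K) ka k <= S.
Proof.
have nd : nondecreasing_seq (fun K => \sum_(0 <= k < K) ka k).
  by move=> i j ij; rewrite (@big_cat_nat _ _ _ i 0 j)//= lerDl sumr_ge0.
have cv : cvgn (fun K => \sum_(0 <= k < K) ka k).
  by apply: nondecreasing_is_cvgn => //; exists S1 => _ [K _ <-].
exists (limn (fun K => \sum_(0 <= k < K) ka k)) => // K; exact: (nondecreasing_cvgn_le nd cv).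
Qed.

Let LK_le K t : LK K t <= L t.
Proof.
have H : LK^~ t @ \oo --> L t by exact: HL.
apply: (cvgr_to_ge H); near=> j; rewrite /LK.
have Kj : (K <= j)%N by near: j; exact: nbhs_infty_ge.
by rewrite (@big_cat_nat _ _ _ K 0 j)//= lerDl sumr_ge0.
Unshelve. all: by end_near. Qed.

Let LK_ge K S t : (forall K, \sum_(0 <= k < K) ka k <= S) ->
  L t - LK K t <= (S - \sum_(0 <= k < K) ka k) * expR t.
Proof.
move=> HS; have H : LK^~ t @ \oo --> L t by exact: HL.
rewrite lerBlDr; apply: (cvgr_to_le H); near=> j; rewrite /LK.
have Kj : (K <= j)%N by near: j; exact: nbhs_infty_ge.
rewrite (@big_cat_nat _ _ _ K 0 j)//= addrC lerD2r.
apply: (@le_trans _ _ (\sum_(K <= i < j) ka i * expR t)); first by apply: ler_sum => i _.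
rewrite -mulr_suml ler_wpM2r ?expR_ge0// lerBrDl.
by rewrite -(@big_cat_nat _ _ _ K 0 j).
Unshelve. all: by end_near. Qed.

Let L_ge0 t : 0 <= L t.
Proof. by have := LK_le 0%N t; rewrite /LK big_geq. Qed.

Let L_le t : L t <= S1 * expR t.
Proof.
have := @LK_ge 0%N S1 t kaS; rewrite /LK !big_geq//; lra.
Qed.

Let S10 : 0 <= S1.
Proof. by have := kaS 0%N; rewrite big_geq. Qed.

(** The subtracted functions reproduce [exp (t / 2) + kp t + c] at plus infinity. The constant [c]
    is obtained by shifting [b1], since a shift only multiplies the transform by [exp (c z)]. *)
Let rho t : R := L t - p1 t - (kp - 1) * b1 t - b1 (t + c).

Let b1_exp t : b1 t = t + b1 (- t).
Proof.
rewrite -{2}(expRK t) -lnM ?posrE ?expR_gt0//; congr ln.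
by rewrite mulrDr mulr1 -expRD subrr expR0 addrC.
Qed.

(** Centre and half width describe the strip [- del < Re z < 1]: [rho] is of order [exp (- del t)]
    at plus infinity and [exp t] at minus infinity. *)
Let rho_dom : exists C, exp_dom rho ((1 - del) / 2) ((1 + del) / 2) C.
Proof.
pose A := S1 + 1 + `|kp - 1| + expR c; pose B := C0 + 1 + `|kp - 1| + expR (- c).
have A0 : 0 <= A by pos.
have B0 : 0 <= B by pos.
exists (A + B) => t; have /andP[d0 d1] := del0.
rewrite exp_split; case: ifPn => t0.
  have -> : (1 - del) / 2 - (1 + del) / 2 = - del by field.
  rewrite mulNr; have -> : rho t = (L t - expR (t / 2) - kp * t - c) + (expR (t / 2) - p1 t) + - ((kp - 1) * b1 (- t)) + - b1 (- (t + c)).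
    by rewrite /rho (b1_exp t) (b1_exp (t + c)); ring.
  have e2 : expR (- t) <= expR (- (del * t)).
    by rewrite ler_expR lerN2 ler_piMl; lra.
  have h1 : `|expR (t / 2) - p1 t| <= expR (- (del * t)).
    have -> : expR (t / 2) - p1 t = expR (t / 2) / (1 + expR t).
      by rewrite /p1 /b2; field.
    rewrite ger0_norm ?(ltW (den t))// ler_pdivrMr// mulrDr mulr1 -expRD.
    have : expR (t / 2) <= expR (- (del * t) + t).
      by rewrite ler_expR; have := ler_wpM2r t0 d1; lra.
    by have := expR_ge0 (- (del * t)); lra.
  have h2 : `|- ((kp - 1) * b1 (- t))| <= `|kp - 1| * expR (- (del * t)).
    by rewrite normrN normrM (ger0_norm (b1_ge0 _)) ler_wpM2l// (le_trans (b1_leE _)).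
  have h3 : `|- b1 (- (t + c))| <= expR (- c) * expR (- (del * t)).
    rewrite normrN (ger0_norm (b1_ge0 _)); apply: le_trans (b1_leE _) _.
    by rewrite opprD expRD mulrC ler_wpM2l.
  have h0 := asy t0.
  apply: (@le_trans _ _ (B * expR (- (del * t)))); last by rewrite ler_wpM2r ?expR_ge0// lerDr.
  have -> : B * expR (- (del * t)) = C0 * expR (- (del * t)) + expR (- (del * t)) + `|kp - 1| * expR (- (del * t)) + expR (- c) * expR (- (del * t)) by rewrite /B; ring.
  by do 3! (tri; apply: lerD => //).
have -> : (1 - del) / 2 + (1 + del) / 2 = 1 by field.
rewrite mul1r; apply: (@le_trans _ _ (A * expR t)); last by rewrite ler_wpM2r ?expR_ge0// lerDl.
have -> : rho t = L t + - p1 t + - ((kp - 1) * b1 t) + - b1 (t + c) by [].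
have -> : A * expR t = S1 * expR t + expR t + `|kp - 1| * expR t + expR c * expR t by rewrite /A; ring.
tri; apply: lerD; last first.
  by rewrite normrN (ger0_norm (b1_ge0 _)) (le_trans (b1_leE _))// expRD mulrC.
tri; apply: lerD; last first.
  by rewrite normrN normrM (ger0_norm (b1_ge0 _)) ler_wpM2l.
tri; apply: lerD; first by rewrite ger0_norm.
rewrite normrN ger0_norm ?mulr_ge0 ?expR_ge0//.
have h : b2 t <= expR t by have := @b2_le 1 t; rewrite mul1r; apply; rewrite ler01 lexx.
apply: le_trans (ler_wpM2l (expR_ge0 _) h) _; rewrite ler_piMl ?expR_ge0//.
by rewrite -[leRHS]expR0 ler_expR; lra.
Qed.

Let rho_cont : continuous rho.
Proof.
move=> t; apply: cvgB; first apply: cvgB; first apply: cvgB.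
- exact: Lc.
- exact: dv_cont (dp1 t).
- by apply: cvgMr; exact: dv_cont (db1 t).
- exact: (dv_cont (@dv_comp R b1 (fun t => t + c) t _ _ (db1 (t + c)) (dvD (dv_id t) (dv_cst c t)))).
Qed.

Let L_le2 : exists2 C, 0 < C & forall t, 0 <= t -> L t <= C * expR (t / 2).
Proof.
exists (1 + 2 * `|kp| + `|c| + C0); first by rewrite !ltr_wpDr.
move=> t t0; have := asy t0; rewrite ler_norml => /andP[_ h].
have E1 : 1 <= expR (t / 2) by rewrite -[leLHS]expR0 ler_expR divr_ge0.
have e1 : kp * t <= 2 * `|kp| * expR (t / 2).
  have h1 := ler_wpM2r t0 (ler_norm kp).
  have h2 := ler_wpM2l (normr_ge0 kp) (expR_ge1Dx (t / 2)); have := normr_ge0 kp; lra.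
have e2 : c <= `|c| * expR (t / 2) by apply: le_trans (ler_norm c) _; rewrite ler_peMr.
have e3 : C0 * expR (- (del * t)) <= C0 * expR (t / 2).
  rewrite ler_wpM2l// ler_expR; have /andP[d0 _] := del0; have := mulr_ge0 (ltW d0) t0; lra.
rewrite !mulrDl; lra.
Qed.

Section Transforms.
Variables H H2 Lam : Cx R -> Cx R.
Hypothesis HH : forall z, `|Re z - 0| < 1 -> cint (tmel b3 z) (H z) /\ derivable H z 1.
Hypothesis HH2 : forall z, `|Re z - 1 / 2| < 1 -> cint (tmel f2 z) (H2 z) /\ derivable H2 z 1.
Hypothesis HLam : forall z, `|Re z - (1 - del) / 2| < (1 + del) / 2 ->
  cint (tmel rho z) (Lam z) /\ derivable Lam z 1.

Let zneq z a : a < Re z -> z != (a%:C%C : Cx R).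
Proof. by move=> h; apply/eqP => E; rewrite E ltxx in h. Qed.

Let B z : Cx R := H z / (z - 0%:C%C) / (z - 0%:C%C).

Let int_b1 z : 0 < Re z < 1 -> cint (tmel b1 z) (B z).
Proof.
move=> z1; have /andP[z0 zl] := z1.
have [d [d0 Hd]] := b2_dom z1; have [d' [C [d'0 Hd']]] := b1_dom z1.
have r0 e : 0 < e -> `|Re z - Re z| < e by rewrite subrr normr0.
apply: (tmel_parts db1 Hd' (r0 _ d'0) (zneq z0)).
apply: (tmel_parts db2 Hd (r0 _ d0) (zneq z0)).
by apply: (HH _).1; rewrite subr0 ger0_norm ?(ltW z0).
Qed.

Let int_p1 z : 1 / 2 < Re z < 3 / 2 -> cint (tmel p1 z) (H2 z / (z - (1 / 2)%:C%C)).
Proof.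
move=> z1; have /andP[z0 zl] := z1; have [d [d0 Hd]] := p1_dom z1.
have r0 : `|Re z - Re z| < d by rewrite subrr normr0.
apply: (tmel_parts dp1 Hd r0 (zneq z0)).
by apply: (HH2 _).1; rewrite ltr_norml; lra.
Qed.

Let T z : Cx R := H2 z / (z - (1 / 2)%:C%C) + ((kp - 1)%:C%C + cexp (z * c%:C%C)) * B z + Lam z.

Let int_L z : 1 / 2 < Re z < 1 -> cint (tmel L z) (T z).
Proof.
move=> /andP[z0 z1]; have /andP[d0 d1] := del0.
have h1 : cint (tmel p1 z) (H2 z / (z - (1 / 2)%:C%C)) by apply: int_p1; lra.
have h2 : cint (tmel b1 z) (B z) by apply: int_b1; lra.
have h3 := tmel_shift c h2.
have h4 : cint (tmel rho z) (Lam z) by apply: (HLam _).1; rewrite ltr_norml; lra.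
have := cint_lin 1 1 (cint_lin 1 (kp - 1)%:C%C h1 h2) (cint_lin 1 1 h3 h4).
congr (cint _ _); last by rewrite /T; ring.
apply/funext => t; rewrite /tmel /mel.
have -> : L t = p1 t + (kp - 1) * b1 t + (b1 (t + c) + rho t) by rewrite /rho; ring.
move: (kp - 1) (p1 t) (b1 t) (b1 (t + c)) (rho t) (cexp _) => w x1 x2 x3 x4 e.
by rewrite !rmorphD; ring.
Qed.

Let int_LK z K : 0 < Re z < 1 -> cint (tmel (LK K) z) (\sum_(0 <= k < K) cpw (ka k) z * B z).
Proof.
move=> z1; have hB := int_b1 z1.
have z0 : cint (tmel (fun=> 0) z) 0.
  have := cint_lin 0 0 hB hB; rewrite !mul0r addr0; congr (cint _ _); apply/funext => t.
  by rewrite /tmel /mel !mul0r addr0.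
elim: K => [|K IH].
  rewrite big_geq//; congr (cint (tmel _ z) _): z0; apply/funext => t; by rewrite /LK big_geq.
have hk : cint (tmel (fun t => ln (1 + ka K * expR t)) z) (cpw (ka K) z * B z).
  have [k0|k0] := ltP 0 (ka K).
    have := tmel_shift (ln (ka K)) hB; rewrite /cpw k0; congr (cint (tmel _ z) _); apply/funext => t.
    by rewrite /b1 expRD lnK ?posrE// mulrC.
  have k00 : ka K = 0 by apply: le_anti; rewrite k0 ka0.
  rewrite /cpw k00 ltxx mul0r; congr (cint (tmel _ z) _): z0; apply/funext => t.
  by rewrite mul0r addr0 ln1.
rewrite big_nat_recr//=; have := cint_lin 1 1 IH hk; rewrite !mul1r; congr (cint _ _); apply/funext => t.
by rewrite !mul1r /tmel /mel -mulrDl -rmorphD /LK big_nat_recr.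
Qed.

(* Interpolating between [S expR t] and [C expR (t / 2)] makes the remainder of the series small in a strip. *)
Let remainder_dom : exists2 M : nat -> R, M K @[K --> \oo] --> (0 : R) &
  forall K, exp_dom (fun t => L t - LK K t) (31 / 40) (9 / 40) (M K).
Proof.
have [S HS Sb] := sums; have [C Cp HC] := L_le2.
pose sg K := S - \sum_(0 <= k < K) ka k.
have sg0 K : 0 <= sg K by rewrite subr_ge0.
have sgl : sg K @[K --> \oo] --> (0 : R).
  by rewrite -[X in _ --> X](subrr S); apply: cvgB => //; exact: cvg_cst.
exists (fun K => sg K + sg K `^ (1 / 10) * C `^ (9 / 10)).
  have h : sg K + sg K `^ (1 / 10) * C `^ (9 / 10) @[K --> \oo] --> (0 + 0 * C `^ (9 / 10) : R).
    apply: cvgD => //; apply: cvgMl.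
    apply/cvgrPdist_le => e e0; move/cvgrPdist_le: sgl => /(_ (e `^ 10)); rewrite powR_gt0// => /(_ isT) Hn.
    near=> K; rewrite sub0r normrN ger0_norm ?powR_ge0//.
    have : `|0 - sg K| <= e `^ 10 by near: K.
    rewrite sub0r normrN ger0_norm// => h.
    have p10 : 0 <= (1 / 10 : R) by lra.
    have := @ge0_ler_powR R _ p10 (sg K) (e `^ 10); rewrite !nnegrE powR_ge0 => /(_ (sg0 K) isT h).
    rewrite -powRrM (_ : 10 * (1 / 10) = 1 :> R) ?powRr1//; [exact: ltW|by field].
  by rewrite mul0r addr0 in h.
move=> K t; have r0 : 0 <= L t - LK K t by rewrite subr_ge0.
have r1 : L t - LK K t <= sg K * expR t by exact: LK_ge.
have q0 : 0 <= sg K `^ (1 / 10) * C `^ (9 / 10) by pos.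
rewrite ger0_norm// exp_split; case: ifPn => t0; last first.
  have -> : (31 / 40 + 9 / 40) * t = t by field.
  by apply: le_trans r1 _; rewrite ler_wpM2r ?expR_ge0// lerDl.
(* The interpolation exponents [1/10] and [9/10] give the left edge [1/10 + 9/20 = 11/20] of the
   strip. *)
have -> : (31 / 40 - 9 / 40) * t = 1 / 10 * t + 9 / 10 * (t / 2) by field.
have LK0 : 0 <= LK K t by rewrite sumr_ge0.
have r2 : L t - LK K t <= C * expR (t / 2) by apply: le_trans (HC t t0); lra.
have [->|rn] := eqVneq (L t - LK K t) 0; first pos.
have rp : 0 < L t - LK K t by lra.
apply: (@le_trans _ _ ((sg K * expR t) `^ (1 / 10) * (C * expR (t / 2)) `^ (9 / 10))).
  have -> : L t - LK K t = (L t - LK K t) `^ (1 / 10) * (L t - LK K t) `^ (9 / 10).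
    by rewrite -powR_add// (_ : 1 / 10 + 9 / 10 = 1 :> R) ?powRr1//; field.
  by apply: ler_pM; rewrite ?powR_ge0//; apply: ge0_ler_powR; rewrite ?nnegrE ?mulr_ge0 ?(ltW Cp).
rewrite !powRM ?(ltW Cp)// -!expRM.
rewrite mulrACA -expRD [t * _]mulrC [t / 2 * _]mulrC; apply: ler_wpM2r; first exact: expR_ge0.
by rewrite lerDr.
Unshelve. all: by end_near. Qed.

Let tmel_bound (f : R -> R) z t (X : R) : `|f t| * expR (- (Re z * t)) <= X ->
  `|Re (tmel f z t)| <= X /\ `|Im (tmel f z t)| <= X.
Proof.
case: z => [a b] /= h; rewrite !mulr0 !mul0r !subr0 ?add0r ?addr0 !normrM.
split; apply: le_trans h; rewrite ler_wpM2l// ger0_norm ?expR_ge0// ler_piMr ?expR_ge0//.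
  exact: cos_max.
exact: sin_max.
Qed.

(** Termwise integration: the partial sums differ from the transform of [L] by that of [L - LK K],
    which is at most a multiple of [M K]. *)
Let sum_L z : 11 / 20 < Re z < 1 -> cV (@sumE R) (fun k => cpw (ka k) z * B z) (T z).
Proof.
move=> /andP[z0 z1]; have [M M0 HM] := remainder_dom.
have hL : cint (tmel L z) (T z) by apply: int_L; lra.
have z31 : `|Re z - 31 / 40| < 9 / 40 by rewrite ltr_norml; lra.
pose d := 9 / 40 - `|Re z - 31 / 40|; have d0 : 0 < d by rewrite subr_gt0.
pose r K t := L t - LK K t.
have hr K : cint (tmel (r K) z) (T z - \sum_(0 <= k < K) cpw (ka k) z * B z).
  have z01 : 0 < Re z < 1 by lra.
  have := cint_lin 1 (-1) hL (int_LK K z01); rewrite mul1r mulN1r; congr (cint _ _); apply/funext => t.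
  by rewrite mul1r mulN1r -mulrBl -rmorphB.
have bd K t : `|Re (tmel (r K) z t)| <= M K * 4 * wd d t + 0 * wd d t /\ `|Im (tmel (r K) z t)| <= M K * 4 * wd d t + 0 * wd d t.
  have h : `|r K t| * expR (- (Re z * t)) <= M K * 4 * wd d t + 0 * wd d t.
    have MK : 0 <= M K := Cnn (HM K).
    rewrite mul0r addr0; apply: le_trans (ler_wpM2r (expR_ge0 _) (HM K t)) _.
    rewrite -2!mulrA ler_wpM2l// -expRD; apply: le_trans (exp_abs_le t (ltW d0)).
    rewrite ler_expR /d; have : (31 / 40 - Re z) * t <= `|Re z - 31 / 40| * `|t|.
      by rewrite -normrM -normrN -mulNr opprB; exact: ler_norm.
    lra.
  by split; [exact: (tmel_bound h).1|exact: (tmel_bound h).2].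
have cM : M K * 4 * (1 / d) + 0 * (1 / d) @[K --> \oo] --> (0 : R).
  have h : M K * 4 * (1 / d) + 0 * (1 / d) @[K --> \oo] --> (0 * 4 * (1 / d) + 0 * (1 / d) : R).
    by apply: cvgD; [apply: cvgMl; apply: cvgMl|exact: cvg_cst].
  have e : 0 * 4 * (1 / d) + 0 * (1 / d) = 0 :> R by rewrite !mul0r addr0.
  by rewrite e in h.
have Rsum (F : nat -> R[i]) K : Re (\sum_(0 <= k < K) F k) = \sum_(0 <= k < K) Re (F k) /\
   Im (\sum_(0 <= k < K) F k) = \sum_(0 <= k < K) Im (F k).
  elim: K => [|K [IH1 IH2]]; first by rewrite !big_geq.
  by rewrite !big_nat_recr//= -IH1 -IH2; case: (\sum_(_ <= _ < _) _) (F K) => [? ?] [? ?].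
have fin (F : nat -> R) (l : R) : (forall K, `|l - \sum_(0 <= k < K) F k| <= M K * 4 * (1 / d) + 0 * (1 / d)) -> sumE F l.
  move=> hF; apply/cvgrPdist_le => e e0; move/cvgrPdist_le: cM => /(_ e e0) Hn.
  near=> K; apply: le_trans (hF K) _.
  have : `|0 - (M K * 4 * (1 / d) + 0 * (1 / d))| <= e by near: K.
  by rewrite sub0r normrN; apply: le_trans; exact: ler_norm.
have Vw K := intE_lin (M K * 4) 0 (intE_wd d0) (intE_wd d0).
split; apply: fin => K; have [h1 h2] := hr K; have [s1 s2] := Rsum (fun k => cpw (ka k) z * B z) K.
  rewrite -s1; have := V_bound (@intE_functional R) h1 (Vw K) (fun t => (bd K t).1).
  by case: (T z) (\sum_(_ <= _ < _) _) => [? ?] [? ?].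
rewrite -s2; have := V_bound (@intE_functional R) h2 (Vw K) (fun t => (bd K t).2).
by case: (T z) (\sum_(_ <= _ < _) _) => [? ?] [? ?].
Unshelve. all: by end_near. Qed.

Definition zeta_near z : Cx R := (kp - 1)%:C%C + cexp (c%:C%C * z) +
  z * (z * ((H z)^-1 * (H2 z * (z - (1 / 2)%:C%C)^-1 + Lam z))).

Lemma zeta_near_sum z : 11 / 20 < Re z < 1 -> H z != 0 ->
  cV (@sumE R) (fun k => cpw (ka k) z) (zeta_near z).
Proof.
move=> z1 H0; have h := sum_L z1; have /andP[z0 _] := z1.
have zn : z != 0 by apply/eqP => E; rewrite E in z0; lra.
have zn2 : z - (1 / 2)%:C%C != 0 by rewrite subr_eq0; apply: zneq; lra.
have Bn : B z = H z / z / z by rewrite /B subr0.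
have B0 : B z != 0 by rewrite Bn !mulf_neq0 ?invr_neq0.
have := cV_lin (sumE_functional R) (B z)^-1 0 h h; rewrite mul0r addr0.
rewrite (_ : (B z)^-1 * T z = zeta_near z); last first.
  rewrite /T /zeta_near Bn [c%:C%C * z]mulrC; move: (cexp _) (kp - 1)%:C%C (z - (1 / 2)%:C%C) (H2 z) (Lam z) (H z) zn2 H0 zn => E k w h2 l hz zn2 H0 zn.
  by field; rewrite zn2 H0.
congr (cV _ _ _); apply/funext => k; rewrite mul0r addr0 mulrC mulfK//.
Qed.

Lemma zeta_near_dv z : - del < Re z < 1 -> z != (1 / 2)%:C%C -> H z != 0 ->
  derivable zeta_near z 1.
Proof.
move=> /andP[z0 z1] z12 H0; have /andP[d0 d1] := del0.
have [_ /derivableP dH] : cint (tmel b3 z) (H z) /\ derivable H z 1 by apply: HH; rewrite ltr_norml; lra.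
have [_ /derivableP dH2] : cint (tmel f2 z) (H2 z) /\ derivable H2 z 1 by apply: HH2; rewrite ltr_norml; lra.
have [_ /derivableP dL] : cint (tmel rho z) (Lam z) /\ derivable Lam z 1 by apply: HLam; rewrite ltr_norml; lra.
have zn : z - (1 / 2)%:C%C != 0 by rewrite subr_eq0.
have dz := cdv_id z.
have d2 := @cdvV R (fun z => z - (1 / 2)%:C%C) z _ zn (cdvD dz (cdv_cst (- (1 / 2)%:C%C) z)).
have D := cdvD (cdvD (cdv_cst (kp - 1)%:C%C z) (cdv_exp c%:C%C z))
  (cdvM dz (cdvM dz (cdvM (cdvV H0 dH) (cdvD (cdvM dH2 d2) dL)))).
by [].
Qed.

Lemma zeta_near_dv0 : H 0 != 0 -> der (0 : Cx R) zeta_near c%:C%C.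
Proof.
move=> H0; have /andP[d0 d1] := del0.
have [_ /derivableP dH] : cint (tmel b3 0) (H 0) /\ derivable H 0 1 by apply: HH => /=; rewrite subrr normr0.
have [_ /derivableP dH2] : cint (tmel f2 0) (H2 0) /\ derivable H2 0 1 by apply: HH2 => /=; rewrite ltr_norml; lra.
have [_ /derivableP dL] : cint (tmel rho 0) (Lam 0) /\ derivable Lam 0 1 by apply: HLam => /=; rewrite ltr_norml; lra.
have zn : (0 : Cx R) - (1 / 2)%:C%C != 0.
  by rewrite sub0r; apply/eqP => -[]; lra.
have dz := cdv_id (0 : Cx R).
have d2 := @cdvV R (fun z => z - (1 / 2)%:C%C) 0 _ zn (cdvD dz (cdv_cst (- (1 / 2)%:C%C) 0)).
apply: cdv_eq (cdvD (cdvD (cdv_cst (kp - 1)%:C%C 0) (cdv_exp c%:C%C 0))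
  (cdvM dz (cdvM dz (cdvM (cdvV H0 dH) (cdvD (cdvM dH2 d2) dL))))) _.
by rewrite mulr0 cexp0 mulr1 !mul0r mulr0 addr0 addr0 add0r.
Qed.

(** Uses [cos (y t) >= 1 - 2 (y t)^2]. The main part is at least [exp (- 2 |t|) / 4], and [t^2]
    times the density is at most [3200 wd (1/20)], with [3200 = 4 * 800] and [800] from
    [t^2 <= 800 exp (|t| / 20)]. *)
Let b3_lower t s y : `|s| <= 9 / 10 ->
  1 / 4 * wd 2 t + - (6400 * y ^+ 2) * wd (1 / 20) t <= b3 t * (expR (- (s * t)) * cos (y * t)).
Proof.
move=> s9; have [h _] := exp_est 0 (y * t); rewrite oppr0 expR0 mul1r addr0 normr0 expR0 mulr1 expr0n add0r in h.
have cy : 1 - 2 * (y * t) ^+ 2 <= cos (y * t) by move: h; rewrite ler_norml => /andP[]; lra.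
have st : `|s * t| <= 9 / 10 * `|t| by rewrite normrM ler_wpM2r.
have st1 : s * t <= 9 / 10 * `|t| := le_trans (ler_norm _) st.
have st2 : - (s * t) <= 9 / 10 * `|t| by apply: le_trans (ler_norm _) _; rewrite normrN.
have bE : 0 <= b3 t * expR (- (s * t)) by pos.
have low : 1 / 4 * wd 2 t <= b3 t * expR (- (s * t)).
  apply: (@le_trans _ _ (1 / 4 * expR (- (2 * `|t|)))); first by rewrite ler_wpM2l ?wd_le//; lra.
  have h1 : 1 / 4 * expR (- (1 * `|t|)) <= b3 t by have := @exp_abs_le R 1 t ler01; rewrite /b3; lra.
  apply: le_trans (ler_wpM2r (expR_ge0 (- (s * t))) h1); rewrite -[leRHS]mulrA; apply: ler_wpM2l; first by lra.
  by rewrite -expRD ler_expR; lra.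
have up : t ^+ 2 * (b3 t * expR (- (s * t))) <= 3200 * wd (1 / 20) t.
  have t2 : t ^+ 2 <= 800 * expR (1 / 20 * `|t|).
    have y0 : 0 <= 1 / 20 * `|t| by [].
    have := expR_ge1Dxn 1 y0; rewrite (_ : 2`! = 2)%N// exprMn real_normK ?num_real; move: y0; glra.
  have h1 : b3 t * expR (- (s * t)) <= expR (- (1 / 10 * `|t|)).
    apply: le_trans (ler_wpM2r (expR_ge0 _) (wd_le 1 t)) _; rewrite -expRD ler_expR; move: t2 low bE st2 st1; glra.
  apply: le_trans (ler_pM (sqr_ge0 t) bE t2 h1) _; rewrite -[leLHS]mulrA -expRD.
  have -> : 1 / 20 * `|t| + - (1 / 10 * `|t|) = - (1 / 20 * `|t|) by field.
  have := @exp_abs_le R (1 / 20) t; glra.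
nra.
Qed.

(** The real part is positive: the main term contributes [1/8], the oscillation costs at most
    [6400 y^2] times [20], which is [0.032] for [|y| = 1/2000]. *)
Lemma H_neq0 z : `|Re z| <= 9 / 10 -> `|Im z| <= 1 / 2000 -> H z != 0.
Proof.
move=> h1 h2; have h3 : `|Re z - 0| < 1 by rewrite subr0; lra.
have [[hr _] _] := HH h3.
have d2 : (0 : R) < 2 by [].
have d20 : (0 : R) < 1 / 20 by lra.
have := intE_mono (intE_lin (1 / 4) (- (6400 * Im z ^+ 2)) (intE_wd d2) (intE_wd d20)) hr.
have y2 : Im z ^+ 2 <= (1 / 2000) ^+ 2.
  rewrite -[Im z ^+ 2]real_normK ?num_real//.
  have : `|Im z| * `|Im z| <= 1 / 2000 * (1 / 2000) by apply: ler_pM.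
  by [].
case: z h1 h2 h3 hr y2 => [s y] /= h1 h2 h3 hr y2 Hm.
suff : 0 < Re (H (Complex s y)) by move=> p; apply/eqP => E; rewrite E ltxx in p.
apply: lt_le_trans (Hm _); first lra.
move=> t; apply: le_trans (b3_lower t y h1) _.
by rewrite /cexp !mulr0 !mul0r !subr0 add0r cosN.
Qed.

End Transforms.

(** Three overlapping convex pieces: a rectangle around [0], a rectangle in the open upper half
    plane passing above the pole [1/2], and the half plane of convergence. The height [1/2000] is
    that of [H_neq0]. *)
Definition zeta_dom : set (Cx R) :=
  [set z | - (del / 2) < Re z < 2 / 5 /\ `|Im z| < 1 / 2000] `|`
  [set z | - (del / 2) < Re z < 9 / 10 /\ 0 < Im z < 1 / 2000] `|`
  [set z | 3 / 5 < Re z].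

Let Re_cont : continuous (fun z : Cx R => Re z).
Proof.
move=> z; apply/(@cvgrPdist_le _ _ _ (nbhs (z : Cx R))) => e e0; near=> w.
have : `|z - w| <= e%:C%C by near: w; apply: (@cvgr_dist_le _ _ _ _ _ id z); [by []|rewrite ltcR].
move=> h; rewrite -lecR; apply: le_trans h.
have -> : Re z - Re w = Re (z - w) by case: (z) (w) => [? ?] [? ?].
exact: normc_ge_Re.
Unshelve. all: by end_near. Qed.

Let Im_cont : continuous (fun z : Cx R => Im z).
Proof.
move=> z; apply/(@cvgrPdist_le _ _ _ (nbhs (z : Cx R))) => e e0; near=> w.
have : `|z - w| <= e%:C%C by near: w; apply: (@cvgr_dist_le _ _ _ _ _ id z); [by []|rewrite ltcR].
move=> h; rewrite -lecR; apply: le_trans h.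
have -> : Im z - Im w = Im (z - w) by case: (z) (w) => [? ?] [? ?].
by rewrite normc_def lecR -sqrtr_sqr ler_wsqrtr// lerDr sqr_ge0.
Unshelve. all: by end_near. Qed.

Let near_Re a z : a < Re z -> \forall w \near z, a < Re w.
Proof. by move=> h; apply: (cvgr_gt _ (@Re_cont z)). Qed.
Let near_Re' a z : Re z < a -> \forall w \near z, Re w < a.
Proof. by move=> h; apply: (cvgr_lt _ (@Re_cont z)). Qed.
Let near_Im a z : a < Im z -> \forall w \near z, a < Im w.
Proof. by move=> h; apply: (cvgr_gt _ (@Im_cont z)). Qed.
Let near_Im' a z : Im z < a -> \forall w \near z, Im w < a.
Proof. by move=> h; apply: (cvgr_lt _ (@Im_cont z)). Qed.

Let zeta_dom_open : open zeta_dom.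
Proof.
rewrite openE => z [[[/andP[h1 h2]]|[/andP[h1 h2] /andP[h3 h4]]]|h1]; rewrite /interior.
- rewrite ltr_norml => /andP[h3 h4]; near=> w; left; left.
  split; first by apply/andP; split; near: w; [exact: near_Re|exact: near_Re'].
  by rewrite ltr_norml; apply/andP; split; near: w; [exact: near_Im|exact: near_Im'].
- near=> w; left; right.
  split; apply/andP; split; near: w; [exact: near_Re|exact: near_Re'|exact: near_Im|exact: near_Im'].
- by near=> w; right => /=; near: w; exact: near_Re.
Unshelve. all: by end_near. Qed.

Let conv_gt a x y t : 0 <= t <= 1 -> a < x -> a < y -> a < x + t * (y - x).
Proof.
move=> /andP[t0 t1] ax ay; have [xy|xy] := leP x y.
  nra.
nra.
Qed.

Let conv_lt a x y t : 0 <= t <= 1 -> x < a -> y < a -> x + t * (y - x) < a.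
Proof.
move=> t1 ax ay; have := @conv_gt (- a) (- x) (- y) t t1; lra.
Qed.

Let ReC x y t : Re ((x : Cx R) + (t%:C%C : Cx R) * (y - x)) = Re x + t * (Re y - Re x).
Proof. by case: x y => [a b] [a' b'] /=; rewrite mul0r subr0. Qed.
Let ImC x y t : Im ((x : Cx R) + (t%:C%C : Cx R) * (y - x)) = Im x + t * (Im y - Im x).
Proof. by case: x y => [a b] [a' b'] /=; rewrite mul0r addr0. Qed.

Let zeta_dom_connected : connected zeta_dom.
Proof.
have /andP[d0 d1] := del0.
apply: connectedU.
- exists (Complex (4 / 5) (1 / 4000)); split; [right|] => /=; [split; apply/andP; split|]; lra.
- apply: connectedU.
  + exists (Complex 0 (1 / 4000)); split; split => /=; [apply/andP; split|rewrite ger0_norm|apply/andP; split|apply/andP; split]; lra.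
  + apply: (@convex_connected _ _ 0); first by split => /=; [apply/andP; split; lra|rewrite normr0; lra].
    move=> x y [/andP[a1 a2]]; rewrite ltr_norml => /andP[a3 a4] [/andP[c1 c2]]; rewrite ltr_norml => /andP[c3 c4] t t1.
    by split => /=; rewrite ?ltr_norml ?ReC ?ImC; apply/andP; split; [exact: conv_gt|exact: conv_lt|exact: conv_gt|exact: conv_lt].
  + apply: (@convex_connected _ _ (Complex 0 (1 / 4000))); first by split => /=; lra.
    move=> x y [/andP[a1 a2] /andP[a3 a4]] [/andP[c1 c2] /andP[c3 c4]] t t1.
    by split; rewrite ?ReC ?ImC; apply/andP; split; [exact: conv_gt|exact: conv_lt|exact: conv_gt|exact: conv_lt].
- apply: (@convex_connected _ _ 1); first by rewrite /=; lra.
  by move=> x y a1 a2 t t1; rewrite /= ReC; exact: conv_gt.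
Qed.

Theorem zeta_continuation : exists (U : set (Cx R)) (Z : Cx R -> Cx R),
  [/\ [/\ open U, connected U & U 0], forall z, 3 / 5 < Re z -> U z,
   forall z, U z -> derivable Z z 1, der (0 : Cx R) Z c%:C%C &
   forall z, 3 / 5 < Re z -> cV (@sumE R) (fun k => cpw (ka k) z) (Z z)].
Proof.
have /andP[d0 d1] := del0.
have [H HH] := mellin_holomorphic b3_cont b3_dom.
have [H2 HH2] := mellin_holomorphic f2_cont f2_dom.
have [C Hrho] := rho_dom.
have [Lam HLam] := mellin_holomorphic rho_cont Hrho.
pose Zn := zeta_near H H2 Lam.
(* The identity for the series at the real point [3/5] yields the convergence that the Dirichlet
   series needs in the whole half plane, beyond the strip [Re z < 1]. *)
have [J HJ] : exists J, sumE (fun k => ka k `^ (3 / 5)) J.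
  have z35 : 11 / 20 < Re (Complex (3 / 5) 0 : R[i]) < 1 by rewrite /=; apply/andP; split; lra.
  have n1 : `|3 / 5 : R| <= 9 / 10 by rewrite ger0_norm; lra.
  have n2 : `|0 : R| <= 1 / 2000 by rewrite normr0; lra.
  have Hn : H (Complex (3 / 5) 0) != 0 := @H_neq0 H HH (Complex (3 / 5) 0) n1 n2.
  have [h _] := zeta_near_sum HH HH2 HLam z35 Hn.
  exists (Re (Zn (Complex (3 / 5) 0))); congr (sumE _ _): h; apply/funext => k.
  rewrite /cpw; case: ifPn => k0.
    by rewrite /cexp /= !mulr0 !mul0r subr0 addr0 cos0 mulr1 /powR gt_eqF.
  have -> : ka k = 0 by apply: le_anti; rewrite ka0 leNgt k0.
  by rewrite powR0//; lra.
have kb k : 0 <= ka k <= S1.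
  rewrite ka0/=; apply: le_trans (kaS k.+1); rewrite big_nat_recr//= lerDr sumr_ge0//.
have s35 : (0 : R) < 3 / 5 by lra.
have [Ls HLs] := dirichlet_holomorphic kb s35 HJ.
(* Both branches are sums of the same series where [3/5 < Re z < 9/10] and [z] is near the real
   axis, so the seam at [3/5] is invisible inside the domain. *)
pose Z z := if 3 / 5 < Re z then Ls z else Zn z.
have agree w : 3 / 5 < Re w < 9 / 10 -> `|Im w| < 1 / 2000 -> Ls w = Zn w.
  move=> /andP[w1 w2] w3; apply: (cV_unique (sumE_functional R) (HLs w w1).1).
  apply: (zeta_near_sum HH HH2 HLam); first by apply/andP; split; lra.
  by apply: (H_neq0 HH); [rewrite ler_norml; lra|exact: ltW].
have ZE w : Re w < 9 / 10 -> `|Im w| < 1 / 2000 -> Zn w = Z w.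
  by move=> w2 w3; rewrite /Z; case: ifPn => // w1; rewrite agree// w1.
have nearE z : Re z < 9 / 10 -> `|Im z| < 1 / 2000 -> \forall w \near z, Zn w = Z w.
  rewrite ltr_norml => h1 /andP[h2 h3]; near=> w; apply: ZE; first by near: w; exact: near_Re'.
  by rewrite ltr_norml; apply/andP; split; near: w; [exact: near_Im|exact: near_Im'].
have dn z : - (del / 2) < Re z < 9 / 10 -> `|Im z| < 1 / 2000 -> z != (1 / 2)%:C%C -> derivable Z z 1.
  move=> /andP[h1 h2] h3 h4; apply: (near_eq_derivable (nearE z h2 h3)).
  apply: (zeta_near_dv HH HH2 HLam) => //; first by apply/andP; split; lra.
  by apply: (H_neq0 HH); [rewrite ler_norml; lra|exact: ltW].
exists zeta_dom, Z; split.
- split => //; left; left; split => /=; first by apply/andP; split; lra.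
  by rewrite normr0; lra.
- by move=> z h; right.
- move=> z [[[/andP[h1 h2] h3]|[/andP[h1 h2] /andP[h3 h4]]]|h1].
  + apply: dn => //; first by apply/andP; split; lra.
    by apply/eqP => E; rewrite E /= in h2; lra.
  + apply: dn => //; first by apply/andP; split; lra.
      by rewrite gtr0_norm.
    by apply/eqP => E; rewrite E /= ltxx in h3.
  + apply: (near_eq_derivable _ (HLs z h1).2).
    by near=> w; rewrite /Z ifT//; near: w; exact: near_Re.
- apply: (near_eq_is_derive (nearE 0 _ _)); rewrite /= ?normr0; [lra|lra|].
  by apply: (zeta_near_dv0 HH HH2 HLam); apply: (H_neq0 HH) => /=; rewrite normr0; lra.
- by move=> z h; rewrite /Z h; exact: (HLs z h).1.
Unshelve. all: by end_near. Qed.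

End Continuation.

(** * The zeta function of the full spectrum and its derivative at zero *)

Section ZetaSum.
Variable R : realType.
Implicit Types (t x y mu : R) (z s : Cx R) (n i j K : nat).

Lemma cV_sum_cvg (f : nat -> Cx R) (I : Cx R) : cV (@sumE R) f I -> \sum_(0 <= k < K) f k @[K --> \oo] --> I.
Proof.
move=> [h1 h2].
have Rsum K : Re (\sum_(0 <= k < K) f k) = \sum_(0 <= k < K) Re (f k) /\
   Im (\sum_(0 <= k < K) f k) = \sum_(0 <= k < K) Im (f k).
  elim: K => [|K [IH1 IH2]]; first by rewrite !big_geq.
  by rewrite !big_nat_recr//= -IH1 -IH2; case: (\sum_(_ <= _ < _) _) (f K) => [? ?] [? ?].
apply/cvgrPdist_le => e e0; have re : 0 < Re e by move: e0; rewrite ltcE => /andP[_].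
have ie : e = (Re e)%:C%C by move: e0; rewrite ltcE => /andP[/eqP + _]; case: (e) => [a b] /= ->.
have e2 : 0 < Re e / 2 by pos.
move/cvgrPdist_le: h1 => /(_ _ e2) h1; move/cvgrPdist_le: h2 => /(_ _ e2) h2.
near=> K; rewrite ie; have [r1 r2] := Rsum K.
have -> : Re e = 2 * (Re e / 2) by field.
apply: normc_le.
  have -> : Re (I - \sum_(0 <= k < K) f k) = Re I - Re (\sum_(0 <= k < K) f k).
    by case: (I) (\sum_(_ <= _ < _) _) => [? ?] [? ?].
  by rewrite r1; near: K.
have -> : Im (I - \sum_(0 <= k < K) f k) = Im I - Im (\sum_(0 <= k < K) f k).
  by case: (I) (\sum_(_ <= _ < _) _) => [? ?] [? ?].
by rewrite r2; near: K.
Unshelve. all: by end_near. Qed.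

Lemma sum_exp_dv n (w : nat -> Cx R) s :
  der s (fun z : Cx R => \sum_(0 <= i < n) (cexp (w i * z) : Cx R) : Cx R) (\sum_(0 <= i < n) w i * cexp (w i * s)).
Proof.
elim: n => [|n IH].
  rewrite big_geq// (_ : (fun z => _) = fun=> 0); first exact: cdv_cst.
  by apply/funext => z; rewrite big_geq.
rewrite big_nat_recr//= (_ : (fun z => _) = fun z => (\sum_(0 <= i < n) (cexp (w i * z) : Cx R) : Cx R) + cexp (w n * z)).
  exact: cdvD IH (cdv_exp _ _).
by apply/funext => z; rewrite big_nat_recr.
Qed.

Lemma cexpN_sum n (w : nat -> Cx R) : cexp (- \sum_(0 <= i < n) w i) = \prod_(0 <= i < n) cexp (- w i) :> R[i].
Proof.
elim: n => [|n IH]; first by rewrite !big_geq// oppr0 cexp0.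
by rewrite !big_nat_recr//= opprD cexpD IH.
Qed.

Variables (W : R -> R) (P C k0 s0 lb e0 : R) (th : nat -> R) (Ts : R).
Hypothesis P0 : 0 < P.
Hypothesis s00 : 0 < s0.
Hypothesis k00 : 0 < k0.
Hypothesis Wasymp : forall k, k0 <= k -> `|W (- k ^+ 2) * (k `^ (e0 - 1) * expR (- k)) - P| <= C * k `^ (- s0).
Hypothesis lb0 : lb < 0.
Hypothesis Wneg : forall lam, lam <= lb -> 0 < W lam.
Hypothesis th0 : forall i, 0 <= th i.
Hypothesis thm : forall i j, (i <= j)%N -> th j <= th i.
Hypothesis thT : forall K, \sum_(0 <= i < K) th i <= Ts.
Hypothesis Wzero : forall lam, (W lam = 0 <-> exists i, (lam - lb) * th i = 1) /\
     forall i j, (lam - lb) * th i = 1 -> (lam - lb) * th j = 1 -> i = j.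
Hypothesis Wprod : forall lam, W lam != 0 ->
  \prod_(0 <= i < K) (1 - (lam - lb) * th i) @[K --> \oo] --> W lam / W lb.
Hypothesis W0 : W 0 != 0.

Let Wz lam i : (lam - lb) * th i = 1 -> W lam = 0.
Proof. by move=> h; apply/(Wzero lam).1; exists i. Qed.

Definition la i : R := lb + (th i)^-1.

Lemma th_to0 x : 0 < x -> exists n, forall i, (n <= i)%N -> th i < x.
Proof.
move=> x0; apply: contrapT => /forallNP H.
have {}H n : x <= th n.
  have /existsNP[i /not_implyP[ni /negP]] := H n; rewrite -leNgt => h; exact: le_trans (thm ni).
have Ts0 : 0 <= Ts by have := thT 0%N; rewrite big_geq.
pose K := (Num.truncn (Ts / x)).+1.
have := thT K; apply/negP; rewrite -ltNge.
apply: (@lt_le_trans _ _ (\sum_(0 <= i < K) x)); last by apply: ler_sum => i _.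
rewrite big_const_nat iter_addr addr0 subn0 -mulr_natr mulrC -ltr_pdivrMr//.
have /andP[_] := truncn_itv (divr_ge0 Ts0 (ltW x0)); exact.
Qed.

Let M := - lb.
Let M0 : 0 < M. Proof. by rewrite oppr_gt0. Qed.

Let thM i : M * th i != 1.
Proof. by apply/eqP => E; move: W0; rewrite (@Wz 0 i) ?eqxx// sub0r. Qed.

(** For [th i > 0], [M th i > 1] means that the eigenvalue [la i] is negative. Such indices form a
    finite initial segment because the [th i] decrease to [0], and equality would make [0] a zero of
    [W]. *)
Lemma negative_part : exists n0, (forall i, (i < n0)%N -> 1 < M * th i) /\ forall i, (n0 <= i)%N -> M * th i < 1.
Proof.
have H : exists n, M * th n < 1.
  have [|n Hn] := @th_to0 M^-1; first by rewrite invr_gt0.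
  by exists n; rewrite mulrC -ltr_pdivlMr// mul1r; exact: Hn.
case: (ex_minnP H) => n Hn mn; exists n; split => i ni.
  rewrite lt_neqAle eq_sym thM leNgt; apply/negP => /mn; by rewrite leqNgt ni.
by apply: le_lt_trans Hn; rewrite ler_wpM2l ?(ltW M0)// thm.
Qed.

Lemma prod_near1 n (x : nat -> R) : exists2 D, 0 <= D & forall mu, 1 <= mu ->
  `|\prod_(0 <= i < n) (1 + x i / mu) - 1| <= D / mu.
Proof.
elim: n => [|n [D D0 HD]].
  by exists 0 => // mu _; rewrite big_geq// subrr normr0 mul0r.
exists (D * (1 + `|x n|) + `|x n|); first pos.
move=> mu mu1; have mu0 : 0 < mu by lra.
rewrite big_nat_recr//=; set p := \prod_(_ <= _ < _) _.
have -> : p * (1 + x n / mu) - 1 = (p - 1) * (1 + x n / mu) + x n / mu by ring.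
tri; rewrite normrM mulrDl.
have xm : `|x n / mu| <= `|x n| by rewrite normrM normfV (gtr0_norm mu0) ler_pdivrMr// ler_peMr.
apply: lerD; last by rewrite normrM normfV (gtr0_norm mu0).
rewrite mulrAC; apply: ler_pM => //; first exact: HD.
by tri; rewrite normr1 lerD2l.
Qed.

Lemma ln_near1 y : `|y - 1| <= 1 / 2 -> `|ln y| <= 2 * `|y - 1|.
Proof.
move=> h; move: (h); rewrite ler_norml => /andP[h1 h2].
have y0 : 0 < y by lra.
have u : ln y <= y - 1 by have := @expR_ge1Dx R (ln y); rewrite lnK ?posrE; lra.
have l : 1 - y^-1 <= ln y.
  by have := @expR_ge1Dx R (- ln y); rewrite expRN lnK ?posrE; lra.
have iy : `|1 - y^-1| <= 2 * `|y - 1|.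
  have -> : 1 - y^-1 = (y - 1) / y by field; rewrite gt_eqF.
  rewrite normrM normfV (gtr0_norm y0) mulrC ler_wpM2r// invf_ple ?posrE; lra.
have n1 := ler_norm (y - 1); have n0 := normr_ge0 (y - 1).
move: iy; rewrite !ler_norml => /andP[i1 i2]; lra.
Qed.

Section Positive.
Variable n0 : nat.
Hypothesis small : forall i, (i < n0)%N -> 1 < M * th i.
Hypothesis large : forall i, (n0 <= i)%N -> M * th i < 1.

(** Reciprocal of the eigenvalue [la i], written so that it is [0] when [th i = 0]. *)
Definition kap i : R := th i / (1 - M * th i).
Let ka j := kap (n0 + j).

Let thn i : 1 - M * th i != 0.
Proof. by rewrite subr_eq0 eq_sym. Qed.

Let ka0 j : 0 <= ka j.
Proof. by rewrite divr_ge0// subr_ge0 ltW// large// leq_addr. Qed.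

Let S1 := Ts / (1 - M * th n0).

Let kaS K : \sum_(0 <= j < K) ka j <= S1.
Proof.
have b0 : 0 < 1 - M * th n0 by rewrite subr_gt0 large.
apply: (@le_trans _ _ (\sum_(0 <= j < K) th (n0 + j)%N / (1 - M * th n0))).
  apply: ler_sum => j _; rewrite ler_wpM2l// lef_pV2 ?posrE ?subr_gt0 ?large ?leq_addr//.
  by rewrite lerD2l lerN2 ler_wpM2l ?(ltW M0)// thm// leq_addr.
rewrite -mulr_suml ler_wpM2r ?invr_ge0 ?(ltW b0)//; apply: le_trans (thT (n0 + K)).
rewrite [leRHS](@big_cat_nat _ _ _ n0 0)//= ?leq_addr//.
have -> : \sum_(n0 <= i < n0 + K) th i = \sum_(0 <= i < K) th (n0 + i)%N.
  by rewrite -{1}[n0]add0n big_addn addKn; apply: eq_bigr => j _; rewrite addnC.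
by rewrite lerDr sumr_ge0.
Qed.

Let pos1 j t : 0 < 1 + ka j * expR t.
Proof. by apply: ltr_pwDl => //; apply: mulr_ge0. Qed.

Let term_ge0 j t : 0 <= ln (1 + ka j * expR t).
Proof. by rewrite ln_ge0// lerDl mulr_ge0 . Qed.

Let term_le j t : ln (1 + ka j * expR t) <= ka j * expR t.
Proof.
by rewrite -[leRHS]expRK ler_ln ?posrE ?expR_gt0//; exact: expR_ge1Dx.
Qed.

Let LK K t : R := \sum_(0 <= j < K) ln (1 + ka j * expR t).

Let LK_le K t : LK K t <= S1 * expR t.
Proof.
apply: (@le_trans _ _ (\sum_(0 <= j < K) ka j * expR t)); first by apply: ler_sum.
by rewrite -mulr_suml ler_wpM2r.
Qed.

Let L_exists : exists L : R -> R, forall t, sumE (fun j => ln (1 + ka j * expR t)) (L t).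
Proof.
suff /choice[L HL] : forall t, exists l : R, sumE (fun j => ln (1 + ka j * expR t)) l by exists L.
move=> t; exists (limn (LK^~ t)); rewrite /sumE -/(LK^~ t).
apply: nondecreasing_is_cvgn; last by exists (S1 * expR t) => _ [K _ <-].
by move=> i j ij; rewrite /LK (@big_cat_nat _ _ _ i 0 j)//= lerDl sumr_ge0.
Qed.

Let L : R -> R := sval (cid L_exists).
Let HL t : sumE (fun j => ln (1 + ka j * expR t)) (L t).
Proof. exact: svalP (cid L_exists) t. Qed.

Let L_bound t : 0 <= L t <= S1 * expR t.
Proof.
have H : LK^~ t @ \oo --> L t by exact: HL.
apply/andP; split; [apply: (cvgr_to_ge H)|apply: (cvgr_to_le H)]; near=> K; last exact: LK_le.
exact: sumr_ge0.
Unshelve. all: by end_near. Qed.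

Let L_lip x y : x <= y -> `|L y - L x| <= S1 * (expR y - expR x).
Proof.
move=> xy; have exy : expR x <= expR y by rewrite ler_expR.
have tl j : ln (1 + ka j * expR y) - ln (1 + ka j * expR x) <= ka j * (expR y - expR x).
  rewrite -ln_div ?posrE//.
  have -> : (1 + ka j * expR y) / (1 + ka j * expR x) = 1 + ka j * (expR y - expR x) / (1 + ka j * expR x).
    by field; rewrite gt_eqF.
  have q0 : 0 <= ka j * (expR y - expR x) by rewrite mulr_ge0// subr_ge0.
  apply: (@le_trans _ _ (ka j * (expR y - expR x) / (1 + ka j * expR x))).
    rewrite -[leRHS]expRK ler_ln ?posrE ?expR_gt0//; first exact: expR_ge1Dx.
    by rewrite ltr_pwDl// divr_ge0// ltW.
  by rewrite ler_pdivrMr// ler_peMr// lerDl mulr_ge0.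
have H : LK K y - LK K x @[K --> \oo] --> L y - L x by apply: cvgB; exact: HL.
rewrite ger0_norm; last first.
  apply: (cvgr_to_ge H); near=> K; rewrite subr_ge0; apply: ler_sum => j _.
  by rewrite ler_ln ?posrE ?pos1// lerD2l ler_wpM2l.
apply: (cvgr_to_le H); near=> K.
rewrite -sumrB; apply: (@le_trans _ _ (\sum_(0 <= j < K) ka j * (expR y - expR x))); first exact: ler_sum.
by rewrite -mulr_suml ler_wpM2r// subr_ge0.
Unshelve. all: by end_near. Qed.

Let S10 : 0 <= S1. Proof. by have := kaS 0%N; rewrite big_geq. Qed.

Let L_cont : continuous L.
Proof.
move=> t; have e0' := @continuous_expR R t.
have h : S1 * `|expR x - expR t| @[x --> t] --> (S1 * `|expR t - expR t| : R).
  apply: cvgMr; apply: cvg_norm; apply: cvgB; last exact: cvg_cst.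
  by [].
rewrite subrr normr0 mulr0 in h.
have h2 : `|L x - L t| @[x --> t] --> (0 : R).
  apply: (squeeze0 (fun x => S1 * `|expR x - expR t|)) => //; last exact: cvg_cst.
  near=> x; rewrite normr_ge0/=; have [xt|/ltW tx] := leP x t.
    by rewrite distrC; apply: le_trans (L_lip xt) _; rewrite ler_wpM2l// distrC ler_norm.
  by apply: le_trans (L_lip tx) _; rewrite ler_wpM2l// ler_norm.
have h3 : L x - L t @[x --> t] --> (0 : R) by apply: norm_cvg0.
have h4 : L x - L t + L t @[x --> t] --> (0 + L t : R) by apply: cvgD; [by []|exact: cvg_cst].
rewrite add0r in h4; rewrite (_ : L = (fun x => L x - L t + L t)); last by apply/funext => x; rewrite subrK.
by rewrite /continuous_at subrK.
Unshelve. all: by end_near. Qed.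

(** Quotient of the product formulas at [- mu] and at [0]: [W (- mu) / W 0] is the product of the
    [1 + mu kap i]. The factors of positive eigenvalues give [exp (L (ln mu))]; the finitely many
    others stay explicit. *)
Let exp_L mu : 0 < mu -> W (- mu) != 0 ->
  expR (L (ln mu)) * (W 0 * \prod_(0 <= i < n0) (1 + mu * kap i)) = W (- mu).
Proof.
move=> mu0 Wm; have Wb : W lb != 0 by rewrite gt_eqF// Wneg.
have h1 := Wprod Wm; have h2 := Wprod W0.
have E K : \prod_(0 <= i < n0 + K) (1 - (- mu - lb) * th i) =
  expR (LK K (ln mu)) * (\prod_(0 <= i < n0) (1 + mu * kap i) * \prod_(0 <= i < n0 + K) (1 - (0 - lb) * th i)).
  have e i : 1 - (- mu - lb) * th i = (1 + mu * kap i) * (1 - (0 - lb) * th i).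
    rewrite /kap; have := thn i; rewrite /M => h; field; move: h; by [].
  rewrite (eq_bigr _ (fun i _ => e i)) big_split/= mulrA; congr (_ * _).
  rewrite (@big_cat_nat _ _ _ n0 0)//= ?leq_addr// mulrC; congr (_ * _).
  rewrite -{1}[n0]add0n big_addn addKn /LK.
  elim: K => [|K IH]; first by rewrite !big_geq// expR0.
  rewrite !big_nat_recr//= expRD IH; congr (_ * _).
  have k1 : 0 < 1 + ka K * mu by rewrite ltr_pwDl// mulr_ge0// ltW.
  by rewrite !lnK; rewrite ?posrE// addnC mulrC.
have c1 : \prod_(0 <= i < n0 + K) (1 - (- mu - lb) * th i) @[K --> \oo] --> W (- mu) / W lb.
  rewrite -(cvg_shiftn n0) in h1; rewrite (_ : (fun K => _) = [sequence \prod_(0 <= i < K + n0) (1 - (- mu - lb) * th i)]_K)//.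
  by apply/funext => K; rewrite addnC.
have c2 : \prod_(0 <= i < n0 + K) (1 - (0 - lb) * th i) @[K --> \oo] --> W 0 / W lb.
  rewrite -(cvg_shiftn n0) in h2; rewrite (_ : (fun K => _) = [sequence \prod_(0 <= i < K + n0) (1 - (0 - lb) * th i)]_K)//.
  by apply/funext => K; rewrite addnC.
have c3 : expR (LK K (ln mu)) * (\prod_(0 <= i < n0) (1 + mu * kap i) * \prod_(0 <= i < n0 + K) (1 - (0 - lb) * th i)) @[K --> \oo] -->
   expR (L (ln mu)) * (\prod_(0 <= i < n0) (1 + mu * kap i) * (W 0 / W lb)).
  apply: cvgM; last exact: cvgMr.
  by apply: continuous_cvg; [exact: continuous_expR|exact: HL].
have e : W (- mu) / W lb = expR (L (ln mu)) * (\prod_(0 <= i < n0) (1 + mu * kap i) * (W 0 / W lb)).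
  have E' : (fun K => \prod_(0 <= i < n0 + K) (1 - (- mu - lb) * th i)) = (fun K => expR (LK K (ln mu)) *
    (\prod_(0 <= i < n0) (1 + mu * kap i) * \prod_(0 <= i < n0 + K) (1 - (0 - lb) * th i))) by apply/funext.
  by rewrite E' in c1; exact: (cvg_unique _ c1 c3).
have := congr1 ( *%R^~ (W lb)) e; rewrite divfK// => ->.
by field.
Qed.

(** With [mu = exp t = k^2], [W (- mu)] equals [P Y k^(1 - e0) exp k] and the explicit factors equal
    [A mu^n0 g], where [Y] and [g] tend to [1]. Taking logarithms gives
    [L = exp (t / 2) + kp t + c + ln Y - ln g]. *)
Let A := W 0 * \prod_(0 <= i < n0) kap i.
Let kp := (1 - e0) / 2 - n0%:R.
Let c := ln (P / A).
Let g mu := \prod_(0 <= i < n0) (1 + (kap i)^-1 / mu).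
Let Y k := W (- k ^+ 2) * (k `^ (e0 - 1) * expR (- k)) / P.

Let kapn i : (i < n0)%N -> kap i != 0.
Proof.
move=> i0; have h := small i0; rewrite mulf_neq0 ?invr_neq0//.
by apply/eqP => E; rewrite E in h; lra.
Qed.

Let prod_g mu : 0 < mu -> W 0 * \prod_(0 <= i < n0) (1 + mu * kap i) = A * mu ^+ n0 * g mu.
Proof.
move=> mu0; rewrite -!mulrA; congr (_ * _); rewrite mulrA.
have -> : mu ^+ n0 = \prod_(0 <= i < n0) mu by rewrite big_const_nat subn0 iter_mulr mulr1.
rewrite -!big_split/=; apply: eq_big_nat => i /andP[_ i0].
have := kapn i0; move: (kap i) => x x0; by field; rewrite gt_eqF.
Qed.

(** [A] has the sign of [W (- mu)] for [mu] large, which is positive: the signs of [W 0] and of the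
    negative reciprocals compensate. *)
Let A_gt0 : 0 < A.
Proof.
have [D D0 HD] := prod_near1 n0 (fun i => (kap i)^-1).
pose mu := M + 1 + 2 * D; have mu1 : 1 <= mu by rewrite /mu; move: M0; lra.
have mu0 : 0 < mu by lra.
have Wm : 0 < W (- mu) by apply: Wneg; rewrite /mu /M; lra.
have := exp_L mu0 (lt0r_neq0 Wm); rewrite prod_g// => E.
have g0 : 0 < g mu.
  have := HD mu mu1; rewrite -/(g mu) ler_norml => /andP[h _].
  have : D / mu <= 1 / 2 by rewrite ler_pdivrMr /mu; move: M0; lra.
  lra.
have : 0 < expR (L (ln mu)) * (A * mu ^+ n0 * g mu) by rewrite E.
by rewrite pmulr_rgt0 ?expR_gt0// pmulr_lgt0// pmulr_lgt0// exprn_gt0.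
Qed.

Let main_eq t : k0 <= expR (t / 2) -> M <= expR t -> 0 < Y (expR (t / 2)) -> 0 < g (expR t) ->
  L t - expR (t / 2) - kp * t - c = ln (Y (expR (t / 2))) - ln (g (expR t)).
Proof.
move=> h1 h2 Y0 g0; pose k := expR (t / 2); have kp0 : 0 < k by pos.
have kk : k ^+ 2 = expR t by rewrite expr2 -expRD; congr expR; field.
have m0 := expR_gt0 t.
have Wm : 0 < W (- expR t) by apply: Wneg; rewrite -[lb]opprK lerN2.
have := exp_L m0 (lt0r_neq0 Wm); rewrite prod_g// expRK => E.
have e1 : W (- expR t) = Y k * P * (k `^ (1 - e0) * expR k).
  rewrite /Y kk; have -> : k `^ (1 - e0) = (k `^ (e0 - 1))^-1 by rewrite -powRN opprB.
  rewrite expRN; have := powR_gt0 (e0 - 1) kp0; have := expR_gt0 k.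
  by move: (k `^ _) (expR k) => x y y0 x0; field; rewrite !gt_eqF.
have : ln (expR (L t) * (A * expR t ^+ n0 * g (expR t))) = ln (Y k * P * (k `^ (1 - e0) * expR k)) by rewrite E e1.
have a1 : 0 < expR t ^+ n0 by pos.
have a2 : 0 < A * expR t ^+ n0 by pos.
have a3 : 0 < k `^ (1 - e0) by pos.
have a4 := expR_gt0 k; have a5 := expR_gt0 (L t).
rewrite lnM ?posrE ?(mulr_gt0 a2 g0)// expRK lnM ?posrE// lnM ?posrE// lnXn// expRK.
rewrite lnM ?posrE ?(mulr_gt0 Y0 P0) ?(mulr_gt0 a3 a4)// lnM ?posrE// lnM ?posrE// expRK ln_powR expRK.
rewrite /c ln_div ?posrE// /kp -[t *+ n0]mulr_natr -/k => H.
have -> : L t = ln (Y k) + ln P + ((1 - e0) * (t / 2) + k) - (ln A + t * n0%:R + ln (g (expR t))) by rewrite -H; ring.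
lra.
Qed.

Let asym : exists C0 del, 0 < del <= 1 / 2 /\
  forall t, 0 <= t -> `|L t - expR (t / 2) - kp * t - c| <= C0 * expR (- (del * t)).
Proof.
have [D D0 HD] := prod_near1 n0 (fun i => (kap i)^-1).
(* The error [k^(- s0)] is [exp (- s0 t / 2)] in the variable [t]. *)
pose del := Num.min (s0 / 2) (1 / 2).
have dl : 0 < del by rewrite lt_min; apply/andP; split; [exact: divr_gt0|lra].
have d1 : del <= s0 / 2 by rewrite ge_min lexx.
have d2 : del <= 1 / 2 by rewrite ge_min lexx orbT.
pose C' := `|C| / P; have C'0 : 0 <= C' by rewrite divr_ge0// ltW.
(* [X] exceeds all thresholds, and beyond [t0] both [exp (t / 2)] and [exp (del t)] exceed [X].
   Below [t0] every term is bounded, and the factor [exp (del t0)] absorbs the bound. *)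
pose X := k0 + M + 2 * D + 2 * C' + 1.
pose t0 := (X + X) / del; have X0 : 0 < X by rewrite /X; move: M0 k00; lra.
have t00 : 0 <= t0 by rewrite divr_ge0 ?ltW// addr_gt0.
pose B := S1 * expR t0 + expR (t0 / 2) + `|kp| * t0 + `|c|.
have B0 : 0 <= B.
  have q1 : 0 <= S1 * expR t0 by apply: mulr_ge0 => //; exact: expR_ge0.
  have q2 : 0 <= `|kp| * t0 by apply: mulr_ge0.
  by apply: addr_ge0 => //; apply: addr_ge0 => //; apply: addr_ge0 => //; exact: expR_ge0.
exists (B * expR (del * t0) + 2 * C' + 2 * D), del; split; first by rewrite dl.
move=> t tp; have [tt|tt] := leP t t0.
  apply: (@le_trans _ _ (B * expR (del * t0) * expR (- (del * t)))); last first.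
    by rewrite ler_wpM2r ?expR_ge0// -addrA lerDl addr_ge0// mulr_ge0.
  apply: (@le_trans _ _ B); last first.
    rewrite -mulrA -expRD ler_peMr// -[leLHS]expR0 ler_expR subr_ge0.
    by rewrite ler_wpM2l// ltW.
  have /andP[l1 l2] := L_bound t.
  have e1 : expR t <= expR t0 by rewrite ler_expR.
  have e2 : expR (t / 2) <= expR (t0 / 2) by rewrite ler_expR ler_wpM2r.
  apply: le_trans (ler_normB _ _) _; apply: lerD => //.
  apply: le_trans (ler_normB _ _) _; apply: lerD; last by rewrite normrM ler_wpM2l// ger0_norm.
  apply: le_trans (ler_normB _ _) _; apply: lerD; last by rewrite ger0_norm ?expR_ge0.
  by rewrite ger0_norm//; apply: le_trans l2 _; rewrite ler_wpM2l.
have Xt : X + X <= del * t.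
  by move: (ltW tt); rewrite ler_pdivrMr// mulrC.
have et : X <= expR (del * t) by have := expR_ge1Dx (del * t); lra.
have dt : del * t <= 1 / 2 * t by nra.
have k1 : X <= expR (t / 2) by apply: le_trans et _; rewrite ler_expR; lra.
have m1 : X <= expR t by apply: le_trans et _; rewrite ler_expR; lra.
have kk0 : k0 <= expR (t / 2) by apply: le_trans k1; rewrite /X; move: M0; lra.
have MM : M <= expR t by apply: le_trans m1; rewrite /X; move: k00; lra.
have mu1 : 1 <= expR t by rewrite -[leLHS]expR0 ler_expR.
have gb : `|g (expR t) - 1| <= D * expR (- (del * t)).
  apply: le_trans (HD _ mu1) _; rewrite -expRN ler_wpM2l// ler_expR; lra.
have Yb : `|Y (expR (t / 2)) - 1| <= C' * expR (- (del * t)).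
  have -> : Y (expR (t / 2)) - 1 = (W (- expR (t / 2) ^+ 2) * (expR (t / 2) `^ (e0 - 1) * expR (- expR (t / 2))) - P) / P.
    by rewrite mulrBl divff ?gt_eqF.
  rewrite normrM normfV (gtr0_norm P0) mulrAC ler_wpM2r ?invr_ge0 ?(ltW P0)//.
  apply: le_trans (Wasymp kk0) _; rewrite -expRM; apply: le_trans (ler_wpM2r (expR_ge0 _) (ler_norm C)) _.
  rewrite ler_wpM2l// ler_expR; have := ler_wpM2r tp d1; glra.
have ei : expR (- (del * t)) <= X^-1 by rewrite expRN lef_pV2 ?posrE ?expR_gt0.
have g12 : `|g (expR t) - 1| <= 1 / 2.
  apply: le_trans gb _; apply: le_trans (ler_wpM2l D0 ei) _; rewrite ler_pdivrMr /X; move: M0 k00; lra.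
have Y12 : `|Y (expR (t / 2)) - 1| <= 1 / 2.
  apply: le_trans Yb _; apply: le_trans (ler_wpM2l C'0 ei) _; rewrite ler_pdivrMr /X; move: M0 k00; lra.
have gp : 0 < g (expR t) by move: g12; rewrite ler_norml => /andP[]; glra.
have Yp : 0 < Y (expR (t / 2)) by move: Y12; rewrite ler_norml => /andP[]; glra.
rewrite main_eq//; apply: le_trans (ler_normB _ _) _.
have := ln_near1 g12; have := ln_near1 Y12.
have : 0 <= B * expR (del * t0) * expR (- (del * t)) by pos.
have -> : (B * expR (del * t0) + 2 * C' + 2 * D) * expR (- (del * t)) =
  B * expR (del * t0) * expR (- (del * t)) + 2 * (C' * expR (- (del * t))) + 2 * (D * expR (- (del * t))) by ring.
move: Yp gp Y12 g12 ei Yb gb mu1; glra.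
Qed.

Lemma positive_zeta : 0 < W 0 * \prod_(0 <= i < n0) kap i /\ exists (U : set (Cx R)) (Z : Cx R -> Cx R),
  [/\ [/\ open U, connected U & U 0], forall z, 3 / 5 < Re z -> U z,
   forall z, U z -> derivable Z z 1, der (0 : Cx R) Z (ln (P / (W 0 * \prod_(0 <= i < n0) kap i)))%:C%C &
   forall z, 3 / 5 < Re z -> cV (@sumE R) (fun j => cpw (kap (n0 + j)) z) (Z z)].
Proof.
split; first exact: A_gt0.
have [C0 [del [dl as_]]] := asym.
exact: (zeta_continuation ka0 kaS HL L_cont dl as_).
Qed.

End Positive.

Variable ml : R -> nat.
Hypothesis ml1 : forall lam, W lam = 0 -> ml lam = 1%N.
Hypothesis ml0 : forall lam, W lam != 0 -> ml lam = 0%N.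

Definition zeta_cut n z : Cx R :=
  \sum_(lam \in [set lam : R | (0 < ml lam)%N /\ lam != 0 /\ `|lam| <= n%:R]) ((ml lam)%:R * cpow_neg lam z).

Let term i z : Cx R := if 0 < th i then cpow_neg (la i) z else 0.

Let laP i : 0 < th i -> (la i - lb) * th i = 1.
Proof. by move=> h; rewrite addrAC subrr add0r mulVf// gt_eqF. Qed.

Let laE i : 0 < th i -> la i = (th i / (1 - M * th i))^-1.
Proof.
by move=> h; rewrite invf_div mulNr opprK mulrDl mul1r mulfK ?gt_eqF// [RHS]addrC.
Qed.

Let Wla i : 0 < th i -> W (la i) = 0.
Proof. by move=> h; apply/(Wzero _).1; exists i; exact: laP. Qed.

Let la_inj i j : 0 < th i -> 0 < th j -> la i = la j -> i = j.
Proof. by move=> hi hj e; apply: (Wzero (la i)).2; [exact: laP|rewrite e; exact: laP]. Qed.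

Let la_neq0 i : 0 < th i -> la i != 0.
Proof. by move=> h; apply: contraNneq W0 => e; rewrite -[X in W X]e Wla. Qed.

Let la_mono i j : (i <= j)%N -> 0 < th j -> la i <= la j.
Proof.
move=> ij hj; have hi : 0 < th i by apply: lt_le_trans (thm ij).
by rewrite lerD2l lef_pV2 ?posrE// thm.
Qed.

Let zero_la lam : W lam = 0 -> exists2 i, 0 < th i & lam = la i.
Proof.
move=> /(Wzero lam).1[i Hi]; have hi : 0 < th i.
  by rewrite lt0r th0 andbT; apply/eqP => e; rewrite e mulr0 in Hi; move/eqP: Hi; rewrite eq_sym oner_eq0.
exists i => //; rewrite /la; have -> : (th i)^-1 = lam - lb by rewrite -[LHS]mul1r -Hi mulfK// gt_eqF.
lra.
Qed.

(** The eigenvalues increase with the index and exceed [lb], so for [n >= - lb] the cut [|lam| <= n]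
    selects an initial segment. The alternative attached to [J], either [n <= J] or an eigenvalue
    [la J > n], is what makes [J] tend to infinity with [n]. *)
Let cut_index n : exists J, ((forall i, 0 < th i -> (`|la i| <= n%:R) = (i < J)%N) /\
  ((n <= J)%N \/ 0 < th J /\ n%:R < la J)) \/ ~~ (- lb <= n%:R).
Proof.
have [nb|nb] := boolP (- lb <= n%:R); last by exists 0%N; right.
have abs i : 0 < th i -> (`|la i| <= n%:R) = (la i <= n%:R).
  move=> hi; have lp : lb <= la i by rewrite lerDl invr_ge0.
  by rewrite ler_norml; have -> : - n%:R <= la i by lra.
have [[i0 Hi0]|H] := pselect (exists i, (0 < th i) && (n%:R < la i)).
  case: (ex_minnP (ex_intro (fun i => (0 < th i) && (n%:R < la i)) i0 Hi0)) => J /andP[J1 J2] mJ.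
  exists J; left; split; last lra.
  move=> i hi; rewrite abs//; have [iJ|Ji] := ltnP i J.
    rewrite leNgt; apply/negP => h; have := mJ i; rewrite hi h => /(_ isT); by rewrite leqNgt iJ.
  by apply/negbTE; rewrite -ltNge (lt_le_trans J2)// la_mono.
have [[J HJ]|H2] := pselect (exists i, ~~ (0 < th i)).
  exists (maxn J n); left; split; last by left; rewrite leq_maxr.
  move=> i hi; rewrite abs//.
  have iJ : (i < J)%N by rewrite ltnNge; apply/negP => Ji; move: HJ; rewrite (lt_le_trans hi (thm Ji)).
  rewrite (leq_trans iJ (leq_maxl _ _)) leNgt; apply/negP => h; by apply: H; exists i; rewrite hi.
have [|N HN] := @th_to0 ((n%:R - lb + 1)^-1).
  by rewrite invr_gt0; move: lb0 (ler0n R n); lra.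
exfalso; apply: H; exists N.
have hN : 0 < th N by apply: contrapT => /negP h; apply: H2; exists N.
rewrite hN /la; have := HN N (leqnn N).
have p : 0 < n%:R - lb + 1 by move: lb0 (ler0n R n); lra.
rewrite -[X in X < _]invrK ltf_pV2 ?posrE ?invr_gt0; lra.
Qed.

Let cut_sum n J z : (forall i, 0 < th i -> (`|la i| <= n%:R) = (i < J)%N) -> zeta_cut n z = \sum_(0 <= i < J) term i z.
Proof.
move=> HJ; pose r := [seq la i | i <- [seq i <- iota 0 J | 0 < th i]].
have ur : uniq r.
  rewrite map_inj_in_uniq ?filter_uniq ?iota_uniq// => i j.
  by rewrite !mem_filter => /andP[hi _] /andP[hj _]; exact: la_inj.
rewrite /zeta_cut (_ : [set lam | _] = [set` r]); last first.
  apply/seteqP; split => lam /=.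
    move=> [m0 [l0 ln]]; have [W0'|Wn] := eqVneq (W lam) 0; last by rewrite ml0 in m0.
    have [i hi E] := zero_la W0'; rewrite E; apply: map_f.
    by rewrite mem_filter hi mem_iota -HJ// -E.
  move=> hr; have [i + ->] : exists2 i, i \in [seq i <- iota 0 J | 0 < th i] & lam = la i by apply/mapP; by [].
  rewrite mem_filter mem_iota/= add0n => /andP[hi iJ].
  by rewrite ml1 ?Wla// la_neq0// HJ.
rewrite -fsbig_seq// big_map big_filter /index_iota subn0.
rewrite big_mkcond; apply: eq_bigr => i _; rewrite /term; case: ifP => // hi.
by rewrite ml1 ?Wla// mul1r.
Qed.

Let cut_cvg z (l : Cx R) : \sum_(0 <= i < K) term i z @[K --> \oo] --> l -> zeta_cut n z @[n --> \oo] --> l.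
Proof.
move=> H; have /choice[J HJ] := cut_index.
have JJ : J n @[n --> \oo] --> \oo.
  apply/cvgnyPge => K; near=> n.
  have nb : - lb <= n%:R by near: n; exact: nbhs_infty_ger.
  have nK : (K <= n)%N by near: n; exact: nbhs_infty_ge.
  have nS : \sum_(0 <= i < K) `|la i| <= n%:R by near: n; exact: nbhs_infty_ger.
  case: (HJ n) => [[_ [nJ|[hJ lJ]]]|]; [exact: leq_trans nJ| |by rewrite nb].
  rewrite leqNgt; apply/negP => JK; move: lJ; apply/negP; rewrite -leNgt.
  apply: le_trans (ler_norm _) _; apply: le_trans nS.
  rewrite (bigD1_seq (J n)) ?mem_index_iota ?iota_uniq//= lerDl; exact: sumr_ge0.
have H2 : \sum_(0 <= i < J n) term i z @[n --> \oo] --> l by exact: (cvg_comp _ _ JJ H).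
apply: cvg_trans H2; apply: near_eq_cvg; near=> n.
have nb : - lb <= n%:R by near: n; exact: nbhs_infty_ger.
by case: (HJ n) => [[h _]|]; [rewrite (cut_sum _ h)|rewrite nb].
Unshelve. all: by end_near. Qed.

Theorem zeta_regularized : exists (U : set (Cx R)) (Z : Cx R -> Cx R),
  [/\ [/\ open U, connected U & U 0], forall z, 3 / 5 < Re z -> U z,
   forall z, U z -> derivable Z z 1, forall z, 3 / 5 < Re z -> zeta_cut n z @[n --> \oo] --> Z z &
   cexp (- ('D_1 Z 0)) = (W 0 / P)%:C%C].
Proof.
have [n0 [small large]] := negative_part.
have [A0 [U [Z [[Uo Uc U0] U35 dZ dZ0 HZ]]]] := positive_zeta small large.
have thn0 i : (i < n0)%N -> 0 < th i.
  move=> /small h; rewrite lt0r th0 andbT; apply/eqP => e; rewrite e in h; lra.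
have lan i : (i < n0)%N -> la i < 0.
  move=> i0; have h := small i i0; have hi := thn0 i i0.
  have : (th i)^-1 < - lb by rewrite -div1r ltr_pdivrMr.
  by rewrite /la; lra.
(* A negative eigenvalue contributes [exp (w z)], with derivative [w] at [0]; then
   [exp (- w) = exp (i pi) |la i| = la i]. *)
pose w i : Cx R := - (Complex 0 pi + Complex (ln (- la i)) 0).
have negE i z : (i < n0)%N -> cpow_neg (la i) z = cexp (w i * z).
  move=> i0; rewrite /cpow_neg ltNge (ltW (lan i i0)) -cexpD; congr cexp; rewrite /w; ring.
pose Zf z : Cx R := Z z + \sum_(0 <= i < n0) (cexp (w i * z) : Cx R).
exists U, Zf; split; [by []|exact: U35| | |].
- move=> z Uz; have /derivableP d1 := dZ z Uz.
  by case: (cdvD d1 (sum_exp_dv n0 w z)).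
- move=> z z35; apply: cut_cvg; have H := cV_sum_cvg (HZ z z35).
  have E K : \sum_(0 <= i < K + n0) term i z = \sum_(0 <= j < K) cpw (kap (n0 + j)) z + \sum_(0 <= i < n0) (cexp (w i * z) : Cx R).
    rewrite addnC (@big_cat_nat _ _ _ n0 0)//= ?leq_addr// addrC; congr (_ + _).
      rewrite -{1}[n0]add0n big_addn addKn; apply: eq_bigr => j _; rewrite addnC /term.
      have h := large (n0 + j)%N (leq_addr _ _); have b0 : 0 < 1 - M * th (n0 + j)%N by lra.
      rewrite /cpw /kap; case: ifPn => hj; last first.
        by have -> : th (n0 + j)%N = 0; [apply: le_anti; rewrite th0 leNgt hj|rewrite mul0r ltxx].
      have -> : 0 < th (n0 + j)%N / (1 - M * th (n0 + j)%N) by pos.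
      have e : la (n0 + j)%N = (th (n0 + j)%N / (1 - M * th (n0 + j)%N))^-1.
        exact: laE.
      have l0 : 0 < la (n0 + j)%N by rewrite e invr_gt0 divr_gt0.
      rewrite /cpow_neg l0 -mulrN; congr (cexp (_ * _)).
      by rewrite -[th _ / _]invrK -e lnV ?posrE// rmorphN.
    by apply: eq_big_nat => i /andP[_ i0]; rewrite /term thn0// negE.
  rewrite -(cvg_shiftn n0).
  have -> : [sequence \sum_(0 <= i < K + n0) term i z]_K = (fun K => \sum_(0 <= j < K) (cpw (kap (n0 + j)) z : Cx R) + \sum_(0 <= i < n0) (cexp (w i * z) : Cx R)).
    by apply/funext => K; exact: E.
  by apply: cvgD; [by []|exact: cvg_cst].
have [_ ->] := cdvD dZ0 (sum_exp_dv n0 w 0).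
have -> : \sum_(0 <= i < n0) w i * cexp (w i * 0) = \sum_(0 <= i < n0) w i.
  by apply: eq_bigr => i _; rewrite mulr0 cexp0 mulr1.
rewrite opprD cexpD cexpN_sum.
set A := W 0 * _ in A0 *.
have -> : cexp (- (ln (P / A))%:C%C) = (A / P)%:C%C.
  rewrite /cexp /= oppr0 cos0 sin0 mulr1 mulr0 expRN lnK ?posrE ?divr_gt0//.
  by rewrite invf_div.
have -> : \prod_(0 <= i < n0) cexp (- w i) = (\prod_(0 <= i < n0) la i)%:C%C.
  rewrite rmorph_prod; apply: eq_big_nat => i /andP[_ i0].
  have l0 := lan i i0; rewrite /w opprK cexpD /cexp /= expR0 cospi sinpi cos0 sin0 lnK ?posrE ?oppr_gt0//.
  by apply/eqP; rewrite eq_complex /=; apply/andP; split; apply/eqP; ring.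
rewrite -rmorphM; congr (_%:C%C).
(* The negative eigenvalues divided out in [A] return here, leaving [W 0 / P] with its sign. *)
have kl : \prod_(0 <= i < n0) kap i * \prod_(0 <= i < n0) la i = 1.
  rewrite -big_split/=; rewrite big_nat; apply: big1 => i /andP[_ i0].
  have h := small i i0; have hi := thn0 i i0.
  have b0 : 1 - M * th i != 0 by rewrite lt_eqF// subr_lt0.
  by rewrite laE// mulfV// mulf_neq0 ?invr_neq0// gt_eqF.
have -> : A / P * \prod_(0 <= i < n0) la i = W 0 / P * (\prod_(0 <= i < n0) kap i * \prod_(0 <= i < n0) la i) by rewrite /A; ring.
by rewrite kl mulr1.
Qed.

End ZetaSum.

(** * Potentials and boundary conditions at the endpoint 0 *)

Section Endpoint.
Variable R : realType.
Implicit Types (q a f g F G : R -> R) (b : bckind R) (lam x y : R).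

(* Indicial exponent of the normalized solution and its second initial datum at the endpoint [0]. *)
Definition bm b a : R := nu_of b a + 1 / 2.
Definition bal b : R := if b is BRob A then - A else 0.

Lemma solves_ode2 q lam F : solves q lam F -> ode2 0 1 (fun x => q x - lam) F (derive1 F).
Proof.
move=> s; split => x x1; have [d1 [d2 e]] := s x x1; first exact: derive1_dv.
by apply: dv_eq (derive1_dv d2) _; lra.
Qed.

Lemma ode2_solves q lam F G : ode2 0 1 (fun x => q x - lam) F G ->
  solves q lam F /\ forall x, 0 < x < 1 -> derive1 F x = G x.
Proof.
move=> [dF dG]; have e x : 0 < x < 1 -> derive1 F x = G x.
  by move=> x1; have [] := dv_derive1 (dF x x1).
split => // x x1; have [d1 _] := dv_derive1 (dF x x1).
have D2 : der x (derive1 F) ((q x - lam) * F x).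
  by apply: (dv_near x1 _ (dG x x1)) => y y1; rewrite e.
have [d2 e2] := dv_derive1 D2.
by split => //; split => //; rewrite e2; ring.
Qed.

Let b01 : (0 : R) < 1. Proof. by []. Qed.

Let right_unique f (u v : R) : f x @[x --> 0^'+] --> u -> f x @[x --> 0^'+] --> v -> u = v.
Proof. exact: right_lim_unique. Qed.

Lemma bc0_eq b a F G : (forall x, 0 < x < 1 -> F x = G x) ->
  (forall x, 0 < x < 1 -> derive1 F x = derive1 G x) -> bc0 b a F -> bc0 b a G.
Proof.
move=> e e'; case: b => [|A|] /=.
- exact: cvg_right_eq.
- move=> [u [v [hu [hv uv]]]]; exists u, v; split; [exact: (cvg_right_eq b01 e hu)|split => //].
  exact: (cvg_right_eq b01 e' hv).
- by apply: cvg_right_eq => // x x1; rewrite e.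
Qed.

Lemma bc0_scale b a F (c : R) : (forall x, 0 < x < 1 -> derivable F x 1) -> bc0 b a F -> bc0 b a (fun x => c * F x).
Proof.
move=> dF; case: b => [|A|] /= h.
- by rewrite -[X in _ --> X](mulr0 c); exact: cvgMr.
- move: h => [u [v [hu [hv uv]]]]; exists (c * u), (c * v); split; first exact: cvgMr.
  split; last by rewrite mulrCA -mulrDr uv mulr0.
  have H : c * derive1 F x @[x --> 0^'+] --> c * v by exact: cvgMr.
  apply: (cvg_right_eq b01 _ H) => x x1.
  have D : der x (fun x => c * F x) (c * derive1 F x).
    by apply: dv_eq (dvM (dv_cst c x) (derive1_dv (dF x x1))) _; rewrite mul0r add0r.
  by have [_ ->] := dv_derive1 D.
- have H : c * (F x / psinu (Num.sqrt (a 0 + 1 / 4)) x) @[x --> 0^'+] --> (c * 0 : R) by exact: cvgMr.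
  rewrite mulr0 in H; apply: (cvg_right_eq b01 _ H) => x _; lra.
Qed.

Let psinu_Theta (nu x : R) : 0 <= nu -> 0 < x -> x `^ (nu + 1 / 2) * Theta (nu + 1 / 2) x = psinu nu x.
Proof.
move=> n0 x0; rewrite /Theta /psinu; have -> : (1 / 2 < nu + 1 / 2) = (0 < nu) by apply/idP/idP; lra.
case: ifPn => h.
  rewrite mulrA -powR_add//; congr (_ `^ _ / _); lra.
have -> : nu = 0 by lra.
by rewrite add0r -[Num.sqrt x]powR12_sqrt ?(ltW x0)// mulrN mul1r.
Qed.

Section Fixed.
Variables (b : bckind R) (a q : R -> R) (d lam : R) (f g : R -> R).
Hypothesis qs : sing_pot (bm b a) d (bal b) q.
Hypothesis fg : nsol (bm b a) (bal b) 1 (fun x => q x - lam) f g.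

Lemma bc0_nsol : bc0 b a f.
Proof.
have [ofg _ _] := fg; have [_ e] := ode2_solves ofg.
case: b qs fg => [|A|] /= qs' fg'.
- have e1 : bm BDir a = 1 by rewrite /bm /=; lra.
  have m12 : 1 / 2 <= bm BDir a by pos.
  have H := bc_Theta_nsol fg' m12; apply: (cvg_right_eq b01 _ H) => x /andP[x0 _].
  rewrite e1 /Theta ifT; last by lra.
  by rewrite mulrA -powR_add// (_ : 1 + (1 - 2 * 1) = 0) ?powRr0; [field|ring].
- have e0 : bm (BRob A) a = 0 by rewrite /bm /=; lra.
  have [h1 h2] := bc_robin_nsol fg' e0.
  exists 1, (- A); split => //; split; last by ring.
  by apply: (cvg_right_eq b01 _ h2) => x x1; rewrite e.
- have m12 : 1 / 2 <= bm BFried a by rewrite /bm /= lerDr.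
  have H := bc_Theta_nsol fg' m12; apply: (cvg_right_eq b01 _ H) => x /andP[x0 _].
  by rewrite psinu_Theta// sqrtr_ge0.
Qed.

Lemma bc0_prop F G : ode2 0 1 (fun x => q x - lam) F G -> bc0 b a F ->
  exists c : R, forall x, 0 < x < 1 -> F x = c * f x /\ G x = c * g x.
Proof.
move=> oFG bF; apply: (wronskian_prop qs fg oFG) => x x1.
have [_ e] := ode2_solves oFG.
case: b qs fg bF => [|A|] /= qs' fg' bF.
- have e1 : bm BDir a = 1 by rewrite /bm /=; lra.
  have m12 : 1 / 2 <= bm BDir a by pos.
  apply: (bc_Theta_wronskian fg' oFG m12 _ x1).
  apply: (cvg_right_eq b01 _ bF) => y /andP[y0 _].
  rewrite e1 /Theta ifT; last by lra.
  by rewrite mulrA -powR_add// (_ : 1 + (1 - 2 * 1) = 0) ?powRr0; [field|ring].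
- have e0 : bm (BRob A) a = 0 by rewrite /bm /=; lra.
  move: bF => [u [v [hu [hv uv]]]].
  have hv' : G x @[x --> 0^'+] --> v by apply: (cvg_right_eq b01 _ hv) => y y1; rewrite e.
  by apply: (bc_robin_wronskian fg' oFG e0 hu hv' _ x1); lra.
- have m12 : 1 / 2 <= bm BFried a by rewrite /bm /= lerDr.
  apply: (bc_Theta_wronskian fg' oFG m12 _ x1).
  apply: (cvg_right_eq b01 _ bF) => y /andP[y0 _].
  by rewrite psinu_Theta// sqrtr_ge0.
Qed.

End Fixed.

Lemma normalized_nsol b a q d phi f g : sing_pot (bm b a) d (bal b) q ->
  nsol (bm b a) (bal b) 1 (fun x => q x - 0) f g -> normalized0 q b a phi ->
  forall x, 0 < x < 1 -> phi x = f x /\ derive1 phi x = g x.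
Proof.
move=> qs fg [sp bp np]; have [c Hc] := bc0_prop qs fg (solves_ode2 sp) bp.
suff c1 : c = 1 by move=> x x1; have := Hc x x1; rewrite c1 !mul1r.
have [_ v1 _] := fg.
have H : c * (f x / x `^ bm b a) @[x --> 0^'+] --> (c * 1 : R) by exact: cvgMr.
rewrite mulr1 in H; apply: (right_unique _ np).
by apply: (cvg_right_eq b01 _ H) => x x1; rewrite (Hc x x1).1 mulrA.
Qed.

Let pow_root (N : nat) (e : R) : (0 < N)%N -> 0 < e -> exists2 r, 0 < r & forall x, 0 < x < r -> 0 < x `^ N%:R^-1 < e.
Proof.
move=> N0 e0; exists (e ^+ N); first pos.
move=> x /andP[x0 xr]; rewrite powR_gt0//=.
have i0 : 0 < N%:R^-1 :> R by rewrite invr_gt0 ltr0n.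
have -> : e = (e ^+ N) `^ N%:R^-1.
  by rewrite -powR_mulrn ?(ltW e0)// -powRrM mulfV ?powRr1 ?(ltW e0)// pnatr_eq0 -lt0n.
by apply: gt0_ltr_powR => //; rewrite nnegrE ltW// exprn_gt0.
Qed.

(** The derivative has a limit at [0], so [a] is Lipschitz there and [a (x^(1/N)) - a 0] is of order
    [x^(1/N)]; this is why [d = 1 / N] in the Friedrichs case. *)
Let smooth_lip a : smooth_01c a -> exists K e, [/\ 0 <= K, 0 < e & forall y, 0 < y < e -> `|a y - a 0| <= K * y].
Proof.
move=> [sa [la ac]]; have [l Hl] := la 1%N; rewrite /= in Hl.
have : \forall y \near 0^'+, `|l - derive1 a y| < 1 by move/cvgrPdist_lt: Hl; apply.
move=> /near_right[e e0 He]; pose r := Num.min e 1.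
have r0 : 0 < r by rewrite lt_min e0.
pose K := `|l| + 1; have K0 : 0 <= K by rewrite addr_ge0.
have dab y : 0 < y < r -> `|derive1 a y| <= K.
  move=> /andP[y0 yr]; have ye : y < e by apply: lt_le_trans yr _; rewrite ge_min lexx.
  have := He y ltac:(lra); rewrite distrC => h.
  have : `|derive1 a y| <= `|derive1 a y - l| + `|l| by rewrite -[X in `|X| <= _](subrK l); exact: ler_normD.
  by rewrite /K; lra.
exists K, r; split => // y /andP[y0 yr].
have dd z : z <= y -> 0 < z -> `|a y - a z| <= K * (y - z).
  move=> zy z0; have := @dv_le_norm R z y a (derive1 a) (fun x => K * x) (fun=> K) zy.
  rewrite -mulrBr; apply => x /andP[zx xy]; have x1 : 0 < x < r by rewrite (lt_le_trans z0)//= (le_lt_trans xy).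
  - apply: derive1_dv; apply: (sa 0%N); have /andP[-> h] := x1; apply: lt_le_trans h _; by rewrite ge_min lexx orbT.
  - exact: dv_lin.
  - exact: dab.
have H : `|a y - a z| @[z --> 0^'+] --> `|a y - a 0|.
  by apply: cvg_norm; apply: cvgB; [exact: cvg_cst|by []].
apply: (cvgr_to_le H); near=> z.
have z0 : 0 < z by [].
have zy : z <= y by near: z; exact: nbhs_right_le.
apply: le_trans (dd z zy z0) _; rewrite ler_wpM2l; lra.
Unshelve. all: by end_near. Qed.

Let near_one (N : nat) q a1 : (0 < N)%N -> smooth_01c a1 ->
  (forall x, 0 < x < 1 -> q x = (1 - x) ^- 2 * a1 ((1 - x) `^ (N%:R^-1))) ->
  exists C e, [/\ 0 <= C, 0 < e & forall x, 0 < x < 1 -> 1 - e < x -> `|q x| <= C / (1 - x) ^+ 2].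
Proof.
move=> N0 sa qE; have [K [e [K0 e0 He]]] := smooth_lip sa.
have [r r0 Hr] := pow_root N0 e0.
exists (`|a1 0| + K * e), r; split => //; first pos.
move=> x /andP[x0 x1] xr; have y0 : 0 < 1 - x by rewrite subr_gt0.
have yr : 0 < 1 - x < r by lra.
have /andP[p0 pe] := Hr _ yr.
rewrite qE ?x0// normrM normfV normrX (gtr0_norm y0) mulrC ler_wpM2r ?invr_ge0 ?exprn_ge0 ?(ltW y0)//.
have := He _ (Hr _ yr) => h.
have : `|a1 ((1 - x) `^ N%:R^-1)| <= `|a1 ((1 - x) `^ N%:R^-1) - a1 0| + `|a1 0| by rewrite -[X in `|X| <= _](subrK (a1 0)); exact: ler_normD.
have : K * (1 - x) `^ N%:R^-1 <= K * e by nra.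
lra.
Qed.

(** Each endpoint has its own estimate and the compact middle part is bounded by continuity. A
    single weight covers all three since both of its factors are at least [1]. *)
Let combine q (kk C1 e1 C2 e2 d : R) : (forall x, 0 < x < 1 -> {for x, continuous q}) -> d <= 2 ->
  0 <= C1 -> 0 < e1 -> (forall x, 0 < x < 1 -> x < e1 -> `|q x - kk / x ^+ 2| <= C1 * x `^ (d - 2)) ->
  0 <= C2 -> 0 < e2 -> (forall x, 0 < x < 1 -> 1 - e2 < x -> `|q x| <= C2 / (1 - x) ^+ 2) ->
  exists2 C, 0 <= C & forall x, 0 < x < 1 -> `|q x - kk / x ^+ 2| <= C * (x `^ (d - 2) / (1 - x) ^+ 2).
Proof.
move=> cq d2 C10 e10 H1 C20 e20 H2.
pose u := Num.min e1 (1 / 4); pose v := 1 - Num.min e2 (1 / 4).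
have u0 : 0 < u by rewrite lt_min e10/=; lra.
have u4 : u <= 1 / 4 by rewrite ge_min lexx orbT.
have ue : u <= e1 by rewrite ge_min lexx.
have m2 : 0 < Num.min e2 (1 / 4) by rewrite lt_min e20/=; lra.
have m4 : Num.min e2 (1 / 4) <= 1 / 4 by rewrite ge_min lexx orbT.
have me : Num.min e2 (1 / 4) <= e2 by rewrite ge_min lexx.
have uv : u / 2 <= 1 - Num.min e2 (1 / 4) / 2 by lra.
have wc : {within `[u / 2, 1 - Num.min e2 (1 / 4) / 2], continuous (fun x => `|q x|)}.
  apply: continuous_in_subspaceT => x; rewrite inE/= in_itv/= => /andP[h1 h2].
  apply: cvg_norm; apply: cq; apply/andP; split; lra.
have [z _ Hz] := EVT_max uv wc.
pose M := `|q z|; have M0 : 0 <= M by exact: normr_ge0.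
pose kq := `|kk| * (4 / u ^+ 2).
have kq0 : 0 <= kq by apply: mulr_ge0 => //; rewrite divr_ge0// exprn_ge0// ltW.
exists (C1 + C2 + M + kq); first by do 3 (apply: addr_ge0 => //).
move=> x /andP[x0 x1]; have y0 : 0 < 1 - x by rewrite subr_gt0.
have px : 1 <= x `^ (d - 2) by apply: powR_ge1; [rewrite x0 ltW|lra].
have iy : 1 <= ((1 - x) ^+ 2)^-1 by rewrite invf_ge1 ?exprn_gt0// expr_le1 ?(ltW y0)//; lra.
set T := x `^ (d - 2) / (1 - x) ^+ 2.
have T1 : 1 <= T by rewrite -[leLHS]mulr1; apply: ler_pM.
have Tx : x `^ (d - 2) <= T by rewrite -[leLHS]mulr1; apply: ler_pM => //; rewrite powR_ge0.
have Ty : ((1 - x) ^+ 2)^-1 <= T by rewrite -[leLHS]mul1r; apply: ler_pM => //; rewrite invr_ge0 exprn_ge0// ltW.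
have kb : u / 2 <= x -> `|kk / x ^+ 2| <= kq.
  move=> ux; rewrite normrM; apply: ler_pM => //.
  rewrite normfV ger0_norm; last by rewrite exprn_ge0// ltW.
  have -> : 4 / u ^+ 2 = ((u / 2) ^+ 2)^-1 by field; rewrite gt_eqF.
  rewrite lef_pV2 ?posrE ?exprn_gt0 ?divr_gt0//.
  nra.
have up c : 0 <= c -> c <= c * T by nra.
have [h1 h2 h3 h4] : [/\ 0 <= C1 * T, 0 <= C2 * T, M <= M * T & kq <= kq * T].
  by split; [apply: mulr_ge0 => //; lra|apply: mulr_ge0 => //; lra|exact: up|exact: up].
have -> : (C1 + C2 + M + kq) * T = C1 * T + C2 * T + M * T + kq * T by ring.
have [xu|xu] := ltP x u.
  have := H1 x ltac:(by rewrite x0) (lt_le_trans xu ue).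
  have := ler_wpM2l C10 Tx; lra.
have k2 := ler_normB (q x) (kk / x ^+ 2).
have [xv|xv] := ltP (1 - Num.min e2 (1 / 4)) x.
  have := H2 x ltac:(by rewrite x0) ltac:(lra).
  have := ler_wpM2l C20 Ty; lra.
have : `|q x| <= M by apply: Hz; rewrite in_itv/=; apply/andP; lra.
lra.
Qed.

(** For the Friedrichs condition [m = nu + 1/2] gives [m^2 - m = a 0], and [m >= 1/2] makes every
    [d > 0] admissible. For the other two [m] is [1] or [0], so [m^2 - m = 0]. *)
Lemma sing_pot_of b (N : nat) q a a1 : (0 < N)%N -> smooth_01c a -> smooth_01c a1 -> - (1 / 4) <= a 0 ->
  (forall x, 0 < x < 1 -> {for x, continuous q}) -> admissible0 b q ->
  (forall x, 0 < x < 1 -> q x = x ^- 2 * a (x `^ (N%:R^-1))) ->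
  (forall x, 0 < x < 1 -> q x = (1 - x) ^- 2 * a1 ((1 - x) `^ (N%:R^-1))) ->
  exists d, sing_pot (bm b a) d (bal b) q.
Proof.
move=> N0 sa sa1 a4 cq adm qE qE1.
have [C2 [e2 [C20 e20 H2]]] := near_one N0 sa1 qE1.
have i0 : 0 < N%:R^-1 :> R by rewrite invr_gt0 ltr0n.
have i1 : N%:R^-1 <= 1 :> R by rewrite invf_le1 ?ltr0n// ler1n.
have reg : extends0 q -> exists C1 e1, [/\ 0 <= C1, 0 < e1 &
    forall x, 0 < x < 1 -> x < e1 -> `|q x - 0 / x ^+ 2| <= C1 * x `^ (3 / 2 - 2)].
  move=> [c hc]; have : \forall y \near 0^'+, `|c - q y| < 1 by move/cvgrPdist_lt: hc; apply; exact: ltr01.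
  move=> /near_right[e e0 He]; exists (`|c| + 1), e; split => //.
  move=> x /andP[x0 x1] xe; rewrite mul0r subr0.
  have := He x ltac:(by rewrite add0r x0); rewrite distrC => h.
  have h2 : `|q x| <= `|q x - c| + `|c| by rewrite -[X in `|X| <= _](subrK c); exact: ler_normD.
  have px : 1 <= x `^ (3 / 2 - 2) by apply: powR_ge1; [rewrite x0 ltW|lra].
  have K0 : 0 <= `|c| + 1 by pos.
  nra.
(* When [q] is bounded near [0] any [d] between [1] and [2] serves; [d > 1] is the requirement for
   [m = 0]. *)
have d2 : (3 / 2 : R) <= 2 by lra.
case: b adm => [|A|] /= adm.
- have [C1 [e1 [C10 e10 H1]]] := reg adm.
  have [C C0 HC] := combine cq d2 C10 e10 H1 C20 e20 H2.
  have mE : bm BDir a = 1 by rewrite /bm /=; lra.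
  exists (3 / 2); rewrite mE; split; [lra|by split; lra|by right; split => //; lra|exact: cq|].
  by exists C => // x x1; rewrite expr1n subrr; exact: HC.
- have [C1 [e1 [C10 e10 H1]]] := reg adm.
  have [C C0 HC] := combine cq d2 C10 e10 H1 C20 e20 H2.
  have mE : bm (BRob A) a = 0 by rewrite /bm /=; lra.
  exists (3 / 2); rewrite mE; split; [lra|by split; lra|by left|exact: cq|].
  by exists C => // x x1; rewrite expr0n/= subrr; exact: HC.
have s0 : 0 <= Num.sqrt (a 0 + 1 / 4) by pos.
have mE : bm BFried a ^+ 2 - bm BFried a = a 0.
  rewrite /bm /=; have := @sqr_sqrtr _ (a 0 + 1 / 4) ltac:(by lra).
  set S := Num.sqrt _ => h; have -> : (S + 1 / 2) ^+ 2 - (S + 1 / 2) = S ^+ 2 - 1 / 4 by field.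
  by rewrite h; ring.
have [K [e [K0 e0 He]]] := smooth_lip sa.
have [r r0 Hr] := pow_root N0 e0.
have H1 x : 0 < x < 1 -> x < r -> `|q x - a 0 / x ^+ 2| <= K * x `^ (N%:R^-1 - 2).
  move=> x1 xr; have /andP[x0 _] := x1; rewrite (qE _ x1) powRB2//.
  have -> : x ^- 2 * a (x `^ N%:R^-1) - a 0 / x ^+ 2 = (a (x `^ N%:R^-1) - a 0) / x ^+ 2 by ring.
  rewrite normrM normfV (ger0_norm (exprn_ge0 2 (ltW x0))) [leRHS]mulrA.
  apply: ler_wpM2r; first by rewrite invr_ge0 exprn_ge0// ltW.
  by apply: He; apply: Hr; rewrite x0.
have d2' : N%:R^-1 <= 2 :> R by lra.
have [C C0 HC] := combine cq d2' K0 r0 H1 C20 e20 H2.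
exists N%:R^-1; split; rewrite ?mE.
- by rewrite /bm /=; lra.
- by split; [|lra|rewrite /bm /=; lra].
- by right; split => //; rewrite /bm /=; lra.
- exact: cq.
- by exists C.
Qed.

End Endpoint.

(** * The endpoint 1 by reflection *)

Section LeftEndpoint.
Variable R : realType.
Implicit Types (q a f : R -> R) (b : bckind R) (lam x y l : R).

(** Reflection changes the sign of the derivative, hence of the Robin coefficient. *)
Definition flipb b : bckind R := if b is BRob B then BRob (- B) else b.

Lemma bm_flip b a : bm (flipb b) a = nu_of b a + 1 / 2. Proof. by case: b. Qed.

Lemma near_left c (P : R -> Prop) : (\forall x \near c^'-, P x) ->
  exists2 e, 0 < e & forall x, c - e < x < c -> P x.
Proof.
move=> [e /= e0 He]; exists e => // x /andP[ax xe]; apply: He => //=.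
by rewrite gtr0_norm; lra.
Qed.

Lemma left_refl f l : f x @[x --> 1^'-] --> l <-> refl f x @[x --> 0^'+] --> l.
Proof.
split => /cvgrPdist_lt H; apply/cvgrPdist_lt => e e0.
  have /near_left[r r0 Hr] := H e e0; near=> x; apply: Hr.
  have x0 : 0 < x by [].
  have xr : x < r by [].
  lra.
have /near_right[r r0 Hr] := H e e0; near=> x.
rewrite -[x](subKr 1); apply: Hr.
have x0 : x < 1 by [].
have xr : 1 - r < x by near: x; apply: nbhs_left_gt; lra.
lra.
Unshelve. all: by end_near. Qed.

Lemma admissible_flip b q : admissible1 b q -> admissible0 (flipb b) (refl q).
Proof.
have E : extends1 q <-> extends0 (refl q) by split => -[c Hc]; exists c; apply/left_refl.
by case: b => [|A|] /= H; try exact/E.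
Qed.

Lemma bc1_flip b a f : (forall x, 0 < x < 1 -> derivable f x 1) ->
  bc1 b a f <-> bc0 (flipb b) a (refl f).
Proof.
move=> df; have b01 : (0 : R) < 1 by [].
have dE x : 0 < x < 1 -> derive1 (refl f) x = - derive1 f (1 - x).
  by move=> x1; have [_ ->] := dv_derive1 (dv_refl (derive1_dv (df _ (in01_refl x1)))).
case: b => [|B|] /=; first exact: left_refl.
- have L l : derive1 f x @[x --> 1^'-] --> l <-> derive1 (refl f) x @[x --> 0^'+] --> - l.
    split.
      move=> /left_refl H; have H' : - refl (derive1 f) x @[x --> 0^'+] --> - l by exact: cvgN.
      by apply: (cvg_right_eq b01 _ H') => x x1; rewrite dE.
    move=> H; apply/left_refl.
    have H' : - derive1 (refl f) x @[x --> 0^'+] --> - - l by exact: cvgN.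
    by rewrite opprK in H'; apply: (cvg_right_eq b01 _ H') => x x1; rewrite dE// opprK.
  split => -[u [v [hu [hv uv]]]].
    by exists u, (- v); split; [exact/left_refl|split; [exact/L|lra]].
  exists u, (- v); split; [exact/left_refl|split; [apply/L; rewrite opprK//|lra]].
- rewrite left_refl; have -> // : refl (fun x => f x / psinu (Num.sqrt (a 0 + 1 / 4)) (1 - x)) =
    fun x => refl f x / psinu (Num.sqrt (a 0 + 1 / 4)) x.
  by apply/funext => x; rewrite /refl subKr.
Qed.

Lemma ode2_refl_solves q lam f : solves q lam f ->
  ode2 0 1 (fun x => q (1 - x) - lam) (refl f) (nrefl (derive1 f)).
Proof.
move=> /solves_ode2[h1 h2]; apply: (ode2_refl (Q := fun x => q (1 - x) - lam)).
by split => // x x1; apply: dv_eq (h2 x x1) _; rewrite subKr.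
Qed.

Lemma normalized1_flip q b a psi : normalized1 q b a psi -> normalized0 (refl q) (flipb b) a (refl psi).
Proof.
move=> [sp bp np]; have [sp' _] := ode2_solves (ode2_refl_solves sp).
have dp x : 0 < x < 1 -> derivable psi x 1 by move=> /sp[].
split; [by []|exact/(bc1_flip _ _ dp)|].
move: np => /left_refl; rewrite -bm_flip /bm.
by under [X in _ -> X]eq_cvg do rewrite /refl; under eq_cvg do rewrite /refl subKr.
Qed.

End LeftEndpoint.

(** * Eigenfunctions, zeros of the Wronskian and multiplicities *)

Section Eigenfunctions.
Variables (R : realType) (q a0 a1 : R -> R) (b0 b1 : bckind R) (d0 d1 : R).
Implicit Types (f g : R -> R) (lam x : R).
Local Notation m0 := (bm b0 a0).
Local Notation m1 := (bm (flipb b1) a1).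
Local Notation al0 := (bal b0).
Local Notation al1 := (bal (flipb b1)).
Hypothesis qs0 : sing_pot m0 d0 al0 q.
Hypothesis qs1 : sing_pot m1 d1 al1 (fun x => q (1 - x)).
Variables (phi dphi ps dps : R -> R -> R).
Hypothesis phiN : forall lam, nsol m0 al0 1 (fun x => q x - lam) (phi lam) (dphi lam).
Hypothesis psN : forall lam, nsol m1 al1 1 (fun x => q (1 - x) - lam) (ps lam) (dps lam).
Local Notation W := (WW phi dphi ps dps).
Local Notation E := (eigfun q b0 a0 b1 a1).

Let I12 : 0 < (1 / 2 : R) < 1. Proof. lra. Qed.

Lemma eigfun_phi lam f : E lam f ->
  exists c, forall x, 0 < x < 1 -> f x = c * phi lam x /\ derive1 f x = c * dphi lam x.
Proof. by move=> [sf [_ [bf _]]]; exact: (bc0_prop qs0 (phiN lam) (solves_ode2 sf) bf). Qed.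

Lemma eigfun_WW lam f : E lam f -> nonzero01 f -> W lam = 0.
Proof.
move=> ef [x0 [x01 fx0]]; have [c Hc] := eigfun_phi ef.
have [sf [_ [_ bf]]] := ef.
have df x : 0 < x < 1 -> derivable f x 1 by move=> /sf[].
have [c' Hc'] := bc0_prop qs1 (psN lam) (ode2_refl_solves sf) ((bc1_flip _ _ df).1 bf).
have c'0 : c' != 0.
  apply: contra fx0 => /eqP c'0; have [+ _] := Hc' (1 - x0) (in01_refl x01).
  by rewrite c'0 mul0r /refl subKr => ->.
apply: (mulfI c'0); rewrite mulr0 /WW /Wr.
have [h1 h2] := Hc' _ (in01_refl I12); have [h3 h4] := Hc _ I12.
rewrite /refl subKr in h1; rewrite /nrefl subKr in h2.
rewrite mulrBr !mulrA /refl -h1 h3 /nrefl mulrN -h2 h4; ring.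
Qed.

Lemma sq_int_bounded f (C : R) : (forall x, 0 < x < 1 -> {for x, continuous f}) ->
  (forall x, 0 < x < 1 -> `|f x| <= C) -> sq_int01 f.
Proof.
move=> cf fC; rewrite /sq_int01.
have mf : measurable_fun (`]0, 1[%classic : set R) (fun x => f x ^+ 2).
  apply: measurable_realfun.subspace_continuous_measurable_fun; first by [].
  apply: continuous_in_subspaceT => x; rewrite inE/= in_itv/= => x1.
  by have c := cf x x1; exact: cvgM.
apply: (@le_lt_trans _ _ (\int[@lebesgue_measure R]_(x in `]0%R, 1%R[) (C ^+ 2)%:E)%E).
  apply: ge0_le_integral => //=.
  - by move=> x _; rewrite lee_fin sqr_ge0.
  - exact/measurable_realfun.measurable_EFinP.
  - move=> x; rewrite in_itv/= => x1; rewrite lee_fin -(real_normK (num_real (f x))).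
    by rewrite lerXn2r ?nnegrE ?(le_trans _ (fC x x1)).
rewrite integral_cst//= lebesgue_measure_itv lte_fin ltr01 -EFinB subr0 mule1.
exact: ltry.
Qed.

(** At a zero [phi] is also a multiple of the solution normalized at [1]; it inherits the boundary
    condition there and is bounded at both ends, hence square integrable. *)
Lemma WW_eigfun lam : W lam = 0 -> E lam (phi lam) /\ nonzero01 (phi lam).
Proof.
move=> W0; have [c c0 Hc] := WW_zero qs0 phiN psN W0.
have op := ode2_phi phiN lam; have [sp dp] := ode2_solves op.
have dd x : 0 < x < 1 -> derivable (phi lam) x 1 by move=> /sp[].
have [C C0 HC] := nsol_growth_weak qs0 (phiN lam).
have [D D0 HD] := nsol_growth_weak qs1 (psN lam).
split; last first.
  have [x1 [x10 x11 fb]] := nsol_pos_near ltr01 (phiN lam).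
  have /andP[h _] := fb x1 ltac:(lra).
  exists x1; split; first by rewrite x10.
  by have := powR_gt0 m0 x10; lra.
split; first by [].
split.
  apply: (@sq_int_bounded _ (C + D / `|c|)) => x x1; first by have [h _] := op; exact: dv_cont (h x x1).
  have /andP[x0 x1'] := x1.
  have D1 : 0 <= D / `|c| by pos.
  have [x12|/ltW x12] := leP x (1 / 2).
    have [h _] := HC x ltac:(lra); lra.
  have [h _] := HD (1 - x) ltac:(lra).
  have [e _] := Hc x x1; rewrite /refl in e.
  have : `|phi lam x| <= D / `|c|.
    by rewrite ler_pdivlMr ?normr_gt0// mulrC -normrM -e.
  lra.
split; first exact: (bc0_nsol qs0 (phiN lam)).
apply/(bc1_flip _ _ dd).
have dpx x : 0 < x < 1 -> derivable (ps lam) x 1.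
  by move=> x1; have [h _] := ode2_ps psN lam; have [] := dv_derive1 (h x x1).
have H := bc0_scale c^-1 dpx (bc0_nsol qs1 (psN lam)).
have [_ eps] := ode2_solves (ode2_ps psN lam).
apply: (bc0_eq _ _ H) => x x1; have [h1 h2] := Hc _ (in01_refl x1).
  by rewrite /refl subKr in h1; rewrite h1 /refl; field.
have [_ ->] := dv_derive1 (dv_refl (derive1_dv (dd _ (in01_refl x1)))).
have D2 : der x (fun x => c^-1 * ps lam x) (c^-1 * derive1 (ps lam) x).
  by apply: dv_eq (dvM (dv_cst c^-1 x) (derive1_dv (dpx x x1))) _; rewrite mul0r add0r.
have [_ ->] := dv_derive1 D2.
rewrite /nrefl subKr in h2; rewrite eps// dp ?in01_refl// -[dps lam x]opprK h2; by field.
Qed.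

(** The condition at [0] alone makes every eigenfunction a multiple of [phi], so two of them are
    never independent. *)
Lemma mult_zero lam : W lam = 0 -> mult q b0 a0 b1 a1 lam = 1%N.
Proof.
move=> W0; have [ef nf] := WW_eigfun W0; rewrite /mult.
case: asboolP => [[f [g [fe [ge fg]]]]|_]; last first.
  by case: asboolP => // H; exfalso; apply: H; exists (phi lam).
exfalso; have [c Hc] := eigfun_phi fe; have [d Hd] := eigfun_phi ge.
have [d0' c0'] : d = 0 /\ - c = 0.
  by apply: fg => x x1; have [-> _] := Hc x x1; have [-> _] := Hd x x1; ring.
have [h _] : (1 : R) = 0 /\ (0 : R) = 0.
  apply: fg => x x1; have [-> _] := Hc x x1.
  have -> : c = 0 by lra.
  lra.
lra.
Qed.

Lemma mult_nonzero lam : W lam != 0 -> mult q b0 a0 b1 a1 lam = 0%N.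
Proof.
move=> W0; rewrite /mult.
have H f : E lam f -> forall x, 0 < x < 1 -> f x = 0.
  move=> ef x x1; apply/eqP; apply: contraNT W0 => fx; apply/eqP/(eigfun_WW ef).
  by exists x.
case: asboolP => [[f [g [fe [ge fg]]]]|_]; last first.
  case: asboolP => // -[f [fe [x [x1 /eqP fx]]]].
  by exfalso; apply: fx; exact: H.
exfalso; have [h _] : (1 : R) = 0 /\ (0 : R) = 0.
  by apply: fg => x x1; rewrite (H f fe x x1) mulr0 mul0r addr0.
lra.
Qed.

End Eigenfunctions.

(** The two [sqrt pi] multiply to [pi], while the leading [2] and the two factors [2^(1/2)] cancel
    the denominators [2]; this is the constant of the asymptotics in the form of the statement. *)
Lemma two_besK (R : realType) (m n : R) :
  2 * (besK (m + 1 / 2) * besK (n + 1 / 2)) = 2 `^ (m + n) * Gamma (m + 1) * Gamma (n + 1) / pi.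
Proof.
have s2 : Num.sqrt pi ^+ 2 = pi :> R by rewrite sqr_sqrtr// pi_ge0.
rewrite /besK -!gamE.
have -> : m + 1 / 2 + 1 / 2 = m + 1 by lra.
have -> : n + 1 / 2 + 1 / 2 = n + 1 by lra.
have h2 : (2 : R) `^ (1 / 2) ^+ 2 = 2.
  by rewrite -powR_dbl// (_ : 2 * (1 / 2) = 1) ?powRr1; lra.
rewrite !powR_add//; move: (2 `^ m) (2 `^ n) (2 `^ (1 / 2)) (gam (m + 1)) (gam (n + 1)) h2 => x y t u v h2.
have -> : 2 * (x * t * u / (2 * Num.sqrt pi) * (y * t * v / (2 * Num.sqrt pi))) =
  x * y * u * v * t ^+ 2 / (2 * Num.sqrt pi ^+ 2).
  lra.
rewrite h2 s2; have := pi_gt0 R; generalize (pi : R) => p p0; field.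
lra.
Qed.

Theorem theorem1p2 (R : realType) (N : nat) (q a0 a1 : R -> R)
    (b0 b1 : bckind R) (phi psi : R -> R) :
  regsing_potential N q a0 a1 ->
  admissible0 b0 q -> admissible1 b1 q ->
  normalized0 q b0 a0 phi -> normalized1 q b1 a1 psi ->
  forall x : R, 0 < x < 1 ->
  is_zeta_det q b0 a0 b1 a1
    (Complex (pi * wronskian psi phi x /
              (2 `^ (nu_of b0 a0 + nu_of b1 a1) *
               Gamma (nu_of b0 a0 + 1) * Gamma (nu_of b1 a1 + 1))) 0).
Proof.
move=> [N0 [sq [sa0 [sa1 [a04 [a14 qE]]]]]] ad0 ad1 nphi npsi x x1.
have cq y : 0 < y < 1 -> {for y, continuous q}.
  by move=> y1; exact: dv_cont (derive1_dv (sq 0%N y y1)).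
have cq1 y : 0 < y < 1 -> {for y, continuous (refl q)}.
  by move=> y1; exact: dv_cont (dv_refl (derive1_dv (sq 0%N _ (in01_refl y1)))).
have [d0 qs0] := sing_pot_of N0 sa0 sa1 a04 cq ad0 (fun y h => (qE y h).1) (fun y h => (qE y h).2).
have qE1 y : 0 < y < 1 -> refl q y = y ^- 2 * a1 (y `^ N%:R^-1).
  by move=> h; rewrite /refl (qE _ (in01_refl h)).2 subKr.
have qE0 y : 0 < y < 1 -> refl q y = (1 - y) ^- 2 * a0 ((1 - y) `^ N%:R^-1).
  by move=> h; rewrite /refl (qE _ (in01_refl h)).1.
have [d1 qs1] := sing_pot_of N0 sa1 sa0 a14 cq1 (admissible_flip ad1) qE1 qE0.
have /choice[F HF] : forall lam, exists fg : (R -> R) * (R -> R),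
    nsol (bm b0 a0) (bal b0) 1 (fun x => q x - lam) fg.1 fg.2.
  by move=> lam; have [f [g H]] := nsol_exists qs0 lam; exists (f, g).
have /choice[G HG] : forall lam, exists fg : (R -> R) * (R -> R),
    nsol (bm (flipb b1) a1) (bal (flipb b1)) 1 (fun x => refl q x - lam) fg.1 fg.2.
  by move=> lam; have [f [g H]] := nsol_exists qs1 lam; exists (f, g).
pose f lam := (F lam).1; pose df lam := (F lam).2.
pose g lam := (G lam).1; pose dg lam := (G lam).2.
pose W := WW f df g dg.
have wE : wronskian psi phi x = W 0.
  have [e1 e2] := normalized_nsol qs0 (HF 0) nphi x1.
  have [e3 e4] := normalized_nsol qs1 (HG 0) (normalized1_flip npsi) (in01_refl x1).
  have [sp _ _] := npsi; have dp : derivable psi x 1 by have [] := sp x x1.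
  have <- : Wr f df g dg 0 x = W 0 by exact: (WrE (phi := f) (dphi := df) (ps := g) (dps := dg) HF HG 0 x1).
  rewrite /Wr /wronskian /refl /nrefl /f /df /g /dg -e1 -e2 -e3 -e4.
  have [_ ->] := dv_derive1 (dv_refl (derive1_dv (f := psi) (x := 1 - (1 - x)) ltac:(by rewrite subKr))).
  by rewrite /refl subKr opprK.
have bE : 2 * (besK (bm b0 a0) * besK (bm (flipb b1) a1)) =
    2 `^ (nu_of b0 a0 + nu_of b1 a1) * Gamma (nu_of b0 a0 + 1) * Gamma (nu_of b1 a1 + 1) / pi.
  by rewrite bm_flip two_besK.
have [C [k0 [s [lb [th [Ts [[s0 k00 Was] [lb0 Wneg] [th0 thm thT] Wz Wp]]]]]]] := spectral_data qs0 qs1 HF HG.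
have mu1 lam : W lam = 0 -> mult q b0 a0 b1 a1 lam = 1%N by exact: (mult_zero qs0 qs1 HF HG).
have mu0 lam : W lam != 0 -> mult q b0 a0 b1 a1 lam = 0%N by exact: (mult_nonzero qs0 qs1 HF HG).
have m00 : 0 <= bm b0 a0 by case: qs0.
have m10 : 0 <= bm (flipb b1) a1 by case: qs1.
have P0 : 0 < 2 * (besK (bm b0 a0) * besK (bm (flipb b1) a1)).
  by apply: mulr_gt0 => //; apply: mulr_gt0; exact: besK_gt0.
have DE : pi * wronskian psi phi x / (2 `^ (nu_of b0 a0 + nu_of b1 a1) *
    Gamma (nu_of b0 a0 + 1) * Gamma (nu_of b1 a1 + 1)) =
    W 0 / (2 * (besK (bm b0 a0) * besK (bm (flipb b1) a1))).
  by rewrite bE invf_div wE; ring.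
(* If [W 0 = 0] then [0] is an eigenvalue, and both the determinant and the Wronskian vanish. *)
rewrite DE /is_zeta_det; have [W0|W0] := eqVneq (W 0) 0.
  by rewrite mu1//= W0 mul0r.
rewrite mu0//=.
have [U [Z [[Uo Uc U0] U35 dZ ZE E]]] := zeta_regularized P0 s0 k00 Was lb0 Wneg th0 thm thT Wz Wp W0 mu1 mu0.
exists (3 / 5), U, Z; split; first by [].
split; first by [].
split; first by [].
split; first by [].
split; first by [].
split; first by [].
by [].
Qed.
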